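(* There exist infinitely many elliptic curves $E$ over $\mathbb{Q}$ (up to isomorphism) with trivial rational $2$-torsion, i.e. $E(\mathbb{Q})[2]=0$, for which the $2$-primary part of the Tate--Shafarevich group of $E$ contains $\mathbb{Z}/2\mathbb{Z}$ as a (direct) factor. *)

(* Defs.v *)
From HB Require Import structures.
From mathcomp Require Import all_boot all_order all_algebra all_field.
From mathcomp Require Import ring reals.

Set Implicit Arguments.
Unset Strict Implicit.
Unset Printing Implicit Defensive.

Import Order.TTheory GRing.Theory Num.Theory.
Local Open Scope ring_scope.

(* Elliptic curves over Q, as smooth Weierstrass cubics                       *)
(*   y^2 + a1 x y + a3 y = x^3 + a2 x^2 + a4 x + a6.                          *)

Definition weierstrass_disc (F : fieldType) (a1 a2 a3 a4 a6 : F) : F :=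
  let b2 := a1 ^+ 2 + 4%:R * a2 in
  let b4 := 2%:R * a4 + a1 * a3 in
  let b6 := a3 ^+ 2 + 4%:R * a6 in
  let b8 := a1 ^+ 2 * a6 + 4%:R * a2 * a6 - a1 * a3 * a4
            + a2 * a3 ^+ 2 - a4 ^+ 2 in
  - (b2 ^+ 2) * b8 - 8%:R * b4 ^+ 3 - 27%:R * b6 ^+ 2
  + 9%:R * b2 * b4 * b6.

Record elliptic_curve := EllipticCurve {
  ec_a1 : rat;
  ec_a2 : rat;
  ec_a3 : rat;
  ec_a4 : rat;
  ec_a6 : rat;
  ec_smooth : weierstrass_disc ec_a1 ec_a2 ec_a3 ec_a4 ec_a6 != 0 }.

(* Isomorphism over Q: E2 is obtained from E1 by the substitution             *)
(*   x = u^2 x' + r,   y = u^3 y' + u^2 s x' + t.                             *)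
Definition ec_iso (E1 E2 : elliptic_curve) : Prop :=
  exists u r s t : rat,
  let: EllipticCurve a1 a2 a3 a4 a6 _ := E1 in
  let: EllipticCurve a1' a2' a3' a4' a6' _ := E2 in
  [/\ u != 0,
      [/\ u * a1' = a1 + 2%:R * s,
          u ^+ 2 * a2' = a2 - s * a1 + 3%:R * r - s ^+ 2 &
          u ^+ 3 * a3' = a3 + r * a1 + 2%:R * t],
      u ^+ 4 * a4' = a4 - s * a3 + 2%:R * r * a2 - (t + r * s) * a1
                     + 3%:R * r ^+ 2 - 2%:R * s * t &
      u ^+ 6 * a6' = a6 + r * a4 + r ^+ 2 * a2 + r ^+ 3 - t * a3
                     - t ^+ 2 - r * t * a1].

(* The group E(L), for L a field of characteristic 0; [None] is the point at  *)
(* infinity. Every field morphism commutes with [ratr] ([fmorph_rat]), so the *)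
(* equation needs no explicit embedding of rat in L.                          *)
Section Points.
Variables (E : elliptic_curve) (L : fieldType).

Local Notation a1 := (ratr (ec_a1 E) : L).
Local Notation a2 := (ratr (ec_a2 E) : L).
Local Notation a3 := (ratr (ec_a3 E) : L).
Local Notation a4 := (ratr (ec_a4 E) : L).
Local Notation a6 := (ratr (ec_a6 E) : L).

Definition on_curve (P : option (L * L)) : bool :=
  if P is Some (x, y) then
    y ^+ 2 + a1 * x * y + a3 * y == x ^+ 3 + a2 * x ^+ 2 + a4 * x + a6
  else true.

Definition raw_opp (P : option (L * L)) : option (L * L) :=
  if P is Some (x, y) then Some (x, - y - a1 * x - a3) else None.

Definition slope (x1 y1 x2 y2 : L) : L :=
  if x1 == x2 then
    (3%:R * x1 ^+ 2 + 2%:R * a2 * x1 + a4 - a1 * y1) / (2%:R * y1 + a1 * x1 + a3)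
  else (y2 - y1) / (x2 - x1).

Definition raw_add (P Q : option (L * L)) : option (L * L) :=
  match P, Q with
  | None, _ => Q
  | _, None => P
  | Some (x1, y1), Some (x2, y2) =>
      if (x1 == x2) && (y2 == - y1 - a1 * x1 - a3) then None else
      let l := slope x1 y1 x2 y2 in
      let x3 := l ^+ 2 + a1 * l - a2 - x1 - x2 in
      let y3 := y1 + l * (x3 - x1) in
      Some (x3, - y3 - a1 * x3 - a3)
  end.

Lemma raw_opp_on_curve P : on_curve P -> on_curve (raw_opp P).
Proof.
case: P => [[x y]|//] /= /eqP e; apply/eqP; rewrite -e; ring.
Qed.

Lemma raw_add_on_curve P Q :
  on_curve P -> on_curve Q -> on_curve (raw_add P Q).
Proof.
case: P => [[x1 y1]|//]; case: Q => [[x2 y2]|//] => C1 C2 /=.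
case: ifP => // /negbT ne.
set l := slope _ _ _ _; set x3 := l ^+ 2 + a1 * l - a2 - x1 - x2.
apply: (@raw_opp_on_curve (Some (x3, y1 + l * (x3 - x1)))).
pose G (x y : L) :=
  x ^+ 3 + a2 * x ^+ 2 + a4 * x + a6 - (y ^+ 2 + a1 * x * y + a3 * y).
have GE x y : on_curve (Some (x, y)) = (G x y == 0).
  by rewrite /= eq_sym -subr_eq0.
move: C1 C2; rewrite !GE => /eqP e1 /eqP e2; apply/eqP.
case: (eqVneq x1 x2) => [ex|nx]; last first.
  have ly : y2 = y1 + l * (x2 - x1).
    rewrite /l /slope (negbTE nx) mulfVK ?subr_eq0 1?eq_sym //; ring.
  apply: (mulfI (x := x1 - x2)); first by rewrite subr_eq0.
  transitivity (G x1 y1 * (x3 - x2) - G x2 y2 * (x3 - x1)).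
    rewrite ly /G /x3; ring.
  by rewrite e1 e2; ring.
subst x2; rewrite eqxx /= in ne.
have ey : y2 = y1.
  apply/eqP; rewrite -subr_eq0; apply/eqP.
  apply: (mulfI (x := y2 - (- y1 - a1 * x1 - a3))); first by rewrite subr_eq0.
  rewrite mulr0; transitivity (G x1 y1 - G x1 y2); first by rewrite /G; ring.
  by rewrite e1 e2 subr0.
subst y2.
have d0 : 2%:R * y1 + a1 * x1 + a3 != 0.
  by apply: contra ne => /eqP h; rewrite -subr_eq0; apply/eqP; rewrite -h; ring.
have ll : l * (2%:R * y1 + a1 * x1 + a3) =
          3%:R * x1 ^+ 2 + 2%:R * a2 * x1 + a4 - a1 * y1.
  by rewrite /l /slope eqxx mulfVK.
transitivity (G x1 y1 + (3%:R * x1 ^+ 2 + 2%:R * a2 * x1 + a4 - a1 * y1 -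
    l * (2%:R * y1 + a1 * x1 + a3)) * (x3 - x1)).
  by rewrite /G /x3; ring.
by rewrite e1 ll; ring.
Qed.

Record point := Point {
  point_val :> option (L * L);
  pointP : on_curve point_val }.

HB.instance Definition _ := [isSub for point_val].
HB.instance Definition _ := [Equality of point by <:].

Definition pt0 : point := @Point None isT.
Definition pt_opp (P : point) : point := Point (raw_opp_on_curve (pointP P)).
Definition pt_add (P Q : point) : point :=
  Point (raw_add_on_curve (pointP P) (pointP Q)).
Definition pt_sub (P Q : point) : point := pt_add P (pt_opp Q).
Definition pt_muln (n : nat) (P : point) : point := iter n (pt_add P) pt0.

End Points.

Arguments pt0 {E L}.

(* The map E(L) -> E(L') induced by a field morphism L -> L'. It serves both  *)
(* for the Galois action and for the extension of scalars.                    *)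
Section PointMap.
Variables (E : elliptic_curve) (L L' : fieldType) (f : {rmorphism L -> L'}).

Definition raw_map (P : option (L * L)) : option (L' * L') :=
  omap (fun xy => (f xy.1, f xy.2)) P.

Lemma raw_map_on_curve P : on_curve E P -> on_curve E (raw_map P).
Proof.
case: P => [[x y]|//] /= /eqP e; apply/eqP; move: e; rewrite -!(fmorph_rat f).
move: (ratr _) (ratr _) (ratr _) (ratr _) (ratr _) => a1 a2 a3 a4 a6.
by rewrite -!rmorphXn -!rmorphM -!rmorphD => ->.
Qed.

Definition pt_map (P : point E L) : point E L' :=
  Point (raw_map_on_curve (pointP P)).

End PointMap.

(* The automorphism group of L over K, for an extension j : K -> L.           *)
Record gal (K L : fieldType) (j : {rmorphism K -> L}) := Gal {
  gal_map :> {rmorphism L -> L};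
  gal_bij : bijective gal_map;
  gal_fix : forall x, gal_map (j x) = j x }.

Section GalMul.
Variables (K L : fieldType) (j : {rmorphism K -> L}).

Lemma gal_mul_fix (s t : gal j) x : (s \o t) (j x) = j x.
Proof. by rewrite /= !gal_fix. Qed.

Definition gal_mul (s t : gal j) : gal j :=
  @Gal K L j (s \o t) (bij_comp (gal_bij s) (gal_bij t)) (gal_mul_fix s t).

End GalMul.

(* Continuous cochains and cocycles of Gal(L/K) with values in the discrete   *)
(* module E(L), Gal(L/K) carrying the Krull topology.                         *)
Section Cohomology.
Variables (E : elliptic_curve) (K L : fieldType) (j : {rmorphism K -> L}).

Definition cochain := gal j -> point E L.

Definition continuous_cochain (c : cochain) : Prop :=
  forall s : gal j, exists A : seq L,
  forall t : gal j, {in A, s =1 t} -> c t = c s.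

Definition cocycle (c : cochain) : Prop :=
  continuous_cochain c /\
  forall s t : gal j, c (gal_mul s t) = pt_add (c s) (pt_map s (c t)).

Definition coboundary (c : cochain) : Prop :=
  exists P : point E L, forall s : gal j, c s = pt_sub (pt_map s P) P.

Definition cochain_add (c d : cochain) : cochain :=
  fun s => pt_add (c s) (d s).
Definition cochain_sub (c d : cochain) : cochain :=
  fun s => pt_sub (c s) (d s).
Definition cochain_muln (n : nat) (c : cochain) : cochain :=
  fun s => pt_muln n (c s).

Definition cohomologous (c d : cochain) : Prop := coboundary (cochain_sub c d).

End Cohomology.

(* algC is an algebraic closure of Q.                                         *)
Definition galQ := gal (ratr : {rmorphism rat -> algC}).

(* Restriction of automorphisms of an extension L/K to the algebraic closure  *)
(* of Q, embedded in L by i.                                                  *)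
Section Restriction.
Variables (K L : fieldType) (j : {rmorphism K -> L}).
Variable (i : {rmorphism algC -> L}).

Lemma rat_root_in_algC (p : {poly rat}) (y : L) :
  p != 0 -> root (map_poly ratr p) y -> exists x : algC, i x = y.
Proof.
move=> p0 py.
have [r Dr] := closed_field_poly_normal (map_poly ratr p : {poly algC}).
have : root (map_poly i (map_poly ratr p)) y.
  by rewrite -map_poly_comp (eq_map_poly (fun x => fmorph_rat i x)).
rewrite Dr map_polyZ rmorph_prod /= rootZ; last first.
  by rewrite fmorph_eq0 lead_coef_eq0 map_poly_eq0.
rewrite (eq_bigr (fun z => 'X - (i z)%:P)); last first.
  by move=> z _; rewrite rmorphB /= map_polyX map_polyC.
rewrite -(big_map i xpredT (fun z => 'X - z%:P)) root_prod_XsubC.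
by case/mapP => x _ ->; exists x.
Qed.

Lemma algC_rat_root (x : algC) :
  exists2 p : {poly rat}, p != 0 & root (map_poly ratr p) x.
Proof.
have [p [Dp mp] _] := minCpolyP x.
by exists p; [exact: monic_neq0 | rewrite -Dp root_minCpoly].
Qed.

Lemma gal_res_ex (t : gal j) (x : algC) : exists y : algC, i y == t (i x).
Proof.
have [p p0 px] := algC_rat_root x.
have [||y <-] := @rat_root_in_algC p (t (i x)) => //; last by exists y.
move: px => /(rmorph_root i) /(rmorph_root t).
by rewrite -!map_poly_comp (eq_map_poly (g := ratr)) // => z /=;
  rewrite !fmorph_rat.
Qed.

Definition gal_res_fun (t : gal j) (x : algC) : algC := xchoose (gal_res_ex t x).

Lemma gal_res_funE t x : i (gal_res_fun t x) = t (i x).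
Proof. exact/eqP/(xchooseP (gal_res_ex t x)). Qed.

Section Morphism.
Variable t : gal j.

Fact gal_res_is_zmod_morphism : zmod_morphism (gal_res_fun t).
Proof.
by move=> x y; apply: (fmorph_inj i); rewrite rmorphB /= !gal_res_funE !rmorphB.
Qed.

Fact gal_res_is_monoid_morphism : monoid_morphism (gal_res_fun t).
Proof.
split=> [|x y]; apply: (fmorph_inj i); first by rewrite gal_res_funE !rmorph1.
by rewrite rmorphM /= !gal_res_funE !rmorphM.
Qed.

HB.instance Definition _ :=
  GRing.isZmodMorphism.Build algC algC (gal_res_fun t) gal_res_is_zmod_morphism.
HB.instance Definition _ :=
  GRing.isMonoidMorphism.Build algC algC (gal_res_fun t)
    gal_res_is_monoid_morphism.

Lemma gal_res_surj (y : algC) : exists x : algC, gal_res_fun t x == y.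
Proof.
have [t' tK t'K] := gal_bij t.
have [p p0 py] := algC_rat_root y.
have [||x Dx] := @rat_root_in_algC p (t' (i y)) => //; last first.
  by exists x; apply/eqP/(fmorph_inj i); rewrite gal_res_funE Dx t'K.
rewrite -(fmorph_root t) t'K -map_poly_comp.
rewrite (eq_map_poly (g := i \o ratr)) ?map_poly_comp ?rmorph_root //.
by move=> z /=; rewrite !fmorph_rat.
Qed.

Lemma gal_res_bij : bijective (gal_res_fun t).
Proof.
have gK : cancel (fun y => xchoose (gal_res_surj y)) (gal_res_fun t).
  by move=> y; exact/eqP/(xchooseP (gal_res_surj y)).
by exists (fun y => xchoose (gal_res_surj y)) => // x; apply: (fmorph_inj _ (gK _)).
Qed.

Lemma gal_res_fix (q : rat) : gal_res_fun t (ratr q) = ratr q.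
Proof. exact: (fmorph_rat (gal_res_fun t)). Qed.

Definition gal_res : galQ :=
  @Gal rat algC ratr (gal_res_fun t) gal_res_bij gal_res_fix.

End Morphism.

Lemma gal_resE (t : gal j) (x : algC) : i (gal_res t x) = t (i x).
Proof. exact: gal_res_funE. Qed.

End Restriction.

(* K, with the absolute value v, is a completion of Q at a place, archimedean *)
(* or not: v is nontrivial on Q, Q is dense in K and K is complete.           *)
Record is_completion (R : realType) (K : fieldType) (v : K -> R) : Prop :=
  IsCompletion {
    compl_pchar : [pchar K] =i pred0;
    compl_ge0 : forall x, 0 <= v x;
    compl_eq0 : forall x, v x = 0 <-> x = 0;
    compl_M : forall x y, v (x * y) = v x * v y;
    compl_D : forall x y, v (x + y) <= v x + v y;
    compl_nontrivial : exists2 q : rat, q != 0 & v (ratr q) != 1;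
    compl_dense : forall x (e : R), 0 < e -> exists q : rat, v (x - ratr q) < e;
    compl_complete : forall u : nat -> K,
      (forall e : R, 0 < e -> exists N, forall m n,
         (N <= m)%N -> (N <= n)%N -> v (u m - u n) < e) ->
      exists l : K, forall e : R, 0 < e -> exists N, forall n,
         (N <= n)%N -> v (u n - l) < e }.

Section TateShafarevich.
Variables (R : realType) (E : elliptic_curve).

Notation cochainQ := (cochain E (ratr : {rmorphism rat -> algC})).

(* The class of c dies in H^1(Q_v, E) for every place v of Q. *)
Definition locally_trivial (c : cochainQ) : Prop :=
  forall (K : fieldType) (v : K -> R), is_completion v ->
  forall (L : closedFieldType) (j : {rmorphism K -> L}),
    (forall x : L, algebraicOver j x) ->
  forall i : {rmorphism algC -> L},
    coboundary (fun t : gal j => pt_map i (c (gal_res i t))).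

(* Cocycles representing the elements of Sha(E/Q), and of its 2-primary part. *)
(* Equality of elements of Sha(E/Q) is the relation [cohomologous].           *)
Definition sha (c : cochainQ) : Prop := cocycle c /\ locally_trivial c.

Definition sha_2primary (c : cochainQ) : Prop :=
  sha c /\ exists n : nat, coboundary (cochain_muln (2 ^ n) c).

(* Sha(E/Q)[2^oo] is isomorphic to Z/2Z x B for some abelian group B: f is a  *)
(* map on cocycles which induces the isomorphism on classes.                  *)
Definition sha_2primary_has_Z2_factor : Prop :=
  exists (B : zmodType) (f : cochainQ -> 'Z_2 * B),
  [/\ forall c d, sha_2primary c -> sha_2primary d ->
        f (cochain_add c d) = f c + f d,
      forall c d, sha_2primary c -> sha_2primary d ->
        (f c = f d <-> cohomologous c d) &
      forall z : 'Z_2 * B, exists2 c, sha_2primary c & f c = z].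

End TateShafarevich.

Definition trivial_rational_2torsion (E : elliptic_curve) : Prop :=
  forall P : point E rat, pt_add P P = pt0 -> P = pt0.

(* Main.v *)
From HB Require Import structures.
From mathcomp Require Import all_boot all_order all_algebra all_solvable all_field.
From mathcomp Require Import generic_quotient ring_quotient closed_field.
From mathcomp Require Import ring lra zify reals boolp classical_sets functions.
Require Import Defs.

Set Implicit Arguments.
Unset Strict Implicit.
Unset Printing Implicit Defensive.

Import Order.TTheory GRing.Theory Num.Theory.
Local Open Scope ring_scope.

(** For odd b prime to 5 let g = 256 - 27 b^4 and E_b : y^2 = f(x) = x^3 + g x + 2 g b^2, of discriminant
    16 (32 g)^2 up to sign, so that Q(i) is the quadratic resolvent field of f. The point Q1 = (-3 b^2, 16 b i)
    of E_b(Q(i)) is negated by complex conjugation; the cocycle xi, equal to Q1 on the automorphisms moving i and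
    to 0 elsewhere, satisfies 2 xi = 0 in H^1. A point M with sigma M = M + Q1 corresponds to a point of the quartic
    w^2 = - (s^2 - 9 b^2)^2 + 64 (2 b s + 16), which has points over every Q_v; hence xi is in Sha.

    If 2 c = xi with c in Sha, halve points to get 2 c(s) = xi(s) for all s. On the automorphisms fixing i and the
    roots th_j of f the values c(s) are 2-torsion points, and Kummer theory together with the point c(conj), a half of
    Q1, gives e in Q[X]/(f) such that the restriction of c to this group is given by the square roots of
    e(th_j) (x(Q1) - th_(j+1)). Compare the rational ternary forms u |-> coefficient of X^2 in e u^2 and in
    beta e u^2, where beta = 2 (X + 2 b^2). Local triviality of c shows that both are isotropic at the odd primes
    of good reduction; at the odd primes dividing g the element beta is a square; both are indefinite; but at 2 exactly
    one of them is isotropic. This contradicts the product formula for Hilbert symbols, that is, quadratic reciprocity.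

    So xi is an element of order 2 of Sha which is not divisible by 2, and a subgroup maximal among those
    containing 2 Sha but not xi is a complement of the subgroup generated by xi. *)

(** * The group law on a short Weierstrass cubic *)

(** Nothing is known about e at 2 or at the primes dividing g, so neither form can be decided there
    by itself; only the comparison of e with beta e is accessible. At 2 it comes down to (2, 10)_2 =
    -1: f has exactly one root used over K = Q_2, the two others lie in K(i), the norm of e at such
    a root is 10 times a square, and there beta is 2 times a square. The number 10 is read off the
    quartic modulo 16. [sha] quantifies over every completion and every algebraic closure, given
    abstractly. Placing xi in Sha therefore means treating an unknown complete field: a dichotomy on
    |2| in the manner of Ostrowski and Hensel's lemma replace a list of places. Exploiting that c is
    in Sha means producing such fields: Cauchy sequences for the p-adic values, maximal ideals for
    algebraic closures, Zorn's lemma for extending field morphisms. The real place only contributes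
    signs, which are read on the real elements of [algC], so no real completion is built. *)

Section ShortWeierstrass.
Variables (L : fieldType) (a b : L).
Hypothesis two_neq0 : 2%:R != 0 :> L.
Hypothesis smooth : forall x, x ^+ 3 + a * x + b = 0 -> 3%:R * x ^+ 2 + a != 0.

Implicit Types P Q : option (L * L).

Definition soncurve P : bool :=
  if P is Some (x, y) then y ^+ 2 == x ^+ 3 + a * x + b else true.

Definition sopp P : option (L * L) := if P is Some (x, y) then Some (x, - y) else None.

Definition sslope (x1 y1 x2 y2 : L) : L :=
  if x1 == x2 then (3%:R * x1 ^+ 2 + a) / (2%:R * y1) else (y2 - y1) / (x2 - x1).

Definition sadd P Q : option (L * L) :=
  match P, Q with
  | None, _ => Q
  | _, None => P
  | Some (x1, y1), Some (x2, y2) =>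
      if (x1 == x2) && (y2 == - y1) then None else
      let l := sslope x1 y1 x2 y2 in
      let x3 := l ^+ 2 - x1 - x2 in
      Some (x3, - (y1 + l * (x3 - x1)))
  end.

(* The line y = l x + n meets the curve at the abscissas x1, x2, x3, counted with multiplicity. *)
Definition line_meets (l n x1 x2 x3 : L) : Prop :=
  [/\ l ^+ 2 = x1 + x2 + x3,
      a = 2%:R * l * n + x1 * x2 + x1 * x3 + x2 * x3 &
      b = n ^+ 2 - x1 * x2 * x3].

Lemma line_meetsC l n x1 x2 x3 : line_meets l n x1 x2 x3 -> line_meets l n x2 x1 x3.
Proof. by case=> h1 h2 h3; split; rewrite ?h1 ?h2 ?h3; ring. Qed.

Lemma line_meetsR l n x1 x2 x3 : line_meets l n x1 x2 x3 -> line_meets l n x3 x1 x2.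
Proof. by case=> h1 h2 h3; split; rewrite ?h1 ?h2 ?h3; ring. Qed.

Lemma line_meetsN l n x1 x2 x3 :
  line_meets l n x1 x2 x3 -> line_meets (- l) (- n) x1 x2 x3.
Proof. by case=> h1 h2 h3; split; rewrite ?sqrrN ?h1 ?h2 ?h3; ring. Qed.

Lemma oppr_eqself (y : L) : (y == - y) = (y == 0).
Proof.
rewrite -subr_eq0 opprK -mulr2n -mulr_natl mulf_eq0 (negbTE two_neq0).
by [].
Qed.

Lemma sqr_eq_opp (y1 y2 : L) : y1 ^+ 2 = y2 ^+ 2 -> y2 != - y1 -> y2 = y1.
Proof.
by move=> /eqP; rewrite eq_sym eqf_sqr => /orP[/eqP //|/eqP ->]; rewrite eqxx.
Qed.

Lemma saddC P Q : soncurve P -> soncurve Q -> sadd P Q = sadd Q P.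
Proof.
case: P Q => [[x1 y1]|] [[x2 y2]|] //= /eqP e1 /eqP e2.
rewrite [x2 == x1]eq_sym; case: (eqVneq x1 x2) => [ex|nx] /=.
  rewrite -(inj_eq oppr_inj) opprK eq_sym; case: ifP => // /negbT ne.
  subst x2; have -> // : y1 = y2.
  by apply: (@sqr_eq_opp y2); [rewrite e1 e2 | rewrite ne].
have d0 : x2 - x1 != 0 by rewrite subr_eq0 eq_sym.
have d0' : x1 - x2 != 0 by rewrite subr_eq0.
have -> : sslope x2 y2 x1 y1 = sslope x1 y1 x2 y2.
  by rewrite /sslope (negbTE nx) eq_sym (negbTE nx); field; rewrite d0 d0'.
set l := sslope _ _ _ _.
have hl : l * (x2 - x1) = y2 - y1.
  by rewrite /l /sslope (negbTE nx) mulfVK.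
have -> : l ^+ 2 - x2 - x1 = l ^+ 2 - x1 - x2 by ring.
have -> : y2 = y1 + l * (x2 - x1) by rewrite hl; ring.
by clearbody l; congr (Some (_, _)); ring.
Qed.

(** Trades the case analysis in [sadd] for the symmetric relation [line_meets], so that chords and
    tangents are treated together from here on. *)
Lemma sadd_line l n x1 x2 x3 :
  line_meets l n x1 x2 x3 -> ~~ ((x1 == x2) && (l * x2 + n == - (l * x1 + n))) ->
  sadd (Some (x1, l * x1 + n)) (Some (x2, l * x2 + n)) =
  Some (x3, - (l * x3 + n)).
Proof.
move=> [h1 h2 h3] ne /=; rewrite (negbTE ne).
have -> : sslope x1 (l * x1 + n) x2 (l * x2 + n) = l.
  rewrite /sslope; case: (eqVneq x1 x2) ne => [ex|nx] /=; last first.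
    by move=> _; field; rewrite subr_eq0 eq_sym.
  subst x2; rewrite oppr_eqself => y0.
  have -> : 3%:R * x1 ^+ 2 + a = l * (2%:R * (l * x1 + n)) by ring: h1 h2.
  by rewrite mulfK // mulf_neq0.
by congr (Some (_, _)); ring: h1.
Qed.

Lemma line_throughP P Q :
  soncurve P -> soncurve Q -> [\/ P = None, Q = None, Q = sopp P |
  exists l n x1 x2 x3, [/\ line_meets l n x1 x2 x3, P = Some (x1, l * x1 + n),
    Q = Some (x2, l * x2 + n) & ~~ ((x1 == x2) && (l * x2 + n == - (l * x1 + n)))]].
Proof.
case: (eqVneq Q (sopp P)) => [->|ne]; first by constructor 3.
case: P Q ne => [[x1 y1]|] [[x2 y2]|] ne /=; [|by constructor..].
move=> /eqP e1 /eqP e2; constructor 4.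
have {ne} ne : ~~ ((x1 == x2) && (y2 == - y1)).
  by apply: contra ne => /andP[/eqP -> /eqP ->].
pose l := sslope x1 y1 x2 y2; pose n := y1 - l * x1.
have y1E : y1 = l * x1 + n by rewrite /n; ring.
suff [x3 h y2E] : exists2 x3, line_meets l n x1 x2 x3 & y2 = l * x2 + n.
  by exists l, n, x1, x2, x3; rewrite -y1E -y2E.
exists (l ^+ 2 - x1 - x2); last first.
  rewrite /n /l /sslope; case: (eqVneq x1 x2) ne => [ex|nx] /=.
    by subst x2 => ne; rewrite (sqr_eq_opp _ ne) ?e1 ?e2 //; ring.
  by move=> _; field; rewrite subr_eq0 eq_sym.
move: (y1E); rewrite /n {n y1E}; case: (eqVneq x1 x2) ne => [ex|nx] /= ne _.
  subst x2; have ey : y2 = y1 by apply: sqr_eq_opp ne; rewrite e1 e2.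
  subst y2; rewrite oppr_eqself in ne.
  have hl : l * (2%:R * y1) = 3%:R * x1 ^+ 2 + a.
    by rewrite /l /sslope eqxx mulfVK // mulf_neq0.
  have ha : a = l * (2%:R * y1) - 3%:R * x1 ^+ 2 by rewrite hl; ring.
  have hb : b = y1 ^+ 2 - x1 ^+ 3 - a * x1 by rewrite e1; ring.
  split; first ring.
  - by rewrite ha; ring.
  - by rewrite hb ha; ring.
have hl : l * (x2 - x1) = y2 - y1 by rewrite /l /sslope (negbTE nx) mulfVK // subr_eq0 eq_sym.
have y2E : y2 = y1 + l * (x2 - x1) by rewrite hl; ring.
have nx' : x2 - x1 != 0 by rewrite subr_eq0 eq_sym.
have ha : a = l * (2%:R * y1 + l * (x2 - x1)) - (x1 ^+ 2 + x1 * x2 + x2 ^+ 2).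
  apply: (mulfI nx'); transitivity ((x2 ^+ 3 + a * x2 + b) - (x1 ^+ 3 + a * x1 + b) -
    (x2 ^+ 3 - x1 ^+ 3)); first ring.
  by rewrite -e1 -e2 y2E; ring.
have hb : b = y1 ^+ 2 - x1 ^+ 3 - a * x1 by rewrite e1; ring.
split; first ring.
- by rewrite ha; ring.
- by rewrite hb ha; ring.
Qed.

Lemma sadd_None P : sadd P None = P. Proof. by case: P => [[]|]. Qed.

Lemma sadd_opp P : sadd P (sopp P) = None.
Proof. by case: P => [[x y]|] //=; rewrite !eqxx. Qed.

Lemma soppK : involutive sopp.
Proof. by case=> [[x y]|] //=; rewrite opprK. Qed.

Lemma sopp_oncurve P : soncurve P -> soncurve (sopp P).
Proof. by case: P => [[x y]|] //=; rewrite sqrrN. Qed.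

Lemma line_oncurve l n x1 x2 x3 : line_meets l n x1 x2 x3 ->
  soncurve (Some (x1, l * x1 + n)).
Proof. by case=> h1 h2 h3 /=; apply/eqP; ring: h1 h2 h3. Qed.

Lemma sadd_oncurve P Q : soncurve P -> soncurve Q -> soncurve (sadd P Q).
Proof.
move=> cP cQ; case: (line_throughP cP cQ) => [->|->|->|] //.
- by rewrite sadd_None.
- by rewrite sadd_opp.
move=> [l [n [x [x' [x3 [h -> -> ne']]]]]].
rewrite (sadd_line h ne') -/(sopp (Some (_, _))).
exact/sopp_oncurve/(line_oncurve (line_meetsR h)).
Qed.

Lemma sopp_add P Q : sopp (sadd P Q) = sadd (sopp P) (sopp Q).
Proof.
case: P Q => [[x1 y1]|] [[x2 y2]|] //=; rewrite eqr_opp.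
case: ifP => // /negbT ne.
have -> : sslope x1 (- y1) x2 (- y2) = - sslope x1 y1 x2 y2.
  rewrite /sslope; case: eqP => _; first by rewrite !mulrN invrN mulrN.
  by rewrite -mulNr; congr (_ / _); ring.
by congr (Some (_, _)); ring.
Qed.

Lemma saddK P Q : soncurve P -> soncurve Q -> sadd (sadd P Q) (sopp Q) = P.
Proof.
move=> cP cQ; case: (line_throughP cP cQ) => [->|->|->|] //.
- by rewrite /= sadd_opp.
- by rewrite !sadd_None.
- by rewrite sadd_opp soppK.
move=> [l [n [x [x' [x3 [h -> -> ne']]]]]].
rewrite (sadd_line h ne') /sopp.
have h' := line_meetsN (line_meetsR (line_meetsC h)).
have e z : - (l * z + n) = - l * z + - n by ring.
rewrite !e (sadd_line h') -?e ?opprK //.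
(* In the excluded case a line of finite slope is tangent at a point of ordinate 0, so [x'] would be
   a double root of the cubic. *)
apply/negP => /andP[/eqP ex]; rewrite ex in h *.
rewrite eq_sym oppr_eqself => /eqP y0.
case: h => h1 h2 h3; have n0 : n = - (l * x') by apply/eqP; rewrite -addr_eq0 addrC y0.
suff /smooth/eqP[] : x' ^+ 3 + a * x' + b = 0 by ring: h1 h2 n0.
by ring: h1 h2 h3 n0.
Qed.

Lemma line_root l n x1 x2 x3 x y : line_meets l n x1 x2 x3 ->
  soncurve (Some (x, y)) -> y = l * x + n -> x != x1 -> x != x2 -> x = x3.
Proof.
move=> [h1 h2 h3] /eqP h4 ey n1 n2; apply/eqP; rewrite -subr_eq0.
have : (x - x1) * (x - x2) * (x - x3) = 0.
  transitivity (x ^+ 3 + a * x + b - y ^+ 2); last by rewrite h4 subrr.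
  by ring: ey h1 h2 h3.
by move/eqP; rewrite !mulf_eq0 !subr_eq0 (negbTE n1) (negbTE n2).
Qed.

Lemma line_tangent l n x1 x3 : line_meets l n x1 x1 x3 ->
  3%:R * x1 ^+ 2 + a = 2%:R * l * (l * x1 + n).
Proof. by case=> h1 h2 h3; ring: h1 h2. Qed.

(** For p = xA + l m and q = l + m this reads p - q l0 = - 2 x0: on the tangent at a point counted
    twice, the conic x^2 + p x - q y + r used for associativity has roots of sum 2 x0, hence is
    itself tangent there. *)
Lemma residual_tangent l n m k x0 xO xA l0 y0 :
    line_meets l n x0 xO xA -> - (l * xA + n) = m * xA + k ->
    l * x0 + n = y0 -> m * x0 + k = y0 ->
    3%:R * x0 ^+ 2 + a = 2%:R * l0 * y0 -> x0 != xA ->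
  xA + l * m - (l + m) * l0 = - (x0 + x0).
Proof.
move=> [h1 h2 _] e1 e2 e3 e4; rewrite -subr_eq0 => ne; apply: (mulIf ne).
have e5 : (l + m) * (x0 - xA) = 2%:R * y0.
  have -> : 2%:R * y0 = y0 + y0 by ring.
  rewrite -{1}e2 -e3; move/eqP: e1; rewrite -subr_eq0 => /eqP e1.
  transitivity ((l + m) * (x0 - xA) + (- (l * xA + n) - (m * xA + k)) * -1).
    by rewrite e1; ring.
  ring.
have e6 : xO = l ^+ 2 - x0 - xA by rewrite h1; ring.
have e7 : n = y0 - l * x0 by rewrite -e2; ring.
apply/eqP; rewrite -subr_eq0; apply/eqP.
transitivity (xA * (x0 - xA) + l * m * (x0 - xA) + (2%:R * x0) * (x0 - xA) -
  l0 * ((l + m) * (x0 - xA))); first ring.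
rewrite e5 (_ : l0 * _ = 3%:R * x0 ^+ 2 + a); last by rewrite e4; ring.
rewrite h2 e6 e7; transitivity (l * ((l + m) * (x0 - xA) - 2%:R * y0)); first ring.
by rewrite e5; ring.
Qed.

(* The cubic through P, Q, R and the residual point -S obtained from two chords
   is the conic H = x^2 + p x - q y + r; the three coefficients only depend on
   P, Q and R, as the difference of two such H is a line. *)
Lemma saddA_line (l n m k l' n' m' k' x1 x2 xR xA xS xB xT : L) :
    line_meets l n x1 x2 xA -> line_meets m k xA xR xS ->
    - (l * xA + n) = m * xA + k ->
    line_meets l' n' x2 xR xB -> line_meets m' k' x1 xB xT ->
    - (l' * xB + n') = m' * xB + k' ->
    l * x1 + n = m' * x1 + k' -> l * x2 + n = l' * x2 + n' ->
    m * xR + k = l' * xR + n' ->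
    ~~ ((x1 == x2) && (l * x2 + n == - (l * x1 + n))) ->
    ~~ ((x2 == xR) && (l' * xR + n' == - (l' * x2 + n'))) ->
    ~~ ((xA == xR) && (m * xR + k == - (m * xA + k))) ->
    ~~ ((x1 == xB) && (m' * xB + k' == - (m' * x1 + k'))) ->
    x1 != xR ->
  xS = xT /\ m * xS + k = m' * xT + k'.
Proof.
move=> hA hS yA hB hT yB e1 e2 e3 n1 n2 n3 n4 n5.
have [a1 a2 a3] := hA; have [b1 b2 b3] := hS.
have [c1 c2 c3] := hB; have [d1 d2 d3] := hT.
have kE : k = - (l * xA + n) - m * xA by rewrite yA; ring.
have kE' : k' = - (l' * xB + n') - m' * xB by rewrite yB; ring.
pose p := xA + l * m; pose q := l + m; pose r := x1 * x2 + q * n.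
pose p' := xB + l' * m'; pose q' := l' + m'; pose r' := x2 * xR + q' * n'.
have pq : p - q * l = - (x1 + x2) by rewrite /p /q; ring: a1.
have pq' : p' - q' * l' = - (x2 + xR) by rewrite /p' /q'; ring: c1.
have rE : r = xR * xS + q * k.
  apply/eqP; rewrite -subr_eq0; apply/eqP.
  transitivity ((a - (2%:R * m * k + xA * xR + xA * xS + xR * xS)) -
    (a - (2%:R * l * n + x1 * x2 + x1 * xA + x2 * xA)) -
    xA * (m ^+ 2 - xA - xR - xS - (l ^+ 2 - x1 - x2 - xA))); last first.
    by rewrite -a2 -b2 a1 b1; ring.
  by rewrite /r /q kE; ring.
have rE' : r' = x1 * xT + q' * k'.
  apply/eqP; rewrite -subr_eq0; apply/eqP.
  transitivity ((a - (2%:R * m' * k' + x1 * xB + x1 * xT + xB * xT)) -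
    (a - (2%:R * l' * n' + x2 * xR + x2 * xB + xR * xB)) -
    xB * (m' ^+ 2 - x1 - xB - xT - (l' ^+ 2 - x2 - xR - xB))); last first.
    by rewrite -c2 -d2 c1 d1; ring.
  by rewrite /r' /q' kE'; ring.
have pm : p - q * m = - (xR + xS) by rewrite /p /q; ring: b1.
have pm' : p' - q' * m' = - (x1 + xT) by rewrite /p' /q'; ring: d1.
pose D x y := (p - p') * x - (q - q') * y + (r - r').
have HE (x p0 q0 r0 l0 n0 : L) : x ^+ 2 + p0 * x - q0 * (l0 * x + n0) + r0 =
  x * (x + (p0 - q0 * l0)) + (r0 - q0 * n0) by ring.
have DE x y : D x y = (x ^+ 2 + p * x - q * y + r) - (x ^+ 2 + p' * x - q' * y + r').
  by rewrite /D; ring.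
have DP : D x1 (l * x1 + n) = 0.
  by rewrite DE {2}e1 !HE pq pm' rE' {1}/r; ring.
have DQ : D x2 (l * x2 + n) = 0.
  by rewrite DE {2}e2 !HE pq pq' {1}/r {1}/r'; ring.
have DR : D xR (l' * xR + n') = 0.
  by rewrite DE -{1}e3 !HE pm pq' {1}rE {1}/r'; ring.
have yA' : - (m * xA + k) = l * xA + n by rewrite -yA opprK.
have n2x : xA = xR -> x2 != xR.
  move=> e; apply: contra n3 => /eqP e'.
  by rewrite yA' e eqxx /= e3 -e' e2.
have n1x : x1 = xB -> x1 != x2.
  move=> e; apply: contra n4 => /eqP e'.
  by rewrite -yB -e1 -e eqxx /= e' e2.
have noR : x2 != xR -> x1 != xR -> l * xR + n != l' * xR + n'.
  move=> nQ nP; apply/negP => /eqP e.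
  have eA : xR = xA.
    apply: (line_root hA (y := l' * xR + n')) => //; try by rewrite eq_sym.
    exact: line_oncurve (line_meetsC hB).
  by move: n3; rewrite yA' -eA eqxx /= e3 -e eqxx.
have noP : x1 != x2 -> x1 != xR -> l' * x1 + n' != l * x1 + n.
  move=> nQ nP; apply/negP => /eqP e.
  have eA : x1 = xB.
    by apply: (line_root hB (y := l * x1 + n)) => //; exact: line_oncurve hA.
  by move: n4; rewrite -yB -e1 -eA eqxx /= e eqxx.
(* The affine function [D] vanishes at the three points, so its linear part is zero unless they are
   collinear, and collinearity contradicts [n3] or [n4]. When two of the points coincide,
   [residual_tangent] supplies the missing linear condition. *)
have [qq pp] : q = q' /\ p = p'.
  case: (eqVneq x1 x2) => [e12|ne12].
    have ne2R : x2 != xR by rewrite -e12.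
    have nB : x1 != xB by apply/negP => /eqP /n1x; rewrite e12 eqxx.
    have t : p' - q' * l = - (x1 + x1).
      apply: (residual_tangent (x0 := x1) (y0 := l * x1 + n) _ yB) nB => //.
      - by rewrite {1}e12; exact: hB.
      - by rewrite {1}e12 -e2 -e12.
      - by rewrite e12 in hA; rewrite e12 (line_tangent hA).
    have dl : (p - p') = (q - q') * l.
      apply/eqP; rewrite -subr_eq0; apply/eqP.
      transitivity ((p - q * l) - (p' - q' * l)); first ring.
      by rewrite pq t -e12 subrr.
    have : (q - q') * ((l * xR + n) - (l' * xR + n')) = 0.
      transitivity (D xR (l' * xR + n') - D x1 (l * x1 + n)); last by rewrite DP DR subrr.
      by rewrite /D dl; ring.
    move/eqP; rewrite mulf_eq0 [X in _ || X]subr_eq0 (negbTE (noR ne2R n5)) orbF.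
    move=> /eqP q0; move: dl; rewrite q0 mul0r => /eqP; rewrite subr_eq0 => /eqP ->.
    by split=> //; apply/eqP; rewrite -subr_eq0 q0.
  case: (eqVneq x2 xR) => [e2R|ne2R].
    have nA : x2 != xA by apply/negP => /eqP e; case/eqP: (n2x (etrans (esym e) e2R)).
    have t : p - q * l' = - (x2 + x2).
      apply: (residual_tangent (x0 := x2) (y0 := l' * x2 + n') _ yA) nA => //.
      - exact: line_meetsC hA.
      - by rewrite e2R e3.
      - by rewrite -e2R in hB; rewrite (line_tangent hB).
    have dl : (p - p') = (q - q') * l'.
      apply/eqP; rewrite -subr_eq0; apply/eqP.
      transitivity ((p - q * l') - (p' - q' * l')); first ring.
      by rewrite pq' t -e2R subrr.
    have : (q - q') * ((l' * x1 + n') - (l * x1 + n)) = 0.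
      transitivity (D x1 (l * x1 + n) - D x2 (l * x2 + n)); last by rewrite DP DQ subrr.
      by rewrite e2 /D dl; ring.
    move/eqP; rewrite mulf_eq0 [X in _ || X]subr_eq0 (negbTE (noP ne12 n5)) orbF.
    move=> /eqP q0; move: dl; rewrite q0 mul0r => /eqP; rewrite subr_eq0 => /eqP ->.
    by split=> //; apply/eqP; rewrite -subr_eq0 q0.
  have dl : (p - p') = (q - q') * l.
    have nz : x1 - x2 != 0 by rewrite subr_eq0.
    apply: (mulIf nz); apply/eqP; rewrite -subr_eq0; apply/eqP.
    transitivity (D x1 (l * x1 + n) - D x2 (l * x2 + n)); last by rewrite DP DQ subrr.
    by rewrite /D; ring.
  have : (q - q') * ((l * xR + n) - (l' * xR + n')) = 0.
    transitivity (D xR (l' * xR + n') - D x1 (l * x1 + n)); last by rewrite DP DR subrr.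
    by rewrite /D dl; ring.
  move/eqP; rewrite mulf_eq0 [X in _ || X]subr_eq0 (negbTE (noR ne2R n5)) orbF.
  move=> /eqP q0; move: dl; rewrite q0 mul0r => /eqP; rewrite subr_eq0 => /eqP ->.
  by split=> //; apply/eqP; rewrite -subr_eq0 q0.
have rr : r = r' by move/eqP: DP; rewrite /D qq pp !subrr !mul0r subrr add0r subr_eq0 => /eqP.
have sE : x1 + x2 + xR + xS = q ^+ 2 - 2%:R * p.
  by rewrite /q /p; ring: a1 b1.
have sE' : x1 + x2 + xR + xT = q' ^+ 2 - 2%:R * p'.
  by rewrite /q' /p'; ring: c1 d1.
have eS : xS = xT by apply: (addrI (x1 + x2 + xR)); rewrite sE sE' qq pp.
split=> //; apply: (mulfI (x := q)); last first.
  transitivity (xS ^+ 2 + p * xS + r).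
    transitivity (xS * (xS + (p - q * m)) + (r - q * k) + q * (m * xS + k) - 0); last first.
      by ring.
    by rewrite pm {1}rE; ring.
  rewrite eS pp rr qq.
  transitivity (xT * (xT + (p' - q' * m')) + (r' - q' * k') + q' * (m' * xT + k')); first ring.
  by rewrite pm' {1}rE'; ring.
(* If q = 0 the second chord is the reflection of the first, so xR is x1 or x2: the former
   contradicts [n5], the latter makes R = -Q, against [n2]. *)
apply/negP => /eqP q0.
have mE : m = - l by apply/eqP; rewrite -addr_eq0 addrC; apply/eqP.
have kE2 : k = - n by rewrite kE mE; ring.
have h3 := hS; rewrite mE kE2 in h3; have := line_meetsN h3; rewrite !opprK => h4.
have nx1 : xR != x1 by rewrite eq_sym.
have [g1 g2 g3] := h4.
have sR : xR + xS = x1 + x2.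
  by apply: (addrI xA); rewrite addrA -g1 a1; ring.
have pR : xR * xS = x1 * x2.
  apply: (addrI (2%:R * l * n + xA * (xR + xS))); rewrite {2}sR.
  transitivity a; first by rewrite g2; ring.
  by rewrite a2; ring.
have /eqP : (xR - x1) * (xR - x2) = 0.
  transitivity (xR ^+ 2 - xR * (x1 + x2) + x1 * x2); first ring.
  by rewrite -sR -pR; ring.
rewrite mulf_eq0 !subr_eq0 (negbTE nx1) /= => /eqP ex.
by move: n2; rewrite -e3 ex eqxx /= mE kE2 -e2 => /negP[]; apply/eqP; ring.
Qed.

(** Every degenerate sum follows from the cancellation law [saddK], and R = P or R = -P from
    commutativity. What remains is the generic configuration of [saddA_line], in which P and R have
    different abscissas. *)
Theorem saddA P Q R : soncurve P -> soncurve Q -> soncurve R ->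
  sadd (sadd P Q) R = sadd P (sadd Q R).
Proof.
move=> cP cQ cR.
have K1 U V : soncurve U -> soncurve V -> sadd (sopp U) (sadd U V) = V.
  move=> cU cV; rewrite (saddC cU cV) saddC ?sadd_oncurve ?sopp_oncurve //.
  exact: saddK.
have K2 U V : soncurve U -> soncurve V -> sadd U (sadd (sopp U) V) = V.
  by move=> cU cV; rewrite -{1}[U]soppK K1 ?sopp_oncurve.
have K3 U V : soncurve U -> soncurve V -> sadd (sadd U (sopp V)) V = U.
  by move=> cU cV; rewrite -{2}[V]soppK saddK ?sopp_oncurve.
have N1 U : sadd None U = U by [].
have SN U : sadd (sopp U) U = None by rewrite -{2}[U]soppK sadd_opp.
case: (eqVneq R P) => [->|nRP].
  by rewrite (saddC (sadd_oncurve cP cQ) cP) (saddC cP cQ).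
case: (eqVneq R (sopp P)) => [->|nRP'].
  rewrite (saddC cP cQ) saddK // saddC ?sadd_oncurve ?sopp_oncurve //.
  by rewrite -{2}[P]soppK saddK ?sopp_oncurve.
case: (line_throughP cP cQ) => [->|->|->|] //; first by rewrite sadd_None.
  by rewrite sadd_opp K2.
move=> [l [n [x1 [x2 [xA [hA eP eQ nPQ]]]]]].
case: (line_throughP cQ cR) => [EQ|->|->|]; first by rewrite EQ in eQ.
- by rewrite !sadd_None.
- by rewrite sadd_opp sadd_None saddK.
move=> [l' [n' [x2' [xR [xB [hB eQ' eR nQR]]]]]].
move: (etrans (esym eQ) eQ') hB nQR => -[<- e2] hB nQR.
have EA : sadd P Q = Some (xA, - (l * xA + n)) by rewrite eP eQ; exact: sadd_line.
have EB : sadd Q R = Some (xB, - (l' * xB + n')).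
  by rewrite eQ e2 eR; apply: sadd_line.
have cA := sadd_oncurve cP cQ; have cB := sadd_oncurve cQ cR.
case: (line_throughP cA cR) => [E|E|E|]; first by rewrite EA in E.
- by rewrite eR in E.
- rewrite E sadd_opp sopp_add (saddC (sopp_oncurve cP)) ?sopp_oncurve //.
  by rewrite K2 ?sopp_oncurve // sadd_opp.
move=> [m [k [xA' [xR' [xS [hS EA' eR' nAR]]]]]].
case: (line_throughP cP cB) => [E|E|E|]; first by rewrite eP in E.
- by rewrite EB in E.
- rewrite E sadd_opp.
  have -> : P = sopp (sadd Q R) by rewrite E soppK.
  rewrite sopp_add (saddC (sopp_oncurve cQ)) ?sopp_oncurve //.
  by rewrite K3 ?sopp_oncurve // SN.
move=> [m' [k' [x1' [xB' [xT [hT eP' EB' nPB]]]]]].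
move: (etrans (esym EA) EA') hS nAR => -[<- yA] hS nAR.
move: (etrans (esym eR) eR') hS nAR => -[<- e3] hS nAR.
move: (etrans (esym eP) eP') hT nPB => -[<- e1] hT nPB.
move: (etrans (esym EB) EB') hT nPB => -[<- yB] hT nPB.
have n5 : x1 != xR.
  apply/negP => /eqP ex; move: cP cR nRP nRP'; rewrite eP eR ex /= => /eqP c1 /eqP c2.
  move=> ne1 ne2; case/eqP: ne1; congr (Some (_, _)).
  apply: sqr_eq_opp; first by rewrite c1 c2.
  by apply: contra ne2 => /eqP ->.
have [eS ey] := saddA_line hA hS yA hB hT yB e1 e2 (esym e3) nPQ nQR nAR nPB n5.
transitivity (Some (xS, - (m * xS + k))).
  by rewrite EA eR yA e3; exact: sadd_line.
by rewrite ey eS EB eP e1 yB; apply/esym/sadd_line.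
Qed.
End ShortWeierstrass.

Lemma rmorph_ratr (L : fieldType) (r : {rmorphism rat -> L}) q : ratr q = r q.
Proof. exact/esym/fmorph_eq_rat. Qed.

(** * Points of y^2 = x^3 + A x + B as an abelian group, and functoriality in the field *)

Section ShortCurve.
Variables (A B : rat) (hAB : weierstrass_disc 0 0 0 A B != 0).
Definition scurve : elliptic_curve := EllipticCurve hAB.

Section Points.
Variables (L : fieldType) (r : {rmorphism rat -> L}).
Local Notation a := (ratr A : L).
Local Notation b := (ratr B : L).

Lemma char0_natr_neq0 n : n.+1%:R != 0 :> L.
Proof. by rewrite -(rmorph_nat r) fmorph_eq0 pnatr_eq0. Qed.

Lemma scurve_smooth (x : L) : x ^+ 3 + a * x + b = 0 -> 3%:R * x ^+ 2 + a != 0.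
Proof.
move=> fx; apply: contra hAB => /eqP dx.
have aE : a = - (3%:R * x ^+ 2) by apply/eqP; rewrite -addr_eq0 addrC dx.
have bE : b = 2%:R * x ^+ 3.
  by apply/eqP; rewrite -subr_eq0; apply/eqP; rewrite -fx aE; ring.
have : r (4%:R * A ^+ 3 + 27%:R * B ^+ 2) = 0.
  rewrite rmorphD !(rmorphXn, rmorphM, rmorph_nat) /= -!(rmorph_ratr r) aE bE; ring.
move/eqP; rewrite fmorph_eq0 /weierstrass_disc => /eqP e; apply/eqP.
transitivity (-16%:R * (4%:R * A ^+ 3 + 27%:R * B ^+ 2)); last by rewrite e mulr0.
ring.
Qed.

Lemma ratr00 : ratr 0 = 0 :> L. Proof. by rewrite (rmorph_ratr r) rmorph0. Qed.

Lemma on_scurve P : on_curve (L := L) scurve P = soncurve a b P.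
Proof. by case: P => [[x y]|] //=; rewrite !ratr00 !mul0r !addr0. Qed.

Lemma raw_oppE P : raw_opp (L := L) scurve P = sopp P.
Proof. by case: P => [[x y]|] //=; rewrite !ratr00 !mul0r !subr0. Qed.

Lemma raw_addE P Q : raw_add (L := L) scurve P Q = sadd a P Q.
Proof.
case: P Q => [[x1 y1]|] [[x2 y2]|] //=; rewrite !ratr00 !mul0r !subr0.
case: ifP => // _.
have -> : slope (L := L) scurve x1 y1 x2 y2 = sslope a x1 y1 x2 y2.
  by rewrite /slope /sslope /= !ratr00 ?mulr0 ?mul0r ?addr0 ?subr0.
by rewrite ?addr0 ?subr0.
Qed.

(* The morphism r is a parameter of the type because the group law needs it. *)
Definition spoint : Type := (fun _ : {rmorphism rat -> L} => point scurve L : Type) r.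
HB.instance Definition _ := Equality.on spoint.
HB.instance Definition _ := SubType.on spoint.
HB.instance Definition _ := [Choice of spoint by <:].

Let two_n0 : 2%:R != 0 :> L := char0_natr_neq0 1.

Lemma spoint_on (P : spoint) : soncurve a b (val P).
Proof. by rewrite -on_scurve; exact: (pointP P). Qed.

Fact spt_addA : associative (fun P Q : spoint => pt_add P Q : spoint).
Proof.
move=> P Q R; apply: val_inj => /=; rewrite !raw_addE.
by rewrite (saddA two_n0 scurve_smooth) // spoint_on.
Qed.

Fact spt_addC : commutative (fun P Q : spoint => pt_add P Q : spoint).
Proof.
by move=> P Q; apply: val_inj => /=; rewrite !raw_addE (@saddC _ a b) // spoint_on.
Qed.

Fact spt_add0 : left_id (pt0 : spoint) (fun P Q : spoint => pt_add P Q : spoint).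
Proof. by move=> P; apply: val_inj. Qed.

Fact spt_addN : left_inverse (pt0 : spoint) (fun P : spoint => pt_opp P : spoint)
  (fun P Q : spoint => pt_add P Q : spoint).
Proof.
move=> P; rewrite spt_addC; apply: val_inj => /=.
by rewrite raw_addE raw_oppE; case: (val P) => [[x y]|] //=; rewrite !eqxx.
Qed.

HB.instance Definition _ := GRing.isZmodule.Build spoint spt_addA spt_addC spt_add0 spt_addN.

End Points.

Lemma pt_map_add (L L' : fieldType) (r : {rmorphism rat -> L}) (f : {rmorphism L -> L'})
    (P Q : spoint r) :
  pt_map f (P + Q) = (pt_map f P : spoint (f \o r)) + pt_map f Q.
Proof.
apply: val_inj; rewrite /= (raw_addE r) (raw_addE (f \o r)) /raw_map -(fmorph_rat f A).
move: (ratr A) => a.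
case: (val P) (val Q) => [[x1 y1]|] [[x2 y2]|] //=.
rewrite -rmorphN !(inj_eq (fmorph_inj f)); case: ifP => // _ /=.
have -> : sslope (f a) (f x1) (f y1) (f x2) (f y2) = f (sslope a x1 y1 x2 y2).
  rewrite /sslope (inj_eq (fmorph_inj f)); case: eqP => _; rewrite fmorph_div.
    by rewrite rmorphD !(rmorphXn, rmorphM, rmorph_nat).
  by rewrite !rmorphB.
by rewrite !(rmorphN, rmorphB, rmorphD, rmorphXn, rmorphM).
Qed.

End ShortCurve.

(** * Elements of order two that are not divisible by two *)

Local Open Scope quotient_scope.

(** [Zorn_bigcup] must also handle the empty chain, where [P] may fail; adding [B0] to every set
    reduces that case to [P B0]. *)
Lemma Zorn_above (T : Type) (P : set T -> Prop) (B0 : set T) :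
  P B0 ->
  (forall F : set (set T), (F !=set0)%classic -> (forall X, F X -> P X /\ (B0 `<=` X)%classic) ->
     total_on F subset -> P (\bigcup_(X in F) X)%classic) ->
  exists A, [/\ (B0 `<=` A)%classic, P A &
     forall B, (A `<=` B)%classic -> P B -> (B `<=` A)%classic].
Proof.
move=> P0 Pch; pose Q X := P (B0 `|` X)%classic.
have [|A [QA maxA]] := @Zorn_bigcup T Q.
  move=> F FQ totF; rewrite /Q; have [[X FX]|/forallNP F0] := pselect (exists X, F X).
    pose F' := [set (B0 `|` X)%classic | X in F]%classic.
    have -> : (B0 `|` \bigcup_(X in F) X = \bigcup_(X in F') X)%classic.
      apply/seteqP; split=> t.
        case=> [B0t|[Y FY Yt]]; first by exists (B0 `|` X)%classic; [exists X|left].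
        by exists (B0 `|` Y)%classic; [exists Y|right].
      by case=> _ [Y FY <-] [|Yt]; [left|right; exists Y].
    apply: Pch; first by exists (B0 `|` X)%classic, X.
      move=> _ [Y FY <-]; split; [exact: FQ | by move=> t Bt; left].
    move=> _ _ [Y FY <-] [Z FZ <-].
    by have [h|h] := totF _ _ FY FZ; [left|right]; exact: setUS.
  rewrite (_ : \bigcup_(X in F) X = set0)%classic ?setU0 //.
  by apply/seteqP; split=> // t [X /F0].
exists (B0 `|` A)%classic; split=> //.
move=> B sB PB; have sAB : (A `<=` B)%classic by move=> t At; apply: sB; right.
have sB0B : (B0 `<=` B)%classic by move=> t Bt; apply: sB; left.
have QB : Q B by rewrite /Q (_ : B0 `|` B = B)%classic //; exact/setUidPr.
have [BA|nBA] := pselect (B `<=` A)%classic; first by move=> t /BA; right.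
by case: (maxA B) => //; split.
Qed.

Section DirectFactor.
Variables (V : zmodType) (N : set V) (x : V).
Hypotheses (N0 : N 0) (NB : forall u v, N u -> N v -> N (u - v)).
Hypotheses (Nx : N (x *+ 2)) (xN2 : forall y, ~ N (y *+ 2 - x)).

Let NN u : N u -> N (- u). Proof. by move=> Nu; rewrite -sub0r; exact: NB. Qed.
Let ND u v : N u -> N v -> N (u + v).
Proof. by move=> Nu Nv; rewrite -[v]opprK; apply: NB => //; exact: NN. Qed.

Lemma maximal_subgroup : exists H : set V,
  [/\ (forall u v, H u -> H v -> H (u - v)), (N `<=` H)%classic,
      ~ H x & forall y, H y \/ H (y - x)].
Proof.
pose P (X : set V) := [/\ forall u v, X u -> X v -> X (u - v), ~ X x &
  (forall u, X (u *+ 2)) /\ (N `<=` X)%classic].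
(* This is N + 2 V; x lies outside it because x is not divisible by 2 modulo N. *)
pose B0 : set V := [set z | exists u, N (z - u *+ 2)]%classic.
have PB0 : P B0.
  split.
  - move=> u v [u' hu] [v' hv]; exists (u' - v').
    rewrite mulrnBl opprB [v' *+ 2 - _]addrC addrACA [- v + _]addrC -[_ - v]opprB.
    exact: NB.
  - by case=> u; rewrite -opprB => /NN; rewrite opprK => /xN2.
  - split=> [u|u Nu]; first by exists u; rewrite subrr.
    by exists 0; rewrite mul0rn subr0.
have [|H [sB0H [Hsub Hx [H2 sNH]] maxH]] := Zorn_above PB0.
  move=> F [X0 FX0] FP totF; split.
  - move=> u v [X FX Xu] [Y FY Yv].
    have [h|h] := totF _ _ FX FY.
      by exists Y => //; have [[c _ _] _] := FP _ FY; apply: c => //; exact: h.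
    by exists X => //; have [[c _ _] _] := FP _ FX; apply: c => //; exact: h.
  - by case=> X FX Xx; have [[_ c _] _] := FP _ FX.
  - have [[_ _ [c1 c2]] _] := FP _ FX0.
    by split=> [u|u Nu]; exists X0 => //; first [exact: c1|exact: c2].
have H0 : H 0 by exact: sNH.
have HN u : H u -> H (- u) by move=> Hu; rewrite -sub0r; exact: Hsub.
have HD u v : H u -> H v -> H (u + v) by move=> Hu Hv; rewrite -[v]opprK; apply/Hsub/HN.
exists H; split=> // y; have [Hy|nHy] := pselect (H y); [by left|right].
pose H' : set V := [set z | H z \/ H (z - y)]%classic.
have [Hx'|nHx'] := pselect (H' x).
  by case: Hx' => // /HN; rewrite opprB.
exfalso; apply: nHy; apply: (maxH H'); last by right; rewrite subrr.
  by move=> z Hz; left.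
split=> //; last first.
  by split=> [u|u Nu]; left; first [exact: H2|exact: sNH].
move=> u v [hu|hu] [hv|hv]; [left; exact: Hsub | right | right | left].
- have -> : u - v - y = u - (v - y) - y *+ 2
    by rewrite mulr2n opprB addrA opprD addrA [u + y - v - y]addrAC addrK.
  by apply: (Hsub) => //; exact: Hsub.
- have -> : u - v - y = (u - y) - v by rewrite addrAC.
  exact: Hsub.
- have -> : u - v = (u - y) - (v - y) by rewrite opprB addrA subrK.
  exact: Hsub.
Qed.

Definition mod_x : {pred V} := fun u => `[< N u \/ N (u - x) >].

Fact mod_x_zmod_closed : zmod_closed mod_x.
Proof.
split=> [|u v]; first by apply/asboolP; left.
move=> /asboolP hu /asboolP hv; apply/asboolP.
case: hu hv => hu [hv|hv]; [left; exact: NB | right | right | left].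
- have -> : u - v - x = u - (v - x) - x *+ 2.
    by rewrite mulr2n opprB addrA opprD addrA [u + x - v - x]addrAC addrK.
  by apply: (NB) => //; exact: NB.
- have -> : u - v - x = (u - x) - v by rewrite addrAC.
  exact: NB.
- have -> : u - v = (u - x) - (v - x) by rewrite opprB addrA subrK.
  exact: NB.
Qed.
HB.instance Definition _ := GRing.isZmodClosed.Build V mod_x mod_x_zmod_closed.

(** The character [chi] with kernel H takes the value 1 at x, so it splits off the subgroup
    generated by x. Paired with the projection to V / (N + Zx) it is injective modulo N, and a wrong
    value of [chi] is corrected by adding x. *)
Theorem Z2_direct_factor : exists (B : zmodType) (f : V -> 'Z_2 * B),
  [/\ forall u v, f (u + v) = f u + f v,
      forall u v, f u = f v <-> N (u - v) &
      forall z, exists u, f u = z].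
Proof.
have [H [Hsub sNH Hx Hor]] := maximal_subgroup.
pose chi u : 'Z_2 := if `[< H u >] then 0 else 1.
have H0 : H 0 by exact: sNH.
have HN u : H u -> H (- u) by move=> Hu; rewrite -sub0r; exact: Hsub.
have HD u v : H u -> H v -> H (u + v) by move=> Hu Hv; rewrite -[v]opprK; apply/Hsub/HN.
have chiD u v : chi (u + v) = chi u + chi v.
  have nn : H (u + v) \/ H u \/ H v.
    have [] := Hor u; first by right; left.
    have [] := Hor v; first by right; right.
    move=> hv' hu'; left; have -> : u + v = (u - x) + (v - x) + x *+ 2.
      by rewrite mulr2n addrACA !subrK.
    by apply: (HD); [exact: HD | exact: sNH].
  have n1 : H (u + v) -> H u -> H v by move=> h hu; rewrite -[v](addKr u) addrC; exact: Hsub.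
  have n2 : H (u + v) -> H v -> H u by move=> h hv; rewrite -[u](addrK v); exact: Hsub.
  have n3 := HD u v; have e2 : 1 + 1 = 0 :> 'Z_2 by apply: val_inj.
  rewrite /chi; case: asboolP => h; case: asboolP => hu; case: asboolP => hv;
    by rewrite ?addr0 ?add0r ?e2 //; tauto.
exists (Quotient.quot mod_x), (fun u => (chi u, \pi_(Quotient.quot mod_x) u)).
split.
- move=> u v; rewrite chiD; congr (_, _); exact: (raddfD (\pi_(Quotient.quot mod_x) : {additive V -> Quotient.quot mod_x})).
- move=> u v; split=> [[e1 e2]|Nuv].
    have : mod_x (u - v) by rewrite -[mod_x _]/(_ \in mod_x) Quotient.idealrBE; apply/eqP.
    case/asboolP => // hx; move: e1.
    have -> : u = (u - v) + v by rewrite subrK.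
    rewrite chiD -[RHS]add0r => /addIr; rewrite /chi; case: asboolP => // h _.
    by case: Hx; rewrite -[x](subKr (u - v)); apply: Hsub => //; exact: sNH.
  congr (_, _).
    by rewrite -[u](subrK v) chiD /chi asboolT ?add0r //; exact: sNH.
  by apply/eqP; rewrite -Quotient.idealrBE; apply/asboolP; left.
case=> e q; have [c <-] : exists c, \pi_(Quotient.quot mod_x) c = q by exists (repr q); rewrite reprK.
have chix : chi x = 1 by rewrite /chi asboolF.
have [->|ne] := eqVneq e (chi c); first by exists c.
exists (c + x); rewrite chiD chix; congr (_, _); last first.
  apply/eqP; rewrite -Quotient.idealrBE addrC addKr; apply/asboolP; right.
  by rewrite subrr.
by case: e (chi c) ne => [[|[|m]] ?] [[|[|n]] ?] //= _; apply: val_inj.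
Qed.

End DirectFactor.

(** * Cochains as a group, and a direct factor of Sha from one non-divisible class *)

Section ShaFactor.
Variables (R : realType) (A B : rat) (hAB : weierstrass_disc 0 0 0 A B != 0).
Let rQ : {rmorphism rat -> algC} := ratr.
Notation E := (scurve hAB).
Notation C := (cochain E rQ).

Section SMap.
Variables (K L : fieldType) (r : {rmorphism rat -> K}) (r' : {rmorphism rat -> L}).
Variable f : {rmorphism K -> L}.

Definition smap (P : spoint hAB r) : spoint hAB r' := pt_map f P.

Fact smap_is_zmod_morphism : zmod_morphism smap.
Proof.
have D (P Q : spoint hAB r) : smap (P + Q) = smap P + smap Q by exact: pt_map_add.
have Z : smap 0 = 0 by exact: val_inj.
by move=> P Q; apply/eqP; rewrite eq_sym subr_eq -D subrK.
Qed.
HB.instance Definition _ := GRing.isZmodMorphism.Build _ _ smap smap_is_zmod_morphism.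

End SMap.
Arguments smap {K L} r r' f P.

Section Sub.
Variables (K L : fieldType) (j : {rmorphism K -> L}) (r : {rmorphism rat -> L}).
Implicit Types c d : gal j -> spoint hAB r.

Lemma coboundaryP c : coboundary (c : cochain E j) <->
  exists P : spoint hAB r, forall s, c s = smap r r s P - P.
Proof. by []. Qed.

Lemma cocycleP c : cocycle (c : cochain E j) <-> continuous_cochain (c : cochain E j) /\
  forall s t, c (gal_mul s t) = c s + smap r r s (c t).
Proof. by []. Qed.

Lemma cochain_mulnE n c : cochain_muln n c = (c *+ n : gal j -> spoint hAB r).
Proof.
apply/funext => s; rewrite /cochain_muln.
elim: n => [|n IH]; first by rewrite mulr0n.
by rewrite mulrS -[(c + _) s]/(c s + (c *+ n) s) -IH.
Qed.

Lemma coboundary0 : coboundary ((0 : gal j -> spoint hAB r) : cochain E j).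
Proof. by apply/coboundaryP; exists 0 => s; rewrite raddf0 subrr. Qed.

Lemma coboundary_sub c d : coboundary (c : cochain E j) -> coboundary (d : cochain E j) ->
  coboundary ((c - d) : cochain E j).
Proof.
move=> /coboundaryP[P hP] /coboundaryP[Q hQ]; apply/coboundaryP; exists (P - Q) => s.
rewrite -[(c - d) s]/(c s - d s) hP hQ (raddfB (smap r r s)).
by rewrite !opprB addrACA [RHS]addrACA [- P - _]addrC.
Qed.

Lemma cocycle_sub c d : cocycle (c : cochain E j) -> cocycle (d : cochain E j) ->
  cocycle ((c - d) : cochain E j).
Proof.
move=> /cocycleP[cc hc] /cocycleP[cd hd]; apply/cocycleP; split=> [s|s t].
  have [A1 h1] := cc s; have [A2 h2] := cd s; exists (A1 ++ A2) => t st.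
  rewrite -[(c - d) s]/(c s - d s) -[(c - d) t]/(c t - d t).
  by rewrite h1 ?h2 // => x xA; apply: st; rewrite mem_cat xA ?orbT.
rewrite -[(c - d) (gal_mul s t)]/(c (gal_mul s t) - d (gal_mul s t)) hc hd.
rewrite -[(c - d) s]/(c s - d s) -[(c - d) t]/(c t - d t) (raddfB (smap r r s)).
by rewrite opprD addrACA.
Qed.

Lemma coboundary_Mn n c : coboundary (c : cochain E j) ->
  coboundary ((c *+ n) : cochain E j).
Proof.
move=> hc; elim: n => [|n IH]; first exact: coboundary0.
rewrite mulrS -[_ *+ n]opprK; apply: coboundary_sub => //.
by rewrite -sub0r; apply: coboundary_sub => //; exact: coboundary0.
Qed.

End Sub.

Notation V0 := (galQ -> spoint hAB rQ).
Definition sha2 : {pred V0} := fun c => `[< sha_2primary R (c : C) >].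

Definition res_cochain (K : fieldType) (L : fieldType) (j : {rmorphism K -> L})
  (i : {rmorphism algC -> L}) (c : V0) : gal j -> spoint hAB (i \o rQ) :=
  fun t => smap rQ (i \o rQ) i (c (gal_res i t)).

Lemma locally_trivial_sub (c d : V0) : locally_trivial R (c : C) ->
  locally_trivial R (d : C) -> locally_trivial R ((c - d) : C).
Proof.
move=> hc hd K v vc L j aj i; have := hd K v vc L j aj i; have := hc K v vc L j aj i.
rewrite -/(res_cochain i c) -/(res_cochain i d) -/(res_cochain i (c - d)).
move=> h1 h2; have -> : res_cochain (j := j) i (c - d) = res_cochain i c - res_cochain i d.
  by apply/funext => t; rewrite -[RHS]/(res_cochain i c t - res_cochain i d t) -raddfB.
exact: (coboundary_sub h1 h2).
Qed.

Fact sha2_zmod_closed : zmod_closed sha2.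
Proof.
split=> [|c d /asboolP[[cc lc] [n hn]] /asboolP[[cd ld] [m hm]]]; apply/asboolP.
  split; first split.
  - apply/cocycleP; split=> [s|s t]; first by exists [::].
    by rewrite -![(0 : V0) _]/(0 : spoint hAB rQ) raddf0 addr0.
  - move=> K v vc L j aj i; rewrite -/(res_cochain i 0).
    have -> : res_cochain (j := j) i 0 = 0 by apply/funext => t; rewrite /res_cochain raddf0.
    exact: coboundary0.
  - by exists 0%N; rewrite (cochain_mulnE (r := rQ)) mul0rn; exact: coboundary0.
split; first by split; [exact: cocycle_sub | exact: locally_trivial_sub].
rewrite (cochain_mulnE (r := rQ)) in hn; rewrite (cochain_mulnE (r := rQ)) in hm.
exists (n + m)%N; rewrite (cochain_mulnE (r := rQ)) mulrnBl; apply: coboundary_sub.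
  by rewrite expnD mulrnA; exact: coboundary_Mn.
by rewrite addnC expnD mulrnA; exact: coboundary_Mn.
Qed.
HB.instance Definition _ := GRing.isZmodClosed.Build V0 sha2 sha2_zmod_closed.

(** A group of cocycles rather than of classes: coboundaries enter as the subgroup [N] of
    [Z2_direct_factor]. *)
Record shaT := ShaT { sha_val :> V0; sha_valP : sha_val \in sha2 }.
HB.instance Definition _ := [isSub for sha_val].
HB.instance Definition _ := [Choice of shaT by <:].
HB.instance Definition _ := [SubChoice_isSubZmodule of shaT by <:].

Theorem sha_direct_factor (xi : C) : sha R xi ->
  coboundary (cochain_muln 2 xi) ->
  (forall c : C, sha R c -> ~ coboundary (cochain_sub (cochain_muln 2 c) xi)) ->
  sha_2primary_has_Z2_factor R E.
Proof.
move=> xiS xi2 nxi.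
have xi2p : (xi : V0) \in sha2 by apply/asboolP; split=> //; exists 1%N.
pose N : set shaT := fun c => coboundary (val c : C).
pose x : shaT := ShaT xi2p.
have Mn2 (c : V0) : c *+ 2 = cochain_muln 2 (c : C) by rewrite (cochain_mulnE (r := rQ)).
have subE (c d : V0) : c - d = cochain_sub (c : C) d by [].
have [||||BB [f [fD fN fS]]] := @Z2_direct_factor shaT N x.
- exact: coboundary0.
- by move=> u v hu hv; rewrite /N raddfB; exact: coboundary_sub.
- by rewrite /N raddfMn /= Mn2.
- move=> y; rewrite /N raddfB raddfMn /= Mn2 subE.
  by apply: nxi; case: y => y /= /asboolP[].
(* The map required lives on all cochains, hence the default value 0 outside the 2-primary part. *)
pose F (c : C) : 'Z_2 * BB := if insub (c : V0) is Some u then f u else 0.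
have FE c (hc : (c : V0) \in sha2) : F c = f (ShaT hc) by rewrite /F insubT.
exists BB, F; split=> [c d hc hd|c d hc hd|z].
- have hc' : (c : V0) \in sha2 by apply/asboolP.
  have hd' : (d : V0) \in sha2 by apply/asboolP.
  have hcd : (c : V0) + d \in sha2 by apply: rpredD.
  by rewrite (FE _ hc') (FE _ hd') -[cochain_add c d]/((c : V0) + d) (FE _ hcd) -fD; congr f; apply: val_inj.
- have hc' : (c : V0) \in sha2 by apply/asboolP.
  have hd' : (d : V0) \in sha2 by apply/asboolP.
  by rewrite (FE _ hc') (FE _ hd') fN /N raddfB /= subE.
- have [[u hu] <-] := fS z; exists (u : C); first exact/asboolP.
  exact: FE.
Qed.

End ShaFactor.

(** * Extension of field morphisms *)

Section RMorphismOf.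
Variables (S T : nzRingType) (f : S -> T).
Hypotheses (fB : zmod_morphism f) (fM : monoid_morphism f).
Definition rmorphism_of_fun of zmod_morphism f & monoid_morphism f : S -> T := f.
HB.instance Definition _ := GRing.isZmodMorphism.Build S T (rmorphism_of_fun fB fM) fB.
HB.instance Definition _ := GRing.isMonoidMorphism.Build S T (rmorphism_of_fun fB fM) fM.
Lemma exists_rmorphism : exists g : {rmorphism S -> T}, g =1 f.
Proof. by exists (rmorphism_of_fun fB fM). Qed.
End RMorphismOf.

Section Extension.
Variables (K L1 L2 : fieldType) (j1 : {rmorphism K -> L1}) (j2 : {rmorphism K -> L2}).
Hypothesis alg1 : forall x, algebraicOver j1 x.

(* The graphs of the K-morphisms from a subring of L1 to L2. *)
Record pmor (G : set (L1 * L2)) : Prop := PMor {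
  pm_K : forall k, G (j1 k, j2 k);
  pm_B : forall u v, G u -> G v -> G (u - v);
  pm_M : forall u v, G u -> G v -> G (u * v);
  pm_0 : forall y, G (0, y) -> y = 0 }.

Section Adjoin.
Variables (G : set (L1 * L2)) (hG : pmor G).

Definition in_graph of pmor G : {pred L1 * L2} := fun u => `[< G u >].
Local Notation inG := (in_graph hG).

Fact in_graph_subring : subring_closed inG.
Proof.
split=> [|u v /asboolP hu /asboolP hv|u v /asboolP hu /asboolP hv]; apply/asboolP.
- by have := pm_K hG 1; rewrite !rmorph1.
- exact: pm_B.
- exact: pm_M.
Qed.
HB.instance Definition _ := GRing.isSubringClosed.Build _ inG in_graph_subring.

Lemma in_graphE u : u \in inG <-> G u. Proof. by split=> /asboolP. Qed.

Definition jj (k : K) : L1 * L2 := (j1 k, j2 k).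
Fact jj_zmod : zmod_morphism jj. Proof. by move=> x y; rewrite /jj !rmorphB. Qed.
Fact jj_monoid : monoid_morphism jj.
Proof. by split=> [|x y]; rewrite /jj ?rmorph1 ?rmorphM. Qed.
HB.instance Definition _ := GRing.isZmodMorphism.Build K _ jj jj_zmod.
HB.instance Definition _ := GRing.isMonoidMorphism.Build K _ jj jj_monoid.

Lemma jj_in (r : {poly K}) : map_poly jj r \is a polyOver inG.
Proof. by apply/polyOverP => k; rewrite coef_map; apply/in_graphE; exact: pm_K. Qed.

Lemma in_graph_fst0 u : u \in inG -> u.1 = 0 -> u = 0.
Proof. by case: u => a b /in_graphE /= h e; move: h; rewrite e => /(pm_0 hG) ->. Qed.

Lemma fst_eval (q : {poly L1 * L2}) z y : (map_poly fst q).[z] = (q.[(z, y)]).1.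
Proof. by rewrite -[z]/((z, y).1) horner_map. Qed.

Lemma alg_nz_const (a : L1) : a != 0 -> exists2 r : {poly K}, r`_0 != 0 & root (map_poly j1 r) a.
Proof.
move=> a0; have [p] := alg1 a; have [n] := ubnP (size p).
elim: n p => // n IH p sp p0 pa.
have [p00|?] := eqVneq p`_0 0; last by exists p.
have /factor_theorem[q Dq] : root p 0 by rewrite /root horner_coef0 p00.
rewrite subr0 in Dq.
have q0 : q != 0 by apply: contra p0 => /eqP q0; rewrite Dq q0 mul0r.
apply: (IH q) => //; first by move: sp; rewrite Dq size_mulX // ltnS.
by move: pa; rewrite Dq rmorphM /= map_polyX rootM rootX (negbTE a0) orbF.
Qed.

(** If r(u.1) = 0 and r(0) is not 0, then -r(0)^-1 times (r - r(0)) / X evaluated at u is an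
    inverse. The identity is checked on first coordinates, which suffices by [in_graph_fst0]. *)
Lemma in_graph_inv u : u \in inG -> u.1 != 0 -> exists2 v, v \in inG & v * u = 1.
Proof.
move=> hu u0; have [r r0 ru] := alg_nz_const u0.
pose c := r`_0; have Dr : r = (\poly_(k < size r) r`_k.+1) * 'X + c%:P.
  apply/polyP=> k; rewrite coefD coefMX coefC coef_poly.
  case: k => [|k] /=; rewrite ?add0r // addr0; case: ltnP => // h.
  by rewrite nth_default // (leq_trans h).
set r' := \poly_(k < _) _ in Dr; pose b := - jj c^-1 * (map_poly jj r').[u].
have r'G : (map_poly jj r').[u] \in inG.
  by apply: rpred_horner; rewrite ?jj_in.
have bG : b \in inG by rewrite rpredM // rpredN; apply/in_graphE; exact: pm_K.
exists b => //; apply/eqP; rewrite -subr_eq0; apply/eqP/in_graph_fst0.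
  by rewrite rpredB ?rpred1 // rpredM.
have r'1 : ((map_poly jj r').[u]).1 = (map_poly j1 r').[u.1].
  by rewrite -horner_map -map_poly_comp.
move: ru; rewrite Dr rmorphD rmorphM /= map_polyX map_polyC /root hornerD hornerMX hornerC /=.
rewrite addr_eq0 => /eqP h /=; rewrite r'1 mulNr mulNr -mulrA h mulrN opprK fmorphV.
by rewrite mulVf ?subrr // fmorph_eq0.
Qed.

(** A polynomial over [L1 * L2] with coefficients in the graph carries at once a polynomial over the
    domain of the partial morphism and its image. *)
Definition is_minpol (z : L1) (p : {poly L1 * L2}) :=
  [/\ p \is a polyOver inG, p \is monic, root (map_poly fst p) z &
   forall q, q \is a polyOver inG -> root (map_poly fst q) z -> (size q < size p)%N -> q = 0].

Lemma exists_minpol z : exists p, is_minpol z p.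
Proof.
pose Q n := `[< exists q, [/\ q \is a polyOver inG, q != 0, root (map_poly fst q) z & size q = n] >].
have exQ : exists n, Q n.
  have [r r0 rz] := alg1 z; exists (size (map_poly jj r)); apply/asboolP.
  exists (map_poly jj r); split=> //; first exact: jj_in.
    apply: contra r0 => /eqP e; apply/eqP/polyP => k; rewrite coef0.
    have /(congr1 (fun q : {poly _} => (q`_k).1)) := e.
    by rewrite coef_map coef0 /= => /eqP; rewrite fmorph_eq0 => /eqP.
  by rewrite -map_poly_comp.
case: (ex_minnP exQ) => n /asboolP[p [pG p0 pz sp]] minn.
have lG : lead_coef p \in inG by rewrite lead_coefE; move/polyOverP: pG; exact.
have l0 : (lead_coef p).1 != 0.
  by apply: contra p0 => /eqP e; rewrite -lead_coef_eq0 (in_graph_fst0 lG e).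
have [v vG vl] := in_graph_inv lG l0.
have svp : size (v *: p) = size p.
  apply/eqP; rewrite eqn_leq size_scale_leq /=.
  have : size (lead_coef p *: (v *: p)) = size p by rewrite scalerA mulrC vl scale1r.
  by move=> {1}<-; rewrite size_scale_leq.
exists (v *: p); split.
- by apply/polyOverP => k; rewrite coefZ rpredM //; move/polyOverP: pG; exact.
- by rewrite monicE lead_coefE svp coefZ -lead_coefE vl.
- rewrite /root; have -> : map_poly fst (v *: p) = v.1 *: map_poly fst p.
    by apply/polyP => k; rewrite !(coef_map, coefZ).
  by rewrite hornerZ (eqP pz) mulr0.
move=> q qG qz; rewrite svp sp => sq; apply/eqP/negPn/negP => q0.
have : (n <= size q)%N by apply: minn; apply/asboolP; exists q.
by rewrite leqNgt sq.
Qed.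

(** Division by the monic [p], one leading term at a time because [L1 * L2] is not a domain. The
    remainder still vanishes at z and is shorter than [p], hence it is 0. *)
Lemma minpol_vanish z y p : is_minpol z p -> root (map_poly snd p) y ->
  forall q, q \is a polyOver inG -> root (map_poly fst q) z -> root (map_poly snd q) y.
Proof.
move=> [pG pm pz pmin] py q; have [n] := ubnP (size q); elim: n q => // n IH q sq qG qz.
have [/pmin -> //|spq] := ltnP (size q) (size p); first by rewrite rmorph0 root0.
pose a := lead_coef q; pose k := (size q - size p)%N.
have aG : a \in inG by rewrite /a lead_coefE; move/polyOverP: qG; exact.
pose q' := q - a *: ('X^k * p).
have sp0 : (0 < size p)%N by rewrite lt0n size_poly_eq0 monic_neq0.
have szX : size ('X^k * p) = size q.
  by rewrite size_Mmonic ?size_polyXn ?addSn /= ?subnK // -size_poly_eq0 size_polyXn.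
have lX : lead_coef ('X^k * p) = 1 by rewrite lead_coef_Mmonic // lead_coefXn.
have sq' : (size q' < n)%N.
  have sq0 : (0 < size q)%N by exact: leq_trans spq.
  rewrite -ltnS (leq_trans _ sq) // ltnS -[X in (_ <= X)%N](prednK sq0) ltnS.
  apply/leq_sizeP => i; rewrite leq_eqVlt => /orP[/eqP <-|hi].
    by rewrite /q' coefB coefZ -{2}szX -!lead_coefE lX mulr1 subrr.
  rewrite /q' coefB coefZ !nth_default ?szX ?mulr0 ?subr0 //; first by rewrite -(prednK sq0).
  by rewrite -(prednK sq0).
have XG : a *: ('X^k * p) \is a polyOver inG.
  rewrite -mul_polyC rpredM ?polyOverC // rpredM //.
  by rewrite rpredX // polyOverX.
have q'G : q' \is a polyOver inG by rewrite rpredB.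
have zM (f : {rmorphism (L1 * L2)%type -> L1}) w : root (map_poly f p) w -> root (map_poly f (a *: ('X^k * p))) w.
  by move=> h; rewrite -mul_polyC !rmorphM rootM rootM h !orbT.
have zM2 w : root (map_poly snd p) w -> root (map_poly snd (a *: ('X^k * p))) w.
  by move=> h; rewrite -mul_polyC !rmorphM rootM rootM h !orbT.
have q'z : root (map_poly fst q') z.
  by rewrite /q' rmorphB /root hornerD hornerN (eqP qz) (eqP (zM _ _ pz)) subrr.
have := IH q' sq' q'G q'z; rewrite /q' rmorphB /root hornerD hornerN (eqP (zM2 _ py)) subr0.
by [].
Qed.

Definition adjoin_graph (z : L1) (y : L2) : set (L1 * L2) :=
  [set u | exists2 q, q \is a polyOver inG & u = q.[(z, y)]]%classic.

Lemma adjoin_graph_sub z y : (G `<=` adjoin_graph z y)%classic.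
Proof.
by move=> u Gu; exists u%:P; rewrite ?hornerC // polyOverC; apply/in_graphE.
Qed.

Lemma adjoin_graph_mem z y : adjoin_graph z y (z, y).
Proof. by exists 'X; rewrite ?hornerX ?polyOverX. Qed.

Lemma adjoin_pmor z y p : is_minpol z p -> root (map_poly snd p) y ->
  pmor (adjoin_graph z y).
Proof.
move=> hp py; split=> [k|u v|u v|w].
- by apply: adjoin_graph_sub; exact: pm_K.
- by move=> [q qG ->] [q' q'G ->]; exists (q - q'); rewrite ?rpredB // !hornerE.
- by move=> [q qG ->] [q1 q1G ->]; exists (q * q1); rewrite ?rpredM // hornerM.
move=> [q qG e]; have : root (map_poly fst q) z by rewrite /root (fst_eval _ _ y) -e.
move=> /(minpol_vanish hp py qG); rewrite /root -[y in _.[y]]/((z, y).2) horner_map -e.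
by move/eqP.
Qed.

End Adjoin.
End Extension.

(** A maximal graph is defined everywhere: a root in [L2] of the image of the minimal polynomial of
    z lets z be adjoined. It is single valued by [pm_0]. *)
Theorem rmorphism_extend (K L1 : fieldType) (L2 : closedFieldType) (j1 : {rmorphism K -> L1})
    (j2 : {rmorphism K -> L2}) (G0 : set (L1 * L2)) :
  (forall x, algebraicOver j1 x) -> pmor j1 j2 G0 ->
  exists phi : {rmorphism L1 -> L2}, forall u, G0 u -> phi u.1 = u.2.
Proof.
move=> alg1 hG0.
have [||G [sG hG maxG]] := @Zorn_above _ (pmor j1 j2) G0 => //.
  move=> F [X0 FX0] FP totF; split=> [k|u v [X FX Xu] [Y FY Yv]|u v [X FX Xu] [Y FY Yv]|y [X FX]].
  - by exists X0 => //; apply: pm_K; exact: (FP _ FX0).1.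
  - have [h|h] := totF _ _ FX FY.
      by exists Y => //; apply: (pm_B (FP _ FY).1) => //; exact: h.
    by exists X => //; apply: (pm_B (FP _ FX).1) => //; exact: h.
  - have [h|h] := totF _ _ FX FY.
      by exists Y => //; apply: (pm_M (FP _ FY).1) => //; exact: h.
    by exists X => //; apply: (pm_M (FP _ FX).1) => //; exact: h.
  - exact: (pm_0 (FP _ FX).1).
have tot z : exists y, G (z, y).
  have [p hp] := exists_minpol alg1 hG z.
  have [pG pm pz _] := hp.
  have sp1 : size (map_poly fst p) = size p.
    by rewrite size_map_poly_id0 // (monicP pm) oner_eq0.
  have sp2 : size (map_poly snd p) = size p.
    by rewrite size_map_poly_id0 // (monicP pm) oner_eq0.
  have [y py] : exists y, root (map_poly snd p) y.
    apply: closed_rootP; rewrite sp2 -sp1; apply/eqP => s1.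
    by have := root_size_gt1 _ pz; rewrite -size_poly_eq0 s1 => /(_ isT).
  exists y; exact: (maxG _ (adjoin_graph_sub hG z y) (adjoin_pmor hp py) _ (adjoin_graph_mem hG z y)).
pose f z := projT1 (cid (tot z)); have fG z : G (z, f z) by rewrite /f; case: cid.
have func x y y' : G (x, y) -> G (x, y') -> y = y'.
  move=> h h'; have := pm_B hG h h'; rewrite -[_ - _]/(x - x, y - y') subrr.
  by move/(pm_0 hG)/eqP; rewrite subr_eq0 => /eqP.
have [||g gE] := @exists_rmorphism _ _ f.
- move=> x y; apply: (func (x - y)); first exact: fG.
  exact: (pm_B hG (fG x) (fG y)).
- split=> [|x y].
    by apply: (func 1); [exact: fG | have := pm_K hG 1; rewrite !rmorph1].
  apply: (func (x * y)); first exact: fG.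
  exact: (pm_M hG (fG x) (fG y)).
by exists g => -[x y] /sG h; rewrite gE /=; exact: func (fG x) h.
Qed.

(** The iterates of y under [phi] remain among the finitely many roots of one polynomial, so the
    orbit loops; by injectivity it returns to y, which is therefore a value of [phi]. *)
Lemma algebraic_endo_bij (K L : fieldType) (j : {rmorphism K -> L}) (phi : {rmorphism L -> L}) :
  (forall x, algebraicOver j x) -> (forall k, phi (j k) = j k) -> bijective phi.
Proof.
move=> aj fj; have sur y : exists x, phi x == y.
  have [p p0 py] := aj y.
  have pr n : root (map_poly j p) (iter n phi y).
    elim: n => //= n /(rmorph_root phi); rewrite -map_poly_comp (eq_map_poly (g := j)) //.
  have q0 : map_poly j p != 0 by rewrite map_poly_eq0.
  have [/(max_poly_roots q0)|] := boolP (uniq (traject phi y (size (map_poly j p)).+1)).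
    rewrite size_traject ltnNge leqnSn => h; exfalso; suff: false by []. apply: h.
    by apply/allP => x /trajectP[n _ ->].
  rewrite looping_uniq negbK => /trajectP[m mn].
  have [d ->] : exists d, size (map_poly j p) = (m + d.+1)%N.
    by exists (size (map_poly j p) - m).-1; rewrite prednK ?subn_gt0 // subnKC // ltnW.
  rewrite iterD => e; exists (iter d phi y).
  have : iter m phi (iter d.+1 phi y) = iter m phi y by [].
  elim: m {mn e} => [/= -> //|m IH]; rewrite !iterS => /fmorph_inj; exact: IH.
exists (fun y => xchoose (sur y)) => x; last exact/eqP/(xchooseP (sur x)).
by apply: (fmorph_inj phi); apply/eqP/(xchooseP (sur (phi x))).
Qed.

Lemma algebraic_rmorphism (L : closedFieldType) (r : {rmorphism rat -> L}) :
  exists i : {rmorphism algC -> L}, forall q, i (ratr q) = r q.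
Proof.
have [||i hi] := @rmorphism_extend _ algC L (ratr : {rmorphism rat -> algC}) r
   [set u | exists q, u = (ratr q, r q)]%classic.
- by move=> x; exact: algC_rat_root.
- split=> [q|u v [q ->] [q' ->]|u v [q ->] [q' ->]|y [q [e ->]]].
  + by exists q.
  + by exists (q - q'); rewrite !rmorphB.
  + by exists (q * q'); rewrite !rmorphM.
  + by move/esym/eqP: e; rewrite fmorph_eq0 => /eqP ->; rewrite rmorph0.
by exists i => q; rewrite (hi (ratr q, r q)) //; exists q.
Qed.

(* A conjugate of z over D different from z exists because the minimal polynomial is not a
   power of X - z in characteristic 0. *)
Theorem gal_moves (K : fieldType) (L : closedFieldType) (j : {rmorphism K -> L}) (D : set L) (z : L) :
  [pchar L] =i pred0 -> (forall x, algebraicOver j x) ->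
  (forall k, D (j k)) -> (forall x y, D x -> D y -> D (x - y)) ->
  (forall x y, D x -> D y -> D (x * y)) -> ~ D z ->
  exists t : gal j, (forall d, D d -> t d = d) /\ t z != z.
Proof.
move=> ch aj DK DB DM nDz.
pose G0 : set (L * L) := [set u | D u.1 /\ u.1 = u.2]%classic.
have hG : pmor j j G0.
  split=> [k|[a b] [c d] [/= Da <-] [/= Dc <-]|[a b] [c d] [/= Da <-] [/= Dc <-]|y [/= _ <-]] //.
  - by split=> //; exact: DK.
  - by split=> //; exact: DB.
  - by split=> //; exact: DM.
have [p hp] := exists_minpol aj hG z; have [pG pm pz pmin] := hp.
have e12 : map_poly snd p = map_poly fst p.
  apply/polyP => k; rewrite !coef_map /=; move/polyOverP: pG => /(_ k) /in_graphE.
  by case: (p`_k) => a b [_ /= ->].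
have pcD k : D (map_poly fst p)`_k.
  by rewrite coef_map /=; move/polyOverP: pG => /(_ k) /in_graphE [].
have p1m : map_poly fst p \is monic.
  by apply: monic_map.
have [y py nyz] : exists2 y, root (map_poly fst p) y & y != z.
  apply: contrapT => H; apply: nDz.
  have al y : root (map_poly fst p) y -> y = z.
    by move=> hy; apply/eqP/negPn/negP => ne; apply: H; exists y.
  have [rs Drs] := closed_field_poly_normal (map_poly fst p).
  rewrite (monicP p1m) scale1r in Drs.
  have rsz : {in rs, forall y, y = z}.
    by move=> y yr; apply: al; rewrite Drs root_prod_XsubC.
  have zr : z \in rs by rewrite -root_prod_XsubC -Drs.
  have n0 : (0 < size rs)%N by case: (rs) zr.
  (* The subleading coefficient of (X - z)^n is - n z; it lies in D, and n is invertible. *)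
  have := pcD (size rs).-1; rewrite Drs coefPn_prod_XsubC -?lt0n //.
  rewrite big_seq (eq_bigr (fun=> z)); last by move=> y /rsz.
  rewrite -big_seq big_const_seq count_predT iter_addr_0 => Dn.
  have nn : (size rs)%:R != 0 :> L by rewrite ((pcharf0P L).1 ch) -lt0n.
  have := DM _ _ (DK (- (size rs)%:R^-1)) Dn.
  rewrite rmorphN fmorphV rmorph_nat mulrNN -[z *+ _]mulr_natl mulKf //.
have [phi hphi] := rmorphism_extend aj (adjoin_pmor hp (etrans (congr1 (fun q : {poly L} => root q y) e12) py)).
have phid d : D d -> phi d = d.
  move=> Dd; apply: (hphi (d, d)); apply: adjoin_graph_sub; by split.
have bphi : bijective phi by apply: (algebraic_endo_bij aj) => k; exact: phid.
exists (Gal bphi (fun k => phid _ (DK k))); split=> //=.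
by rewrite (hphi (z, y)) //; exact: adjoin_graph_mem.
Qed.

(** * Algebraic closures *)

Local Open Scope quotient_scope.

Section QuotientField.
Variables (S : comNzRingType) (I : idealr S).
Hypothesis maxI : forall x, x \notin I -> exists y, x * y - 1 \in I.

Definition qfield of (forall x, x \notin I -> exists y, x * y - 1 \in I) : Type :=
  {ideal_quot I}.
Local Notation F := (qfield maxI).
HB.instance Definition _ := GRing.ComNzRing.on F.
Definition qpi : S -> F := \pi_{ideal_quot I}.
HB.instance Definition _ := GRing.RMorphism.on qpi.

Lemma qpi_eq0 x : (qpi x == 0) = (x \in I).
Proof.
have := Quotient.idealrBE I x 0; rewrite subr0 => ->.
by rewrite -[X in qpi x == X](rmorph0 qpi).
Qed.

Lemma qpi_surj y : exists x, qpi x = y.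
Proof. by exists (repr (y : {ideal_quot I})); exact: reprK. Qed.

Fact qfield_inv_ex (y : F) : exists z : F, if y == 0 then z = 0 else z * y = 1.
Proof.
case: (boolP (y == 0)) => y0; first by exists 0.
have [x Dx] := qpi_surj y; have [|x' hx'] := @maxI x; first by rewrite -qpi_eq0 Dx.
exists (qpi x'); rewrite -Dx mulrC -rmorphM.
by apply/eqP; rewrite -subr_eq0 -(rmorph1 qpi) -rmorphB qpi_eq0.
Qed.
Definition qfield_inv (y : F) : F := projT1 (cid (qfield_inv_ex y)).

Fact qfield_mulVf y : y != 0 -> qfield_inv y * y = 1.
Proof. by rewrite /qfield_inv; case: cid => z /=; case: eqP. Qed.
Fact qfield_inv0 : qfield_inv 0 = 0.
Proof. by rewrite /qfield_inv; case: cid => z /=; rewrite eqxx. Qed.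
HB.instance Definition _ := GRing.ComNzRing_isField.Build F qfield_mulVf qfield_inv0.

Lemma qfieldP : exists (F : fieldType) (pi : {rmorphism S -> F}),
  (forall x, (pi x == 0) = (x \in I)) /\ forall y, exists x, pi x = y.
Proof. by exists F, qpi; split; [exact: qpi_eq0 | exact: qpi_surj]. Qed.

End QuotientField.

Section IdealOfSet.
Variables (S : comNzRingType) (I : set S).
Hypotheses (I0 : I 0) (IB : forall x y, I x -> I y -> I (x - y)).
Hypotheses (IM : forall a x, I x -> I (a * x)) (I1 : ~ I 1).

Definition ideal_of_set : {pred S} := fun x => `[< I x >].
Fact ideal_of_set_closed : idealr_closed ideal_of_set.
Proof.
split=> [||a u v /asboolP hu /asboolP hv]; first exact/asboolP.
  by apply/negP => /asboolP.
apply/asboolP; rewrite -[v]opprK; apply: IB; first exact: IM.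
by rewrite -mulN1r; exact: IM.
Qed.
HB.instance Definition _ := isIdealr.Build S ideal_of_set ideal_of_set_closed.

Lemma field_mod_maximal : (forall x, ~ I x -> exists y, I (x * y - 1)) ->
  exists (F : fieldType) (pi : {rmorphism S -> F}),
  (forall x, pi x = 0 <-> I x) /\ forall y, exists x, pi x = y.
Proof.
move=> maxI; have [|F [pi [h1 h2]]] := @qfieldP S ideal_of_set.
  move=> x /asboolP /maxI[y hy]; exists y; exact/asboolP.
exists F, pi; split=> // x; split=> [/eqP|h]; first by rewrite h1 => /asboolP.
by apply/eqP; rewrite h1; exact/asboolP.
Qed.
End IdealOfSet.

Theorem field_mod_ideal (S : comNzRingType) (I : set S) :
  I 0 -> (forall x y, I x -> I y -> I (x - y)) -> (forall a x, I x -> I (a * x)) -> ~ I 1 ->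
  exists (F : fieldType) (pi : {rmorphism S -> F}), forall x, I x -> pi x = 0.
Proof.
move=> I0 IB IM I1.
pose P (J : set S) := [/\ forall x y, J x -> J y -> J (x - y),
  forall a x, J x -> J (a * x) & ~ J 1].
have [||J [sIJ [JB JM J1] maxJ]] := @Zorn_above S P I => //.
  move=> F [X0 FX0] FP totF; split.
  - move=> u v [X FX Xu] [Y FY Yv]; have [h|h] := totF _ _ FX FY.
      by exists Y => //; have [[c _ _] _] := FP _ FY; apply: c => //; exact: h.
    by exists X => //; have [[c _ _] _] := FP _ FX; apply: c => //; exact: h.
  - by move=> a x [X FX Xx]; exists X => //; have [[_ c _] _] := FP _ FX; exact: c.
  - by case=> X FX X1; have [[_ _ c] _] := FP _ FX.
have J0 : J 0 by exact: sIJ.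
have JD x y : J x -> J y -> J (x + y).
  by move=> hx hy; rewrite -[y]opprK; apply: JB => //; rewrite -mulN1r; exact: JM.
have [x nJx|F [pi [piJ _]]] := field_mod_maximal J0 JB JM J1; last first.
  by exists F, pi => x /sIJ /piJ.
pose J' := [set z | exists a y, J y /\ z = a * x + y]%classic.
have [[a [y [Jy e]]]|nJ'1] := pselect (J' 1).
  by exists a; rewrite mulrC e opprD addNKr -mulN1r; exact: JM.
exfalso; apply: nJx; apply: (maxJ J').
- by move=> z Jz; exists 0, z; rewrite mul0r add0r.
- split=> // [u v [a [y [Jy ->]]] [a' [y' [Jy' ->]]]|b u [a [y [Jy ->]]]].
    exists (a - a'), (y - y'); split; first exact: JB.
    by ring.
  exists (b * a), (b * y); split; first exact: JM.
  by ring.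
- by exists 1, 0; rewrite mul1r addr0.
Qed.

Definition splits (F : fieldType) (p : {poly F}) :=
  exists rs : seq F, p = lead_coef p *: \prod_(r <- rs) ('X - r%:P).

(** No irreducible factor is chosen: the quotient is by some maximal ideal containing [p]. *)
Lemma exists_root_ext (K : fieldType) (p : {poly K}) : (1 < size p)%N ->
  exists (F : fieldType) (j : {rmorphism K -> F}) (a : F), root (map_poly j p) a.
Proof.
move=> sp; have [||||F [pi piI]] := @field_mod_ideal {poly K} [set q | p %| q]%classic.
- exact: dvdp0.
- by move=> x y hx hy; exact: dvdp_sub.
- by move=> a x hx; exact: dvdp_mull.
- by move=> /= /dvdp_leq; rewrite oner_eq0 size_poly1 => /(_ isT); rewrite leqNgt sp.
exists F, (pi \o polyC), (pi 'X); rewrite map_poly_comp /root horner_map /=.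
by rewrite -[_.['X]]/(p \Po 'X) comp_polyXr piI /=.
Qed.

Lemma splits_map (F F' : fieldType) (j : {rmorphism F -> F'}) p :
  splits p -> splits (map_poly j p).
Proof.
move=> [rs Dp]; exists (map j rs); rewrite {1}Dp map_polyZ lead_coef_map rmorph_prod /= big_map.
by congr (_ *: _); apply: eq_bigr => r _; rewrite rmorphB /= map_polyX map_polyC.
Qed.

Lemma exists_splitting (K : fieldType) (p : {poly K}) :
  exists (F : fieldType) (j : {rmorphism K -> F}), splits (map_poly j p).
Proof.
have [n] := ubnP (size p); elim: n K p => // n IH K p sp.
have [s1|s1] := leqP (size p) 1.
  exists K, idfun, [::]; rewrite map_poly_id // big_nil (size1_polyC s1) lead_coefC.
  by rewrite -mul_polyC mulr1.
have [F1 [j1 [a /factor_theorem[q Dq]]]] := exists_root_ext s1.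
have q0 : q != 0.
  apply/eqP => q0; move: Dq s1; rewrite q0 mul0r => /eqP; rewrite map_poly_eq0.
  by move=> /eqP ->; rewrite size_poly0.
have sq : (size q < n)%N.
  have : size (map_poly j1 p) = (size q).+1 by rewrite Dq size_Mmonic ?monicXsubC // size_XsubC addn2.
  by rewrite size_map_poly => e; rewrite e in sp.
have [F2 [j2 [rs Drs]]] := IH F1 q sq.
exists F2, (j2 \o j1), (j2 a :: rs); rewrite map_poly_comp Dq rmorphM /=.
rewrite lead_coefM Drs lead_coefZ (monicP (monic_prod_XsubC _ _ _)) mulr1.
rewrite rmorphB /= map_polyX map_polyC lead_coefXsubC mulr1 big_cons.
by rewrite lead_coef_map -scalerAl mulrC.
Qed.

Lemma exists_splitting_seq (K : fieldType) (s : seq {poly K}) :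
  exists (F : fieldType) (j : {rmorphism K -> F}), forall p, p \in s -> splits (map_poly j p).
Proof.
elim: s => [|p s [F [j hj]]]; first by exists K, idfun.
have [F2 [j2 h2]] := exists_splitting (map_poly j p).
exists F2, (j2 \o j) => q; rewrite inE map_poly_comp => /orP[/eqP -> //|/hj].
exact: splits_map.
Qed.

Section DepProd.
Variables (T : Type) (t0 : T) (F : T -> fieldType).
(** The phantom index [t0] records that the product is not empty, whence [1 != 0]. *)
Definition dprod_of of T := forall t, F t.
Local Notation D := (dprod_of t0).
HB.instance Definition _ := gen_eqMixin D.
HB.instance Definition _ := gen_choiceMixin D.
Implicit Types x y z : D.

Let ext x y : (forall t, x t = y t) -> x = y. Proof. exact: functional_extensionality_dep. Qed.
Fact dprod_addA : associative (fun x y : D => (fun t => x t + y t) : D).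
Proof. by move=> x y z; apply: ext => t; exact: addrA. Qed.
Fact dprod_addC : commutative (fun x y : D => (fun t => x t + y t) : D).
Proof. by move=> x y; apply: ext => t; exact: addrC. Qed.
Fact dprod_add0 : left_id ((fun=> 0) : D) (fun x y : D => (fun t => x t + y t) : D).
Proof. by move=> x; apply: ext => t; exact: add0r. Qed.
Fact dprod_addN : left_inverse ((fun=> 0) : D) (fun x : D => (fun t => - x t) : D)
  (fun x y : D => (fun t => x t + y t) : D).
Proof. by move=> x; apply: ext => t; exact: addNr. Qed.
HB.instance Definition _ := GRing.isZmodule.Build D dprod_addA dprod_addC dprod_add0 dprod_addN.
Fact dprod_mulA : associative (fun x y : D => (fun t => x t * y t) : D).
Proof. by move=> x y z; apply: ext => t; exact: mulrA. Qed.
Fact dprod_mulC : commutative (fun x y : D => (fun t => x t * y t) : D).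
Proof. by move=> x y; apply: ext => t; exact: mulrC. Qed.
Fact dprod_mul1 : left_id ((fun=> 1) : D) (fun x y : D => (fun t => x t * y t) : D).
Proof. by move=> x; apply: ext => t; exact: mul1r. Qed.
Fact dprod_mulD : left_distributive (fun x y : D => (fun t => x t * y t) : D) +%R.
Proof. by move=> x y z; apply: ext => t; exact: mulrDl. Qed.
Fact dprod_1n0 : ((fun=> 1) : D) != 0.
Proof.
apply/eqP => e; have : (1 : F t0) = 0 by exact: (congr1 (fun f : D => f t0) e).
by move/eqP; rewrite oner_eq0.
Qed.
HB.instance Definition _ := GRing.Zmodule_isComNzRing.Build D dprod_mulA dprod_mulC dprod_mul1
  dprod_mulD dprod_1n0.

Definition dproj (t : T) (x : D) : F t := x t.
Fact dproj_zmod t : zmod_morphism (dproj t). Proof. by []. Qed.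
Fact dproj_monoid t : monoid_morphism (dproj t). Proof. by []. Qed.
HB.instance Definition _ t := GRing.isZmodMorphism.Build D (F t) (dproj t) (dproj_zmod t).
HB.instance Definition _ t := GRing.isMonoidMorphism.Build D (F t) (dproj t) (dproj_monoid t).

Variables (K : fieldType) (j : forall t, {rmorphism K -> F t}).
Definition dprod_emb (k : K) : D := fun t => j t k.
Fact dprod_emb_zmod : zmod_morphism dprod_emb.
Proof. by move=> a b; apply: ext => t; exact: rmorphB. Qed.
Fact dprod_emb_monoid : monoid_morphism dprod_emb.
Proof.
by split=> [|a b]; apply: ext => t; [exact: rmorph1 | exact: rmorphM].
Qed.
HB.instance Definition _ := GRing.isZmodMorphism.Build K D dprod_emb dprod_emb_zmod.
HB.instance Definition _ := GRing.isMonoidMorphism.Build K D dprod_emb dprod_emb_monoid.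

End DepProd.

(** An ultraproduct: each finite list s of polynomials has a splitting field F s. In the product of
    all F s, the elements vanishing at every s that contains some fixed s0 form a proper ideal, and
    the quotient by a maximal ideal above it splits every polynomial at once. *)
Theorem exists_splitting_all (K : fieldType) :
  exists (F : fieldType) (j : {rmorphism K -> F}), forall p, splits (map_poly j p).
Proof.
have hs (s : seq {poly K}) : exists Fj : {F : fieldType & {rmorphism K -> F}},
    forall p, p \in s -> splits (map_poly (projT2 Fj) p).
  by have [F [j h]] := exists_splitting_seq s; exists (existT _ F j).
pose Fj s := projT1 (cid (hs s)); pose F s := projT1 (Fj s).
pose j s : {rmorphism K -> F s} := projT2 (Fj s).
have jP s p : p \in s -> splits (map_poly (j s) p) by have h := projT2 (cid (hs s)); exact: h.
pose D := dprod_of F [::].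
pose dp s : {rmorphism D -> F s} := @dproj _ [::] F s.
pose I : set D := [set x : D | exists s0 : seq {poly K}, forall s : seq {poly K},
  {subset s0 <= s} -> dp s x = 0]%classic.
have [||||Om [pi piI]] := @field_mod_ideal D I.
- by exists [::] => s _; rewrite rmorph0.
- move=> x y [s1 h1] [s2 h2]; exists (s1 ++ s2) => s ss; rewrite rmorphB h1 ?h2 ?subrr //.
    by move=> z hz; apply: ss; rewrite mem_cat hz orbT.
  by move=> z hz; apply: ss; rewrite mem_cat hz.
- by move=> a x [s1 h1]; exists s1 => s ss; rewrite rmorphM h1 ?mulr0.
- by case=> s /(_ s (fun=> id)) /eqP; rewrite rmorph1 oner_eq0.
exists Om, (pi \o dprod_emb [::] j) => p.
have hr s : exists rs : seq (F s), p \in s -> map_poly (j s) p = lead_coef (map_poly (j s) p) *: \prod_(r <- rs) ('X - r%:P).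
  have [|h] := boolP (p \in s); last by exists [::].
  by move/jP => [rs h]; exists rs.
pose rs s := projT1 (cid (hr s)).
have rsE s : p \in s -> map_poly (j s) p = lead_coef (map_poly (j s) p) *: \prod_(r <- rs s) ('X - r%:P).
  by rewrite /rs; case: cid.
(* The k-th root is assembled coordinate by coordinate; it has a meaning only at the lists s
   containing p, which is enough modulo the ideal. *)
pose n := (size p).-1; pose r (k : 'I_n) : D := fun s => (rs s)`_k.
have [->|p0] := eqVneq p 0.
  by exists [::]; rewrite rmorph0 lead_coef0 scale0r.
exists [seq pi (r k) | k : 'I_n]; rewrite big_map.
apply/eqP; rewrite -subr_eq0; apply/eqP.
pose q := map_poly (dprod_emb [::] j) p - (dprod_emb [::] j (lead_coef p)) *: \prod_(k : 'I_n) ('X - (r k)%:P).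
have -> : map_poly (pi \o dprod_emb [::] j) p - lead_coef (map_poly (pi \o dprod_emb [::] j) p) *:
   \prod_(k <- enum 'I_n) ('X - (pi (r k))%:P) = map_poly pi q.
  rewrite rmorphB /= map_polyZ rmorph_prod lead_coef_map -map_poly_comp /= big_enum.
  congr (_ - _ *: _); apply: eq_bigr => k _.
  by rewrite rmorphB /= map_polyX map_polyC.
apply/polyP => k; rewrite coef_map coef0; apply: piI; exists [:: p] => s /(_ p).
rewrite inE eqxx => /(_ isT) ps.
have sz : size (rs s) = n.
  have := congr1 (fun q : {poly _} => size q) (rsE s ps).
  rewrite size_map_poly size_scale ?lead_coef_eq0 ?map_poly_eq0 //.
  by rewrite size_prod_XsubC /n => ->.
rewrite -coef_map; suff -> : map_poly (dp s) q = 0 by rewrite coef0.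
rewrite rmorphB /= map_polyZ rmorph_prod -map_poly_comp /=.
rewrite (_ : map_poly (dp s \o dprod_emb [::] j) p = map_poly (j s) p) // {1}rsE //.
rewrite lead_coef_map; apply/eqP; rewrite subr_eq0; apply/eqP; congr (_ *: _).
rewrite (big_nth 0) big_mkord sz; apply: eq_bigr => i _.
by rewrite rmorphB /= map_polyX map_polyC.
Qed.

Section AlgSub.
Variables (K Om : fieldType) (j : {rmorphism K -> Om}).
Hypothesis spl : forall p, splits (map_poly j p).

Definition alg_pred of (forall p, splits (map_poly j p)) : {pred Om} :=
  fun x => `[< algebraicOver j x >].
Local Notation A := (alg_pred spl).
Fact alg_divring : divring_closed A.
Proof.
split=> [|u v /asboolP hu /asboolP hv|u v /asboolP hu /asboolP hv]; apply/asboolP.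
- exact: algebraic1.
- exact: algebraic_sub.
- exact: algebraic_div.
Qed.
HB.instance Definition _ := GRing.isDivringClosed.Build Om A alg_divring.
Record algsub := AlgSub { algsub_val :> Om; algsub_valP : algsub_val \in A }.
HB.instance Definition _ := [isSub for algsub_val].
HB.instance Definition _ := [Choice of algsub by <:].
HB.instance Definition _ := [SubChoice_isSubIntegralDomain of algsub by <:].
HB.instance Definition _ := [SubIntegralDomain_isSubField of algsub by <:].

(** A root of q exists in some extension of [Om]. Being algebraic over K, it is a root of a
    polynomial over K, which already splits in [Om]; so the root comes from [Om] and is
    algebraic. *)
Fact algsub_closed : GRing.closed_field_axiom algsub.
Proof.
move=> n P n0; pose q := 'X^n - \poly_(i < n) val (P i).
have sp : (size (\poly_(i < n) val (P i)) <= n)%N by exact: size_poly.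
have qm : q \is monic.
  rewrite monicE /q lead_coefDl ?lead_coefXn // size_polyXn size_polyN ltnS.
  exact: sp.
have sq : size q = n.+1.
  by rewrite /q size_polyDl size_polyXn // size_polyN ltnS.
have [|Om' [i [y qy]]] := @exists_root_ext Om q; first by rewrite sq ltnS.
have [p p0 py] : algebraicOver (i \o j) y.
  apply/integral_algebraic; apply: (integral_root _ qy).
    by rewrite map_poly_eq0 monic_neq0.
  move=> c /(nthP 0)[k kq <-]; apply/integral_algebraic; rewrite coef_map.
  have : q`_k \in A.
    rewrite /q coefB coefXn coef_poly; case: ifP => _; last by rewrite subr0 rpred_nat.
    by rewrite rpredB ?rpred_nat //; exact: valP.
  move/asboolP => [r r0 rq]; exists r => //.
  by rewrite map_poly_comp; exact: rmorph_root.
have [rs Drs] := spl p.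
move: py; rewrite map_poly_comp Drs map_polyZ rmorph_prod /= rootZ; last first.
  by rewrite fmorph_eq0 lead_coef_eq0 map_poly_eq0.
rewrite (eq_bigr (fun z => 'X - (i z)%:P)); last first.
  by move=> z _; rewrite rmorphB /= map_polyX map_polyC.
rewrite -(big_map i xpredT (fun z => 'X - z%:P)) root_prod_XsubC.
case/mapP => x xrs Dy.
have xA : x \in A.
  apply/asboolP; exists p => //; rewrite Drs rootZ ?root_prod_XsubC //.
  by rewrite lead_coef_eq0 map_poly_eq0.
exists (AlgSub xA); apply: val_inj.
rewrite (rmorphXn (val : {rmorphism algsub -> Om})) (raddf_sum (val : {rmorphism algsub -> Om})).
transitivity (x ^+ n) => //.
move: qy; rewrite Dy fmorph_root /q /root hornerD hornerN hornerXn subr_eq0 => /eqP ->.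
rewrite horner_poly; apply: eq_bigr => k _.
pose w : {rmorphism algsub -> Om} := val.
by rewrite -[RHS]/(w (P k * AlgSub xA ^+ k)) (rmorphM w) (rmorphXn w).
Qed.
HB.instance Definition _ := Field_isAlgClosed.Build algsub algsub_closed.

Fact algsub_emb_in k : j k \in A.
Proof. by apply/asboolP; exact: algebraic_id. Qed.
Definition algsub_emb k : algsub := AlgSub (algsub_emb_in k).
Fact algsub_emb_zmod : zmod_morphism algsub_emb.
Proof. by move=> x y; apply: val_inj; rewrite /= rmorphB. Qed.
Fact algsub_emb_monoid : monoid_morphism algsub_emb.
Proof. by split=> [|x y]; apply: val_inj; rewrite /= ?rmorph1 ?rmorphM. Qed.
HB.instance Definition _ := GRing.isZmodMorphism.Build K algsub algsub_emb algsub_emb_zmod.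
HB.instance Definition _ := GRing.isMonoidMorphism.Build K algsub algsub_emb algsub_emb_monoid.

Lemma algsub_algebraic (x : algsub) : algebraicOver algsub_emb x.
Proof.
have /asboolP[p p0 px] := algsub_valP x; exists p => //.
rewrite -(fmorph_root (val : {rmorphism algsub -> Om})) -map_poly_comp.
by [].
Qed.

End AlgSub.

Theorem exists_algebraic_closure (K : fieldType) :
  exists (L : closedFieldType) (j : {rmorphism K -> L}), forall x, algebraicOver j x.
Proof.
have [Om [j spl]] := exists_splitting_all K.
by exists (algsub spl), (algsub_emb spl); exact: algsub_algebraic.
Qed.

(** * Completions of the rationals *)

Section UltraAbs.
Variables (R : realType) (K : fieldType) (a : K -> R).

Record ultra_abs : Prop := UltraAbs {
  ua_ge0 : forall x, 0 <= a x;
  ua_eq0 : forall x, a x = 0 <-> x = 0;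
  ua_M : forall x y, a (x * y) = a x * a y;
  ua_D : forall x y, a (x + y) <= Num.max (a x) (a y) }.

Hypothesis ha : ultra_abs.

Lemma ua0 : a 0 = 0. Proof. exact/(ua_eq0 ha). Qed.
Lemma ua1 : a 1 = 1.
Proof.
have : a 1 * a 1 = a 1 * 1 by rewrite -(ua_M ha) !mulr1.
apply: mulfI; apply/eqP => /(ua_eq0 ha)/eqP; by rewrite oner_eq0.
Qed.
Lemma uaX x n : a (x ^+ n) = a x ^+ n.
Proof. by elim: n => [|n IH]; rewrite ?expr0 ?ua1 // !exprS (ua_M ha) IH. Qed.
Lemma uaN1 : a (-1) = 1.
Proof.
apply/eqP; rewrite -(@pexpr_eq1 _ _ 2) ?(ua_ge0 ha) // -uaX sqrrN expr1n.
by rewrite ua1.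
Qed.
Lemma uaN x : a (- x) = a x. Proof. by rewrite -mulN1r (ua_M ha) uaN1 mul1r. Qed.
Lemma uaBC x y : a (x - y) = a (y - x). Proof. by rewrite -uaN opprB. Qed.
Lemma ua_gt0 x : (0 < a x) = (x != 0).
Proof.
rewrite lt_def (ua_ge0 ha) andbT; congr negb.
by apply/eqP/eqP => /(ua_eq0 ha).
Qed.
Lemma uaV x : a x^-1 = (a x)^-1.
Proof.
have [->|x0] := eqVneq x 0; first by rewrite invr0 ua0 invr0.
have ax : a x != 0 by rewrite gt_eqF // ua_gt0.
by apply: (mulfI ax); rewrite -(ua_M ha) !divff // ua1.
Qed.
Lemma ua_div x y : a (x / y) = a x / a y. Proof. by rewrite (ua_M ha) uaV. Qed.
Lemma uaD_le x y e : a x <= e -> a y <= e -> a (x + y) <= e.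
Proof. by move=> hx hy; apply: le_trans (ua_D ha x y) _; rewrite ge_max hx hy. Qed.
Lemma uaD_lt x y e : a x < e -> a y < e -> a (x + y) < e.
Proof. by move=> hx hy; apply: le_lt_trans (ua_D ha x y) _; rewrite gt_max hx hy. Qed.
Lemma uaB_le x y e : a x <= e -> a y <= e -> a (x - y) <= e.
Proof. by move=> hx hy; apply: uaD_le; rewrite ?uaN. Qed.
Lemma uaB_lt x y e : a x < e -> a y < e -> a (x - y) < e.
Proof. by move=> hx hy; apply: uaD_lt; rewrite ?uaN. Qed.
Lemma ua_sum_le (I : Type) (r : seq I) (P : pred I) (F : I -> K) e : 0 <= e ->
  (forall i, P i -> a (F i) <= e) -> a (\sum_(i <- r | P i) F i) <= e.
Proof.
move=> e0 h; elim/big_ind: _ => //; first by rewrite ua0.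
by move=> x y; exact: uaD_le.
Qed.

Lemma ua_eq x y : a (x - y) < a y -> a x = a y.
Proof.
move=> h; apply/eqP; rewrite eq_le.
have -> : a x <= a y by rewrite -[x](subrK y); apply: uaD_le => //; exact: ltW.
rewrite leNgt; apply/negP => lt; have := uaB_lt lt h.
by rewrite subKr ltxx.
Qed.

Lemma uaD_eql x y : a x < a y -> a (x + y) = a y.
Proof. by move=> h; apply: ua_eq; rewrite addrK. Qed.

Lemma ua_nat n : a n%:R <= 1.
Proof.
elim: n => [|n IH]; first by rewrite ua0.
by rewrite -addn1 natrD; apply: uaD_le => //; rewrite ua1.
Qed.

Lemma ua_int (n : int) : a n%:~R <= 1.
Proof. by case: n => n; rewrite ?NegzE ?rmorphN ?uaN /= ?uaN; exact: ua_nat. Qed.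

End UltraAbs.

Section Complete.
Variables (R : realType) (a : rat -> R).
Hypothesis ha : ultra_abs a.
Hypothesis a_nontriv : exists2 q, q != 0 & a q != 1.

Definition cauchy (x : nat -> rat) := forall e : R, 0 < e ->
  exists N, forall m n, (N <= m)%N -> (N <= n)%N -> a (x m - x n) < e.
Definition null (x : nat -> rat) := forall e : R, 0 < e ->
  exists N, forall n, (N <= n)%N -> a (x n) < e.
(** For an ultrametric value, |x_n| is eventually constant along a Cauchy sequence that is not null.
    The limit of the values is thus described without any convergence in [R]. *)
Definition lims (x : nat -> rat) (r : R) :=
  (null x /\ r = 0) \/ (exists N, forall n, (N <= n)%N -> a (x n) = r) /\ 0 < r.

Lemma cauchy_lims x : cauchy x -> exists r, lims x r.
Proof.
move=> cx; have [nx|] := pselect (null x); first by exists 0; left.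
move/existsNP => [e /not_implyP[e0 /forallNP h]].
have [N hN] := cx _ e0; have /existsNP[n0 /not_implyP[Nn0 /negP]] := h N.
rewrite -leNgt => en; exists (a (x n0)); right; split; last exact: lt_le_trans en.
by exists N => n Nn; apply: (ua_eq ha); apply: lt_le_trans en; exact: hN.
Qed.

Lemma lims_uniq x r s : lims x r -> lims x s -> r = s.
Proof.
have aux t u : null t -> (exists N, forall n, (N <= n)%N -> a (t n) = u) -> 0 < u -> False.
  move=> nt [N hN] u0; have [M hM] := nt _ u0.
  have := hM (maxn M N) (leq_maxl _ _); rewrite hN ?leq_maxr // ltxx.
  by [].
move=> [[n1 ->]|[[N h1] r0]] [[n2 ->]|[[M h2] s0]] //.
- by case: (aux x s n1) => //; exists M.
- by case: (aux x r n2) => //; exists N.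
by rewrite -(h1 (maxn N M)) ?leq_maxl // h2 ?leq_maxr.
Qed.

Lemma lims_bound x r e : lims x r -> (exists N, forall n, (N <= n)%N -> a (x n) <= e) -> 0 <= e -> r <= e.
Proof.
move=> [[_ ->] //|[[N h] _]] [M h2] _.
by rewrite -(h (maxn N M)) ?leq_maxl // h2 ?leq_maxr.
Qed.

Lemma cauchyB x y : cauchy x -> cauchy y -> cauchy (fun n => x n - y n).
Proof.
move=> cx cy e e0; have [N h] := cx e e0; have [M h2] := cy e e0.
exists (maxn N M) => m n; rewrite !geq_max => /andP[a1 a2] /andP[b1 b2].
have -> : x m - y m - (x n - y n) = (x m - x n) - (y m - y n) by ring.
by apply: (uaB_lt ha); [exact: h | exact: h2].
Qed.

Lemma cauchy_bound x : cauchy x -> exists2 B, 0 < B & exists N, forall n, (N <= n)%N -> a (x n) <= B.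
Proof.
move=> cx; have [N h] := cx 1 ltr01; exists (1 + a (x N)).
  by rewrite ltr_pwDl // (ua_ge0 ha).
exists N => n Nn; rewrite -[x n](subrK (x N)); apply: (uaD_le ha).
  by rewrite ler_wpDr ?(ua_ge0 ha) // ltW // h.
by rewrite ler_wpDl.
Qed.

Lemma cauchyM x y : cauchy x -> cauchy y -> cauchy (fun n => x n * y n).
Proof.
move=> cx cy e e0; have [B B0 [N1 hB]] := cauchy_bound cx; have [C C0 [N2 hC]] := cauchy_bound cy.
have [N3 h3] := cx (e / C) (divr_gt0 e0 C0); have [N4 h4] := cy (e / B) (divr_gt0 e0 B0).
exists (maxn (maxn N1 N2) (maxn N3 N4)) => m n; rewrite !geq_max.
move=> /andP[/andP[m1 m2] /andP[m3 m4]] /andP[/andP[n1 n2] /andP[n3 n4]].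
have -> : x m * y m - x n * y n = x m * (y m - y n) + (x m - x n) * y n by ring.
apply: (uaD_lt ha); rewrite (ua_M ha).
  apply: (le_lt_trans (y := B * a (y m - y n))).
    by rewrite ler_wpM2r ?(ua_ge0 ha) // hB.
  by rewrite mulrC -ltr_pdivlMr // h4.
apply: (le_lt_trans (y := a (x m - x n) * C)).
  by rewrite ler_wpM2l ?(ua_ge0 ha) // hC.
by rewrite -ltr_pdivlMr // h3.
Qed.

Lemma cauchy_cst q : cauchy (fun=> q).
Proof. by move=> e e0; exists 0%N => m n _ _; rewrite subrr (ua0 ha). Qed.

Lemma nullB x y : null x -> null y -> null (fun n => x n - y n).
Proof.
move=> cx cy e e0; have [N h] := cx e e0; have [M h2] := cy e e0.
exists (maxn N M) => n; rewrite !geq_max => /andP[a1 a2].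
by apply: (uaB_lt ha); [exact: h | exact: h2].
Qed.

Lemma nullM x y : cauchy x -> null y -> null (fun n => x n * y n).
Proof.
move=> cx ny e e0; have [B B0 [N1 hB]] := cauchy_bound cx.
have [N h] := ny (e / B) (divr_gt0 e0 B0); exists (maxn N1 N) => n.
rewrite geq_max => /andP[n1 n2]; rewrite (ua_M ha).
apply: (le_lt_trans (y := B * a (y n))); first by rewrite ler_wpM2r ?(ua_ge0 ha) // hB.
by rewrite mulrC -ltr_pdivlMr // h.
Qed.

Definition cauchy_pred : {pred nat -> rat} := fun x => `[< cauchy x >].
Fact cauchy_subring : subring_closed cauchy_pred.
Proof.
split=> [|x y /asboolP hx /asboolP hy|x y /asboolP hx /asboolP hy]; apply/asboolP.
- exact: cauchy_cst.
- exact: cauchyB.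
- exact: cauchyM.
Qed.
HB.instance Definition _ := GRing.isSubringClosed.Build _ cauchy_pred cauchy_subring.
Record cseq := CSeq { cseq_val :> nat -> rat; cseq_valP : cseq_val \in cauchy_pred }.
HB.instance Definition _ := [isSub for cseq_val].
HB.instance Definition _ := [Choice of cseq by <:].
HB.instance Definition _ := [SubChoice_isSubComNzRing of cseq by <:].

Lemma cseqP (x : cseq) : cauchy x. Proof. by have /asboolP := cseq_valP x. Qed.
Definition mkc x (cx : cauchy x) : cseq := @CSeq x (introT (asboolP _) cx).

(** The null sequences form a maximal ideal: a Cauchy sequence outside it has eventually constant
    nonzero value, so its termwise inverse is Cauchy; possible zeros at the start are inverted to
    0. *)
Lemma cseq_field : exists (F : fieldType) (pi : {rmorphism cseq -> F}),
  (forall x, pi x = 0 <-> null x) /\ forall y, exists x, pi x = y.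
Proof.
apply: (@field_mod_maximal cseq (fun x => null x)).
- by move=> e e0; exists 0%N => n _; rewrite (ua0 ha).
- by move=> x y; exact: nullB.
- by move=> c x; apply: nullM; exact: cseqP.
- move=> /(_ 1 ltr01)[N /(_ N (leqnn N))]; rewrite -[_ N]/(1 : rat) (ua1 ha) ltxx.
  by [].
move=> x nx; have [r [[//]|[[N hN] r0]]] := cauchy_lims (cseqP x).
have cy : cauchy (fun n => (x n)^-1).
  move=> e e0; have [M h] := cseqP x (mulr_gt0 e0 (mulr_gt0 r0 r0)).
  exists (maxn N M) => m n; rewrite !geq_max => /andP[m1 m2] /andP[n1 n2].
  have am := hN _ m1; have an := hN _ n1.
  have xm : x m != 0 by rewrite -(ua_gt0 ha) am.
  have xn : x n != 0 by rewrite -(ua_gt0 ha) an.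
  have -> : (x m)^-1 - (x n)^-1 = (x n - x m) / (x m * x n).
    by field; rewrite xm xn.
  rewrite (ua_div ha) (ua_M ha) am an ltr_pdivrMr ?mulr_gt0 //.
  exact: h.
exists (mkc cy) => e e0; exists N => n Nn.
have xn : x n != 0 by rewrite -(ua_gt0 ha) hN.
by rewrite -[_ n]/(x n * (x n)^-1 - 1) divff // subrr (ua0 ha).
Qed.

Theorem exists_completion : exists (K : fieldType) (v : K -> R) (r : {rmorphism rat -> K}),
  is_completion v /\ forall q, v (r q) = a q.
Proof.
have [K [pi [pi0 pis]]] := cseq_field; exists K.
pose V y r := exists x : cseq, pi x = y /\ lims x r.
have Vex y : exists r, V y r.
  by have [x hx] := pis y; have [r hr] := cauchy_lims (cseqP x); exists r, x.
pose v y := projT1 (cid (Vex y)).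
have vP y : V y (v y) by rewrite /v; case: cid.
have vE (x : cseq) r : lims x r -> v (pi x) = r.
  have [x' [e h']] := vP (pi x) => h; apply: (lims_uniq (x := x)) => //.
  have nx : null (fun n => x n - x' n).
    have : pi (x - x') = 0 by rewrite rmorphB e subrr.
    by move/pi0.
  case: h' => [[n' ->]|[[N hN] r0]].
    left; split=> //; have nn : null (fun n => 0 - x' n).
      by apply: nullB => // e1 e0; exists 0%N => n _; rewrite (ua0 ha).
    move=> e1 e0; have [M hM] := nullB nx nn e0; exists M => n /hM.
    by rewrite sub0r opprK subrK.
  right; split=> //; have [M hM] := nx _ r0; exists (maxn N M) => n; rewrite geq_max => /andP[h1 h2].
  by rewrite -(hN n h1); apply: (ua_eq ha); rewrite (hN n h1); exact: hM.
pose rr (q : rat) : cseq := mkc (cauchy_cst q).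
have rrB : zmod_morphism rr by move=> x y; exact: val_inj.
have rrM : monoid_morphism rr by split=> [|x y]; exact: val_inj.
have [r0 r0E] := exists_rmorphism rrB rrM.
pose r : {rmorphism rat -> K} := pi \o r0.
have vr q : v (r q) = a q.
  apply: vE; rewrite r0E; have [->|q0] := eqVneq q 0.
    by left; split; [move=> e e0; exists 0%N => n _ |]; rewrite (ua0 ha).
  by right; split; [exists 0%N | rewrite (ua_gt0 ha)].
have rq q : ratr q = r q by exact: rmorph_ratr.
have vl x : exists2 c : cseq, pi c = x & lims c (v x) by have [c [h1 h2]] := vP x; exists c.
have vge0 x : 0 <= v x by have [c _ [[_ ->]|[_ /ltW]]] := vl x.
have veq0 x : v x = 0 <-> x = 0.
  have [c <- [[n0 ->]|[_ p0]]] := vl x; first by split=> // _; apply/pi0.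
  split=> [e|/pi0 n0]; first by rewrite e ltxx in p0.
  by rewrite (vE c 0) //; left.
have vD x y : v (x + y) <= Num.max (v x) (v y).
  have [c <- hc] := vl x; have [d <- hd] := vl y; rewrite -rmorphD.
  have ev (z : cseq) t : lims z (v (pi z)) -> v (pi z) <= t -> 0 < t -> exists N, forall n, (N <= n)%N -> a (z n) <= t.
    move=> [[n0 _] _ t0|[[N h] _] ht t0].
      by have [N h] := n0 _ t0; exists N => n /h /ltW.
    by exists N => n /h ->.
  have ml : v (pi c) <= Num.max (v (pi c)) (v (pi d)) by rewrite le_max lexx.
  have mr : v (pi d) <= Num.max (v (pi c)) (v (pi d)) by rewrite le_max lexx orbT.
  have [m0|] := ltP 0 (Num.max (v (pi c)) (v (pi d))).
    have [N h] := ev c _ hc ml m0.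
    have [M h2] := ev d _ hd mr m0.
    have [z ez hz] := vl (pi (c + d)).
    have hz' : lims (c + d) (v (pi (c + d))).
      have [r' hr'] := cauchy_lims (cseqP (c + d)); by rewrite (vE _ _ hr').
    apply: (lims_bound hz'); last exact: ltW.
    exists (maxn N M) => n; rewrite geq_max => /andP[h3 h4].
    by apply: (uaD_le ha); [exact: h | exact: h2].
  rewrite ge_max => /andP[h1 h2].
  have e1 : pi c = 0 by apply/veq0/eqP; rewrite eq_le h1 vge0.
  have e2 : pi d = 0 by apply/veq0/eqP; rewrite eq_le h2 vge0.
  by rewrite rmorphD e1 e2 addr0 maxxx.
have vM x y : v (x * y) = v x * v y.
  have [c <- hc] := vl x; have [d <- hd] := vl y; rewrite -rmorphM; apply: vE.
  case: hc => [[n0 ->]|[[N h] p1]].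
    left; rewrite mul0r; split=> //; rewrite mulrC.
    exact: (nullM (cseqP d) n0).
  case: hd => [[n0 ->]|[[M h2] p2]].
    left; rewrite mulr0; split=> //.
    exact: (nullM (cseqP c) n0).
  right; split; last exact: mulr_gt0.
  exists (maxn N M) => n; rewrite geq_max => /andP[h3 h4].
  by rewrite -(h n) // -(h2 n) // -(ua_M ha).
have uv : ultra_abs v by split.
exists v, r; split=> //; split=> //.
- move=> p; apply/negP => /andP[pp]; rewrite -(rmorph_nat r) fmorph_eq0 pnatr_eq0.
  by move/eqP => p0; rewrite p0 in pp.
- move=> x y; apply: le_trans (vD x y) _; rewrite ge_max lerDl lerDr !vge0.
  by [].
- by have [q q0 q1] := a_nontriv; exists q => //; rewrite rq vr.
- move=> x e e0; have [c <- _] := vl x; have [N h] := cseqP c e0.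
  exists (c N); rewrite rq /r /= r0E -rmorphB.
  have [r' hr'] := cauchy_lims (cseqP (c - rr (c N))); rewrite (vE _ _ hr').
  case: hr' => [[_ ->] //|[[M hM] _]]; rewrite -(hM (maxn N M)) ?leq_maxr //.
  by apply: h; rewrite ?leq_maxl.
move=> u cu.
have inv_ev (e : R) : 0 < e -> exists N, forall n, (N <= n)%N -> n.+1%:R^-1 < e.
  move=> e0; exists (Num.bound e^-1) => n hn.
  rewrite -[e]invrK ltf_pV2 ?posrE ?invr_gt0 //.
  apply: lt_le_trans (archi_boundP _) _; first by rewrite invr_ge0 ltW.
  by rewrite ler_nat (leq_trans hn).
(* Completeness: the n-th term is replaced by a rational within 1 / (n + 1); these rationals form a
   Cauchy sequence, whose class is the limit. *)
have qex n : exists q, v (u n - r q) < n.+1%:R^-1.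
  have [c <- _] := vl (u n); have [|N h] := cseqP c (e := n.+1%:R^-1); first by rewrite invr_gt0 ltr0n.
  exists (c N); rewrite /r /= r0E -rmorphB.
  have [r' hr'] := cauchy_lims (cseqP (c - rr (c N))); rewrite (vE _ _ hr').
  case: hr' => [[_ ->]|[[M hM] _]]; first by rewrite invr_gt0 ltr0n.
  rewrite -(hM (maxn N M)) ?leq_maxr //.
  by apply: h; rewrite ?leq_maxl.
pose q n := projT1 (cid (qex n)).
have hq n : v (u n - r (q n)) < n.+1%:R^-1 by rewrite /q; case: cid.
have cq : cauchy q.
  move=> e e0; have [N h] := cu e e0; have [M h2] := inv_ev e e0.
  exists (maxn N M) => m n; rewrite !geq_max => /andP[m1 m2] /andP[n1 n2].
  rewrite -vr rmorphB.
  have -> : r (q m) - r (q n) = (u m - u n) - (u m - r (q m)) + (u n - r (q n)) by ring.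
  apply: (uaD_lt uv); last by apply: lt_trans (hq n) _; exact: h2.
  apply: (uaB_lt uv); first exact: h.
  by apply: lt_trans (hq m) _; exact: h2.
exists (pi (mkc cq)) => e e0; have [N h] := cq e e0; have [M h2] := inv_ev e e0.
exists (maxn N M) => n; rewrite geq_max => /andP[n1 n2].
have -> : u n - pi (mkc cq) = (u n - r (q n)) - (pi (mkc cq) - r (q n)) by ring.
apply: (uaB_lt uv); first by apply: lt_trans (hq n) _; exact: h2.
rewrite /r /= r0E -rmorphB.
have [r' hr'] := cauchy_lims (cseqP (mkc cq - rr (q n))); rewrite (vE _ _ hr').
case: hr' => [[_ ->] //|[[M' hM] _]]; rewrite -(hM (maxn N M')) ?leq_maxr //.
by apply: h; rewrite ?leq_maxl.
Qed.

End Complete.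

(** * The p-adic absolute value of the rationals *)

Section Padic.
Variables (R : realType) (p : nat).
Hypothesis pp : prime p.

Definition pabs_int (n : int) : R := if n == 0 then 0 else p%:R^-1 ^+ logn p `|n|%N.

Let p0 : 0 < p%:R :> R. Proof. by rewrite ltr0n prime_gt0. Qed.
Let p1 : p%:R^-1 <= 1 :> R. Proof. by rewrite invf_le1 // ler1n prime_gt0. Qed.

Lemma pabs_int_ge0 n : 0 <= pabs_int n.
Proof. by rewrite /pabs_int; case: ifP => // _; rewrite exprn_ge0 // invr_ge0 ltW. Qed.
Lemma pabs_int_gt0 n : n != 0 -> 0 < pabs_int n.
Proof. by move=> /negPf n0; rewrite /pabs_int n0 exprn_gt0 // invr_gt0. Qed.
Lemma pabs_intM m n : pabs_int (m * n) = pabs_int m * pabs_int n.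
Proof.
rewrite /pabs_int mulf_eq0; have [->|m0] := eqVneq m 0; first by rewrite /= mul0r.
have [->|n0] := eqVneq n 0; first by rewrite /= mulr0.
by rewrite /= abszM lognM ?absz_gt0 // exprD.
Qed.
Lemma pabs_intD m n : pabs_int (m + n) <= Num.max (pabs_int m) (pabs_int n).
Proof.
wlog h : m n / (logn p `|m| <= logn p `|n|)%N.
  move=> H; have [h|/ltnW h] := leqP (logn p `|m|) (logn p `|n|); first by apply: H.
  by rewrite addrC maxC; exact: H.
have [->|m0] := eqVneq m 0; first by rewrite add0r le_max lexx orbT.
have [->|n0] := eqVneq n 0; first by rewrite addr0 le_max lexx.
rewrite le_max; apply/orP; left; rewrite /pabs_int (negPf m0).
case: ifP => s0; first by rewrite exprn_ge0 // invr_ge0 ltW.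
apply: ler_wiXn2l; rewrite ?invr_ge0 ?(ltW p0) //.
rewrite -pfactor_dvdn ?absz_gt0 ?s0 //.
have : (((p ^ logn p `|m|)%N : int) %| m + n)%Z.
  by rewrite rpredD // unfold_in /= ?absz_nat pfactor_dvdn ?absz_gt0 // h.
by rewrite dvdzE absz_nat.
Qed.

Definition pabs (q : rat) : R := pabs_int (numq q) / pabs_int (denq q).

Lemma pabs_frac (m d : int) (q : rat) : d != 0 -> m%:~R = q * d%:~R ->
  pabs q = pabs_int m / pabs_int d.
Proof.
move=> d0 e; have n0 := @pabs_int_gt0 (denq q) (denq_neq0 _); have := pabs_int_gt0 d0.
rewrite lt0r => /andP[d1 _]; move: n0; rewrite lt0r => /andP[n1 _].
apply/eqP; rewrite /pabs eqr_div //.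
rewrite -!pabs_intM; apply/eqP; congr pabs_int; apply/eqP.
rewrite -(eqr_int rat) !rmorphM /= e {1}[X in X * _](_ : _ = q * (denq q)%:~R).
  by rewrite mulrAC.
by rewrite -{2}[q]divq_num_den mulfVK // intr_eq0 denq_neq0.
Qed.

Lemma pabs_ultra : ultra_abs pabs.
Proof.
have dn0 x : denq x != 0 by exact: denq_neq0.
have nE (x : rat) : (numq x)%:~R = x * (denq x)%:~R :> rat.
  by rewrite -{2}[x]divq_num_den mulfVK // intr_eq0.
split=> [x|x|x y|x y].
- by rewrite divr_ge0 // pabs_int_ge0.
- split=> [/eqP|->]; last by rewrite /pabs /pabs_int numq_eq0 eqxx mul0r.
  rewrite mulf_eq0 invr_eq0 [_ (denq x) == 0]gt_eqF ?pabs_int_gt0 // orbF.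
  by move=> h; apply/eqP; rewrite -numq_eq0; apply: contraTT h => /pabs_int_gt0/gt_eqF ->.
- rewrite (@pabs_frac (numq x * numq y) (denq x * denq y)) ?mulf_neq0 //.
    by rewrite !pabs_intM /pabs invfM mulrACA.
  by rewrite !rmorphM /= !nE mulrACA.
rewrite (@pabs_frac (numq x * denq y + numq y * denq x) (denq x * denq y)) ?mulf_neq0 //; last first.
  by rewrite rmorphD !rmorphM /= !nE; ring.
have d0 : 0 < pabs_int (denq x * denq y) by rewrite pabs_int_gt0 ?mulf_neq0.
rewrite ler_pdivrMr //; apply: le_trans (pabs_intD _ _) _.
rewrite ge_max !pabs_intM; apply/andP; split.
  apply: (le_trans (y := pabs x * (pabs_int (denq x) * pabs_int (denq y)))).
    by rewrite /pabs mulrA divfK // gt_eqF // pabs_int_gt0.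
  by rewrite ler_wpM2r ?le_max ?lexx // mulr_ge0 ?pabs_int_ge0.
apply: (le_trans (y := pabs y * (pabs_int (denq x) * pabs_int (denq y)))).
  by rewrite /pabs [_ (denq x) * _]mulrC mulrA divfK // gt_eqF // pabs_int_gt0.
by rewrite ler_wpM2r ?le_max ?lexx ?orbT // mulr_ge0 ?pabs_int_ge0.
Qed.

Lemma pabs_p : pabs p%:R = p%:R^-1.
Proof.
rewrite (@pabs_frac p 1) //; last by rewrite mulr1.
have p0' : ((p : int) == 0) = false by apply/negP => /eqP[e]; move: p0; rewrite e ltxx.
by rewrite /pabs_int p0' /= logn1 expr0 divr1 logn_prime // eqxx expr1.
Qed.

End Padic.

(** * Square roots in complete fields *)

Section RealPowers.
Variable R : realType.

Lemma bernoulli (t : R) n : 0 <= t -> 1 + n%:R * t <= (1 + t) ^+ n.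
Proof.
move=> t0; elim: n => [|n IH]; first by rewrite mul0r addr0 expr0.
rewrite exprSr; apply: (le_trans (y := (1 + n%:R * t) * (1 + t))); last first.
  by rewrite ler_wpM2r // addr_ge0.
have : 0 <= n%:R * t * t by rewrite !mulr_ge0.
by rewrite -[n.+1]addn1 natrD; nra.
Qed.

(** The tensor power trick: if c = 1 + t with t > 0, then c^(2k) >= (k t)^2 grows quadratically in
    k. *)
Lemma linear_growth (c A B : R) : 0 <= A -> 0 <= B -> 0 <= c ->
  (forall k : nat, c ^+ k <= A * k%:R + B) -> c <= 1.
Proof.
move=> A0 B0 c0 h; rewrite leNgt; apply/negP => c1.
pose t := c - 1; have t0 : 0 < t by rewrite subr_gt0.
have Dc : c = 1 + t by rewrite /t addrC subrK.
pose M := (2%:R * A + B) / t ^+ 2.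
have M0 : 0 <= M by rewrite divr_ge0 ?sqr_ge0 // addr_ge0 // mulr_ge0.
pose k := (Num.bound M).+1; have Mk : M < k%:R.
  by apply: lt_trans (archi_boundP M0) _; rewrite ltr_nat.
have k1 : 1 <= k%:R :> R by rewrite ler1n.
have h1 := h (2 * k)%N; have h2 := bernoulli k (ltW t0).
have h3 : (k%:R * t) ^+ 2 <= c ^+ (2 * k).
  have u0 : 0 <= (1 + t) ^+ k by rewrite exprn_ge0 // addr_ge0 // ltW.
  have w0 : 0 <= k%:R * t by rewrite mulr_ge0 // ltW.
  rewrite mulnC exprM Dc; apply: lerXn2r; rewrite ?nnegrE //.
  by apply: le_trans h2; rewrite ler_wpDl.
move: Mk; rewrite ltr_pdivrMr ?exprn_gt0 // => Mk.
move: h1; rewrite natrM => h1; have := le_trans h3 h1; rewrite exprMn.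
have : B <= B * k%:R by rewrite ler_peMr.
have : (2%:R * A + B) * k%:R < k%:R * t ^+ 2 * k%:R by rewrite ltr_pM2r // (lt_le_trans ltr01).
rewrite expr2; nra.
Qed.

Lemma expr_small (q e : R) : 0 <= q -> q < 1 -> 0 < e ->
  exists N, forall n, (N <= n)%N -> q ^+ n < e.
Proof.
move=> q0 q1 e0; have [->|qn0] := eqVneq q 0.
  by exists 1%N => n n1; rewrite expr0n; case: n n1.
have qp : 0 < q by rewrite lt_def qn0.
pose t := q^-1 - 1; have t0 : 0 < t by rewrite subr_gt0 invf_gt1.
have M0 : 0 <= (e * t)^-1 by rewrite invr_ge0 mulr_ge0 // ltW.
exists (Num.bound (e * t)^-1) => n hn.
have h1 : (e * t)^-1 < n%:R by apply: lt_le_trans (archi_boundP M0) _; rewrite ler_nat.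
have h2 := bernoulli n (ltW t0); have e1 : 1 + t = q^-1 by rewrite /t; ring.
rewrite e1 exprVn in h2.
rewrite -[e]invrK -[q ^+ n]invrK ltf_pV2 ?posrE ?invr_gt0 ?exprn_gt0 //.
apply: lt_le_trans h2; apply: (lt_trans (y := n%:R * t)); last by rewrite ltrDr.
by rewrite -ltr_pdivrMr // -invfM.
Qed.

End RealPowers.

Section Completion.
Variables (R : realType) (K : fieldType) (v : K -> R).
Hypothesis cv : is_completion v.

Lemma vc0 : v 0 = 0. Proof. exact/(compl_eq0 cv). Qed.
Lemma vc1 : v 1 = 1.
Proof.
have : v 1 * v 1 = v 1 * 1 by rewrite -(compl_M cv) !mulr1.
apply: mulfI; apply/eqP => /(compl_eq0 cv)/eqP; by rewrite oner_eq0.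
Qed.
Lemma vcX x n : v (x ^+ n) = v x ^+ n.
Proof. by elim: n => [|n IH]; rewrite ?expr0 ?vc1 // !exprS (compl_M cv) IH. Qed.
Lemma vcN x : v (- x) = v x.
Proof.
rewrite -mulN1r (compl_M cv) [v (-1)](_ : _ = 1) ?mul1r //; apply/eqP.
by rewrite -(@pexpr_eq1 _ _ 2) ?(compl_ge0 cv) // -vcX sqrrN expr1n vc1.
Qed.
Lemma vcB_le x y : v (x - y) <= v x + v y.
Proof. by rewrite -[v y]vcN; exact: (compl_D cv). Qed.
Lemma vc_gt0 x : (0 < v x) = (x != 0).
Proof.
rewrite lt_def (compl_ge0 cv) andbT; congr negb.
by apply/eqP/eqP => /(compl_eq0 cv).
Qed.
Lemma vcV x : v x^-1 = (v x)^-1.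
Proof.
have [->|x0] := eqVneq x 0; first by rewrite invr0 vc0 invr0.
have ax : v x != 0 by rewrite gt_eqF // vc_gt0.
by apply: (mulfI ax); rewrite -(compl_M cv) !divff // vc1.
Qed.

Lemma natK_eq0 n : (n%:R == 0 :> K) = (n == 0%N).
Proof. exact: ((pcharf0P K).1 (compl_pchar cv)). Qed.

Lemma vc_limit (u : nat -> K) (C q : R) : 0 <= q -> q < 1 -> 0 <= C ->
  (forall n, v (u n.+1 - u n) <= C * q ^+ n) ->
  exists l, forall e, 0 < e -> exists N, forall n, (N <= n)%N -> v (u n - l) < e.
Proof.
move=> q0 q1 C0 h; apply: (compl_complete cv) => e e0.
have q1' : 0 < 1 - q by rewrite subr_gt0.
have hd n d : v (u (n + d)%N - u n) * (1 - q) <= C * q ^+ n * (1 - q ^+ d).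
  elim: d => [|d IH]; first by rewrite addn0 subrr vc0 mul0r expr0 subrr mulr0.
  have -> : u (n + d.+1)%N - u n = (u (n + d).+1 - u (n + d)%N) + (u (n + d)%N - u n).
    by rewrite addnS; ring.
  have h1 := compl_D cv (u (n + d).+1 - u (n + d)%N) (u (n + d)%N - u n).
  have h2 := h (n + d)%N.
  have : (v (u (n + d).+1 - u (n + d)%N) + v (u (n + d)%N - u n)) * (1 - q) <=
     C * q ^+ (n + d) * (1 - q) + C * q ^+ n * (1 - q ^+ d).
    by rewrite mulrDl lerD // ler_wpM2r // ltW.
  move: h1; rewrite -(ler_pM2r q1') => h1 h3; apply: le_trans (le_trans h1 h3) _.
  by rewrite exprD exprS le_eqVlt; apply/orP; left; apply/eqP; ring.
have C1 : 0 < C + 1 by rewrite ltr_wpDl.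
have e1 : 0 < e / 2%:R * (1 - q) / (C + 1) by rewrite divr_gt0 // mulr_gt0 // divr_gt0.
have [N hN] := expr_small q0 q1 e1.
have hb n : (N <= n)%N -> v (u n - u N) < e / 2%:R.
  move=> /subnKC <-; have := hd N (n - N)%N.
  have : C * q ^+ N * (1 - q ^+ (n - N)) <= (C + 1) * q ^+ N.
    rewrite -mulrA; apply: ler_pM => //; first by rewrite mulr_ge0 ?exprn_ge0 // subr_ge0 exprn_ile1 // ltW.
      by rewrite lerDl.
    by rewrite ler_piMr ?exprn_ge0 // lerBlDr lerDl exprn_ge0.
  have := hN N (leqnn N); rewrite ltr_pdivlMr ?ltr_wpDl // mulrC => a1 a2 a3.
  have := le_lt_trans (le_trans a3 a2) a1.
  by rewrite ltr_pM2r.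
exists N => m n /hb hm /hb hn.
have -> : u m - u n = (u m - u N) - (u n - u N) by ring.
apply: le_lt_trans (vcB_le _ _) _; rewrite [e]splitr; exact: ltrD.
Qed.

(** Binary expansion: n is a sum of at most k powers of 2, each of value at most 1. *)
Lemma digits_le k n : v 2%:R <= 1 -> (n < 2 ^ k)%N -> v n%:R <= k%:R.
Proof.
move=> h2; elim: k n => [|k IH] n.
  by rewrite expn0 ltnS leqn0 => /eqP ->; rewrite vc0.
rewrite expnS => hn; rewrite -[n]odd_double_half natrD.
apply: le_trans (compl_D cv _ _) _; rewrite -[k.+1]add1n natrD lerD //.
  by case: (odd n); rewrite ?vc1 ?vc0.
rewrite -mul2n natrM (compl_M cv); apply: le_trans (IH n./2 _).
  by rewrite ler_piMl ?(compl_ge0 cv).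
by rewrite -(ltn_pmul2l (isT : 0 < 2)%N) mul2n (leq_ltn_trans _ hn) // -{2}[n]odd_double_half leq_addl.
Qed.

(** Since n^k has at most n k + 1 binary digits, |n|^k grows at most linearly in k. *)
Lemma nat_le1 : v 2%:R <= 1 -> forall n, v n%:R <= 1.
Proof.
move=> h2 n; apply: (@linear_growth R _ n%:R 1) => //; first exact: (compl_ge0 cv).
move=> k; rewrite -vcX -natrX.
have := @digits_le (n * k).+1 (n ^ k) h2; rewrite -[(n * k).+1]addn1 natrD natrM; apply.
apply: (@leq_ltn_trans (2 ^ (n * k))); last by rewrite ltn_exp2l ?addn1.
case: (k) => [|k']; first by rewrite muln0.
by rewrite expnM leq_exp2r // ltnW // ltn_expl.
Qed.

(** The binomial formula bounds |x + y|^k by (k + 1) M^k, with M the larger of |x| and |y|; taking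
    k-th powers removes the factor k + 1. *)
Lemma ultra_of_nat : (forall n, v n%:R <= 1) -> ultra_abs v.
Proof.
move=> h; split; [exact: (compl_ge0 cv) | exact: (compl_eq0 cv) | exact: (compl_M cv) |].
move=> x y; set M := Num.max _ _.
have xM : v x <= M by rewrite le_max lexx.
have yM : v y <= M by rewrite le_max lexx orbT.
have M0 : 0 <= M by apply: le_trans xM; exact: (compl_ge0 cv).
have [Mp|] := ltP 0 M; last first.
  move=> M0'; have Mz : M = 0 by apply/eqP; rewrite eq_le M0' M0.
  have z t : v t <= M -> t = 0.
    by move=> ht; apply/(compl_eq0 cv)/eqP; rewrite eq_le (compl_ge0 cv) andbT -Mz.
  by rewrite (z x) // (z y) // addr0 vc0.
rewrite -[M]mul1r -ler_pdivrMr //.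
apply: (@linear_growth R _ 1 1) => //; first by rewrite divr_ge0 // (compl_ge0 cv).
move=> k; rewrite expr_div_n ler_pdivrMr ?exprn_gt0 // -vcX exprDn.
have -> : (1 * k%:R + 1) * M ^+ k = \sum_(i < k.+1) M ^+ k.
  by rewrite sumr_const card_ord -[M ^+ k *+ _]mulr_natl -[k.+1]addn1 natrD mul1r.
elim/big_ind2: _ => [|a1 a2 b1 b2 h1 h2|i _]; first by rewrite vc0.
  by apply: le_trans (compl_D cv _ _) _; exact: lerD.
rewrite -mulr_natl !(compl_M cv) !vcX.
have -> : M ^+ k = 1 * (M ^+ (k - i) * M ^+ i) by rewrite mul1r -exprD subnK // -ltnS.
have c0 := compl_ge0 cv.
by rewrite !ler_pM ?mulr_ge0 ?exprn_ge0 // lerXn2r ?nnegrE.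
Qed.

Lemma arch_or_ultra : 1 < v 2%:R \/ ultra_abs v.
Proof. by have [h|h] := leP (v 2%:R) 1; [right; exact/ultra_of_nat/nat_le1 | left]. Qed.

Lemma arch_nat k n : 1 < v 2%:R -> (n < 2 ^ k)%N -> v n%:R * (v 2%:R - 1) <= v 2%:R ^+ k.
Proof.
move=> h2 hn; suff : v n%:R * (v 2%:R - 1) <= v 2%:R ^+ k - 1 by move=> h; apply: le_trans h _; rewrite gerBl.
elim: k n hn => [|k IH] n.
  by rewrite expn0 ltnS leqn0 => /eqP ->; rewrite vc0 mul0r expr0 subrr.
rewrite expnS => hn; have h3 := compl_D cv (odd n)%:R (n./2).*2%:R.
rewrite -natrD odd_double_half -mul2n natrM (compl_M cv) in h3.
have h4 : v (odd n)%:R <= 1 by case: (odd n); rewrite ?vc1 ?vc0.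
have h5 : v n./2%:R * (v 2%:R - 1) <= v 2%:R ^+ k - 1.
  apply: IH; rewrite -(ltn_pmul2l (isT : 0 < 2)%N) mul2n (leq_ltn_trans _ hn) //.
  by rewrite -{2}[n]odd_double_half leq_addl.
rewrite exprS.
have := ler_wpM2l (ltW (lt_trans ltr01 h2)) h5.
have h6 : 0 < v 2%:R - 1 by rewrite subr_gt0.
have := ler_wpM2r (ltW h6) h3; nra.
Qed.

(* Binary approximations of the square root converge geometrically for every archimedean v. *)
Lemma arch_sqrt (A : nat) : 1 < v 2%:R -> exists w : K, w ^+ 2 = A%:R.
Proof.
move=> h2; pose t := v 2%:R; have t0 : 0 < t by exact: lt_trans h2.
have two0 : 2%:R != 0 :> K by rewrite natK_eq0.
(* The n-th approximation is the integer part of the square root of A 4^n, divided by 2^n;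
   consecutive ones differ by 0 or 2^-(n+1). Only |2| > 1 is known about v. *)
have sq n : exists m, (m ^ 2 <= A * 4 ^ n < m.+1 ^ 2)%N.
  pose P m := (m ^ 2 <= A * 4 ^ n)%N.
  have exP : exists m, P m by exists 0%N.
  have ub m : P m -> (m <= A * 4 ^ n)%N.
    by apply: leq_trans; rewrite expnS expn1; case: (m) => // m'; rewrite leq_pmulr.
  case: (ex_maxnP exP ub) => m Pm maxm; exists m; rewrite -/(P m) Pm ltnNge /=.
  by apply/negP => /maxm; rewrite ltnn.
pose m n := projT1 (cid (sq n)).
have hm n : (m n ^ 2 <= A * 4 ^ n < (m n).+1 ^ 2)%N by rewrite /m; case: cid.
have step n : m n.+1 = (2 * m n)%N \/ m n.+1 = (2 * m n).+1.
  have /andP[a1 a2] := hm n; have /andP[b1 b2] := hm n.+1; move: b1 b2; rewrite [(4 ^ n.+1)%N]expnS.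
  by move: (m n) (m n.+1) (4 ^ n)%N a1 a2 => x y z; rewrite !expnS !expn0; nia.
pose u n : K := (m n)%:R / 2%:R ^+ n.
have du n : v (u n.+1 - u n) <= t^-1 * t^-1 ^+ n.
  have -> : u n.+1 - u n = (m n.+1 - 2 * m n)%N%:R / 2%:R ^+ n.+1.
    rewrite /u natrB ?natrM; last by case: (step n) => ->.
    by rewrite exprS; field; rewrite expf_neq0.
  rewrite (compl_M cv) vcV vcX -/t -exprS exprVn ler_piMl ?invr_ge0 ?exprn_ge0 ?(ltW t0) //.
  by case: (step n) => ->; rewrite ?subnn ?subSnn ?vc0 ?vc1.
have [|||w hw] := vc_limit _ _ _ du; rewrite ?invf_lt1 ?invr_ge0 ?(ltW t0) //.
exists w; apply/eqP; rewrite -subr_eq0; apply/eqP/(compl_eq0 cv)/eqP.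
rewrite eq_le (compl_ge0 cv) andbT leNgt; apply/negP => d0; set d := v _ in d0.
(* |u_n^2 - A| <= C t^{-n} *)
have hJ n : v (u n ^+ 2 - A%:R) * (t - 1) <= t ^+ A.+2 * t^-1 ^+ n.
  have /andP[a1 a2] := hm n.
  have -> : u n ^+ 2 - A%:R = - ((A * 4 ^ n - m n ^ 2)%N%:R / 2%:R ^+ (2 * n)).
    rewrite /u natrB // natrM !natrX mulnC exprM [4%:R](_ : _ = 2%:R ^+ 2); last by rewrite -natrX.
    by rewrite -!exprM [(2 * n)%N]mulnC exprM; field; rewrite expf_neq0.
  rewrite vcN (compl_M cv) vcV vcX -/t mulrAC ler_pdivrMr ?exprn_gt0 //.
  have hl : (A * 4 ^ n - m n ^ 2 < 2 ^ (A.+2 + n))%N.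
    have hA : (A < 2 ^ A)%N by exact: ltn_expl.
    have e4 : (4 ^ n = 2 ^ n * 2 ^ n)%N by rewrite -expnMn.
    have z0 : (0 < 2 ^ n)%N by rewrite expn_gt0.
    move: a1 a2; rewrite e4 expnD !expnS !expn0; move: (2 ^ n)%N z0 (2 ^ A)%N hA (m n).
    move=> z z0 B AB x a1 a2.
    have xz : (x <= A * z)%N.
      rewrite leqNgt; apply/negP => lt; have := leq_mul lt lt.
      case: (A) a1 => [|A']; first by rewrite !mul0n; nia.
      have : (A'.+1 * (z * z) <= (A'.+1 * z) * (A'.+1 * z))%N by rewrite mulnACA leq_pmul2r ?muln_gt0 ?z0 // leq_pmulr.
      nia.
    have : (A * z < B * z)%N by rewrite ltn_pmul2r.
    nia.
  apply: le_trans (arch_nat h2 hl) _; rewrite -/t exprD exprVn mul2n -addnn exprD.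
  have tn : t ^+ n != 0 by rewrite gt_eqF // exprn_gt0.
  by rewrite le_eqVlt; apply/orP; left; apply/eqP; field.
have tm : 0 < t - 1 by rewrite subr_gt0.
pose C := t ^+ A.+2; have C0 : 0 < C by rewrite exprn_gt0.
pose W := 2%:R * v w + 1; have W0 : 0 < W by rewrite ltr_wpDl ?mulr_ge0 ?(compl_ge0 cv).
have d20 : 0 < d / 2%:R by rewrite divr_gt0.
have e0 : 0 < Num.min 1 (d / 2%:R / W) by rewrite lt_min ltr01 divr_gt0.
have [N hN] := hw _ e0.
have ti0 : 0 <= t^-1 by rewrite invr_ge0 ltW.
have ti1 : t^-1 < 1 by rewrite invf_lt1.
have e1 : 0 < d / 2%:R * (t - 1) / C by rewrite divr_gt0 // mulr_gt0.
have [N2 hN2] := expr_small ti0 ti1 e1.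
have := hN _ (leq_maxl N N2); have := hN2 _ (leq_maxr N N2).
set n := maxn N N2; rewrite ltr_pdivlMr // mulrC => b1; rewrite lt_min => /andP[b2 b3].
have b4 : v (u n ^+ 2 - A%:R) < d / 2%:R by rewrite -(ltr_pM2r tm); exact: le_lt_trans (hJ n) b1.
have : d <= v (u n - w) * W + v (u n ^+ 2 - A%:R).
  have -> : d = v ((u n ^+ 2 - A%:R) - (u n - w) * ((u n - w) + 2%:R * w)) by congr v; ring.
  apply: le_trans (vcB_le _ _) _; rewrite addrC lerD // (compl_M cv) ler_wpM2l ?(compl_ge0 cv) //.
  apply: le_trans (compl_D cv _ _) _; rewrite /W addrC lerD //; last exact: ltW.
  rewrite (compl_M cv) ler_wpM2r ?(compl_ge0 cv) //.
  by rewrite -[2%:R]/(1 + 1) -[2%:R]/(1 + 1); apply: le_trans (compl_D cv _ _) _; rewrite vc1.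
move: b3; rewrite ltr_pdivlMr // => b3 hd.
by have := le_lt_trans hd (ltrD b3 b4); rewrite -splitr ltxx.
Qed.

End Completion.

(** * Ultrametric fields *)

Section Ultra.
Variables (R : realType) (K : fieldType) (v : K -> R).
Hypotheses (cv : is_completion v) (ua : ultra_abs v).
Let v_ge0 := ua_ge0 ua.

Definition vint (F : {poly K}) := forall i, v F`_i <= 1.

Lemma vint_horner F x : vint F -> v x <= 1 -> v F.[x] <= 1.
Proof.
move=> hF hx; rewrite horner_coef; apply: (ua_sum_le ua) => // i _.
by rewrite (ua_M ua) (uaX ua) mulr_ile1 ?exprn_ge0 ?exprn_ile1.
Qed.

Lemma vint_deriv F : vint F -> vint F^`().
Proof.
move=> hF i; rewrite coef_deriv -mulr_natl (ua_M ua) mulr_ile1 //; exact: (ua_nat ua).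
Qed.

Lemma vint_cons F c : vint (F * 'X + c%:P) -> vint F /\ v c <= 1.
Proof.
move=> h; split=> [i|]; first by have := h i.+1; rewrite coefD coefMX coefC addr0.
by have := h 0%N; rewrite coefD coefMX coefC add0r.
Qed.

Lemma vint_taylor F x h : vint F -> v x <= 1 -> v h <= 1 ->
  exists2 c, v c <= 1 & F.[x + h] = F.[x] + F^`().[x] * h + h ^+ 2 * c.
Proof.
move=> hF hx hh; elim/poly_ind: F hF => [_|F c0 IH /vint_cons[hF _]].
  by exists 0; rewrite ?(ua0 ua) // derivC !horner0; ring.
have [c hc e] := IH hF; exists (c * (x + h) + F^`().[x]).
  apply: (uaD_le ua); last exact/vint_horner/hx/vint_deriv.
  by rewrite (ua_M ua) mulr_ile1 //; apply: (uaD_le ua).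
by rewrite derivD derivM derivX derivC !hornerE e; ring.
Qed.

Lemma vint_lip F x y : vint F -> v x <= 1 -> v y <= 1 -> v (F.[x] - F.[y]) <= v (x - y).
Proof.
move=> hF hx hy; have h1 : v (x - y) <= 1 by exact: (uaB_le ua).
have [c hc] := vint_taylor hF hy h1; rewrite [y + _]addrC subrK => ->.
have -> : F.[y] + F^`().[y] * (x - y) + (x - y) ^+ 2 * c - F.[y] =
   (x - y) * (F^`().[y] + (x - y) * c) by ring.
rewrite (ua_M ua) ler_piMr //; apply: (uaD_le ua); first exact/vint_horner/hy/vint_deriv.
by rewrite (ua_M ua) mulr_ile1.
Qed.

Lemma hensel F a : vint F -> v a <= 1 -> v F.[a] < 1 -> v F^`().[a] = 1 ->
  exists2 r, F.[r] = 0 & v (r - a) <= v F.[a].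
Proof.
move=> hF ha Fa F'a; set q := v F.[a]; have q0 : 0 <= q by exact: v_ge0.
pose N x := x - F.[x] / F^`().[x]; pose u n := iter n N a.
(* Newton's iteration; the geometric rate, weaker than the true quadratic one, is what [vc_limit]
   takes. *)
have inv n : [/\ v (u n - a) <= q, v F^`().[u n] = 1 & v F.[u n] <= q * q ^+ n].
  elim: n => [|n [h1 h2 h3]]; first by rewrite subrr (ua0 ua) expr0 mulr1.
  have hu : v (u n) <= 1 by rewrite -[u n](subrK a); apply: (uaD_le ua) => //; apply: le_trans h1 _; exact: ltW.
  have hq : v F.[u n] <= q by apply: le_trans h3 _; rewrite ler_piMr // exprn_ile1 // ltW.
  pose h := - (F.[u n] / F^`().[u n]).
  have vh : v h = v F.[u n] by rewrite (uaN ua) (ua_div ua) h2 divr1.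
  have hh : v h <= q by rewrite vh.
  have hh1 : v h <= 1 by apply: le_trans hh _; exact: ltW.
  have nz : F^`().[u n] != 0 by rewrite -(ua_gt0 ua) h2.
  have uS : u n.+1 = u n + h by [].
  split.
  - rewrite uS addrAC; exact: (uaD_le ua).
  - have := vint_lip (x := u n + h) (vint_deriv hF) (uaD_le ua hu hh1) hu.
    rewrite addrAC subrr add0r => h4; rewrite uS -h2; apply: (ua_eq ua); rewrite h2.
    by apply: le_lt_trans h4 (le_lt_trans hh Fa).
  have [c hc e] := vint_taylor hF hu hh1.
  rewrite uS e /h mulrN mulrC divfK // subrr add0r sqrrN (ua_M ua) (uaX ua) (ua_div ua) h2 divr1.
  apply: (le_trans (y := v F.[u n] ^+ 2)); first by rewrite ler_piMr // exprn_ge0.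
  by rewrite expr2 exprS; apply: ler_pM.
have q1 := Fa.
have [|l hl] := vc_limit cv q0 Fa q0 (u := u).
  move=> n; have [h1 h2 h3] := inv n; rewrite /u /= -/(u n) /N addrAC subrr add0r.
  by rewrite (uaN ua) (ua_div ua) h2 divr1.
have la : v (l - a) <= q.
  have [q0'|qz] := ltP 0 q.
    have [M hM] := hl _ q0'; have [h1 _ _] := inv M.
    have -> : l - a = (u M - a) - (u M - l) by ring.
    by apply: (uaB_le ua) => //; apply/ltW/hM.
  have qq : q = 0 by apply/eqP; rewrite eq_le qz q0.
  rewrite leNgt; apply/negP => lt; have lt' : 0 < v (l - a) by rewrite -qq.
  have [M hM] := hl _ lt'; have [h1 _ _] := inv M; have := hM M (leqnn M).
  have ea : u M = a by apply/eqP; rewrite -subr_eq0; apply/eqP/(ua_eq0 ua)/eqP; rewrite eq_le v_ge0 -qq h1.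
  by rewrite ea (uaBC ua) ltxx.
exists l => //; apply/(ua_eq0 ua)/eqP; rewrite eq_le v_ge0 andbT leNgt; apply/negP => F0.
have l1 : v l <= 1 by rewrite -[l](subrK a); apply: (uaD_le ua) => //; apply: le_trans la _; exact: ltW.
have [M hM] := hl _ F0; have [M2 hM2] := expr_small q0 Fa F0.
set n := maxn M M2; have [h1 h2 h3] := inv n.
have hu : v (u n) <= 1 by rewrite -[u n](subrK a); apply: (uaD_le ua) => //; apply: le_trans h1 _; exact: ltW.
have a1 : v F.[u n] < v F.[l].
  apply: le_lt_trans h3 _; apply: le_lt_trans (hM2 n (leq_maxr _ _)).
  by rewrite ler_piMl ?exprn_ge0 // ltW.
have a2 : v (F.[u n] - F.[l]) < v F.[l].
  by apply: le_lt_trans (vint_lip hF hu l1) _; exact: hM (leq_maxl _ _).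
have := uaB_lt ua a1 a2; rewrite subKr ltxx.
by [].
Qed.

Lemma vint_sqrX u : v u <= 1 -> vint ('X^2 - u%:P).
Proof.
move=> hu i; rewrite coefB coefXn coefC; apply: (uaB_le ua); first by case: eqP; rewrite ?(ua1 ua) ?(ua0 ua).
by case: eqP; rewrite ?(ua0 ua).
Qed.

Lemma sqrt_odd u c : v 2%:R = 1 -> v c = 1 -> v (u - c ^+ 2) < 1 ->
  exists2 s, s ^+ 2 = u & v (s - c) < 1.
Proof.
move=> h2 hc hu; have u1 : v u <= 1.
  rewrite -[u](subrK (c ^+ 2)); apply: (uaD_le ua); first exact: ltW.
  by rewrite (uaX ua) hc expr1n.
have e1 : ('X^2 - u%:P).[c] = - (u - c ^+ 2) by rewrite !hornerE; ring.
have [||||r] := @hensel ('X^2 - u%:P) c; rewrite ?hc //; first exact: vint_sqrX.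
- by rewrite e1 (uaN ua).
- by rewrite derivB derivXn derivC subr0 /= hornerMn hornerX -mulr_natl (ua_M ua) h2 hc mulr1.
move=> + hr; rewrite !hornerE => /eqP; rewrite subr_eq0 => /eqP rr; exists r => //.
by apply: le_lt_trans hr _; rewrite e1 (uaN ua).
Qed.

(** The substitution s = 1 + 2 r turns s^2 = u into r^2 + r = (u - 1) / 4, whose derivative at 0 is
    1, so Hensel's lemma applies even at 2. *)
Lemma sqrt_two u : v 2%:R < 1 -> v (u - 1) <= v 8%:R -> exists2 s, s ^+ 2 = u & v (s - 1) <= v 2%:R ^+ 2.
Proof.
move=> h2 hu.
have n4 : 4%:R != 0 :> K by rewrite (natK_eq0 cv).
pose m := (u - 1) / 4%:R; have hm : v m <= v 2%:R.
  by rewrite (ua_div ua) ler_pdivrMr ?(ua_gt0 ua) // -(ua_M ua) -natrM.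
have mlt : v m < 1 by exact: le_lt_trans h2.
have e1 : ('X^2 + 'X - m%:P).[0] = - m by rewrite !hornerE ?expr0n /=; ring.
have [||||r] := @hensel ('X^2 + 'X - m%:P) 0.
- move=> i; rewrite !coefD coefN coefXn coefX coefC.
  by case: i => [|[|[|i]]] /=; rewrite ?(add0r, addr0, subr0, oppr0) ?(uaN ua) ?(ua1 ua) ?(ua0 ua) // ltW.
- by rewrite (ua0 ua).
- by rewrite e1 (uaN ua).
- rewrite derivB derivD derivXn derivX derivC subr0 hornerD hornerMn hornerC hornerXn /= expr1 mul0rn add0r.
  exact: (ua1 ua).
rewrite e1 (uaN ua) subr0 => + hr; rewrite !hornerE => er; exists (1 + 2%:R * r).
  have -> : u = 1 + 4%:R * m by rewrite /m mulrC divfK // addrC subrK.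
  have -> : m = r ^+ 2 + r by apply/eqP; rewrite eq_sym -subr_eq0 er.
  by ring.
rewrite [1 + _]addrC addrK (ua_M ua) expr2 ler_wpM2l //.
exact: le_trans hm.
Qed.

Lemma exists_small_prime : exists2 p, prime p & v p%:R < 1.
Proof.
apply: contrapT => H; have v1 p : prime p -> v p%:R = 1.
  move=> pp; apply/eqP; rewrite eq_le (ua_nat ua) leNgt; apply/negP => lt.
  by apply: H; exists p.
have vn n : (0 < n)%N -> v n%:R = 1.
  have [m] := ubnP n; elim: m n => // m IH n nm n0.
  have [n1|n1] := leqP n 1; first by rewrite [n](_ : _ = 1%N) ?(ua1 ua) //; apply/eqP; rewrite eqn_leq n1.
  rewrite -(divnK (pdiv_dvd n)) natrM (ua_M ua) (v1 (pdiv n)) ?pdiv_prime // mulr1 IH //.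
    by rewrite (leq_trans _ (nm : (n <= m)%N)) // ltn_Pdiv // prime_gt1 // pdiv_prime.
  by rewrite divn_gt0 ?pdiv_gt0 // pdiv_leq.
have vz (n : int) : n != 0 -> v n%:~R = 1.
  case: n => n n0; first by rewrite vn // lt0n -eqz_nat.
  by rewrite NegzE rmorphN (uaN ua) vn.
have [q q0] := compl_nontrivial cv; rewrite /ratr (ua_div ua) !vz ?numq_eq0 ?denq_neq0 //.
by rewrite divr1 eqxx.
Qed.

Lemma intK_eq0 (n : int) : (n%:~R == 0 :> K) = (n == 0).
Proof.
by case: n => n; rewrite ?NegzE ?rmorphN ?oppr_eq0 /= (natK_eq0 cv).
Qed.

Section Prime.
Variable p : nat.
Hypotheses (pp : prime p) (vp : v p%:R < 1).

Let vp0 : 0 < v p%:R. Proof. by rewrite (ua_gt0 ua) (natK_eq0 cv) -lt0n prime_gt0. Qed.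

Lemma v_coprime n : ~~ (p %| n)%N -> v n%:R = 1.
Proof.
move=> pn; apply/eqP; rewrite eq_le (ua_nat ua) leNgt; apply/negP => lt.
have n0 : (0 < n)%N by case: (n) pn; rewrite ?dvdn0.
have [km kn e _] := egcdnP p n0.
have /eqP cop : coprime n p by rewrite coprime_sym prime_coprime.
have : v (1 : K) < 1.
  have -> : 1 = (km * n)%N%:R - (kn * p)%N%:R :> K by rewrite e cop natrD addrC addKr.
  by apply: (uaB_lt ua); rewrite natrM (ua_M ua); apply: le_lt_trans (ler_piMl _ (ua_nat ua _)) _; rewrite ?v_ge0.
by rewrite (ua1 ua) ltxx.
Qed.

Lemma v_nat n : (0 < n)%N -> v n%:R = v p%:R ^+ logn p n.
Proof.
move=> n0; have [m cm e] := pfactor_coprime pp n0.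
by rewrite {1}e natrM (ua_M ua) natrX (uaX ua) v_coprime ?mul1r // -prime_coprime.
Qed.

Lemma v_int_dvd (n : int) k : ((p ^ k)%N %| n)%Z -> v n%:~R <= v p%:R ^+ k.
Proof.
move=> /dvdzP[m ->]; rewrite rmorphM /= (ua_M ua) -[X in _ * v X]/((p ^ k)%N%:R).
by rewrite natrX (uaX ua) ler_piMl ?exprn_ge0 // (ua_int ua).
Qed.

Lemma v_ratE (q : rat) : exists a b : nat, q != 0 -> v (ratr q) * v p%:R ^+ b = v p%:R ^+ a.
Proof.
have vz (n : int) : n != 0 -> v n%:~R = v p%:R ^+ logn p `|n|.
  move=> n0; have -> : v n%:~R = v `|n|%N%:R.
    by case: (n) => m //; rewrite NegzE rmorphN (uaN ua).
  by rewrite v_nat // absz_gt0.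
exists (logn p `|numq q|), (logn p `|denq q|) => q0.
rewrite /ratr (ua_div ua) !vz ?numq_eq0 ?denq_neq0 // divfK // expf_neq0 // gt_eqF //.
Qed.

Lemma v_rat_near x : x != 0 -> exists q : rat, q != 0 /\ v x = v (ratr q).
Proof.
move=> x0; have vx0 : 0 < v x by rewrite (ua_gt0 ua).
have [q hq] := compl_dense cv x vx0.
have e : v x = v (ratr q) by apply/esym/(ua_eq ua); rewrite (uaBC ua).
exists q; split=> //; apply: contraTN isT => /eqP q0.
by move: e => /eqP; rewrite q0 /ratr rmorph0 mul0r (ua0 ua) => /eqP/(ua_eq0 ua)/eqP; rewrite (negPf x0).
Qed.

Lemma v_parity x : x != 0 -> exists2 y, y != 0 & v x = v y ^+ 2 \/ v x = v p%:R * v y ^+ 2.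
Proof.
move=> x0; have [q [q0 e]] := v_rat_near x0; have [a [b /(_ q0)]] := v_ratE q; rewrite -e => h.
have pn0 : p%:R != 0 :> K by rewrite -(ua_gt0 ua).
have pb : v p%:R ^+ b != 0 by rewrite expf_neq0 // gt_eqF.
have -> : v x = v p%:R ^+ a / v p%:R ^+ b by rewrite -h mulfK.
have {h}-> : v p%:R ^+ a / v p%:R ^+ b = v p%:R ^+ (a + b) / (v p%:R ^+ b) ^+ 2.
  by rewrite exprD expr2 invfM mulrA mulfK.
exists (p%:R ^+ (a + b)./2 / p%:R ^+ b); first by rewrite mulf_neq0 ?invr_eq0 ?expf_neq0.
rewrite (ua_div ua) !(uaX ua) expr_div_n -(exprM _ _./2) muln2.
have e2 := odd_double_half (a + b).
move: ((a + b)./2).*2 e2 => m; case: (odd _) => /= <-; [right|left].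
  by rewrite exprD expr1 mulrA.
by rewrite add0n.
Qed.

(** By density x is close to a rational of value at most 1; its denominator is prime to p and is
    inverted modulo p^k by Bezout. *)
Lemma residue x k : v x <= 1 -> exists n : nat, v (x - n%:R) <= v p%:R ^+ k.
Proof.
move=> hx; have pk0 : 0 < v p%:R ^+ k by rewrite exprn_gt0.
have [q hq] := compl_dense cv x pk0.
have q1 : v (ratr q) <= 1.
  have -> : ratr q = x - (x - ratr q) :> K by ring.
  apply: (uaB_le ua) => //; apply: le_trans (ltW hq) _; by rewrite exprn_ile1 // ltW.
have vz (n : int) : ~~ (p %| `|n|)%N -> v n%:~R = 1.
  have -> : v n%:~R = v `|n|%N%:R.
    by case: (n) => m //; rewrite NegzE rmorphN (uaN ua).
  exact: v_coprime.
have pd : ~~ (p %| `|denq q|)%N.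
  apply/negP => pd; have pn : ~~ (p %| `|numq q|)%N.
    apply/negP => pn; have := coprime_num_den q => /eqP; have := dvdn_gcd p `|numq q| `|denq q|.
    by rewrite pn pd /= => + e; rewrite e dvdn1 => /eqP p1; have := pp; rewrite p1.
  move: q1; rewrite /ratr (ua_div ua) (vz _ pn) div1r invf_le1 ?(ua_gt0 ua) ?intK_eq0 ?denq_neq0 //.
  rewrite -[denq q]gez0_abs ?denq_ge0 // leNgt => /negP; apply.
  have /dvdnP[m ->] := pd; rewrite -pmulrn natrM (ua_M ua).
  by apply: le_lt_trans (ler_piMl _ (ua_nat ua _)) vp; rewrite v_ge0.
have d1 := vz _ pd; set d := denq q in d1 pd; set m := numq q.
have dn0 : d%:~R != 0 :> K by rewrite -(ua_gt0 ua) d1.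
have cop : coprimez d (p ^ k)%N.
  by rewrite coprimezE absz_nat coprimeXr // coprime_sym prime_coprime.
have [[a b] hab] : exists ab : int * int, ab.1 * d + ab.2 * (p ^ k)%N = 1.
  by have [a [b]] := Bezoutz d (p ^ k)%N; rewrite (eqP cop) => e; exists (a, b).
pose t := (a * m %% (p ^ k)%N)%Z.
have t0 : 0 <= t by apply: modz_ge0; rewrite gt_eqF // ltz_nat expn_gt0 prime_gt0.
have hxt : v (ratr q - t%:~R) <= v p%:R ^+ k.
  have -> : ratr q - t%:~R = (m - t * d)%:~R / d%:~R :> K.
    by rewrite intrB intrM mulrBl (mulfK dn0).
  rewrite (ua_div ua) d1 divr1; apply: v_int_dvd; apply/dvdzP.
  have -> : t = a * m - (a * m %/ (p ^ k)%N)%Z * (p ^ k)%N by apply/eqP; rewrite eq_sym subr_eq addrC -divz_eq.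
  exists (b * m + (a * m %/ (p ^ k)%N)%Z * d).
  have -> : m - (a * m - (a * m %/ (p ^ k)%N)%Z * (p ^ k)%N) * d =
     m * 1 - a * d * m + (a * m %/ (p ^ k)%N)%Z * (p ^ k)%N * d by ring.
  by rewrite -hab /=; ring.
exists `|t|%N; have -> : `|t|%N%:R = t%:~R :> K by rewrite -{2}[t]gez0_abs.
have -> : x - t%:~R = (x - ratr q) + (ratr q - t%:~R) by ring.
by apply: (uaD_le ua) => //; exact: ltW.
Qed.

End Prime.
End Ultra.

(** * Quartic polynomials over prime fields *)

Section FiniteField.
Variable p : nat.
Hypotheses (pp : prime p) (op : odd p).
Local Notation Fp := 'F_p.
Local Notation m := p.-1./2.

Lemma m2 : (m * 2)%N = p.-1.
Proof. by rewrite muln2 -{2}[p.-1]odd_double_half -subn1 oddB ?prime_gt0 // op. Qed.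

Lemma Fp_expp (x : Fp) : x ^+ p = x.
Proof. by rewrite -[X in _ ^+ X](card_Fp pp) expf_card. Qed.

Lemma Fp_exp1 (x : Fp) : x != 0 -> x ^+ p.-1 = 1.
Proof.
by move=> x0; apply: (mulfI x0); rewrite mulr1 -exprS prednK ?prime_gt0 // Fp_expp.
Qed.

Lemma Fp_prim : exists z : Fp, p.-1.-primitive_root z.
Proof.
have h : has p.-1.-primitive_root (enum (predC1 (0 : Fp))).
  apply: has_prim_root; first by rewrite -ltnS prednK ?prime_gt0 ?prime_gt1.
  - by apply/allP => x; rewrite mem_enum unity_rootE => /= x0; rewrite Fp_exp1.
  - exact: enum_uniq.
  - by rewrite -cardE cardC1 card_Fp.
by have /hasP[z _ hz] := h; exists z.
Qed.

Lemma Fp_euler (a : Fp) : a ^+ m = 1 -> exists y, a = y ^+ 2.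
Proof.
have [z hz] := Fp_prim; have m0 : (0 < m)%N.
  by rewrite half_gt0 -ltnS prednK ?prime_gt0 //; case: (p) op pp => [|[|[|]]].
move=> am; have [->|a0] := eqVneq a 0; first by exists 0; rewrite expr0n.
have [[k /= _] Dk] := prim_rootP hz (Fp_exp1 a0).
move: am; rewrite Dk -exprM => /eqP; rewrite -(prim_order_dvd hz) => h.
have : (m * 2 %| k * m)%N by rewrite m2.
by rewrite mulnC dvdn_pmul2r // => /dvdnP[t ->]; exists (z ^+ t); rewrite -exprM.
Qed.

Lemma Fp_pm1 (a : Fp) : a != 0 -> a ^+ m = 1 \/ a ^+ m = -1.
Proof.
move=> a0; have /eqP : (a ^+ m) ^+ 2 = 1 ^+ 2 by rewrite -exprM m2 Fp_exp1 // expr1n.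
by rewrite eqf_sqr => /orP[/eqP|/eqP]; [left|right].
Qed.

Lemma Fp_poly_vanish (P : {poly Fp}) : (size P <= p)%N -> (forall x, P.[x] = 0) -> P = 0.
Proof.
move=> sP h; apply/eqP/negPn/negP => P0.
have := max_poly_roots P0 (rs := enum Fp); rewrite enum_uniq -cardE card_Fp // ltnNge sP.
by move=> H; suff: false by []; apply: H => //; apply/allP => x _; rewrite /root h.
Qed.

(* If F had only nonsquare values, F^m + 1 would vanish on Fp, hence be a multiple of X^p - X;
   differentiating the quotient relation twice forces F to divide F'^2. *)
Lemma quartic_value (F : {poly Fp}) : (7 <= p)%N -> size F = 5%N -> coprimep F F^`() ->
  exists x y, F.[x] = y ^+ 2.
Proof.
move=> p7 sF cF; apply: contrapT => H.
have Fm x : F.[x] ^+ m = -1.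
  have F0 : F.[x] != 0 by apply/eqP => e; apply: H; exists x, 0; rewrite e expr0n.
  by case: (Fp_pm1 F0) => // /Fp_euler[y e]; case: H; exists x, y.
have p0 : (p%:R : Fp) = 0 by exact: pchar_Fp_0.
pose X' : {poly Fp} := 'X^p - 'X.
have p1 : (1 < p)%N by exact: prime_gt1.
have sX : size X' = p.+1.
  by rewrite size_polyDl size_polyXn // size_polyN size_polyX.
have X0 : X' != 0 by rewrite -size_poly_eq0 sX.
have F0 : F != 0 by rewrite -size_poly_eq0 sF.
have dX : X'^`() = -1.
  by rewrite derivB derivXn derivX -scaler_nat p0 scale0r sub0r.
pose G := (F ^+ m + 1) %/ X'.
have eG : F ^+ m + 1 = X' * G.
  rewrite {1}(divp_eq (F ^+ m + 1) X') -/G mulrC.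
  suff -> : (F ^+ m + 1) %% X' = 0 by rewrite addr0.
  apply: Fp_poly_vanish => [|x]; first by rewrite -ltnS -sX ltn_modp.
  have := congr1 (horner^~ x) (divp_eq (F ^+ m + 1) X').
  rewrite !hornerD hornerM [X'.[x]](_ : _ = 0); last by rewrite /X' hornerD hornerN hornerXn hornerX Fp_expp subrr.
  by rewrite mulr0 add0r horner_exp Fm hornerC addNr => <-.
have m0 : (0 < m)%N by rewrite half_gt0; lia.
have sP : size (F ^+ m + 1) = (p.-1 * 2).+1.
  have s1 : size (F ^+ m) = (p.-1 * 2).+1.
    have := size_exp F m; rewrite sF /= => e; rewrite -[size _]prednK; last first.
      by rewrite lt0n size_poly_eq0 expf_neq0.
    by rewrite e -m2; congr _.+1; lia.
  by rewrite size_polyDl ?s1 ?size_poly1 //; lia.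
have G0 : G != 0 by apply/eqP => e; move: sP; rewrite eG e mulr0 size_poly0.
have sG : size G = p.-1.
  have := sP; rewrite eG size_mul // sX addSn /=; clear -p7; move: (size G) => sg; lia.
pose h := F^`() * G + 2%:R * F * G^`().
(* The derivative of F^m + 1 = X' G, multiplied by 2 F; here 2 m = p - 1 is -1 and X' has derivative
   -1. *)
have e1 : F^`() + 2%:R * F * G = X' * h.
  have := congr1 deriv eG; rewrite derivD derivC addr0 derivM dX deriv_exp => e.
  have {e} : 2%:R * F * (F^`() * F ^+ m.-1 *+ m) = 2%:R * F * (-1 * G + X' * G^`()) by rewrite e.
  have -> : 2%:R * F * (F^`() * F ^+ m.-1 *+ m) = - (F^`() * (X' * G - 1)).
    have em : F ^+ m = F * F ^+ m.-1 by rewrite -exprS prednK.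
    rewrite -eG addrK em -[_ *+ m]mulr_natl.
    have -> : 2%:R * F * (m%:R * (F^`() * F ^+ m.-1)) = (m * 2)%N%:R * (F^`() * (F * F ^+ m.-1)) by rewrite natrM; ring.
    have -> : (m * 2)%N%:R = -1 :> {poly Fp}.
      have e1 : p.-1%:R + 1 = p%:R :> {poly Fp} by rewrite natr1 prednK // prime_gt0.
      by rewrite m2; apply/eqP; rewrite -addr_eq0 e1 -polyC_natr p0.
    by rewrite mulN1r.
  move=> e; have -> : X' * h = X' * F^`() * G + X' * (2%:R * F * G^`()) by rewrite /h; ring.
  have -> : X' * (2%:R * F * G^`()) = - (F^`() * (X' * G - 1)) + 2%:R * F * G by rewrite e; ring.
  ring.
have sF' : (size F^`() <= 4)%N by have := lt_size_deriv F0; rewrite sF.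
have sh : (size h <= 3)%N.
  have [->|h0] := eqVneq h 0; first by rewrite size_poly0.
  have : (size (X' * h)%R <= p + 3)%N.
    rewrite -e1 (leq_trans (size_polyD _ _)) // geq_max (leq_trans sF') /=; last by lia.
    rewrite -mulrA (leq_trans (size_polyMleq _ _)) // -polyC_natr size_polyC.
    have := size_polyMleq F G; rewrite sF sG; move: (size (F * G)%R) => t ht.
    by case: (_ != 0) => /=; clear -ht p7; lia.
  rewrite size_mul // sX addSn /=; clear -p7; move: (size h) => sg; lia.
pose W := 2%:R * F * h^`() - F^`() * h.
have e2 : F * (2%:R * F^`()^`() + 4%:R * h) - F^`() ^+ 2 = X' * W.
  have := congr1 deriv e1.
  rewrite derivD !derivM dX -polyC_natr derivC mul0r add0r polyC_natr => d1.
  have e3 : F^`()^`() + F^`() * G = X' * h^`() - 2%:R * h.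
    have -> : F^`()^`() + F^`() * G = F^`()^`() + (2%:R * F^`() * G + 2%:R * F * G^`()) - h by rewrite /h; ring.
    rewrite d1; ring.
  have -> : F^`()^`() = X' * h^`() - 2%:R * h - F^`() * G by rewrite -e3 addrK.
  have -> : X' * W = 2%:R * F * X' * h^`() - F^`() * (X' * h) by rewrite /W; ring.
  rewrite -e1; ring.
(* The left side of [e2] has degree at most 6, less than the degree p of X'; this is where p >= 7
   enters. *)
have W0 : W = 0.
  apply/eqP/negPn/negP => W0; have := congr1 (fun q : {poly _} => size q) e2.
  rewrite size_mul // sX => e.
  have sW : (0 < size W)%N by rewrite lt0n size_poly_eq0.
  have : (size (F * (2%:R * F^`()^`() + 4%:R * h) - F^`() ^+ 2)%R <= 7)%N; last by rewrite e addSn /=; clear -p7 sW; move: (size W) sW => t; lia.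
  have cs (n : nat) (q : {poly Fp}) k : (size q <= k)%N -> (size (n%:R * q)%R <= k)%N.
    by rewrite -polyC_natr mul_polyC; apply: leq_trans (size_scale_leq _ _).
  have sF2 : (size F^`()^`() <= 3)%N.
    have [->|F'0] := eqVneq F^`() 0; first by rewrite derivC size_poly0.
    by have := lt_size_deriv F'0; move: sF'; move: (size F^`()) (size F^`()^`()) => t t'; clear; lia.
  rewrite (leq_trans (size_polyD _ _)) // size_polyN geq_max; apply/andP; split.
    rewrite (leq_trans (size_polyMleq _ _)) // sF.
    have : (size (2%:R * F^`()^`() + 4%:R * h)%R <= 3)%N by rewrite (leq_trans (size_polyD _ _)) // geq_max !cs.
    by move: (size _) => t; clear; lia.
  by rewrite expr2 (leq_trans (size_polyMleq _ _)) //; move: sF'; move: (size _) => t; clear; lia.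
have : F %| F^`() ^+ 2.
  by move/eqP: e2; rewrite W0 mulr0 subr_eq0 => /eqP <-; exact: dvdp_mulr.
have c2 : coprimep F (F^`() ^+ 2) by rewrite coprimep_expr.
by move=> d; have := dvdp_gcd F F (F^`() ^+ 2); rewrite dvdpp d => /dvdp_leq; rewrite -size_poly_eq0 (eqP c2) sF => /(_ isT).
Qed.
End FiniteField.

Section Vint.
Variables (R : realType) (K : fieldType) (v : K -> R).
Hypothesis ua : ultra_abs v.
Lemma vintC c : v c <= 1 -> vint v c%:P.
Proof. by move=> h i; rewrite coefC; case: eqP; rewrite ?(ua0 ua). Qed.
Lemma vintX : vint v 'X.
Proof. by move=> i; rewrite coefX; case: eqP; rewrite ?(ua0 ua) ?(ua1 ua). Qed.
Lemma vintD P Q : vint v P -> vint v Q -> vint v (P + Q).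
Proof. by move=> h1 h2 i; rewrite coefD; exact: (uaD_le ua). Qed.
Lemma vintN P : vint v P -> vint v (- P).
Proof. by move=> h1 i; rewrite coefN (uaN ua). Qed.
Lemma vintM P Q : vint v P -> vint v Q -> vint v (P * Q).
Proof.
move=> h1 h2 i; rewrite coefM; apply: (ua_sum_le ua) => // k _.
by rewrite (ua_M ua) mulr_ile1 ?(ua_ge0 ua).
Qed.
Lemma vintXn P n : vint v P -> vint v (P ^+ n).
Proof.
move=> h; elim: n => [|n IH]; first by rewrite expr0; apply: vintC; rewrite (ua1 ua).
by rewrite exprS; exact: vintM.
Qed.
End Vint.

(** * The quartic attached to xi and its points over every completion *)

Definition quartic (F : comNzRingType) (b : F) : {poly F} :=
  - ('X^2 - (9%:R * b ^+ 2)%:P) ^+ 2 + 64%:R%:P * ((2%:R * b)%:P * 'X + 16%:R%:P).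
Definition qval (F : comNzRingType) (b s : F) : F :=
  - (s ^+ 2 - 9%:R * b ^+ 2) ^+ 2 + 64%:R * (2%:R * b * s + 16%:R).
Definition qder (F : comNzRingType) (b s : F) : F :=
  - (4%:R * (s * (s ^+ 2 - 9%:R * b ^+ 2))) + 128%:R * b.

Lemma rmorph_qval (F F' : comNzRingType) (j : {rmorphism F -> F'}) b s :
  j (qval b s) = qval (j b) (j s).
Proof.
rewrite /qval (rmorphD j) (rmorphN j) (rmorphXn j) (rmorphB j) (rmorphXn j) (rmorphM j 9%:R).
by rewrite (rmorphM j 64%:R) !(rmorph_nat j) (rmorphD j) (rmorphM j (2%:R * b)) (rmorphM j 2%:R) (rmorphXn j) !(rmorph_nat j).
Qed.

Lemma rmorph_qder (F F' : comNzRingType) (j : {rmorphism F -> F'}) b s :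
  j (qder b s) = qder (j b) (j s).
Proof.
rewrite /qder (rmorphD j) (rmorphN j) (rmorphM j 4%:R) (rmorphM j s) (rmorphB j) (rmorphXn j) (rmorphM j 9%:R).
by rewrite (rmorphM j 128%:R) (rmorphXn j) !(rmorph_nat j).
Qed.

Lemma quarticE (F : comNzRingType) (b s : F) : (quartic b).[s] = qval b s.
Proof. by rewrite /quartic /qval !hornerE; ring. Qed.

Lemma quartic_derE (F : comNzRingType) (b s : F) : (quartic b)^`().[s] = qder b s.
Proof.
rewrite /quartic derivD derivN deriv_exp derivB derivXn !derivM derivC mul0r add0r derivD derivM.
rewrite !derivC derivX mul0r !add0r !addr0 subr0 mulr1 /qder.
rewrite !(hornerE, hornerMn, hornerXn, horner_exp) /= ?expr1; ring.
Qed.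

Lemma map_quartic (F F' : comNzRingType) (j : {rmorphism F -> F'}) b :
  map_poly j (quartic b) = quartic (j b).
Proof.
rewrite /quartic.
have h1 : map_poly j ('X^2 - (9%:R * b ^+ 2)%:P) = 'X^2 - (j (9%:R * b ^+ 2))%:P.
  by rewrite rmorphB /= map_polyXn map_polyC.
have h2 : map_poly j ((2%:R * b)%:P * 'X + 16%:R%:P) = (j (2%:R * b))%:P * 'X + (j 16%:R)%:P.
  by rewrite rmorphD (rmorphM (map_poly j)) /= map_polyX !map_polyC.
rewrite rmorphD rmorphN rmorphXn (rmorphM (map_poly j)) /= h1 h2 map_polyC /=.
by rewrite (rmorphM j 9%:R) (rmorphM j 2%:R) (rmorphXn j) !(rmorph_nat j).
Qed.

Lemma size_quartic (F : fieldType) (b : F) : size (quartic b) = 5%N.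
Proof.
have s2 : size ('X^2 - (9%:R * b ^+ 2)%:P) = 3%N by rewrite size_XnsubC.
have s4 : size (('X^2 - (9%:R * b ^+ 2)%:P) ^+ 2) = 5%N.
  have := size_exp ('X^2 - (9%:R * b ^+ 2)%:P) 2; rewrite s2 => e.
  rewrite -[LHS]prednK ?e // lt0n size_poly_eq0 expf_neq0 // -size_poly_eq0 s2.
  by [].
rewrite size_polyDl size_polyN s4 // mul_polyC.
apply: leq_ltn_trans (size_scale_leq _ _) _.
apply: leq_ltn_trans (size_polyD _ _) _; rewrite gtn_max size_polyC mul_polyC.
rewrite (leq_ltn_trans (size_scale_leq _ _)) ?size_polyX //.
by case: (_ != 0).
Qed.

(** With T = s^2 - 9 b^2 a double root satisfies T^2 = 128 (b s + 8) and s T = 32 b; elimination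
    gives b (3 b s + 16)^2 = 0. If b = 0 then s = 0 and a power of 2 vanishes; if 3 b s = -16 then g
    = 0. *)
Lemma quartic_no_double (F : fieldType) (b s : F) : 2%:R != 0 :> F ->
  256%:R - 27%:R * b ^+ 4 != 0 -> qval b s = 0 -> qder b s = 0 -> False.
Proof.
move=> n2 gn0 h1 h2; have n4 : 4%:R != 0 :> F.
  by rewrite (_ : 4%:R = 2%:R * 2%:R) ?mulf_neq0 // -natrM.
have np k : 2%:R ^+ k != 0 :> F by rewrite expf_neq0.
pose T := s ^+ 2 - 9%:R * b ^+ 2.
have eT2 : T ^+ 2 = 128%:R * (b * s + 8%:R).
  by apply/eqP; rewrite -subr_eq0 -oppr_eq0; apply/eqP; rewrite -h1 /qval /T; ring.
have esT : s * T = 32%:R * b.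
  apply: (mulfI n4); apply/eqP; rewrite -subr_eq0 -oppr_eq0; apply/eqP; rewrite -h2 /qder /T; ring.
have eA : b * s ^+ 3 + 8%:R * s ^+ 2 - 8%:R * b ^+ 2 = 0.
  apply: (mulfI (np 7)); rewrite mulr0.
  transitivity ((s * T) ^+ 2 - (32%:R * b) ^+ 2 - s ^+ 2 * (T ^+ 2 - 128%:R * (b * s + 8%:R))).
    by ring.
  by rewrite eT2 esT !subrr mulr0 subr0.
have eB : 8%:R * s ^+ 2 + 9%:R * b ^+ 3 * s + 24%:R * b ^+ 2 = 0.
  transitivity ((b * s ^+ 3 + 8%:R * s ^+ 2 - 8%:R * b ^+ 2) - b * (s * T - 32%:R * b)).
    by rewrite /T; ring.
  by rewrite eA esT subrr mulr0 subr0.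
have eC : b * (3%:R * b * s + 16%:R) ^+ 2 = 0.
  transitivity (s * (8%:R * s ^+ 2 + 9%:R * b ^+ 3 * s + 24%:R * b ^+ 2) - 8%:R * (s * T - 32%:R * b)).
    by rewrite /T; ring.
  by rewrite eB esT subrr !mulr0 subr0.
move/eqP: eC; rewrite mulf_eq0 expf_eq0 /= => /orP[/eqP b0|/eqP u0].
  have : s ^+ 3 = 0.
    transitivity (s * T - 32%:R * b + (9%:R * b * s + 32%:R) * b); first by rewrite /T; ring.
    by rewrite esT b0 !mulr0 subrr addr0.
  move/eqP; rewrite expf_eq0 /= => /eqP s0.
  have : 2%:R ^+ 10 = 0 :> F.
    transitivity (128%:R * (b * s + 8%:R) - 128%:R * s * b); first by ring.
    by rewrite -eT2 /T s0 b0; ring.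
  by move/eqP; rewrite (negPf (np _)).
have eU : 3%:R * b * s = - 16%:R by apply/eqP; rewrite -addr_eq0 u0.
have : 2%:R ^+ 4 * (256%:R - 27%:R * b ^+ 4) = 0.
  transitivity (- 27%:R * b ^+ 3 * (s * T - 32%:R * b) + ((3%:R * b * s) * ((3%:R * b * s) ^+ 2 - 81%:R * b ^+ 4)
     - (- 16%:R) * ((- 16%:R) ^+ 2 - 81%:R * b ^+ 4))).
    by rewrite /T; ring.
  by rewrite eU esT !subrr mulr0 addr0.
by move/eqP; rewrite mulf_eq0 (negPf (np _)) (negPf gn0).
Qed.

Lemma quartic_coprime (F : fieldType) (b : F) : 2%:R != 0 :> F ->
  256%:R - 27%:R * b ^+ 4 != 0 -> coprimep (quartic b) (quartic b)^`().
Proof.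
move=> n2 gn0; rewrite /coprimep; apply: contraT => ng.
have sg : (1 < size (gcdp (quartic b) (quartic b)^`()))%N.
  rewrite ltn_neqAle eq_sym ng lt0n size_poly_eq0 gcdp_eq0 negb_and.
  by rewrite -size_poly_eq0 size_quartic.
have [F' [j [x rx]]] := exists_root_ext sg.
move: rx; rewrite gcdp_map root_gcd -deriv_map map_quartic /root quarticE quartic_derE.
move=> /andP[/eqP r1 /eqP r2].
exfalso; apply: (quartic_no_double _ _ r1 r2).
  by rewrite -(rmorph_nat j) fmorph_eq0.
rewrite (_ : _ - _ = j (256%:R - 27%:R * b ^+ 4)) ?fmorph_eq0 //.
by rewrite rmorphB rmorphM rmorphXn !rmorph_nat.
Qed.

Section Solutions.
Variables (R : realType) (K : fieldType) (v : K -> R).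
Hypothesis cv : is_completion v.
Variable b : nat.
Hypothesis ob : odd b.

Let gz : int := 256 - 27 * (b : int) ^+ 4.

Lemma gz_map (F : comNzRingType) : gz%:~R = 256%:R - 27%:R * b%:R ^+ 4 :> F.
Proof. by rewrite /gz !(rmorphB, rmorphM, rmorphXn). Qed.

Lemma sqr_odd_mod8 (n : nat) : odd n -> (n ^ 2 %% 8 = 1)%N.
Proof.
move=> on; have : (n %% 8 < 8)%N by rewrite ltn_mod.
rewrite -modnXm; have : odd (n %% 8).
  by move: on; rewrite {1}(divn_eq n 8) oddD oddM andbF.
by case: (n %% 8)%N => [|[|[|[|[|[|[|[|]]]]]]]].
Qed.

Lemma vint_quartic (ua : ultra_abs v) (x : K) : v x <= 1 -> vint v (quartic x).
Proof.
move=> hx; have vn := ua_nat ua; rewrite /quartic.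
have hx2 : v (9%:R * x ^+ 2) <= 1 by rewrite (ua_M ua) (uaX ua) mulr_ile1 ?exprn_ge0 ?exprn_ile1 ?(ua_ge0 ua).
have hx1 : v (2%:R * x) <= 1 by rewrite (ua_M ua) mulr_ile1 ?(ua_ge0 ua).
apply: (vintD ua).
  apply/(vintN ua)/(vintXn ua)/(vintD ua); first exact/(vintXn ua)/(vintX ua).
  exact/(vintN ua)/(vintC ua).
apply/(vintM ua); first exact/(vintC ua).
apply/(vintD ua); last exact/(vintC ua).
by apply/(vintM ua); [exact/(vintC ua) | exact: (vintX ua)].
Qed.

Lemma v_int_unit (ua : ultra_abs v) p (n : int) : prime p -> v p%:R < 1 -> ~~ (p %| n)%Z -> v n%:~R = 1.
Proof.
move=> pp vp; have -> : v n%:~R = v `|n|%N%:R.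
  by case: (n) => m //; rewrite NegzE rmorphN (uaN ua).
by rewrite dvdzE absz_nat => /(v_coprime ua pp vp).
Qed.

(** The primes 2, 3, those dividing g and the archimedean case have an explicit s; at 5 there is a
    square root of -1. At the other primes the quartic is separable modulo p, represents a square
    there by [quartic_value], and the solution lifts. *)
Theorem local_solution : (exists i : K, i ^+ 2 = -1) \/
  exists s w : K, w ^+ 2 = qval b%:R s.
Proof.
have [v2|ua] := arch_or_ultra cv.
  (* At s = 3 b the negative term vanishes and the value is a natural number. *)
  right; have [w hw] := arch_sqrt cv (128 * (3 * b ^ 2 + 8)) v2.
  by exists (3%:R * b%:R), w; rewrite hw /qval natrM natrD natrM natrX; ring.
have [p pp vp] := exists_small_prime cv ua.
have vdvd (n : int) : (p %| n)%Z -> v n%:~R < 1.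
  move=> h; apply: le_lt_trans vp; rewrite -[v p%:R]expr1.
  by apply: (v_int_dvd ua); rewrite expn1.
have vun := v_int_unit ua pp vp.
have vn1 := ua_nat ua; have v0 := ua_ge0 ua.
have [p2|pn2] := eqVneq p 2%N.
  (* At s = b the quartic equals 64 (2 b^2 + 16 - b^4), and the second factor is 1 modulo 8. *)
  right; have v2 : v 2%:R < 1 by rewrite -p2.
  have [k ek] : exists k : int, 2 * (b : int) ^+ 2 + 16 - (b : int) ^+ 4 = 1 + 8 * k.
    have := divn_eq (b ^ 2) 8; rewrite sqr_odd_mod8 //; set q := (_ %/ 8)%N => e.
    have e' : (b : int) ^+ 2 = 8 * (q : int) + 1 by rewrite -(natz b) -natrX e natrD natrM natz mulrC.
    exists (2 - 8 * (q : int) ^+ 2); rewrite (_ : (b : int) ^+ 4 = ((b : int) ^+ 2) ^+ 2); last by ring.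
    by rewrite e'; ring.
  have [|w hw _] := sqrt_two cv ua (u := (2 * (b : int) ^+ 2 + 16 - (b : int) ^+ 4)%:~R) v2.
    rewrite ek rmorphD rmorph1 addrC addKr rmorphM /= (ua_M ua) ler_piMr //.
    exact: (ua_int ua).
  exists b%:R, (8%:R * w); rewrite exprMn hw /qval !(rmorphD, rmorphN, rmorphM, rmorphXn) /=.
  by ring.
have op : odd p by have [|//] := even_prime pp; move/eqP; rewrite (negPf pn2).
have v2 : v 2%:R = 1.
  by apply: (v_coprime ua pp vp); apply: contraNN pn2 => /dvdn_leq-/(_ isT); have := prime_gt1 pp; case: (p) op => [|[|[|]]].
have [p3|pn3] := eqVneq p 3.
  (* At s = 0 the value is 32^2 - 81 b^4, a square modulo 3. *)
  right; have [||w hw _] := @sqrt_odd _ _ _ cv ua (1024%:R - 81%:R * b%:R ^+ 4) 32%:R v2.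
  - have -> : 32%:R = 2%:R ^+ 5 :> K by rewrite -natrX.
    by rewrite (uaX ua) v2 expr1n.
  - rewrite (_ : _ - _ = ((- 27 * (b : int) ^+ 4) * 3)%:~R); first by apply: vdvd; rewrite p3 dvdz_mull.
    by rewrite !(rmorphN, rmorphM, rmorphXn) /=; ring.
  by exists 0, w; rewrite hw /qval; ring.
have [p5|pn5] := eqVneq p 5.
  left; have [|w hw _] := @sqrt_odd _ _ _ cv ua (-1) 2%:R v2 v2.
    have -> : -1 - 2%:R ^+ 2 = - 5%:R :> K by ring.
    by rewrite (uaN ua); move: vp; rewrite p5.
  by exists w.
right; have p7 : (7 <= p)%N.
  by move: pp pn2 pn3 pn5 op; case: (p) => [|[|[|[|[|[|[|]]]]]]].
(* If p divides g then b is a unit and 16 / b is a simple root modulo p: the value there is a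
   multiple of g and the derivative is -1024 b modulo g. *)
have [pg|png] := boolP (p %| gz)%Z.
  have pb : ~~ (p %| b)%N.
    apply/negP => pb; have : (p %| gz + 27 * (b : int) ^+ 3 * (b : int))%Z.
      by rewrite rpredD // dvdz_mull.
    have -> : gz + 27 * (b : int) ^+ 3 * (b : int) = 256%:R by rewrite /gz; ring.
    rewrite natz dvdzE !absz_nat (_ : 256 = 2 ^ 8)%N // Euclid_dvdX // => /andP[/dvdn_leq-/(_ isT) + _].
    by move: p7; case: (p) => [|[|[|]]].
  have vb : v b%:R = 1 by exact: (v_coprime ua pp vp).
  have bn0 : b%:R != 0 :> K by rewrite -(ua_gt0 ua) vb.
  have vg := vdvd _ pg; set gK : K := gz%:~R in vg.
  have egK : gK = 256%:R - 27%:R * b%:R ^+ 4.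
    exact: gz_map.
  have eq1 : (quartic (b%:R : K)).[16%:R / b%:R] = - gK * (gK / b%:R ^+ 4 + 24%:R).
    by rewrite quarticE /qval egK; field.
  have eq2 : (quartic (b%:R : K))^`().[16%:R / b%:R] = - (64%:R * gK / b%:R ^+ 3) - 1024%:R * b%:R.
    by rewrite quartic_derE /qder egK; field.
  have [||||r hr _] := @hensel _ _ _ cv ua (quartic (b%:R : K)) (16%:R / b%:R).
  - by apply: (vint_quartic ua).
  - by rewrite (ua_div ua) vb divr1.
  - rewrite eq1 mulNr (uaN ua) (ua_M ua); apply: le_lt_trans vg; rewrite ler_piMr //.
    apply: (uaD_le ua) => //; rewrite (ua_div ua) (uaX ua) vb expr1n divr1.
    exact: (ua_int ua).
  - have v1 : v (- (1024%:R * b%:R)) = 1.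
      have e10 : 1024%:R = 2%:R ^+ 10 :> K by rewrite -natrX.
      by rewrite (uaN ua) (ua_M ua) vb e10 (uaX ua) v2 expr1n mulr1.
    rewrite eq2 -v1; apply: (ua_eq ua); rewrite v1 addrK (uaN ua) (ua_div ua) (uaX ua) vb expr1n divr1.
    by rewrite (ua_M ua); apply: le_lt_trans vg; rewrite ler_piMl.
  by exists r, 0; rewrite expr0n /= -quarticE hr.
pose bp : 'F_p := b%:R.
have n2 : 2%:R != 0 :> 'F_p.
  by rewrite -(dvdn_pcharf (pchar_Fp pp)); apply/negP => /dvdn_leq-/(_ isT); move: p7; case: (p) => [|[|[|]]].
have intF (n : int) : (n%:~R == 0 :> 'F_p) = (p %| n)%Z by rewrite (dvdz_pcharf (pchar_Fp pp)).
have gn0 : 256%:R - 27%:R * bp ^+ 4 != 0.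
  by rewrite /bp -gz_map intF.
have [x [y hxy]] := quartic_value pp op p7 (size_quartic bp) (quartic_coprime n2 gn0).
pose s : int := nat_of_ord x; pose z : nat := nat_of_ord y.
have xE : x = s%:~R by rewrite -{1}[x]natr_Zp.
have yE : y = (z : int)%:~R by rewrite -{1}[y]natr_Zp.
pose N := qval (b : int) s; pose N' := qder (b : int) s.
have mapN (F : comNzRingType) : N%:~R = qval b%:R s%:~R :> F.
  exact: (@rmorph_qval _ F (intmul 1)).
have mapN' (F : comNzRingType) : N'%:~R = qder b%:R s%:~R :> F.
  exact: (@rmorph_qder _ F (intmul 1)).
have dN : (p %| N - (z : int) ^+ 2)%Z.
  rewrite -intF rmorphB rmorphXn /= mapN -xE -yE subr_eq0 -hxy quarticE.
  by [].
have vs : v s%:~R <= 1 by exact: (ua_int ua).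
(* A nonzero square value lifts through its square root; a zero value is a simple root by
   [quartic_no_double] and lifts to a point with w = 0. *)
have [pz|pnz] := boolP (p %| z)%N; last first.
  have [||w hw _] := @sqrt_odd _ _ _ cv ua N%:~R z%:R v2.
  - exact: (v_coprime ua pp vp).
  - by have := vdvd _ dN; rewrite rmorphB rmorphXn.
  by exists s%:~R, w; rewrite hw mapN.
have [||r hr _] := @hensel _ _ _ cv ua (quartic (b%:R : K)) s%:~R (vint_quartic ua (vn1 b)) vs.
- rewrite quarticE -mapN; apply: vdvd; rewrite -[N](subrK ((z : int) ^+ 2)) rpredD //.
  by rewrite expr2 dvdz_mull.
- rewrite quartic_derE -mapN'; apply: vun; rewrite -intF mapN' -xE; apply/eqP => h.
  apply: (quartic_no_double n2 gn0 _ h); rewrite -quarticE hxy yE.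
  by apply/eqP; rewrite -rmorphXn intF expr2 dvdz_mull.
by exists r, 0; rewrite expr0n /= -quarticE hr.
Qed.

End Solutions.

(** * The class xi *)

(* Locked, because unification of rational numerals by computation does not terminate. *)
Fact gF_key : unit. Proof. exact: tt. Qed.
Definition gF (F : pzRingType) (b : nat) : F := locked_with gF_key (256%:R - 27%:R * b%:R ^+ 4).
Lemma gFE (F : pzRingType) b : gF F b = 256%:R - 27%:R * b%:R ^+ 4.
Proof. by rewrite /gF unlock. Qed.

Lemma rmorph_gF (F F' : pzRingType) (f : {rmorphism F -> F'}) b : f (gF F b) = gF F' b.
Proof. by rewrite !gFE rmorphB rmorphM rmorphXn !rmorph_nat. Qed.

Lemma family_discE (F : fieldType) (g c : F) :
  weierstrass_disc 0 0 0 g (2%:R * (g * c)) = - 64%:R * g ^+ 2 * (g + 27%:R * c ^+ 2).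
Proof. by rewrite /weierstrass_disc; ring. Qed.

(** The reason for the shape of g: the discriminant -64 g^2 (g + 27 b^4) becomes minus a square. *)
Lemma gF_256 (F : comNzRingType) (b : nat) : gF F b + 27%:R * (b%:R ^+ 2) ^+ 2 = 256%:R.
Proof. by rewrite !gFE; ring. Qed.

Section Family.
Variable b : nat.
Hypothesis ob : odd b.

Lemma gF_neq0 : gF rat b != 0.
Proof.
rewrite !gFE subr_eq0 -natrX -natrM eqr_nat; apply/negP => /eqP e.
by have := congr1 odd e; rewrite oddM oddX ob.
Qed.

Let A : rat := gF rat b.
Let B : rat := 2%:R * gF rat b * b%:R ^+ 2.

Lemma family_disc : weierstrass_disc 0 0 0 A B != 0.
Proof.
suff : - 64%:R * A ^+ 2 * (A + 27%:R * (b%:R ^+ 2) ^+ 2) != 0 by rewrite -family_discE mulrA.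
have nz k : k.+1%:R != 0 :> rat by rewrite pnatr_eq0.
rewrite gF_256; apply: mulf_neq0; last exact: nz.
by apply: mulf_neq0; [rewrite oppr_eq0; exact: nz | rewrite expf_neq0 // gF_neq0].
Qed.
Local Notation hAB := family_disc.
Definition Eb : elliptic_curve := scurve hAB.

Section Pts.
Variables (L : fieldType) (r : {rmorphism rat -> L}).
Local Notation g := (gF L b).
Local Notation bL := (b%:R : L).

Lemma ratrA : ratr A = g. Proof. by rewrite (rmorph_ratr r) rmorph_gF. Qed.
Lemma ratrB : ratr B = 2%:R * g * bL ^+ 2.
Proof.
by rewrite (rmorph_ratr r) /B (rmorphM r (2%:R * gF rat b)) (rmorphM r 2%:R) (rmorphXn r) rmorph_gF !(rmorph_nat r).
Qed.
Lemma gF_neq0L : g != 0.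
Proof. by rewrite -(rmorph_gF r) fmorph_eq0 gF_neq0. Qed.
Lemma bF_neq0L : bL != 0.
Proof. by rewrite -(rmorph_nat r) fmorph_eq0 pnatr_eq0; case: (b) ob. Qed.

Definition fb (x : L) := x ^+ 3 + g * x + 2%:R * g * bL ^+ 2.

Lemma on_Eb x y : on_curve (L := L) Eb (Some (x, y)) = (y ^+ 2 == fb x).
Proof. by rewrite (on_scurve hAB r) /= ratrA ratrB. Qed.

Fact mkpt_on x y : y ^+ 2 = fb x -> on_curve (L := L) Eb (Some (x, y)).
Proof. by move=> h; rewrite on_Eb; apply/eqP. Qed.
Definition mkpt x y (h : y ^+ 2 = fb x) : spoint hAB r := Point (mkpt_on h).

Lemma spt_addval (P Q : spoint hAB r) : val (P + Q) = sadd g (val P) (val Q).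
Proof. by rewrite -ratrA -(raw_addE hAB r). Qed.

Section Q1.
Variable I : L.
Hypothesis I2 : I ^+ 2 = -1.
Local Notation x1 := (- 3%:R * bL ^+ 2).

Lemma Q1_on : (16%:R * bL * I) ^+ 2 = fb x1.
Proof. by rewrite /fb !gFE; ring: I2. Qed.
Definition Q1 : spoint hAB r := mkpt Q1_on.

(** The line of slope I s through Q1 meets the curve in two more points, whose abscissas are the
    roots of a quadratic polynomial of discriminant - qval b s = (I w)^2. *)
Lemma point_fit (s w X Y : L) : w ^+ 2 = qval bL s ->
  X = (- (x1 + s ^+ 2) + I * w) / 2%:R -> Y = I * (16%:R * bL + s * (X - x1)) -> Y ^+ 2 = fb X.
Proof.
move=> ew eX eY; have n2 : 2%:R != 0 :> L := char0_natr_neq0 r 1.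
have e2 : 2%:R * X = - (x1 + s ^+ 2) + I * w by rewrite eX mulrC divfK.
have e0 : X ^+ 2 + (x1 + s ^+ 2) * X + (x1 ^+ 2 + g + 2%:R * (16%:R * bL) * s - s ^+ 2 * x1) = 0.
  apply: (mulfI n2); apply: (mulfI n2); rewrite !mulr0.
  transitivity ((2%:R * X + (x1 + s ^+ 2)) ^+ 2 - (x1 + s ^+ 2) ^+ 2 + 4%:R * (x1 ^+ 2 + g + 2%:R * (16%:R * bL) * s - s ^+ 2 * x1)).
    by ring.
  have e3 : - (x1 + s ^+ 2) + I * w + (x1 + s ^+ 2) = I * w by ring.
  by rewrite e2 e3 exprMn I2 ew /qval !gFE; ring.
apply/eqP; rewrite -subr_eq0; apply/eqP.
transitivity (- (X - x1) * (X ^+ 2 + (x1 + s ^+ 2) * X + (x1 ^+ 2 + g + 2%:R * (16%:R * bL) * s - s ^+ 2 * x1))).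
  by rewrite eY exprMn I2 /fb !gFE; ring.
by rewrite e0 mulr0.
Qed.

(** The second residual point of that line is the negative of (X', Y'); so adding Q1 has the same
    effect as replacing I by -I. *)
Lemma point_fit_add (s w X Y X' Y' : L) (hP : Y ^+ 2 = fb X) (hP' : Y' ^+ 2 = fb X') : w ^+ 2 = qval bL s ->
  X = (- (x1 + s ^+ 2) + I * w) / 2%:R -> Y = I * (16%:R * bL + s * (X - x1)) ->
  X' = (- (x1 + s ^+ 2) - I * w) / 2%:R -> Y' = - I * (16%:R * bL + s * (X' - x1)) ->
  mkpt hP + Q1 = mkpt hP'.
Proof.
move=> ew eX eY eX' eY'; have n2 : 2%:R != 0 :> L := char0_natr_neq0 r 1.
have I0 : I != 0 by apply: contra_eq_neq I2 => ->; rewrite expr0n /= eq_sym oppr_eq0 oner_eq0.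
have e2 : 2%:R * X = - (x1 + s ^+ 2) + I * w by rewrite eX mulrC divfK.
have e2' : 2%:R * X' = - (x1 + s ^+ 2) - I * w by rewrite eX' mulrC divfK.
apply: val_inj; rewrite spt_addval /=.
have lm : line_meets g (2%:R * g * bL ^+ 2) (I * s) (I * (16%:R * bL - s * x1)) X x1 X'.
  have s1 : X + X' = - (x1 + s ^+ 2).
    by apply: (mulfI n2); rewrite mulrDr e2 e2'; ring.
  have s2 : X * X' = x1 ^+ 2 + g + 2%:R * (16%:R * bL) * s - s ^+ 2 * x1.
    apply: (mulfI n2); apply: (mulfI n2).
    transitivity ((2%:R * X) * (2%:R * X')); first by ring.
    rewrite e2 e2'; transitivity ((x1 + s ^+ 2) ^+ 2 - I ^+ 2 * w ^+ 2); first by ring.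
    by rewrite I2 ew /qval !gFE; ring.
  split.
  - by rewrite addrAC s1 exprMn I2; ring.
  - transitivity (X * X' + x1 * (X + X') + 2%:R * (I * s) * (I * (16%:R * bL - s * x1))); last by ring.
    rewrite s1 s2; transitivity (x1 ^+ 2 + g + 2%:R * (16%:R * bL) * s - s ^+ 2 * x1 - x1 * (x1 + s ^+ 2) + 2%:R * I ^+ 2 * s * (16%:R * bL - s * x1)); last by ring.
    by rewrite I2; ring.
  - transitivity (I ^+ 2 * (16%:R * bL - s * x1) ^+ 2 - x1 * (X * X')); last by ring.
    by rewrite I2 s2 !gFE; ring.
have h1 : Y = I * s * X + I * (16%:R * bL - s * x1) by rewrite eY; ring.
have h2 : 16%:R * bL * I = I * s * x1 + I * (16%:R * bL - s * x1) by ring.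
have h3 : Y' = - (I * s * X' + I * (16%:R * bL - s * x1)) by rewrite eY'; ring.
rewrite h1 h2 h3; apply: (sadd_line n2 lm).
rewrite negb_and; apply/orP; have [ex|] := eqVneq X x1; [right|by left].
rewrite -h1 -h2 eY ex subrr mulr0 addr0 -addr_eq0.
have -> : 16%:R * bL * I + I * (16%:R * bL) = 2%:R * (16%:R * (bL * I)) by ring.
rewrite !mulf_neq0 // ?bF_neq0L //; exact: (char0_natr_neq0 r 15).
Qed.
End Q1.
End Pts.

Lemma rmorph_fb (L L' : fieldType) (f : {rmorphism L -> L'}) x : f (fb x) = fb (f x).
Proof.
rewrite /fb !(rmorphD f) [f (x ^+ 3)]rmorphXn (rmorphM f (gF L b)) (rmorphM f (2%:R * _)) (rmorphM f 2%:R).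
by rewrite !(rmorph_gF f) (rmorphXn f) !(rmorph_nat f).
Qed.

Let rQ : {rmorphism rat -> algC} := ratr.
Definition QC : spoint hAB rQ := Q1 rQ (sqrCi algC).
Definition xi : galQ -> spoint hAB rQ := fun s => if s 'i == 'i then 0 else QC.

Lemma galQ_i (K L : fieldType) (f : {rmorphism K -> L}) (I : K) (J : L) : I ^+ 2 = -1 -> J ^+ 2 = -1 ->
  f I = J \/ f I = - J.
Proof.
move=> h1 h2; have /eqP : f I ^+ 2 = J ^+ 2 by rewrite -rmorphXn h1 h2 rmorphN rmorph1.
by rewrite eqf_sqr => /orP[/eqP|/eqP]; [left|right].
Qed.

Lemma Ci_neqN : (- 'i == 'i :> algC) = false.
Proof. by rewrite -subr_eq0 -opprD oppr_eq0 -mulr2n -mulr_natl mulf_eq0 pnatr_eq0 /= (negPf (neq0Ci _)). Qed.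

Lemma smap_Q1 (L L' : fieldType) (r : {rmorphism rat -> L}) (r' : {rmorphism rat -> L'})
    (f : {rmorphism L -> L'}) I I' (h : I ^+ 2 = -1) (h' : I' ^+ 2 = -1) :
  (f I = I' -> smap r' f (Q1 r h) = Q1 r' h') /\
  (f I = - I' -> smap r' f (Q1 r h) = - Q1 r' h').
Proof.
split=> e; apply: val_inj; rewrite /= ?(raw_oppE hAB r') /= !(rmorphM, rmorphXn, rmorphN, rmorph_nat) /= e //.
by rewrite !(ratr00 r') mul0r !subr0 mulrN.
Qed.

Lemma xi_fix (s : galQ) : s 'i = 'i -> xi s = 0 /\ smap rQ s QC = QC.
Proof. by move=> e; rewrite /xi e eqxx; split=> //; apply: (smap_Q1 rQ rQ s _ _).1. Qed.
Lemma xi_move (s : galQ) : s 'i = - 'i -> xi s = QC /\ smap rQ s QC = - QC.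
Proof. by move=> e; rewrite /xi e Ci_neqN; split=> //; apply: (smap_Q1 rQ rQ s _ _).2. Qed.

Lemma xi_cocycle : cocycle (xi : cochain Eb rQ).
Proof.
apply/cocycleP; split=> [s|s t]; first by exists [:: 'i] => t h; rewrite /xi h ?mem_head.
have [ei|ei] := galQ_i t (sqrCi algC) (sqrCi algC); have [si|si] := galQ_i s (sqrCi algC) (sqrCi algC).
- have [-> _] := xi_fix ei; have [-> _] := xi_fix si; have [|-> _] := @xi_fix (gal_mul s t).
    by rewrite /= ei si.
  by rewrite raddf0 addr0.
- have [-> _] := xi_fix ei; have [-> _] := xi_move si; have [|-> _] := @xi_move (gal_mul s t).
    by rewrite /= ei si.
  by rewrite raddf0 addr0.
- have [-> _] := xi_move ei; have [-> ->] := xi_fix si; have [|-> _] := @xi_move (gal_mul s t).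
    by rewrite /= ei rmorphN si.
  by rewrite add0r.
have [-> _] := xi_move ei; have [-> ->] := xi_move si; have [|-> _] := @xi_fix (gal_mul s t).
  by rewrite /= ei rmorphN si opprK.
by rewrite subrr.
Qed.

Lemma xi_double : coboundary (cochain_muln 2 (xi : cochain Eb rQ)).
Proof.
rewrite (cochain_mulnE (r := rQ)); apply/coboundaryP; exists (- QC) => s.
rewrite mulr2n -[(xi + xi) s]/(xi s + xi s) (raddfN (smap rQ s)) opprK /=.
by have [/xi_fix[-> ->]|/xi_move[-> ->]] := galQ_i s (sqrCi algC) (sqrCi algC);
  rewrite ?addr0 ?addNr ?opprK.
Qed.

Lemma xi_res (K : fieldType) (L : closedFieldType) (j : {rmorphism K -> L}) (i : {rmorphism algC -> L})
   (t : gal j) (hI : (i 'i) ^+ 2 = -1) :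
  (t (i 'i) = i 'i -> res_cochain i xi t = 0) /\
  (t (i 'i) = - i 'i -> res_cochain i xi t = Q1 (i \o rQ) hI).
Proof.
split=> e; rewrite /res_cochain.
  have [|-> _] := @xi_fix (gal_res i t); last exact: raddf0.
  by apply: (fmorph_inj i); rewrite gal_resE.
have [|-> _] := @xi_move (gal_res i t); first by apply: (fmorph_inj i); rewrite gal_resE rmorphN.
exact: (smap_Q1 rQ (i \o rQ) i _ _).1.
Qed.

(** If -1 is a square in K the restriction of xi vanishes identically. Otherwise the point of
    [point_fit] over K(I) is moved by Q1 exactly by the automorphisms that negate I. *)
Theorem xi_locally_trivial (R : realType) : locally_trivial R (xi : cochain Eb rQ).
Proof.
move=> K v cv L j aj i; rewrite -/(res_cochain i xi); apply/coboundaryP.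
pose r : {rmorphism rat -> L} := i \o rQ; set I := i 'i.
have hI : I ^+ 2 = -1 by rewrite -rmorphXn sqrCi rmorphN rmorph1.
have [[k hk]|[s [w hw]]] := local_solution cv ob.
  exists 0 => t; rewrite raddf0 subrr; apply: (xi_res _ hI).1.
  by have [e|e] := galQ_i j hk hI; rewrite -/I -[I]opprK -?e ?rmorphN ?gal_fix ?e ?opprK.
have hw' : (j w) ^+ 2 = qval b%:R (j s) by rewrite -rmorphXn hw rmorph_qval rmorph_nat.
pose X := (- (- 3%:R * b%:R ^+ 2 + (j s) ^+ 2) + I * j w) / 2%:R.
pose Y := I * (16%:R * b%:R + j s * (X - (- 3%:R * b%:R ^+ 2))).
have hM := point_fit r hI hw' (erefl X) (erefl Y).
exists (mkpt r hM) => t.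
have t3 : t (- 3%:R * b%:R ^+ 2) = - 3%:R * b%:R ^+ 2.
  by rewrite (rmorphM t (- 3%:R)) (rmorphN t) (rmorphXn t) !(rmorph_nat t).
have tX : t X = (- (- 3%:R * b%:R ^+ 2 + (j s) ^+ 2) + t I * j w) / 2%:R.
  by rewrite /X (fmorph_div t) (rmorphD t) (rmorphN t) (rmorphD t) t3 (rmorphXn t) (rmorphM t I) !gal_fix (rmorph_nat t).
have tY : t Y = t I * (16%:R * b%:R + j s * (t X - (- 3%:R * b%:R ^+ 2))).
  by rewrite /Y (rmorphM t I) (rmorphD t) (rmorphM t (j s)) (rmorphB t) t3 (rmorphM t 16%:R) !(rmorph_nat t) gal_fix.
have [e|e] := galQ_i t hI hI; rewrite e in tX tY.
  rewrite (xi_res _ hI).1 //; apply/eqP; rewrite eq_sym subr_eq0; apply/eqP.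
  by apply: val_inj => /=; rewrite /raw_map /= tY tX.
rewrite (xi_res _ hI).2 //; apply/eqP; rewrite eq_sym subr_eq addrC; apply/eqP.
have eX : t X = (- (- 3%:R * b%:R ^+ 2 + (j s) ^+ 2) - I * j w) / 2%:R by rewrite tX [- I * _]mulNr.
have hM' : (t Y) ^+ 2 = fb (t X).
  by rewrite -rmorphXn hM rmorph_fb.
rewrite (point_fit_add r hI hM hM' hw' (erefl X) (erefl Y) eX tY).
exact: val_inj.
Qed.

Theorem xi_sha (R : realType) : sha R (xi : cochain Eb rQ).
Proof. by split; [exact: xi_cocycle | exact: xi_locally_trivial]. Qed.

End Family.

(** * Quadratic reciprocity *)

(** The quadratic symbol as a boolean, [true] for -1, so that products of symbols become [(+)]. *)
Definition nr (p : nat) (u : int) : bool := (u%:~R : 'F_p) ^+ p.-1./2 != 1.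

Section Legendre.
Variable p : nat.
Hypotheses (pp : prime p) (op : odd p).
Local Notation Fp := 'F_p.
Local Notation m := p.-1./2.

Lemma Fp_int_eq0 (n : int) : (n%:~R == 0 :> Fp) = (p %| n)%Z.
Proof. by rewrite (dvdz_pcharf (pchar_Fp pp)). Qed.

Lemma odd_prime_gt2 : (2 < p)%N.
Proof. by have := prime_gt1 pp; case: (p) op => [|[|[|]]]. Qed.

Lemma Fp_N1 : (1 : Fp) != -1.
Proof.
rewrite -subr_eq0 opprK (_ : 1 + 1 = 2%:R) // -(dvdn_pcharf (pchar_Fp pp)).
by apply/negP => /dvdn_leq-/(_ isT); rewrite leqNgt odd_prime_gt2.
Qed.

Lemma nr_pow u : ~~ (p %| u)%Z -> (u%:~R : Fp) ^+ m = (-1) ^+ nr p u.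
Proof.
move=> pu; rewrite /nr; have u0 : (u%:~R : Fp) != 0 by rewrite Fp_int_eq0.
by have [->|->] := Fp_pm1 pp op u0; rewrite ?eqxx //= eq_sym Fp_N1 expr1.
Qed.

Lemma dvdzM_prime (u w : int) : (p %| u * w)%Z = (p %| u)%Z || (p %| w)%Z.
Proof. by rewrite !dvdzE abszM !absz_nat Euclid_dvdM. Qed.

Lemma nrM u w : ~~ (p %| u)%Z -> ~~ (p %| w)%Z -> nr p (u * w) = nr p u (+) nr p w.
Proof.
move=> pu pw; have puw : ~~ (p %| u * w)%Z by rewrite dvdzM_prime negb_or pu.
have := nr_pow puw; rewrite rmorphM exprMn !nr_pow // -signr_addb.
have N1' : (-1 == 1 :> Fp) = false by rewrite eq_sym (negPf Fp_N1).
move/eqP; case: (nr p u); case: (nr p w); case: (nr p _) => //=;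
  by rewrite ?expr0 ?expr1 ?(negPf Fp_N1) ?N1'.
Qed.

Lemma nr1 : nr p 1 = false.
Proof. by rewrite /nr rmorph1 expr1n eqxx. Qed.

Lemma nrN1 : nr p (-1) = (p %% 4 == 3)%N.
Proof.
rewrite /nr rmorphN rmorph1 -signr_odd.
have -> : odd m = (p %% 4 == 3)%N.
  have e : (p = (m * 2).+1)%N by rewrite m2 // prednK ?prime_gt0.
  rewrite {2}e; have := odd_double_half m; move: m => k; case: (odd k) => /= <-; lia.
by case: (_ == 3)%N; rewrite ?expr1 ?expr0 ?eqxx // eq_sym Fp_N1.
Qed.

Lemma nr_nonresidue : exists n : Fp, n != 0 /\ n ^+ m = -1.
Proof.
have [z hz] := Fp_prim pp; have z0 : z != 0.
  apply/eqP => z0; have := prim_expr_order hz; rewrite z0 expr0n.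
  have -> : (p.-1 == 0)%N = false by have := odd_prime_gt2; lia.
  by move/eqP; rewrite eq_sym oner_eq0.
exists z; split=> //; have [e|//] := Fp_pm1 pp op z0.
have := odd_prime_gt2; have := m2 pp op; move/eqP: e; rewrite -(prim_order_dvd hz).
move/dvdn_leq; case: (m) => [|k]; first by lia.
by move/(_ isT); lia.
Qed.

Section GaussSum.
Variables (F : fieldType) (z : F).
Hypotheses (z1 : z != 1) (zp : z ^+ p = 1).

Definition jac (a : Fp) : F := if a == 0 then 0 else (-1) ^+ (a ^+ m != 1).

Lemma chiM a b : jac (a * b) = jac a * jac b.
Proof.
rewrite /jac mulf_eq0; have [->|a0] := eqVneq a 0; first by rewrite /= mul0r.
have [->|b0] := eqVneq b 0; first by rewrite /= mulr0.
rewrite -signr_addb exprMn /=; congr (_ ^+ nat_of_bool _).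
have [->|->] := Fp_pm1 pp op a0; have [->|->] := Fp_pm1 pp op b0;
  by rewrite ?mulrNN ?mulr1 ?mul1r ?eqxx ?(eq_sym (-1)) ?Fp_N1.
Qed.

Lemma chi_sqr a : a != 0 -> jac a ^+ 2 = 1.
Proof. by move=> /negPf a0; rewrite /jac a0 sqrr_sign. Qed.

Lemma chi0 : jac 0 = 0. Proof. by rewrite /jac eqxx. Qed.

Lemma zmod (n : nat) : z ^+ n = z ^+ (n %% p). Proof. by rewrite {1}(divn_eq n p) exprD mulnC exprM zp expr1n mul1r. Qed.

Definition zz (a : Fp) : F := z ^+ nat_of_ord a.

Lemma val_Fp_D (a b : Fp) : nat_of_ord (a + b) = ((nat_of_ord a + nat_of_ord b) %% p)%N.
Proof. by rewrite -[a in LHS]natr_Zp -[b in LHS]natr_Zp -natrD val_Fp_nat. Qed.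
Lemma val_Fp_M (a b : Fp) : nat_of_ord (a * b) = ((nat_of_ord a * nat_of_ord b) %% p)%N.
Proof. by rewrite -[a in LHS]natr_Zp -[b in LHS]natr_Zp -natrM val_Fp_nat. Qed.

Lemma zD (a b : Fp) : zz (a + b) = zz a * zz b.
Proof. by rewrite /zz val_Fp_D -zmod exprD. Qed.
Lemma zM (a b : Fp) : zz (a * b) = (zz b) ^+ nat_of_ord a.
Proof. by rewrite /zz val_Fp_M -zmod mulnC exprM. Qed.

Lemma sum_z (c : Fp) : c != 0 -> \sum_(a : Fp) zz (a * c) = 0.
Proof.
move=> c0; have zc : zz c != 1.
  apply: contra z1 => /eqP e; have : zz (c^-1 * c) = 1 by rewrite zM e expr1n.
  rewrite mulVf // /zz /= modn_small ?expr1 => [->//|].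
  by rewrite Fp_Zcast // prime_gt1.
have e1 : \sum_(a : Fp) zz (a * c) = zz c * \sum_(a : Fp) zz (a * c).
  rewrite mulr_sumr (reindex_inj (addIr 1)) /=; apply: eq_bigr => a _.
  by rewrite mulrDl mul1r zD mulrC.
apply/eqP; have : (1 - zz c) * \sum_(a : Fp) zz (a * c) = 0 by rewrite mulrBl mul1r -e1 subrr.
by move/eqP; rewrite mulf_eq0 subr_eq0 eq_sym (negPf zc).
Qed.

Hypothesis F2 : 2%:R != 0 :> F.

Lemma sum_chi : \sum_(a : Fp) jac a = 0.
Proof.
have [n [n0 hn]] := nr_nonresidue.
have cn : jac n = -1 by rewrite /jac (negPf n0) hn eq_sym Fp_N1 expr1.
have e1 : \sum_(a : Fp) jac a = - \sum_(a : Fp) jac a.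
  rewrite {1}(reindex_inj (mulfI n0)) /= -mulN1r -cn mulr_sumr.
  by apply: eq_bigr => a _; rewrite chiM.
apply: (mulfI F2); rewrite mulr0 mulr_natl mulr2n {1}e1 addNr.
by [].
Qed.

Definition gauss : F := \sum_(a : Fp) jac a * zz a.

(** Writing the second summation variable as a c separates the characters: the sum over a of z^(a (1
    + c)) is p when c = -1 and 0 otherwise. *)
Lemma gauss_sqr : gauss ^+ 2 = jac (-1) * p%:R.
Proof.
have e1 : gauss ^+ 2 = \sum_(c : Fp) jac c * \sum_(a : Fp | a != 0) zz (a * (1 + c)).
  rewrite expr2 {1}/gauss mulr_suml (bigD1 0) //= chi0 !mul0r add0r.
  under [RHS]eq_bigr => c _ do rewrite mulr_sumr.
  rewrite exchange_big /=; apply: eq_bigr => a a0.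
  rewrite /gauss mulr_sumr (reindex_inj (mulfI a0)) /=; apply: eq_bigr => c _.
  rewrite chiM mulrDr mulr1 zD mulrACA [jac a * (_ * _)]mulrA -expr2 chi_sqr // mul1r.
  by [].
have e2 (c : Fp) : \sum_(a : Fp | a != 0) zz (a * (1 + c)) = (if c == -1 then p%:R else 0) - 1.
  have : \sum_(a : Fp) zz (a * (1 + c)) = (if c == -1 then p%:R else 0).
    have [->|cn] := eqVneq c (-1).
      under eq_bigr => a _ do rewrite addrN mulr0.
      have -> : zz 0 = 1 by [].
      by rewrite sumr_const cardE -cardE card_Fp.
    by apply: sum_z; rewrite addrC -[1]opprK subr_eq0.
  rewrite (bigD1 0) //= mul0r => <-; have -> : zz 0 = 1 by [].
  by rewrite addrC addrK.
rewrite e1; under eq_bigr => c _ do rewrite e2 mulrBr mulr1.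
rewrite big_split /= sumrN sum_chi subr0 (bigD1 (-1)) //= eqxx big1 ?addr0 //.
by move=> c /negPf ->; rewrite mulr0.
Qed.

Variable q : nat.
Hypotheses (pq : prime q) (oq : odd q) (Fq : q \in [pchar F]) (npq : ~~ (p %| q)%N).

Lemma gauss_frob : gauss ^+ q = jac q%:R * gauss.
Proof.
have q0 : (q%:R : Fp) != 0 by rewrite -(dvdn_pcharf (pchar_Fp pp)).
rewrite -[LHS]/(pFrobenius_aut Fq gauss) /gauss rmorph_sum /= mulr_sumr.
rewrite [RHS](reindex_inj (mulfI q0)) /=; apply: eq_bigr => a _.
rewrite chiM mulrA mulrA -expr2 chi_sqr // mul1r.
rewrite pFrobenius_autE exprMn; congr (_ * _).
  rewrite /jac; case: ifP => _; first by rewrite expr0n; case: (q) pq.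
  by case: (_ != 1); rewrite ?expr0 ?expr1n // expr1 -signr_odd oq.
rewrite zM /zz val_Fp_nat // -!exprM [LHS]zmod [RHS]zmod modnMmr.
by [].
Qed.

End GaussSum.
End Legendre.

Section Reciprocity.
Variables p q : nat.
Hypotheses (pp : prime p) (op : odd p) (pq : prime q) (oq : odd q) (npq : p != q).

Lemma prime_ndvd (p' q' : nat) : prime p' -> prime q' -> p' != q' -> ~~ (p' %| q')%N.
Proof. by move=> h1 h2 h3; rewrite dvdn_prime2. Qed.

(** The Gauss sum of a p-th root of unity in characteristic q: its q-th power is computed by
    Frobenius, and from its square by Euler's criterion. *)
Theorem quad_reciprocity : nr p q (+) nr q p = (p %% 4 == 3)%N && (q %% 4 == 3)%N.
Proof.
pose P : {poly 'F_q} := \poly_(i < p) 1.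
have sP : size P = p by rewrite size_poly_eq // oner_neq0.
have p2 := odd_prime_gt2 pp op; have q2 := odd_prime_gt2 pq oq.
have [|F [j [z rz]]] := @exists_root_ext _ P; first by rewrite sP ltnW.
have Fq : q \in [pchar F] by rewrite (fmorph_pchar j) pchar_Fp.
have pqn : ~~ (p %| q)%N by exact: prime_ndvd.
have qpn : ~~ (q %| p)%N by apply: prime_ndvd => //; rewrite eq_sym.
have F2 : 2%:R != 0 :> F.
  by rewrite -(dvdn_pcharf Fq); apply/negP => /dvdn_leq-/(_ isT); rewrite leqNgt q2.
have p0 : p%:R != 0 :> F by rewrite -(dvdn_pcharf Fq).
have ez : \sum_(i < p) z ^+ i = 0.
  have -> : \sum_(i < p) z ^+ i = (map_poly j P).[z]; last exact/eqP.
  rewrite horner_coef size_map_poly sP; apply: eq_bigr => i _.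
  by rewrite coef_map coef_poly ltn_ord /= rmorph1 mul1r.
have zp : z ^+ p = 1.
  by apply/eqP; rewrite -subr_eq0 subrX1 ez mulr0.
have z1 : z != 1.
  apply: contra p0 => /eqP z1; move: ez; rewrite z1; under eq_bigr => i _ do rewrite expr1n.
  by rewrite sumr_const card_ord => ->.
have g2 := gauss_sqr pp op z1 zp F2; have gq := gauss_frob pp op zp pq oq Fq pqn.
set G := gauss p z in g2 gq.
have chE (u : int) : ~~ (p %| u)%Z -> jac F (u%:~R : 'F_p) = (-1) ^+ nr p u.
  by move=> pu; rewrite /jac Fp_int_eq0 // (negPf pu).
have c1 : jac F (-1 : 'F_p) = (-1) ^+ nr p (-1).
  have := chE (-1); rewrite rmorphN rmorph1; apply.
  by rewrite dvdzE absz_nat /= dvdn1; case: eqP p2 => // ->.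
have cq : jac F (q%:R : 'F_p) = (-1) ^+ nr p q by apply: (chE q); rewrite dvdzE !absz_nat.
have G0 : G != 0.
  apply/eqP => G0; move: g2; rewrite G0 expr0n /= c1 => /esym/eqP.
  by rewrite mulf_eq0 signr_eq0 (negPf p0).
have gq1 : G ^+ q.-1 = (-1) ^+ nr p q.
  by apply: (mulfI G0); rewrite -exprS prednK ?prime_gt0 // gq cq mulrC.
have : (G ^+ 2) ^+ q.-1./2 = (-1) ^+ nr p q by rewrite -exprM mulnC m2.
rewrite g2 c1 exprMn.
have e3 : (p%:R : F) ^+ q.-1./2 = (-1) ^+ nr q p.
  have h := @nr_pow q pq oq p; have := congr1 j (h _); rewrite rmorphXn rmorph_sign => <-.
    by rewrite -[(p : int)%:~R]/(p%:R) rmorph_nat.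
  by rewrite dvdzE !absz_nat.
have e4 : ((-1 : F) ^+ nr p (-1)) ^+ q.-1./2 = (-1) ^+ (nr p (-1) && nr q (-1)).
  case: (nr p (-1)); last by rewrite expr0 expr1n.
  rewrite expr1 /=; have h := @nr_pow q pq oq (-1); have := congr1 j (h _); rewrite rmorphXn rmorph_sign => <-.
    by rewrite !rmorphN !rmorph1.
  by rewrite dvdzE absz_nat /= dvdn1; case: eqP q2 => // ->.
rewrite e3 e4 -signr_addb nrN1 // nrN1 // => /eqP.
have n1 : (1 == -1 :> F) = false by apply/negbTE; rewrite -subr_eq0 opprK (_ : 1 + 1 = 2%:R).
have n2 : (-1 == 1 :> F) = false by rewrite eq_sym.
by case: (nr p q); case: (nr q p); case: (_ && _); rewrite /= ?expr0 ?expr1 ?n1 ?n2.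
Qed.

(** For z with z^4 = -1 the element t = z + z^-1 has square 2, and Frobenius sends it to t or -t
    according to q modulo 8. *)
Theorem two_residue : nr q 2 = ((q %% 8 == 3) || (q %% 8 == 5))%N.
Proof.
have q2 := odd_prime_gt2 pq oq.
pose P : {poly 'F_q} := 'X^4 + 1%:P.
have [|F [j [z]]] := @exists_root_ext _ P; first by rewrite size_XnaddC.
rewrite /root rmorphD /= map_polyXn map_polyC /= rmorph1 hornerD hornerXn hornerC addr_eq0 => /eqP z4.
have Fq : q \in [pchar F] by rewrite (fmorph_pchar j) pchar_Fp.
have F2 : 2%:R != 0 :> F.
  by rewrite -(dvdn_pcharf Fq); apply/negP => /dvdn_leq-/(_ isT); rewrite leqNgt q2.
have z0 : z != 0 by apply/eqP => z0; move/eqP: z4; rewrite z0 expr0n /= eq_sym oppr_eq0 oner_eq0.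
pose y := z^-1; have zy : z * y = 1 by rewrite divff.
have yE : y = - z ^+ 3 by apply: (mulfI z0); rewrite zy mulrN -exprS z4 opprK.
pose t := z + y; have t2 : t ^+ 2 = 2%:R by rewrite /t yE; ring: z4.
have t0 : t != 0 by apply: contra F2 => /eqP t0; rewrite -t2 t0 expr0n.
have z8 : z ^+ 8 = 1 by rewrite (exprM z 4 2) z4 sqrrN expr1n.
have tq : t ^+ q = (-1) ^+ ((q %% 8 == 3) || (q %% 8 == 5))%N * t.
  rewrite -[LHS]/(pFrobenius_aut Fq t) rmorphD /= !pFrobenius_autE.
  have zq : z ^+ q = z ^+ (q %% 8) by rewrite {1}(divn_eq q 8) exprD mulnC exprM z8 expr1n mul1r.
  have yq : y ^+ q = (z ^+ (q %% 8))^-1 by rewrite /y exprVn zq.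
  have oq8 : odd (q %% 8) by move: oq; rewrite {1}(divn_eq q 8) oddD oddM andbF.
  rewrite zq yq; have : (q %% 8 < 8)%N by rewrite ltn_mod.
  have zV n w : z ^+ n * w = 1 -> (z ^+ n)^-1 = w.
    by move=> e; rewrite -[LHS]mulr1 -e mulKf // expf_neq0.
  move: (q %% 8)%N oq8 => [|[|[|[|[|[|[|[|]]]]]]]] //= _ _; rewrite ?expr0 ?mul1r ?expr1 //.
  - rewrite (zV 3%N (- z)); last by rewrite mulrN -exprSr z4 opprK.
    by rewrite /t yE; ring.
  - rewrite (zV 5%N (- y)); last by rewrite mulrN -[5%N]/(4 + 1)%N exprD z4 expr1 mulN1r mulNr opprK.
    by rewrite /t -[5%N]/(4 + 1)%N exprD z4 expr1; ring.
  - rewrite (zV 7%N z); last by rewrite -exprSr z8.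
    by rewrite /t yE -[7%N]/(4 + 3)%N exprD z4; ring.
have : (t ^+ 2) ^+ q.-1./2 = (-1) ^+ ((q %% 8 == 3) || (q %% 8 == 5))%N.
  rewrite -exprM mulnC m2 //; apply: (mulfI t0).
  by rewrite -exprS prednK ?prime_gt0 // tq mulrC.
rewrite t2; have h := @nr_pow q pq oq 2; have := congr1 j (h _); rewrite rmorphXn rmorph_sign.
rewrite -[(2 : int)%:~R]/(2%:R) rmorph_nat => -> //; last first.
  by rewrite dvdzE !absz_nat; apply/negP => /dvdn_leq-/(_ isT); rewrite leqNgt q2.
move/eqP.
have n1 : (1 == -1 :> F) = false by apply/negbTE; rewrite -subr_eq0 opprK (_ : 1 + 1 = 2%:R).
have n2 : (-1 == 1 :> F) = false by rewrite eq_sym.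
by case: (nr q 2); case: (_ || _); rewrite /= ?expr0 ?expr1 ?n1 ?n2.
Qed.

End Reciprocity.

(** * Hilbert symbols *)

Definition al (p : nat) (A : int) : nat := logn p `|A|%N.
Definition up (p : nat) (A : int) : int := (A %/ (p ^ al p A)%N)%Z.
(** For odd u these are the parities of (u - 1) / 2 and (u^2 - 1) / 8. *)
Definition eps (u : int) : bool := (u %% 4)%Z == 3.
Definition om (u : int) : bool := ((u %% 8)%Z == 3) || ((u %% 8)%Z == 5).

(** The explicit formula for the Hilbert symbol (A, B)_p, with [true] for -1; [sol_symbol] shows
    that it decides solvability of the conic. *)
Definition hs (p : nat) (A B : int) : bool :=
  if p == 2%N then (eps (up p A) && eps (up p B)) (+) ((odd (al p A) && om (up p B)) (+) (odd (al p B) && om (up p A)))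
  else ((odd (al p A) && odd (al p B)) && nr p (-1)) (+) ((odd (al p B) && nr p (up p A)) (+) (odd (al p A) && nr p (up p B))).

Lemma hsC p A B : hs p A B = hs p B A.
Proof.
rewrite /hs; case: (p == 2%N); first by rewrite [eps _ && _]andbC [X in _ (+) X]addbC.
by rewrite [odd _ && odd _]andbC [X in _ (+) X]addbC.
Qed.

Section Valuation.
Variables (p : nat) (pp : prime p).

Lemma pk_neq0 k : ((p ^ k)%N : int) != 0.
Proof. by rewrite eqz_nat -lt0n expn_gt0 prime_gt0. Qed.

Lemma up_eq A : A = up p A * (p ^ al p A)%N.
Proof. by rewrite /up divzK // dvdzE absz_nat pfactor_dvdnn. Qed.

Lemma up_ndvd A : A != 0 -> ~~ (p %| up p A)%Z.
Proof.
move=> A0; apply/negP => /dvdzP[k e].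
have : ((p ^ (al p A).+1)%N %| A)%Z.
  by apply/dvdzP; exists k; rewrite {1}(up_eq A) e expnS PoszM; ring.
by rewrite dvdzE absz_nat pfactor_dvdn ?absz_gt0 // ltnn.
Qed.

Lemma alM A B : A != 0 -> B != 0 -> al p (A * B) = (al p A + al p B)%N.
Proof. by move=> A0 B0; rewrite /al abszM lognM ?absz_gt0. Qed.

Lemma upM A B : A != 0 -> B != 0 -> up p (A * B) = up p A * up p B.
Proof.
move=> A0 B0; apply: (mulIf (pk_neq0 (al p A + al p B))); rewrite -alM // -up_eq alM //.
by rewrite {1}(up_eq A) {1}(up_eq B) expnD PoszM; ring.
Qed.

Lemma al_unit A : ~~ (p %| A)%Z -> al p A = 0%N.
Proof. by rewrite dvdzE absz_nat => h; rewrite /al lognE (negPf h) !andbF. Qed.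
End Valuation.

Lemma up_unit p A : prime p -> ~~ (p %| A)%Z -> up p A = A.
Proof. by move=> pp h; rewrite {2}(up_eq p A) al_unit // expn0 mulr1. Qed.

Lemma mod8_odd (u : int) : ~~ (2 %| u)%Z ->
  [\/ (u %% 8)%Z = 1, (u %% 8)%Z = 3, (u %% 8)%Z = 5 | (u %% 8)%Z = 7].
Proof.
move=> h; have h1 : 0 <= (u %% 8)%Z by exact: modz_ge0.
have h2 : (u %% 8)%Z < 8 by exact: ltz_pmod.
have h3 : ~~ (2 %| (u %% 8)%Z)%Z.
  by apply: contra h => h; rewrite (divz_eq u 8) rpredD // dvdz_mull.
case: (u %% 8)%Z h1 h2 h3 => [[|[|[|[|[|[|[|[|k]]]]]]]]|k] //= _ _ _;
  by [constructor 1|constructor 2|constructor 3|constructor 4].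
Qed.

Lemma eps8 u : eps u = ((u %% 8)%Z %% 4 == 3)%Z.
Proof.
rewrite /eps {1}(divz_eq u 8) (_ : (u %/ 8)%Z * 8 = ((u %/ 8)%Z * 2) * 4) ?modzMDl //.
by rewrite -mulrA. Qed.

Lemma epsM u w : ~~ (2 %| u)%Z -> ~~ (2 %| w)%Z -> eps (u * w) = eps u (+) eps w.
Proof.
move=> hu hw; rewrite !eps8 -modzMml -modzMmr.
by have [->|->|->|->] := mod8_odd hu; have [->|->|->|->] := mod8_odd hw.
Qed.

Lemma omM u w : ~~ (2 %| u)%Z -> ~~ (2 %| w)%Z -> om (u * w) = om u (+) om w.
Proof.
move=> hu hw; rewrite /om -modzMml -modzMmr.
by have [->|->|->|->] := mod8_odd hu; have [->|->|->|->] := mod8_odd hw.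
Qed.

Lemma hsM p A A' B : prime p -> A != 0 -> A' != 0 -> B != 0 -> hs p (A * A') B = hs p A B (+) hs p A' B.
Proof.
move=> pp A0 A'0 B0; rewrite /hs alM // upM // oddD; case: eqP => [p2|/eqP pn2].
  have h1 := up_ndvd pp A0; have h2 := up_ndvd pp A'0; subst p.
  rewrite epsM // omM //.
  by case: (eps (up 2 A)); case: (eps (up 2 A')); case: (eps _); case: (odd _); case: (odd _); case: (om _); case: (om _); case: (om _); case: (odd _).
have op : odd p by have [e|//] := even_prime pp; rewrite e in pn2.
rewrite (nrM pp op) ?up_ndvd //.
by case: (odd _); case: (odd _); case: (odd _); case: (nr _ _); case: (nr _ _); case: (nr _ _); case: (nr _ _).
Qed.

Definition tot (N : nat) (A B : int) : bool :=
  \big[addb/false]_(p < N | prime p) hs p A B (+) ((A < 0) && (B < 0)).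

Lemma totC N A B : tot N A B = tot N B A.
Proof. by rewrite /tot andbC; congr (_ (+) _); apply: eq_bigr => p _; exact: hsC. Qed.

Lemma totM N A A' B : A != 0 -> A' != 0 -> B != 0 -> tot N (A * A') B = tot N A B (+) tot N A' B.
Proof.
move=> A0 A'0 B0; rewrite /tot (eq_bigr (fun p : 'I_N => hs p A B (+) hs p A' B)); last first.
  by move=> p pp; exact: hsM.
rewrite big_split /= [X in _ = X]addbACA; congr (_ (+) _); rewrite -andb_addl; congr (_ && _).
have [A1|A1|A1] := ltgtP A 0; have [A2|A2|A2] := ltgtP A' 0 => //; try by move: A0 A'0; rewrite ?A1 ?A2.
- by rewrite ltNge ltW // nmulr_rgt0.
- by rewrite nmulr_rlt0.
- by rewrite pmulr_rlt0.
- by rewrite ltNge ltW // pmulr_rgt0.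
Qed.

Lemma big_delta N (q : nat) (x : bool) : (q < N)%N -> prime q ->
  \big[addb/false]_(p < N | prime p) ((p == q :> nat) && x) = x.
Proof.
move=> qN pq; rewrite (bigD1 (Ordinal qN)) //= eqxx big1 ?addbF // => i /andP[_ ne].
by rewrite -[_ == q]/(i == Ordinal qN) (negPf ne).
Qed.

Lemma al_prime (p q : nat) : prime p -> prime q -> al p q = (p == q).
Proof. by move=> pp pq; rewrite /al absz_nat logn_prime // eq_sym. Qed.
Lemma up_prime (p q : nat) : prime p -> prime q -> up p q = if p == q then 1 else q.
Proof.
move=> pp pq; case: eqP => [->|/eqP ne].
  by rewrite /up al_prime // eqxx expn1 divzz eqz_nat -lt0n prime_gt0.
by apply: up_unit => //; rewrite dvdzE !absz_nat; exact: prime_ndvd.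
Qed.
Lemma al_N1 p : al p (-1) = 0%N. Proof. by rewrite /al abszN1 logn1. Qed.
Lemma up_N1 p : up p (-1) = -1. Proof. by rewrite /up al_N1 expn0 divz1. Qed.

Lemma eps_nat (q : nat) : eps q = (q %% 4 == 3)%N.
Proof. by rewrite /eps modz_nat. Qed.
Lemma om_nat (q : nat) : om q = ((q %% 8 == 3) || (q %% 8 == 5))%N.
Proof. by rewrite /om modz_nat. Qed.

Lemma odd_of_prime q : prime q -> q != 2%N -> odd q.
Proof. by move=> pq; have [->|] := even_prime pq. Qed.

(** By bilinearity the product formula is needed only for -1 and primes. There the nontrivial local
    terms sit at 2, at the primes themselves and at infinity, and their sum is reciprocity or one of
    its supplements. *)
Lemma tot_gen N : (2 < N)%N -> forall x y : int,
  (x = -1 \/ exists2 q : nat, prime q /\ (q < N)%N & x = q) ->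
  (y = -1 \/ exists2 q : nat, prime q /\ (q < N)%N & y = q) -> tot N x y = false.
Proof.
move=> N2; have d2 x : \big[addb/false]_(p < N | prime p) ((p == 2 :> nat) && x) = x by exact: big_delta.
have N1q (q : nat) : prime q -> (q < N)%N -> tot N (-1) q = false.
  move=> pq qN; rewrite /tot andbF addbF.
  have [q2|q2] := eqVneq q 2%N.
    rewrite big1 // => p pp; rewrite /hs al_N1 up_N1 up_prime // al_prime // q2 /=.
    by case: (nat_of_ord p == 2%N).
  have oq := odd_of_prime pq q2.
  rewrite (eq_bigr (fun p : 'I_N => ((p == 2 :> nat) && (q %% 4 == 3)%N) (+) ((p == q :> nat) && (q %% 4 == 3)%N))).
    by rewrite big_split /= d2 big_delta // addbb.
  move=> p pp; rewrite /hs al_N1 up_N1 up_prime // al_prime //=.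
  case: eqP => [p2|/eqP pn2].
    by rewrite p2 eq_sym (negPf q2) /= -eps_nat addbF.
  case: eqP => [->|] /=; last by rewrite ?addbF.
  by rewrite nrN1 // ?addbF.
have qq (q q' : nat) : prime q -> (q < N)%N -> prime q' -> (q' < N)%N -> tot N q q' = false.
  move=> pq qN pq' qN'; rewrite /tot -[X in _ && X]/false andbF addbF.
  have [q2|q2] := eqVneq q 2%N; have [q2'|q2'] := eqVneq q' 2%N.
  - rewrite big1 // => p pp; rewrite /hs !up_prime // !al_prime // q2 q2'.
    by case: (nat_of_ord p == 2%N).
  - have oq := odd_of_prime pq' q2'.
    rewrite (eq_bigr (fun p : 'I_N => ((p == 2 :> nat) && om q') (+) ((p == q' :> nat) && om q'))).
      by rewrite big_split /= d2 big_delta // addbb.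
    move=> p pp; rewrite /hs !up_prime // !al_prime // q2.
    case: eqP => [->|/eqP pn2]; first by rewrite eq_sym (negPf q2') /= !addbF.
    by case: eqP => [->|] //=; rewrite two_residue // -om_nat addbF.
  - have oq := odd_of_prime pq q2.
    rewrite (eq_bigr (fun p : 'I_N => ((p == 2 :> nat) && om q) (+) ((p == q :> nat) && om q))).
      by rewrite big_split /= d2 big_delta // addbb.
    move=> p pp; rewrite hsC /hs !up_prime // !al_prime // q2'.
    case: eqP => [->|/eqP pn2]; first by rewrite eq_sym (negPf q2) /= !addbF.
    by case: eqP => [->|] //=; rewrite two_residue // -om_nat addbF.
  have oq := odd_of_prime pq q2; have oq' := odd_of_prime pq' q2'.
  have [e|ne] := eqVneq q q'.
    subst q'.
    rewrite (eq_bigr (fun p : 'I_N => ((p == 2 :> nat) && (q %% 4 == 3)%N) (+) ((p == q :> nat) && (q %% 4 == 3)%N))).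
      by rewrite big_split /= d2 big_delta // addbb.
    move=> p pp; rewrite /hs !up_prime // !al_prime //.
    case: eqP => [->|/eqP pn2]; first by rewrite eq_sym (negPf q2) /= -eps_nat andbb !addbF.
    by case: eqP => [->|] //=; rewrite nr1 nrN1 // !addbF.
  rewrite (eq_bigr (fun p : 'I_N => ((p == 2 :> nat) && ((q %% 4 == 3) && (q' %% 4 == 3))%N) (+)
     (((p == q :> nat) && nr q q') (+) ((p == q' :> nat) && nr q' q)))).
    by rewrite !big_split /= d2 !big_delta // quad_reciprocity // addbb.
  move=> p pp; rewrite /hs !up_prime // !al_prime //.
  case: eqP => [->|/eqP pn2].
    by rewrite (eq_sym 2%N q) (negPf q2) (eq_sym 2%N q') (negPf q2') /= -!eps_nat !addbF.
  case: eqP => [->|/eqP pnq] /=; first by rewrite (negPf ne) /= addbF.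
  by case: eqP => [->|] //=; rewrite addbF.
move=> x y [->|[q [pq qN] ->]] [->|[q' [pq' qN'] ->]] //.
- rewrite /tot (eq_bigr (fun p : 'I_N => (p == 2 :> nat) && true)); first by rewrite d2.
  by move=> p pp; rewrite /hs al_N1 up_N1 /= andbT; case: eqP.
- exact: N1q.
- by rewrite totC; exact: N1q.
- exact: qq.
Qed.

Lemma int_prime_ind (N : nat) (P : int -> Prop) : P 1 -> P (-1) ->
  (forall q : nat, prime q -> (q < N)%N -> P q) ->
  (forall A B, A != 0 -> B != 0 -> P A -> P B -> P (A * B)) ->
  forall A, A != 0 -> (`|A| < N)%N -> P A.
Proof.
move=> P1 PN1 Pq PM; have Pn (n : nat) : (0 < n)%N -> (n < N)%N -> P n.
  have [m] := ubnP n; elim: m n => // m IH n nm n0 nN.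
  have [n1|n1] := leqP n 1; first by rewrite [n](_ : _ = 1%N) //; apply/eqP; rewrite eqn_leq n1.
  have pd := pdiv_prime n1.
  have e : (n = n %/ pdiv n * pdiv n)%N by rewrite divnK // pdiv_dvd.
  have lt : (n %/ pdiv n < n)%N by rewrite ltn_Pdiv // prime_gt1.
  have d0 : (0 < n %/ pdiv n)%N by rewrite divn_gt0 ?pdiv_gt0 // pdiv_leq.
  rewrite e PoszM; apply: PM; rewrite ?eqz_nat -?lt0n ?pdiv_gt0 //.
    by apply: IH => //; [exact: leq_trans lt _ | exact: ltn_trans nN].
  by apply: Pq => //; apply: leq_ltn_trans nN; exact: pdiv_leq.
move=> [n|n] A0 AN; first by apply: Pn => //; rewrite lt0n -eqz_nat.
by rewrite NegzE -mulN1r; apply: PM => //; exact: Pn.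
Qed.

Theorem product_formula N A B : (2 < N)%N -> A != 0 -> B != 0 -> (`|A| < N)%N -> (`|B| < N)%N ->
  tot N A B = false.
Proof.
move=> N2 A0 B0 AN BN.
have t1 x : x != 0 -> tot N 1 x = false.
  by move=> x0; have := @totM N 1 1 x isT isT x0; rewrite mulr1 addbb.
have g1 (y : int) : (y = -1 \/ exists2 q : nat, prime q /\ (q < N)%N & y = q) -> tot N A y = false.
  move=> hy; have y0 : y != 0 by case: hy => [->//|[q [pq _] ->]]; rewrite eqz_nat -lt0n prime_gt0.
  apply: (@int_prime_ind N (fun A => tot N A y = false)) => //.
  - exact: t1.
  - by apply: tot_gen => //; left.
  - by move=> q pq qN; apply: tot_gen => //; right; exists q.
  - by move=> x x' x0 x0' hx hx'; rewrite totM // hx hx'.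
apply: (@int_prime_ind N (fun B => tot N A B = false)) => //.
- by rewrite totC t1.
- by apply: g1; left.
- by move=> q pq qN; apply: g1; right; exists q.
- by move=> x x' x0 x0' hx hx'; rewrite totC totM // totC hx totC hx'.
Qed.

Theorem symbol_parity A B A' B' : A != 0 -> B != 0 -> A' != 0 -> B' != 0 ->
  (forall p, prime p -> odd p -> hs p A B = hs p A' B') ->
  ((A < 0) && (B < 0)) = ((A' < 0) && (B' < 0)) -> hs 2 A B = hs 2 A' B'.
Proof.
move=> A0 B0 A'0 B'0 hodd hinf.
pose N := (`|A| + `|B| + `|A'| + `|B'| + 3)%N.
have N2 : (2 < N)%N by rewrite /N addn3.
have f1 : tot N A B = false by apply: product_formula => //; rewrite /N; lia.
have f2 : tot N A' B' = false by apply: product_formula => //; rewrite /N; lia.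
move: (etrans f1 (esym f2)); rewrite /tot hinf => /(can_inj (addbK _)).
have two : prime (Ordinal N2 : nat) by [].
rewrite (bigD1 (Ordinal N2)) //= [RHS](bigD1 (Ordinal N2)) //=.
rewrite (eq_bigr (fun p : 'I_N => hs p A' B')) => [/(can_inj (addbK _))//|p /andP[pp pn2]].
by apply: hodd => //; apply: odd_of_prime.
Qed.

(** * The conics z^2 = A x^2 + B y^2 over complete fields *)

Section Sol.
Variable K : fieldType.
Implicit Types A B : K.

Definition sol A B := exists x y z : K, (x, y, z) != (0, 0, 0) /\ z ^+ 2 = A * x ^+ 2 + B * y ^+ 2.

Lemma tri_neq0 x y z : ((x, y, z) != (0, 0, 0) :> K * K * K) = [|| x != 0, y != 0 | z != 0].
Proof. by rewrite !xpair_eqE !negb_and -orbA. Qed.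

Lemma solC A B : sol A B -> sol B A.
Proof.
move=> [x [y [z [h e]]]]; exists y, x, z; split; last by rewrite e addrC.
by move: h; rewrite !tri_neq0 orbCA.
Qed.

Lemma sol_sqr A B d : d != 0 -> sol (A * d ^+ 2) B <-> sol A B.
Proof.
move=> d0; split=> [[x [y [z [h e]]]]|[x [y [z [h e]]]]].
  exists (d * x), y, z; split; last by rewrite e; ring.
  by move: h; rewrite !tri_neq0 mulf_eq0 (negPf d0).
exists (x / d), y, z; split; last by rewrite e; field.
by move: h; rewrite !tri_neq0 mulf_eq0 invr_eq0 (negPf d0) orbF.
Qed.

Lemma sol_negmul A B : A != 0 -> B != 0 -> sol A B <-> sol A (- (A * B)).
Proof.
move=> A0 B0; split=> [[x [y [z [h e]]]]|[x [y [z [h e]]]]].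
  exists z, y, (A * x); split; last by rewrite exprMn e; ring.
  by move: h; rewrite !tri_neq0 mulf_eq0 (negPf A0) /=; case: (x == 0); case: (y == 0); case: (z == 0).
exists (z / A), y, x; split.
  by move: h; rewrite !tri_neq0 mulf_eq0 invr_eq0 (negPf A0) orbF; case: (x == 0); case: (y == 0); case: (z == 0).
apply: (mulfI A0); rewrite expr_div_n.
transitivity (z ^+ 2 + A * B * y ^+ 2); first by rewrite e; ring.
by field.
Qed.
End Sol.

Lemma sol2_sqr (K : fieldType) (A B c d : K) : c != 0 -> d != 0 -> sol (A * c ^+ 2) (B * d ^+ 2) <-> sol A B.
Proof.
move=> c0 d0; split.
  by move=> /(sol_sqr _ _ c0)/solC/(sol_sqr _ _ d0)/solC.
by move=> /solC/(sol_sqr _ _ d0)/solC/(sol_sqr _ _ c0).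
Qed.

Section Local.
Variables (R : realType) (K : fieldType) (v : K -> R) (p : nat).
Hypotheses (cv : is_completion v) (ua : ultra_abs v) (pp : prime p) (vp : v p%:R < 1).
Let v0 := ua_ge0 ua.
Let vp0 : 0 < v p%:R. Proof. by rewrite (ua_gt0 ua) (natK_eq0 cv) -lt0n prime_gt0. Qed.

Lemma v_int (n : int) : v n%:~R = v `|n|%N%:R.
Proof. by case: n => m //; rewrite NegzE rmorphN (uaN ua). Qed.

Lemma v_lt1_dvd (n : int) : (v n%:~R < 1) = (p %| n)%Z.
Proof.
apply/idP/idP => [|h].
  by apply: contraTT => h; rewrite (v_int_unit ua pp vp h) ltxx.
apply: le_lt_trans vp; rewrite -[v p%:R]expr1.
by apply: (v_int_dvd ua); rewrite expn1.
Qed.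

Lemma v_prime_odd s : v p%:R != v s ^+ 2.
Proof.
apply/eqP => e; have s0 : s != 0 by apply: contraTneq vp0 => s0; rewrite e s0 (ua0 ua) expr0n ltxx.
have [q [q0 eq]] := v_rat_near cv ua s0; have [a [b /(_ q0)]] := v_ratE cv ua pp vp q; rewrite -eq => h.
have : v p%:R ^+ (1 + b * 2) = v p%:R ^+ (a * 2).
  by rewrite exprD expr1 {1}e !exprM -h exprMn.
have vpn : v p%:R != 1 by rewrite lt_eqF.
by move/(ieexprIn vp0 vpn); lia.
Qed.

Lemma max_scale (x y z : K) : (x, y, z) != (0, 0, 0) -> exists t, t != 0 /\
  [/\ v (x / t) <= 1, v (y / t) <= 1, v (z / t) <= 1 & [\/ x / t = 1, y / t = 1 | z / t = 1]].
Proof.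
move=> h; have [t [t0 tm ht]] : exists t, [/\ t != 0, [\/ t = x, t = y | t = z] & [/\ v x <= v t, v y <= v t & v z <= v t]].
  have nz (t : K) : v x <= v t -> v y <= v t -> v z <= v t -> t != 0.
    move=> h1 h2 h3; apply: contra h => /eqP t0; move: h1 h2 h3; rewrite t0 (ua0 ua) => h1 h2 h3.
    have zz s : v s <= 0 -> s == 0 by move=> hs; apply/eqP/(ua_eq0 ua)/eqP; rewrite eq_le hs v0.
    by rewrite !xpair_eqE !zz.
  have [xy|/ltW xy] := leP (v x) (v y).
    have [yz|/ltW yz] := leP (v y) (v z).
      by exists z; split; [apply: nz => //; exact: le_trans yz|constructor 3|split => //; exact: le_trans yz].
    by exists y; split; [apply: nz|constructor 2|].
  have [xz|/ltW xz] := leP (v x) (v z).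
    by exists z; split; [apply: nz => //; exact: le_trans xz|constructor 3|split => //; exact: le_trans xz].
  by exists x; split; [apply: nz|constructor 1|].
have vt : 0 < v t by rewrite (ua_gt0 ua).
have le1 s : v s <= v t -> v (s / t) <= 1 by move=> hs; rewrite (ua_div ua) ler_pdivrMr // mul1r.
exists t; split=> //; case: ht => h1 h2 h3; split; rewrite ?le1 //.
by case: tm => <-; [constructor 1|constructor 2|constructor 3]; rewrite divff.
Qed.

Section Odd.
Hypothesis op : odd p.
Let v2 : v 2%:R = 1.
Proof.
apply: (v_coprime ua pp vp); apply/negP => /dvdn_leq-/(_ isT).
by rewrite leqNgt odd_prime_gt2.
Qed.

Lemma unit_sqrt (u : int) : ~~ (p %| u)%Z -> nr p u = false -> exists2 s : K, s ^+ 2 = u%:~R & s != 0.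
Proof.
move=> pu h; have e := nr_pow pp op pu; rewrite h expr0 in e.
have [y ey] := Fp_euler pp op e; pose c : nat := nat_of_ord y.
have yE : y = (c : int)%:~R by rewrite -{1}[y]natr_Zp.
have dv : (p %| u - (c : int) ^+ 2)%Z.
  by rewrite -Fp_int_eq0 // rmorphB rmorphXn /= -yE ey subrr.
have vu : v u%:~R = 1 by exact: (v_int_unit ua pp vp).
have hv : v (u%:~R - c%:R ^+ 2) < 1.
  by move: dv; rewrite -v_lt1_dvd rmorphB rmorphXn.
have vc : v c%:R = 1.
  have : v (c%:R ^+ 2) = 1 by rewrite -vu; apply: (ua_eq ua); rewrite vu (uaBC ua).
  by rewrite (uaX ua) => /eqP; rewrite sqrf_eq1 => /orP[/eqP//|/eqP h1]; have := v0 c%:R; rewrite h1 ler0N1.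
have [s s2 _] := sqrt_odd cv ua v2 vc hv; exists s => //.
by apply/eqP => s0; move: vu; rewrite -s2 s0 expr0n /= (ua0 ua) => /eqP; rewrite eq_sym oner_eq0.
Qed.

(** If a x^2 + b y^2 = 1 had no solution modulo p, then (1 - a x^2) / b would never be a square, and
    (1 - a X^2)^m + b^m, of degree p - 1, would vanish on all of F_p. *)
Lemma sol_units (u w : int) : ~~ (p %| u)%Z -> ~~ (p %| w)%Z -> sol (u%:~R : K) w%:~R.
Proof.
move=> pu pw; have m2p := m2 pp op; set m := p.-1./2 in m2p.
pose a : 'F_p := u%:~R; pose b : 'F_p := w%:~R.
have a0 : a != 0 by rewrite Fp_int_eq0.
have b0 : b != 0 by rewrite Fp_int_eq0.
have [x [y hxy]] : exists x y : 'F_p, a * x ^+ 2 + b * y ^+ 2 = 1.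
  apply: contrapT => H; pose P : {poly 'F_p} := (1 - a *: 'X^2) ^+ m + (b ^+ m)%:P.
  have m0 : (0 < m)%N by have := odd_prime_gt2 pp op; lia.
  have s1 : size (1 - a *: 'X^2 : {poly 'F_p}) = 3%N.
    by rewrite addrC size_polyDl size_polyN size_scale // size_polyXn // size_poly1.
  have s2 : size ((1 - a *: 'X^2 : {poly 'F_p}) ^+ m) = p.
    have := size_exp (1 - a *: 'X^2 : {poly 'F_p}) m; rewrite s1 /= mulnC m2p => e.
    have q0 : (0 < size ((1 - a *: 'X^2 : {poly 'F_p}) ^+ m))%N.
      by rewrite size_poly_gt0 expf_neq0 // -size_poly_gt0 s1.
    by rewrite -(prednK q0) e prednK // prime_gt0.
  have sP : size P = p.
    rewrite size_polyDl s2 // size_polyC; case: (_ != 0); have := prime_gt1 pp; lia.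
  have : P = 0.
    apply: (Fp_poly_vanish pp) => [|x]; first by rewrite sP.
    rewrite /P hornerD horner_exp hornerC hornerD hornerN hornerZ hornerXn -[1]/(1%:P) hornerC.
    set t := 1 - a * x ^+ 2.
    have tb0 : t / b != 0.
      apply/eqP => e; apply: H; exists x, 0; rewrite expr0n /= mulr0 addr0.
      by apply/eqP; rewrite eq_sym -subr_eq0 -/t; move/eqP: e; rewrite mulf_eq0 invr_eq0 (negPf b0) orbF.
    have [e|e] := Fp_pm1 pp op tb0.
      have [y ey] := Fp_euler pp op e; case: H; exists x, y; rewrite -ey [b * (t / b)]mulrC divfK // /t addrC subrK.
      by [].
    have -> : t ^+ m = (t / b) ^+ m * b ^+ m by rewrite -exprMn divfK.
    by rewrite -/m e mulN1r addNr.
  by move/eqP; rewrite -size_poly_eq0 sP; case: (p) pp.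
pose X : nat := nat_of_ord x; pose Y : nat := nat_of_ord y.
have xE : x = (X : int)%:~R by rewrite -{1}[x]natr_Zp.
have yE : y = (Y : int)%:~R by rewrite -{1}[y]natr_Zp.
have dv : (p %| u * (X : int) ^+ 2 + w * (Y : int) ^+ 2 - 1)%Z.
  by rewrite -Fp_int_eq0 // rmorphB rmorphD !(rmorphXn, rmorphM) rmorph1 /= -xE -yE -/a -/b hxy subrr.
have hv : v (u%:~R * X%:R ^+ 2 + w%:~R * Y%:R ^+ 2 - 1 ^+ 2) < 1.
  by move: dv; rewrite -v_lt1_dvd rmorphB rmorphD !(rmorphXn, rmorphM) rmorph1 expr1n.
have [s es _] := sqrt_odd cv ua v2 (ua1 ua) hv.
exists X%:R, Y%:R, s; split=> //; rewrite tri_neq0.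
apply/negPn/negP; rewrite !negb_or !negbK => /and3P[/eqP X0 /eqP Y0 _]; move: hv.
by rewrite X0 Y0 !expr0n /= !mulr0 addr0 sub0r (uaN ua) expr1n (ua1 ua) ltxx.
Qed.

(** For a nonresidue w, z^2 - w y^2 is the norm form of the unramified quadratic extension, so its
    valuation is even: cancellation would make w a square modulo p. *)
Lemma norm_form (w : int) (y z : K) : ~~ (p %| w)%Z -> nr p w -> exists t, (t = y \/ t = z) /\
  v (z ^+ 2 - w%:~R * y ^+ 2) = v t ^+ 2 /\ (t = 0 -> y = 0 /\ z = 0).
Proof.
move=> pw hn; have vw : v w%:~R = 1 by exact: (v_int_unit ua pp vp).
have vwy : v (w%:~R * y ^+ 2) = v y ^+ 2 by rewrite (ua_M ua) vw mul1r (uaX ua).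
have vn (s t : K) : v s <= v t -> t = 0 -> s = 0.
  by move=> hs t0; apply/(ua_eq0 ua)/eqP; rewrite eq_le v0 andbT -(ua0 ua) -t0.
have [lt|lt|eq] := ltgtP (v z) (v y).
- exists y; split; first by left.
  split; last by move=> y0; split=> //; apply: (vn z y) => //; exact: ltW.
  rewrite -vwy -[in RHS](uaN ua); apply: (ua_eq ua); rewrite addrK (uaN ua) vwy (uaX ua).
  by rewrite ltr_pXn2r ?nnegrE.
- exists z; split; first by right.
  split; last by move=> y0; split=> //; apply: (vn y z) => //; exact: ltW.
  rewrite -(uaX ua); apply: (ua_eq ua); rewrite addrAC subrr add0r (uaN ua) vwy (uaX ua).
  by rewrite ltr_pXn2r ?nnegrE.
exists y; split; first by left.
split; last by move=> y0; split=> //; apply: (vn z y) => //; rewrite eq.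
have [y0|y0] := eqVneq y 0.
  have z0 : z = 0 by apply: (vn z y) => //; rewrite eq.
  by rewrite y0 z0 expr0n /= mulr0 subrr (ua0 ua) expr0n.
have e1 : z ^+ 2 - w%:~R * y ^+ 2 = y ^+ 2 * ((z / y) ^+ 2 - w%:~R) by field.
rewrite e1 (ua_M ua) (uaX ua) -[RHS]mulr1; congr (_ * _).
set c := z / y; have vc : v c = 1 by rewrite (ua_div ua) eq divff // gt_eqF // (ua_gt0 ua).
apply/eqP; rewrite eq_le; apply/andP; split.
  by apply: (uaB_le ua); rewrite ?vw // (uaX ua) vc expr1n.
rewrite leNgt; apply/negP => lt.
have vc1 : v c <= 1 by rewrite vc.
have [n hn1] := residue cv ua pp vp 1 vc1; rewrite expr1 in hn1.
have vcn : v (c + n%:R) <= 1 by apply: (uaD_le ua); rewrite ?vc // (ua_nat ua).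
have : v ((n%:R : K) ^+ 2 - w%:~R) < 1.
  have -> : n%:R ^+ 2 - w%:~R = (c ^+ 2 - w%:~R) - (c - n%:R) * (c + n%:R) by ring.
  apply: (uaB_lt ua) => //; rewrite (ua_M ua); apply: le_lt_trans (ler_piMr _ vcn) _ => //.
  exact: le_lt_trans hn1 vp.
rewrite (_ : n%:R ^+ 2 - w%:~R = ((n : int) ^+ 2 - w)%:~R); last by rewrite rmorphB rmorphXn.
rewrite v_lt1_dvd -Fp_int_eq0 // rmorphB rmorphXn /= subr_eq0 => /eqP ew.
move: hn; rewrite /nr -ew -exprM mulnC m2 // Fp_exp1 ?eqxx //.
by apply: contra pw => /eqP n0; rewrite -Fp_int_eq0 // -ew n0 expr0n.
Qed.

Lemma sol_ramified (u w : int) : ~~ (p %| u)%Z -> ~~ (p %| w)%Z ->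
  sol (p%:R * u%:~R : K) w%:~R <-> nr p w = false.
Proof.
move=> pu pw; split=> [[x [y [z [h e]]]]|h]; last first.
  have [s es s0] := unit_sqrt pw h; exists 0, 1, s; split; first by rewrite tri_neq0 oner_neq0 orbT.
  by rewrite es expr0n /= mulr0 add0r expr1n mulr1.
case hn : (nr p w) => //; exfalso; have vu : v u%:~R = 1 by exact: (v_int_unit ua pp vp).
have [t [_ [et t0]]] := norm_form y z pw hn.
have e2 : v t ^+ 2 = v p%:R * v x ^+ 2.
  by rewrite -et e addrK (ua_M ua) (ua_M ua) vu mulr1 (uaX ua).
have [x0|x0] := eqVneq x 0.
  have tz : t = 0.
    have : v t ^+ 2 = 0 by rewrite e2 x0 (ua0 ua) expr0n /= mulr0.
    by move/eqP; rewrite sqrf_eq0 => /eqP/(ua_eq0 ua).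
  by have [y0 z0] := t0 tz; move: h; rewrite x0 y0 z0 eqxx.
have vx : v x != 0 by rewrite gt_eqF // (ua_gt0 ua).
have := v_prime_odd (t / x); rewrite (ua_div ua) expr_div_n e2 mulfK ?expf_neq0 // eqxx.
by [].
Qed.

Lemma half_pow k : exists2 d : K, d != 0 & p%:R ^+ k = (if odd k then p%:R else 1) * d ^+ 2.
Proof.
have p0 : p%:R != 0 :> K by rewrite -(ua_gt0 ua).
exists (p%:R ^+ k./2); first exact: expf_neq0.
rewrite -exprM muln2 -{1}[k]odd_double_half exprD; case: (odd k) => //=.
Qed.

Lemma int_split (A : int) : A != 0 -> exists2 d : K, d != 0 &
  A%:~R = (if odd (al p A) then p%:R else 1) * (up p A)%:~R * d ^+ 2.
Proof.
move=> A0; have [d d0 e] := half_pow (al p A); exists d => //.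
rewrite {1}(up_eq p A) rmorphM /= -[X in _ * X]/((p ^ al p A)%N%:R) natrX e mulrA.
by congr (_ * _); exact: mulrC.
Qed.

Theorem sol_symbol_odd (A B : int) : A != 0 -> B != 0 -> sol (A%:~R : K) B%:~R <-> hs p A B = false.
Proof.
move=> A0 B0; have [c c0 ->] := int_split A0; have [d d0 ->] := int_split B0.
rewrite (sol2_sqr _ _ c0 d0); have hu := up_ndvd pp A0; have hw := up_ndvd pp B0.
set u := up p A in hu *; set w := up p B in hw *.
have pn2 : (p == 2%N) = false by apply/negP => /eqP p2; move: op; rewrite p2.
rewrite /hs pn2 -/u -/w; case: (odd (al p A)); case: (odd (al p B)) => /=; rewrite ?mul1r ?addbF.
- have p0 : p%:R != 0 :> K by rewrite -(ua_gt0 ua).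
  have u0 : u%:~R != 0 :> K by rewrite -(ua_gt0 ua) (v_int_unit ua pp vp hu).
  have w0 : w%:~R != 0 :> K by rewrite -(ua_gt0 ua) (v_int_unit ua pp vp hw).
  (* When both valuations are odd, B is replaced by - A B, which is a unit up to the square p^2. *)
  rewrite (sol_negmul (mulf_neq0 p0 u0) (mulf_neq0 p0 w0)).
  have -> : - (p%:R * u%:~R * (p%:R * w%:~R)) = (-1 * u * w)%:~R * p%:R ^+ 2 :> K.
    by rewrite !rmorphM rmorphN rmorph1; ring.
  have h1 : ~~ (p %| -1)%Z by rewrite dvdzE absz_nat /= dvdn1; case: eqP pp => // ->.
  have h2 : ~~ (p %| -1 * u)%Z by rewrite (dvdzM_prime pp) negb_or h1.
  have h3 : ~~ (p %| -1 * u * w)%Z by rewrite (dvdzM_prime pp) negb_or h2.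
  have -> : nr p (-1) (+) (nr p u (+) nr p w) = nr p (-1 * u * w) by rewrite !(nrM pp op) // addbA.
  rewrite -(sol_ramified hu h3); split=> [/solC/(sol_sqr _ _ p0)/solC //|h].
  by apply/solC/(sol_sqr _ _ p0)/solC.
- by rewrite (sol_ramified hu hw).
- rewrite -(sol_ramified hw hu); split; exact: solC.
- by split=> // _; exact: sol_units.
Qed.
End Odd.

Section Two.
Hypothesis p2 : p = 2%N.
Let v2 : v 2%:R < 1. Proof. by rewrite -p2. Qed.
Let n2 : 2%:R != 0 :> K. Proof. by rewrite (natK_eq0 cv). Qed.

Definition reps : seq nat := [:: 1; 3; 5; 7; 2; 6; 10; 14]%N.
Definition sq16 : seq nat := [:: 0; 1; 4; 9]%N.
(** Finite verification at 2 on representatives modulo squares: either there is no primitive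
    solution modulo 16, or some small x, y give a value that is 1 modulo 8, 4 modulo 32 or 16, hence
    a square. *)
Definition pairs_ok : bool := all (fun A => all (fun B =>
  if hs 2 (A : nat) (B : nat) then
    all (fun X => all (fun Y => all (fun Z => [|| odd X, odd Y | odd Z] ==> ((A * X + B * Y) %% 16 != Z)%N) sq16) sq16) sq16
  else has (fun x => has (fun y => (((A * x ^ 2 + B * y ^ 2) %% 8 == 1) || ((A * x ^ 2 + B * y ^ 2) %% 32 == 4)
     || (A * x ^ 2 + B * y ^ 2 == 16))%N) (iota 0 4)) (iota 0 4)) reps) reps.

Lemma pairs_okP : pairs_ok. Proof. by vm_compute. Qed.

Lemma sqrt_mod8 (n : nat) : (n %% 8 == 1)%N -> exists2 s : K, s ^+ 2 = n%:R & s != 0.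
Proof.
move=> /eqP e; have [|s hs1 _] := sqrt_two cv ua (u := n%:R) v2.
  rewrite (divn_eq n 8) e natrD addrK natrM (ua_M ua) ler_piMl //.
  exact: (ua_nat ua).
exists s => //; apply/eqP => s0; move: hs1; rewrite s0 expr0n => /esym/eqP; rewrite (natK_eq0 cv).
by move/eqP => n0; rewrite n0 in e.
Qed.

Lemma sq16_mod (n : nat) : (n ^ 2 %% 16)%N \in sq16 /\ odd (n ^ 2 %% 16) = odd n.
Proof.
rewrite -modnXm; have h : (n %% 16 < 16)%N by rewrite ltn_mod.
have -> : odd n = odd (n %% 16) by rewrite {1}(divn_eq n 16) oddD oddM andbF.
by move: (n %% 16)%N h; do 16?case=> //.
Qed.

Lemma sol_reps (A B : nat) : A \in reps -> B \in reps -> sol (A%:R : K) B%:R <-> hs 2 A B = false.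
Proof.
move=> hA hB; have /allP/(_ A hA)/allP/(_ B hB) := pairs_okP; case: ifP => hAB.
  move=> hall; split=> // [[x [y [z [h e]]]]]; exfalso.
  have [t [t0 [hx hy hz ht]]] := max_scale h.
  have {}e : (z / t) ^+ 2 = A%:R * (x / t) ^+ 2 + B%:R * (y / t) ^+ 2.
    by rewrite !expr_div_n e mulrDl !mulrA.
  move: (x / t) (y / t) (z / t) hx hy hz ht e => {x y z h t0 t} x y z hx hy hz ht e.
  have [a ha] := residue cv ua pp vp 4 hx; have [b hb] := residue cv ua pp vp 4 hy; have [c hc] := residue cv ua pp vp 4 hz.
  have sqd (s : K) (n : nat) : v s <= 1 -> v (s - n%:R) <= v p%:R ^+ 4 -> v (s ^+ 2 - n%:R ^+ 2) <= v p%:R ^+ 4.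
    move=> h1 h2; rewrite subr_sqr (ua_M ua); apply: le_trans h2; rewrite ler_piMr //.
    by apply: (uaD_le ua) => //; exact: (ua_nat ua).
  have oddt (s : K) (n : nat) : s = 1 -> v (s - n%:R) <= v p%:R ^+ 4 -> odd n.
    move=> -> h2; case on: (odd n) => //; exfalso.
    have p4 : v p%:R ^+ 4 < 1 by rewrite exprn_ilt1.
    have vn : v n%:R < 1 by rewrite -[n%:R]/((n : int)%:~R) v_lt1_dvd dvdzE !absz_nat p2 dvdn2 on.
    by have := uaD_lt ua (le_lt_trans h2 p4) vn; rewrite subrK (ua1 ua) ltxx.
  have some_odd : [|| odd a, odd b | odd c].
    by case: ht => [h1|h1|h1]; apply/or3P; [constructor 1|constructor 2|constructor 3]; apply: oddt h1 _.
  have hv : v (A%:R * a%:R ^+ 2 + B%:R * b%:R ^+ 2 - c%:R ^+ 2) <= v p%:R ^+ 4.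
    have -> : A%:R * a%:R ^+ 2 + B%:R * b%:R ^+ 2 - c%:R ^+ 2 =
       (z ^+ 2 - c%:R ^+ 2) - (A%:R * (x ^+ 2 - a%:R ^+ 2) + B%:R * (y ^+ 2 - b%:R ^+ 2)) :> K by rewrite e; ring.
    apply: (uaB_le ua); first exact: sqd.
    by apply: (uaD_le ua); rewrite (ua_M ua); apply: le_trans (ler_piMl _ (ua_nat ua _)) _; rewrite ?v0 // sqd.
  have [ma oa] := sq16_mod a; have [mb ob] := sq16_mod b; have [mc oc] := sq16_mod c.
  have := allP (allP (allP hall _ ma) _ mb) _ mc; rewrite oa ob oc some_odd /= => /negP; apply.
  pose n1 := (A * a ^ 2 + B * b ^ 2)%N; pose n3 := (c ^ 2)%N.
  have {hv} h16 : (16%N %| (n1 : int) - (n3 : int))%Z.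
    have e1 : ((n1 : int) - (n3 : int))%:~R = A%:R * a%:R ^+ 2 + B%:R * b%:R ^+ 2 - c%:R ^+ 2 :> K.
      by rewrite rmorphB /= -!pmulrn /n1 /n3 natrD !(natrX, natrM).
    move: hv; rewrite -e1; set N : int := _ - _; have [->|N0] := eqVneq N 0; first by rewrite dvdz0.
    have hN : (0 < `|N|)%N by rewrite absz_gt0.
    apply: contraTT => h16; rewrite -ltNge (v_int N) (v_nat ua pp vp hN) (ltr_iXn2l vp0 vp).
    rewrite ltnNge -(pfactor_dvdn _ pp) ?absz_gt0 // p2.
    by move: h16; rewrite dvdzE absz_nat.
  move: h16; rewrite -eqz_mod_dvd !modz_nat eqz_nat => h16.
  by rewrite -modnDm !modnMmr modnDm.
move=> /hasP[x _ /hasP[y _ hxy]]; split=> // _.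
have nz (s : K) : s != 0 -> s ^+ 2 = (A * x ^ 2 + B * y ^ 2)%N%:R -> sol (A%:R : K) B%:R.
  move=> s0 es; exists x%:R, y%:R, s; split; first by rewrite tri_neq0 s0 !orbT.
  by rewrite es natrD (natrM _ A) (natrM _ B) !natrX.
case/orP: hxy => [/orP[h|h]|/eqP h].
- by have [s es s0] := sqrt_mod8 h; exact: nz es.
- move: nz; set n := (A * x ^ 2 + B * y ^ 2)%N in h *; have [k ek] : exists k, (n = 4 * k)%N /\ (k %% 8 == 1)%N.
    exists (n %/ 4)%N; move: h; clearbody n; lia.
  have [s es s0] := sqrt_mod8 ek.2; move=> nz; apply: (nz (2%:R * s)); first by rewrite mulf_neq0.
  by rewrite ek.1 exprMn es natrM; congr (_ * _); rewrite -natrX.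
by apply: (nz 4%:R); rewrite ?(natK_eq0 cv) // h -natrX.
Qed.

Lemma odd_rep (u : int) : ~~ (2 %| u)%Z -> exists2 r : nat, r \in [:: 1; 3; 5; 7]%N &
  [/\ eps u = eps r, om u = om r & exists2 s : K, s != 0 & u%:~R = r%:R * s ^+ 2].
Proof.
move=> hu; have [r hr er] : exists2 r : nat, r \in [:: 1; 3; 5; 7]%N & (u %% 8)%Z = r.
  by have [->|->|->|->] := mod8_odd hu; [exists 1%N|exists 3%N|exists 5%N|exists 7%N].
have ru : (r %% 8 = r)%N by move: hr; rewrite !inE => /or4P[] /eqP ->.
have or : odd r by move: hr; rewrite !inE => /or4P[] /eqP ->.
exists r => //; split.
- by rewrite !eps8 er [(r %% 8)%Z]modz_nat ru.
- by rewrite /om er [(r %% 8)%Z]modz_nat ru.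
have vr : v r%:R = 1 by apply: (v_coprime ua pp vp); rewrite p2 dvdn2 or.
have r0 : r%:R != 0 :> K by rewrite -(ua_gt0 ua) vr.
have [|s hs1 _] := sqrt_two cv ua (u := u%:~R / r%:R) v2.
  have -> : u%:~R / r%:R - 1 = (u - (r : int))%:~R / r%:R :> K by rewrite rmorphB /= mulrBl divff.
  rewrite (ua_div ua) vr divr1 {1}(divz_eq u 8) er addrK rmorphM /= (ua_M ua) ler_piMl //.
  exact: (ua_int ua).
exists s; last by rewrite hs1 mulrC divfK.
apply/eqP => s0; move: hs1; rewrite s0 expr0n => /esym/eqP; rewrite mulf_eq0 invr_eq0 (negPf r0) orbF.
by rewrite (intK_eq0 cv) => /eqP u0; move: hu; rewrite u0 dvdz0.
Qed.

Theorem sol_symbol_two (A B : int) : A != 0 -> B != 0 -> sol (A%:~R : K) B%:~R <-> hs 2 A B = false.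
Proof.
move=> A0 B0; have [c c0 ->] := int_split A0; have [d d0 ->] := int_split B0.
rewrite (sol2_sqr _ _ c0 d0); have := up_ndvd pp A0; have := up_ndvd pp B0; rewrite p2 => hw hu.
set u := up 2 A in hu *; set w := up 2 B in hw *.
have [r hr [er1 er2 [s s0 ->]]] := odd_rep hu; have [r' hr' [er1' er2' [s' s0' ->]]] := odd_rep hw.
rewrite [_ * (r%:R * _)]mulrA [_ * (r'%:R * _)]mulrA (sol2_sqr _ _ s0 s0').
pose f (x : bool) (r : nat) : nat := if x then (2 * r)%N else r.
have fE x (r0 : nat) : (if x then 2%:R else 1) * r0%:R = (f x r0)%:R :> K.
  by case: x; rewrite /f ?natrM ?mul1r.
have fr x r0 : r0 \in [:: 1; 3; 5; 7]%N -> f x r0 \in reps.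
  by rewrite !inE => /or4P[] /eqP ->; case: x.
have ff x r0 : r0 \in [:: 1; 3; 5; 7]%N -> odd (al 2 (f x r0)) = x /\ up 2 (f x r0) = r0.
  by rewrite !inE => /or4P[] /eqP ->; case: x; vm_compute.
rewrite !fE (sol_reps (fr _ _ hr) (fr _ _ hr')) /hs /=.
have [-> ->] := ff (odd (al 2 A)) _ hr; have [-> ->] := ff (odd (al 2 B)) _ hr'.
by rewrite -/u -/w er1 er2 er1' er2'.
Qed.

End Two.

Theorem sol_symbol (A B : int) : A != 0 -> B != 0 -> sol (A%:~R : K) B%:~R <-> hs p A B = false.
Proof.
have [e|op] := even_prime pp; last exact: sol_symbol_odd.
by rewrite e; exact: sol_symbol_two.
Qed.
End Local.

(** * Ternary quadratic forms *)

(* The form a x^2 + b y^2 + c z^2 + 2 (d y z + e x z + f x y). *)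
Record tform (F : Type) := TForm { ta : F; tb : F; tc : F; td : F; te : F; tf : F }.

Definition tmap (F F' : Type) (h : F -> F') (q : tform F) :=
  TForm (h (ta q)) (h (tb q)) (h (tc q)) (h (td q)) (h (te q)) (h (tf q)).

Section Forms.
Variable F : fieldType.
Implicit Types q : tform F.

Definition teval q (x y z : F) : F :=
  ta q * x ^+ 2 + tb q * y ^+ 2 + tc q * z ^+ 2 + 2%:R * (td q * (y * z) + te q * (x * z) + tf q * (x * y)).
Definition tdet q : F :=
  ta q * tb q * tc q + 2%:R * td q * te q * tf q - ta q * td q ^+ 2 - tb q * te q ^+ 2 - tc q * tf q ^+ 2.
Definition tdiag (a b c : F) := TForm a b c 0 0 0.
Definition tiso q : Prop := exists x y z, (x, y, z) != (0, 0, 0) :> F * F * F /\ teval q x y z = 0.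

Definition sw12 q := TForm (tb q) (ta q) (tc q) (te q) (td q) (tf q).
Definition sw13 q := TForm (tc q) (tb q) (ta q) (tf q) (te q) (td q).
Definition tshear t q := TForm (ta q) (ta q * t ^+ 2 + tb q + 2%:R * tf q * t) (tc q) (td q + t * te q) (te q) (tf q + ta q * t).

(* Equivalence under the substitutions generated by permutations of the variables and x := x + t y with t in O. *)
Inductive teq (O : F -> Prop) : tform F -> tform F -> Prop :=
| teq_refl q : teq O q q
| teq_12 q q' : teq O (sw12 q) q' -> teq O q q'
| teq_13 q q' : teq O (sw13 q) q' -> teq O q q'
| teq_sh t q q' : O t -> teq O (tshear t q) q' -> teq O q q'.

Lemma tdet_teq O q q' : teq O q q' -> tdet q = tdet q'.
Proof.
by elim=> {q q'} // [q q' _ <-|q q' _ <-|t q q' _ _ <-]; rewrite /tdet /=; ring.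
Qed.

Lemma tdet_diag a b c : tdet (tdiag a b c) = a * b * c.
Proof. by rewrite /tdet /=; ring. Qed.

Lemma teval_diag a b c x y z : teval (tdiag a b c) x y z = a * x ^+ 2 + b * y ^+ 2 + c * z ^+ 2.
Proof. by rewrite /teval /= !mul0r !addr0 mulr0 addr0. Qed.

Lemma tiso_diag a b c : a != 0 -> b != 0 -> c != 0 -> tiso (tdiag a b c) <-> sol (- (a * c)) (- (b * c)).
Proof.
move=> a0 b0 c0; split=> [[x [y [z [n0 e]]]]|[x [y [z [n0 e]]]]].
  exists x, y, (c * z); split; first by move: n0; rewrite !tri_neq0 mulf_eq0 (negPf c0).
  apply/eqP; rewrite -subr_eq0; apply/eqP; transitivity (c * (a * x ^+ 2 + b * y ^+ 2 + c * z ^+ 2)); first by ring.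
  by rewrite -teval_diag e mulr0.
exists x, y, (z / c); split.
  by move: n0; rewrite !tri_neq0 mulf_eq0 invr_eq0 (negPf c0) orbF.
rewrite teval_diag; apply: (mulfI c0); rewrite mulr0.
transitivity ((c * (z / c)) ^+ 2 + a * c * x ^+ 2 + b * c * y ^+ 2); first by ring.
by rewrite mulrC divfK // e; ring.
Qed.

Lemma teq_23 O q q' : teq O (TForm (ta q) (tc q) (tb q) (td q) (tf q) (te q)) q' -> teq O q q'.
Proof. by move=> h; apply: teq_12; apply: teq_13; apply: teq_12; case: q h. Qed.

Section Diagonalisation.
Variables (R : realType) (v : F -> R).
Hypotheses (ua : ultra_abs v) (v2 : v 2%:R = 1).
Local Notation O := (fun t : F => v t <= 1).

Let v1 : O 1. Proof. by rewrite /= (ua1 ua). Qed.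
Let quot x y : v x <= v y -> O (- (x / y)).
Proof.
move=> h; rewrite /= (uaN ua) (ua_div ua); have [->|y0] := eqVneq y 0; first by rewrite (ua0 ua) invr0 mulr0.
by rewrite ler_pdivrMr ?mul1r // (ua_gt0 ua).
Qed.
Let quotK x y : v x <= v y -> x + y * - (x / y) = 0.
Proof.
have [->|y0] := eqVneq y 0.
  rewrite (ua0 ua) => h; have -> : x = 0 by apply/(ua_eq0 ua)/le_anti; rewrite h (ua_ge0 ua).
  by rewrite mul0r add0r.
by move=> _; rewrite mulrN mulrCA divff // mulr1 subrr.
Qed.
Let v_sum3 x y z : v x < v z -> v y < v z -> v (y + x + 2%:R * z) = v z.
Proof.
move=> h1 h2; have e2 : v (2%:R * z) = v z by rewrite (ua_M ua) v2 mul1r.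
by rewrite (uaD_eql ua) e2 //; apply: (uaD_lt ua).
Qed.

(** Integral elimination requires a pivot of maximal value. If the off-diagonal d dominates, adding
    one variable to the other creates the diagonal entry b + c + 2 d, of the value of d because |2|
    = 1. *)
Lemma diag_binary a b c d : exists b' c', teq O (TForm a b c d 0 0) (tdiag a b' c').
Proof.
have base x y z w : v w <= v y -> exists b' c', teq O (TForm x y z w 0 0) (tdiag x b' c').
  move=> h; pose t := - (w / y).
  exists y, (y * t ^+ 2 + z + 2%:R * w * t).
  apply: teq_12; apply: teq_13; apply: teq_12; apply: teq_13.
  apply: (teq_sh (t := t)); first exact: quot.
  rewrite /tshear /= !mulr0 !addr0 quotK //; apply: teq_13; apply: teq_23.
  exact: teq_refl.
have [|h1] := leP (v d) (v b); first exact: base.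
have [h2|h2] := leP (v d) (v c).
  have [b' [c' h]] := base a c b d h2; exists b', c'; apply: teq_23; exact: h.
have [|b' [c' h]] := base a (c + b + 2%:R * d) c (d + c).
  rewrite (v_sum3 h1 h2); apply: (uaD_le ua) => //; exact: ltW.
exists b', c'; apply: teq_13; rewrite /sw13 /=; apply: (teq_sh (t := 1)); first exact: v1.
rewrite /tshear /= !mulr0 !addr0 !mulr1 expr1n mulr1; apply: teq_13; exact: h.
Qed.

Lemma diag_pivot a b c d e f : v f <= v a -> v e <= v a ->
  exists a' b' c', teq O (TForm a b c d e f) (tdiag a' b' c').
Proof.
move=> hf he; exists a; pose t := - (f / a); pose s := - (e / a).
have [b' [c' h]] := diag_binary a (a * t ^+ 2 + b + 2%:R * f * t) (a * s ^+ 2 + c + 2%:R * e * s) (d + t * e).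
exists b', c'; apply: (teq_sh (t := t)); first exact: quot.
rewrite /tshear /= quotK //; apply: teq_23 => /=; apply: (teq_sh (t := s)); first exact: quot.
rewrite /tshear /= quotK // mulr0 addr0; apply: teq_23 => /=; exact: h.
Qed.

Lemma diagonalise q : exists a b c, teq O q (tdiag a b c).
Proof.
have P a b c d e f : v e <= v f -> v d <= v f -> exists a' b' c', teq O (TForm a b c d e f) (tdiag a' b' c').
  move=> he hd; have [ha|ha] := leP (v f) (v a); first by apply: diag_pivot => //; exact: le_trans ha.
  have [hb|hb] := leP (v f) (v b).
    have [|a' [b' [c' h]]] := @diag_pivot b a c e d f hb; first exact: le_trans hb.
    by exists a', b', c'; apply: teq_12.
  have [||a' [b' [c' h]]] := @diag_pivot (b + a + 2%:R * f) b c d (e + d) (f + b).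
  - by rewrite v_sum3 //; apply: (uaD_le ua) => //; exact: ltW.
  - by rewrite v_sum3 //; apply: (uaD_le ua).
  exists a', b', c'; apply: teq_12; rewrite /sw12 /=; apply: (teq_sh (t := 1)); first exact: v1.
  by rewrite /tshear /= !mulr1 expr1n mulr1 mul1r; apply: teq_12.
case: q => a b c d e f; have [h1|h1] := leP (v e) (v f); have [h2|h2] := leP (v d) (v f).
- exact: P.
- have [||a' [b' [c' h]]] := P c b a f e d; [exact: le_trans (ltW h2)|exact: ltW|].
  by exists a', b', c'; apply: teq_13.
- have [||a' [b' [c' h]]] := P a c b d f e; [exact: ltW|exact: le_trans (ltW h1)|].
  by exists a', b', c'; apply: teq_23.
have [h3|h3] := leP (v d) (v e).
  have [||a' [b' [c' h]]] := P a c b d f e; [exact: ltW|exact: h3|].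
  by exists a', b', c'; apply: teq_23.
have [||a' [b' [c' h]]] := P c b a f e d; [exact: ltW|exact: ltW|].
by exists a', b', c'; apply: teq_13.
Qed.

Definition tint q := [/\ v (ta q) <= 1, v (tb q) <= 1, v (tc q) <= 1 & [/\ v (td q) <= 1, v (te q) <= 1 & v (tf q) <= 1]].

Lemma tint_teq q q' : teq O q q' -> tint q -> tint q'.
Proof.
have vM1 x y : v x <= 1 -> v y <= 1 -> v (x * y) <= 1 by move=> hx hy; rewrite (ua_M ua) mulr_ile1 ?(ua_ge0 ua).
elim=> {q q'} // [q q' _ IH|q q' _ IH|t q q' ht _ IH] [h1 h2 h3 [h4 h5 h6]]; apply: IH; split=> //=.
- apply: (uaD_le ua); first by apply: (uaD_le ua) => //; apply: (vM1) => //; rewrite expr2; apply: (vM1).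
  by apply: (vM1) => //; apply: (vM1) => //; exact: (ua_nat ua).
- by split=> //; apply: (uaD_le ua) => //; apply: (vM1).
Qed.
End Diagonalisation.
End Forms.

Section Maps.
Variables (F K : fieldType) (h : {rmorphism F -> K}).

Lemma teval_shear t q x y z : teval (tmap h (tshear t q)) x y z = teval (tmap h q) (x + h t * y) y z.
Proof.
rewrite /teval /= !rmorphD [h (2%:R * _ * t)]rmorphM [h (2%:R * _)]rmorphM rmorph_nat !(rmorphXn, rmorphM) /=; ring.
Qed.

Lemma tiso_teq O (q q' : tform F) : teq O q q' -> tiso (tmap h q) <-> tiso (tmap h q').
Proof.
elim=> {q q'} // [q q' _ <-|q q' _ <-|t q q' _ _ <-].
- split=> -[x [y [z [n0 e]]]]; exists y, x, z; (split; first by move: n0; rewrite !tri_neq0 orbCA);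
  by rewrite -e /teval /=; ring.
- split=> -[x [y [z [n0 e]]]]; exists z, y, x; (split; first by move: n0; rewrite !tri_neq0; case/or3P=> ->; rewrite ?orbT);
  by rewrite -e /teval /=; ring.
have sh := teval_shear t q.
split=> -[x [y [z [n0 e]]]]; last first.
  exists (x + h t * y), y, z; split; last by rewrite -sh.
  move: n0; rewrite !tri_neq0; have [->|] := eqVneq y 0; last by rewrite !orbT.
  by rewrite mulr0 addr0.
exists (x - h t * y), y, z; split; last by rewrite sh subrK.
move: n0; rewrite !tri_neq0; have [->|] := eqVneq y 0; last by rewrite !orbT.
by rewrite mulr0 subr0.
Qed.
End Maps.

(* Semi-definiteness is tested on the real elements of algC. *)
Lemma tneg_teq O (q q' : tform rat) : teq O q q' ->
  (forall x y z : algC, x \is Num.real -> y \is Num.real -> z \is Num.real -> teval (tmap ratr q') x y z <= 0) ->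
  (forall x y z : algC, x \is Num.real -> y \is Num.real -> z \is Num.real -> teval (tmap ratr q) x y z <= 0).
Proof.
elim=> {q q'} // [q q' _ IH|q q' _ IH|t q q' _ _ IH] h x y z rx ry rz.
- by have := IH h y x z ry rx rz; congr (_ <= 0); rewrite /teval /=; ring.
- by have := IH h z y x rz ry rx; congr (_ <= 0); rewrite /teval /=; ring.
have rt : ratr t * y \is Num.real by rewrite realM // rpred_rat.
have := IH h (x - ratr t * y) y z (rpredB rx rt) ry rz; congr (_ <= 0).
by rewrite (teval_shear (ratr : {rmorphism rat -> algC})) subrK.
Qed.

Section Local.
Variables (R : realType) (K : fieldType) (v : K -> R) (p : nat).
Hypotheses (cv : is_completion v) (ua : ultra_abs v) (pp : prime p) (vp : v p%:R < 1).

Lemma v2_odd : odd p -> v 2%:R = 1.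
Proof. by move=> op; apply: (v_coprime ua pp vp); apply: contraL op; rewrite (dvdn_prime2 pp) // => /eqP ->. Qed.

Lemma unit_int_sqr u : odd p -> v u = 1 -> exists2 n : int, n \notin dvdz p & exists2 s : K, s != 0 & u = n%:~R * s ^+ 2.
Proof.
move=> op vu; have [|n hn] := residue cv ua pp vp (x := u) 1; first by rewrite vu.
rewrite expr1 in hn; have h1 : v (n%:R - u) < v u by rewrite -opprB (uaN ua) vu; apply: le_lt_trans vp.
have vn : v n%:R = 1 by rewrite (ua_eq ua h1).
have n0 : n%:R != 0 :> K by rewrite -(ua_gt0 ua) vn.
exists (n : int).
  by rewrite -(v_lt1_dvd ua pp vp (n : int)) -pmulrn vn ltxx.
have [|||s hs _] := sqrt_odd cv ua (u := u / n%:R) (c := 1).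
- exact: v2_odd.
- exact: ua1.
- have -> : u / n%:R - 1 ^+ 2 = - (n%:R - u) / n%:R by rewrite expr1n opprB mulrBl divff.
  by rewrite (ua_div ua) (uaN ua) vn divr1 -vu.
exists s; last by rewrite hs -pmulrn mulrC divfK.
by apply/eqP => s0; move: hs; rewrite s0 expr0n => /esym/eqP; rewrite mulf_eq0 invr_eq0 (negPf n0) orbF => /eqP u0; move: vu; rewrite u0 (ua0 ua) => /eqP; rewrite eq_sym oner_eq0.
Qed.

Lemma sol_units_K u w : odd p -> v u = 1 -> v w = 1 -> sol u w.
Proof.
move=> op vu vw; have [n hn [s s0 ->]] := unit_int_sqr op vu; have [m hm [t t0 ->]] := unit_int_sqr op vw.
apply/(sol_sqr _ _ s0)/solC/(sol_sqr _ _ t0)/solC; exact: (sol_units cv ua pp vp op).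
Qed.

(** Integral diagonalisation preserves the unit determinant, so all three diagonal entries are
    units, and a conic with unit coefficients has a point at an odd prime. *)
Lemma unimodular_isotropic (q : tform K) : odd p -> tint v q -> v (tdet q) = 1 -> tiso q.
Proof.
move=> op hq dq; have [a [b [c h]]] := diagonalise ua (v2_odd op) q.
have [ha hb hc _] := tint_teq ua h hq; rewrite /= in ha hb hc.
have e : v a * v b * v c = 1 by rewrite -!(ua_M ua) -tdet_diag -(tdet_teq h).
have big x y : v x <= 1 -> 0 <= y -> y <= 1 -> v x * y = 1 -> v x = 1.
  by move=> hx y0 y1 exy; apply/le_anti; rewrite hx -exy ler_piMr ?(ua_ge0 ua).
have nn := (ua_ge0 ua).
have va : v a = 1 by apply: (big a (v b * v c)); rewrite ?mulr_ge0 ?mulr_ile1 // mulrA.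
have vb : v b = 1 by apply: (big b (v a * v c)); rewrite ?mulr_ge0 ?mulr_ile1 // mulrCA mulrA.
have vc : v c = 1 by apply: (big c (v a * v b)); rewrite ?mulr_ge0 ?mulr_ile1 // mulrC.
have id_map (q' : tform K) : tmap (idfun : {rmorphism K -> K}) q' = q' by case: q'.
rewrite -(id_map q); apply/(tiso_teq _ h); rewrite id_map; apply/tiso_diag; rewrite -?(ua_gt0 ua) ?va ?vb ?vc ?ltr01 //.
by apply: sol_units_K => //; rewrite (uaN ua) (ua_M ua) ?va ?vb vc mulr1.
Qed.
End Local.

(** * The algebra F[X]/(X^3 + A X + B) and the forms it carries *)

Section Cubic.
Variables (F : fieldType) (A B : F).
Definition tri : Type := F * F * F.
Implicit Types u w : tri.

Definition mulA u w : tri := let: (u0, u1, u2) := u in let: (w0, w1, w2) := w in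
  let c3 := u1 * w2 + u2 * w1 in let c4 := u2 * w2 in
  (u0 * w0 - B * c3, u0 * w1 + u1 * w0 - A * c3 - B * c4, u0 * w2 + u1 * w1 + u2 * w0 - A * c4).
Definition ev u (t : F) : F := let: (u0, u1, u2) := u in u0 + u1 * t + u2 * t ^+ 2.
Definition top u : F := u.2.
(** The product of the two other conjugates of u, written in coordinates; [mul_adjA] turns it into
    an inverse up to the norm. *)
Definition adjA u : tri := let: (u0, u1, u2) := u in
  ((u0 - A * u2) ^+ 2 + u1 * (A * u1 + B * u2), - (u1 * (u0 - A * u2) + u2 * (A * u1 + B * u2)), u1 ^+ 2 - u2 * (u0 - A * u2)).
Definition normA u : F := let: (u0, u1, u2) := u in
  u0 * ((u0 - A * u2) ^+ 2 + u1 * (A * u1 + B * u2)) + B * u2 * (u1 * (u0 - A * u2) + u2 * (A * u1 + B * u2)) - B * u1 * (u1 ^+ 2 - u2 * (u0 - A * u2)).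
Definition scA (k : F) u : tri := let: (u0, u1, u2) := u in (k * u0, k * u1, k * u2).
Definition Qf e u : F := top (mulA e (mulA u u)).

Lemma mulAC u w : mulA u w = mulA w u.
Proof. by case: u w => [[? ?] ?] [[? ?] ?] /=; congr (_, _, _); ring. Qed.
Lemma mulAA u w z : mulA u (mulA w z) = mulA (mulA u w) z.
Proof. by case: u w z => [[? ?] ?] [[? ?] ?] [[? ?] ?] /=; congr (_, _, _); ring. Qed.
Lemma mul_adjA u : mulA (adjA u) u = (normA u, 0, 0).
Proof. by case: u => [[? ?] ?] /=; congr (_, _, _); ring. Qed.
Lemma scA_mul k u : mulA (k, 0, 0) u = scA k u.
Proof. by case: u => [[? ?] ?] /=; congr (_, _, _); ring. Qed.
Lemma normA_mul u w : normA (mulA u w) = normA u * normA w.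
Proof. by case: u w => [[? ?] ?] [[? ?] ?] /=; ring. Qed.
Lemma ev_mulA u w t : t ^+ 3 + A * t + B = 0 -> ev (mulA u w) t = ev u t * ev w t.
Proof.
case: u w => [[u0 u1] u2] [[w0 w1] w2] /= e; apply/eqP; rewrite eq_sym -subr_eq0; apply/eqP.
transitivity ((t ^+ 3 + A * t + B) * (u1 * w2 + u2 * w1 + u2 * w2 * t)); first by ring.
by rewrite e mul0r.
Qed.

Definition gram e : tform F := let: (e0, e1, e2) := e in
  TForm e2 (e0 - A * e2) (- (B * e1) - A * (e0 - A * e2)) (- (A * e1) - B * e2) (e0 - A * e2) e1.
Lemma gramE e x y z : teval (gram e) x y z = Qf e (x, y, z).
Proof. by case: e => [[? ?] ?]; rewrite /teval /Qf /top /=; ring. Qed.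
Lemma gram_det e : tdet (gram e) = - normA e.
Proof. by case: e => [[? ?] ?]; rewrite /tdet /=; ring. Qed.
(** Multiplication by w is a change of variables, so isotropy depends on e only modulo squares, and
    by [Qf_sc] only modulo scalars. *)
Lemma Qf_mul e u w : Qf e (mulA w u) = Qf (mulA e (mulA w w)) u.
Proof. by rewrite /Qf; congr (top _); rewrite -!mulAA; congr (mulA e _); rewrite [mulA u (mulA w u)]mulAA [mulA u w]mulAC -!mulAA. Qed.
Lemma Qf_sc k e u : Qf (scA k e) u = k * Qf e u.
Proof. by case: e u => [[? ?] ?] [[? ?] ?]; rewrite /Qf /top /=; ring. Qed.

Lemma Qf_scr k e u : Qf e (scA k u) = k ^+ 2 * Qf e u.
Proof. by case: e u => [[? ?] ?] [[? ?] ?]; rewrite /Qf /top /=; ring. Qed.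

Lemma tiso_gram e : tiso (gram e) <-> exists u, u != (0, 0, 0) :> tri /\ Qf e u = 0.
Proof.
split=> [[x [y [z [n0 h]]]]|[[[x y] z] [n0 h]]]; first by exists (x, y, z); rewrite -gramE.
by exists x, y, z; rewrite gramE.
Qed.

Lemma tiso_gram_sc k e : k != 0 -> tiso (gram (scA k e)) <-> tiso (gram e).
Proof.
move=> k0; rewrite !tiso_gram; split=> -[u [n0 h]]; exists u; split=> //; move: h; rewrite Qf_sc.
  by move/eqP; rewrite mulf_eq0 (negPf k0) => /eqP.
by move->; rewrite mulr0.
Qed.

Lemma mulA_neq0 w u : normA w != 0 -> u != (0, 0, 0) :> tri -> mulA w u != (0, 0, 0) :> tri.
Proof.
move=> w0; apply: contra_neq => e; have : mulA (adjA w) (mulA w u) = mulA (adjA w) (0, 0, 0) by rewrite e.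
have z0 a : mulA a (0, 0, 0) = (0, 0, 0) by case: a => [[a b] c] /=; congr (_, _, _); ring.
rewrite mulAA mul_adjA scA_mul z0; case: u {e} => [[x y] z] /= [h1 h2 h3].
by congr (_, _, _); apply: (mulfI w0); rewrite mulr0.
Qed.

Lemma tiso_gram_square e w : normA w != 0 -> tiso (gram (mulA e (mulA w w))) <-> tiso (gram e).
Proof.
move=> w0; rewrite !tiso_gram; split=> -[u [n0 h]].
  by exists (mulA w u); rewrite Qf_mul mulA_neq0.
exists (mulA (adjA w) u); rewrite -Qf_mul mulAA [mulA w _]mulAC mul_adjA.
have na : normA (adjA w) != 0.
  have := congr1 normA (mul_adjA w); rewrite normA_mul => h'; apply: contra_neq w0 => e0; move: h'; rewrite e0 mul0r /=.
  by rewrite !(mulr0, subr0, addr0, mul0r, oppr0, expr0n) /= => /esym/eqP; rewrite !mulf_eq0 !orbb; do ?[case/orP]; move=> /eqP.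
split; first by rewrite mulA_neq0.
by rewrite scA_mul Qf_scr h mulr0.
Qed.
End Cubic.

(** * The forms at odd primes *)

Section Small.
Variables (R : realType) (K : fieldType) (v : K -> R) (ua : ultra_abs v).
Lemma vM_le1 x y : v x <= 1 -> v y <= 1 -> v (x * y) <= 1.
Proof. by move=> hx hy; rewrite (ua_M ua) mulr_ile1 ?(ua_ge0 ua). Qed.
Lemma vM_lt1 x y : v x < 1 -> v y <= 1 -> v (x * y) < 1.
Proof. by move=> hx hy; rewrite (ua_M ua); apply: le_lt_trans hx; rewrite ler_piMr ?(ua_ge0 ua). Qed.
Lemma vMr_lt1 x y : v x <= 1 -> v y < 1 -> v (x * y) < 1.
Proof. by move=> hx hy; rewrite mulrC; exact: vM_lt1. Qed.
Lemma vX_le1 x n : v x <= 1 -> v (x ^+ n) <= 1.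
Proof. by move=> hx; rewrite (uaX ua) exprn_ile1 ?(ua_ge0 ua). Qed.
Lemma vN_le1 x : v x <= 1 -> v (- x) <= 1. Proof. by rewrite (uaN ua). Qed.
Lemma vN_lt1 x : v x < 1 -> v (- x) < 1. Proof. by rewrite (uaN ua). Qed.
Lemma v_neq0 x : v x = 1 -> x != 0.
Proof. by move=> h; rewrite -(ua_gt0 ua) h. Qed.
Lemma v1_le x : v x = 1 -> v x <= 1. Proof. by move->. Qed.
Lemma vV_1 x : v x = 1 -> v x^-1 = 1. Proof. by move=> h; rewrite (uaV ua) h invr1. Qed.
Lemma v_near1 x y : v y = 1 -> v (x - y) < 1 -> v x = 1.
Proof. by move=> hy h; rewrite (ua_eq ua (y := y)) // hy. Qed.
Lemma v1_or x : v x <= 1 -> v x = 1 \/ v x < 1.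
Proof. by rewrite le_eqVlt => /orP[/eqP|]; [left|right]. Qed.
Lemma v_lt1_sqr x : v (x ^+ 2) < 1 -> v x < 1.
Proof. by apply: contraTT; rewrite -!leNgt (uaX ua) => h; rewrite exprn_ege1. Qed.
End Small.

Ltac vle ua := repeat first
  [ assumption | exact: (ua_nat ua _) | (apply: (v1_le); assumption) | rewrite (ua1 ua); exact: lexx | apply: (vN_le1 ua)
  | apply: (vX_le1 ua) | apply: (vM_le1 ua) | apply: (uaD_le ua) ].
Ltac vlt ua := repeat first
  [ assumption | apply: (vN_lt1 ua) | apply: (uaD_lt ua)
  | (apply: (vM_lt1 ua); [by vlt ua | by vle ua]) | (apply: (vMr_lt1 ua); [by vle ua | by vlt ua]) ].

Section NoRoot.
Variables (R : realType) (K : fieldType) (v : K -> R) (p : nat).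
Hypotheses (cv : is_completion v) (ua : ultra_abs v) (pp : prime p) (vp : v p%:R < 1) (op : odd p).
Variables (A B : K).
Hypotheses (vA : v A <= 1) (vB : v B <= 1).
Hypothesis noroot : forall a, v a <= 1 -> v (a ^+ 3 + A * a + B) = 1.

(** A cubic without root modulo p is irreducible there, so the residue algebra is a field and a
    primitive e has unit norm. The proof is explicit: a norm of value less than 1 yields a root
    modulo p. *)
Lemma noroot_norm (e0 e1 e2 : K) : v e0 <= 1 -> v e1 <= 1 -> v e2 <= 1 ->
  [\/ e0 = 1, e1 = 1 | e2 = 1] -> v (normA A B (e0, e1, e2)) = 1.
Proof.
move=> h0 h1 h2 h; have le1 : v (normA A B (e0, e1, e2)) <= 1 by rewrite /normA; vle ua.
have [//|lt1] := v1_or le1; exfalso.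
have nr a : v a <= 1 -> v (a ^+ 3 + A * a + B) < 1 -> False.
  by move=> ha; rewrite noroot // ltxx.
have [ve2|ve2] := v1_or h2.
  have e20 := v_neq0 ua ve2; have vi := vV_1 ua ve2.
  pose al := e1 / e2; pose ga := e0 / e2.
  have val : v al <= 1 by rewrite /al; vle ua; rewrite vi.
  have vga : v ga <= 1 by rewrite /ga; vle ua; rewrite vi.
  (* The remainder r1 X + r0 of the cubic modulo X^2 + al X + ga, with quotient X - al. If r1 is a
     unit, - r0 / r1 is the root modulo p; otherwise r0 is small as well and al is. *)
  pose r1 := A + al ^+ 2 - ga; pose r0 := B + al * ga.
  have vr1 : v r1 <= 1 by rewrite /r1; vle ua.
  have vr0 : v r0 <= 1 by rewrite /r0; vle ua.
  have eN : normA A B (e0, e1, e2) = e2 ^+ 3 * (r0 ^+ 2 - r0 * r1 * al + r1 ^+ 2 * ga).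
    have -> : e1 = e2 * al by rewrite /al mulrC divfK.
    have -> : e0 = e2 * ga by rewrite /ga mulrC divfK.
    by rewrite /normA /r0 /r1; ring.
  have {}lt1 : v (r0 ^+ 2 - r0 * r1 * al + r1 ^+ 2 * ga) < 1.
    by move: lt1; rewrite eN (ua_M ua) (uaX ua) ve2 expr1n mul1r.
  have [vr|vr] := v1_or vr1.
    have r10 := v_neq0 ua vr; pose a := - (r0 / r1).
    have va : v a <= 1 by rewrite /a; vle ua; rewrite (vV_1 ua vr).
    apply: (nr a va).
    have -> : a ^+ 3 + A * a + B = (r0 ^+ 2 - r0 * r1 * al + r1 ^+ 2 * ga) * (a - al) * (r1^-1) ^+ 2.
      have ea : r1 * a + r0 = 0 by rewrite /a mulrN mulrCA divff // mulr1 addNr.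
      transitivity ((a ^+ 2 + al * a + ga) * (a - al) + (r1 * a + r0)); first by rewrite /r1 /r0; ring.
      rewrite ea addr0; have -> : a ^+ 2 + al * a + ga = (r0 ^+ 2 - r0 * r1 * al + r1 ^+ 2 * ga) * (r1^-1) ^+ 2.
        by rewrite /a; field.
      by ring.
    have vi1 := vV_1 ua vr; apply: (vM_lt1 ua); last by vle ua.
    by apply: (vM_lt1 ua) => //; vle ua.
  have vr02 : v (r0 ^+ 2) < 1.
    have -> : r0 ^+ 2 = (r0 ^+ 2 - r0 * r1 * al + r1 ^+ 2 * ga) + r1 * (r0 * al - r1 * ga) by ring.
    by apply: (uaD_lt ua) => //; apply: (vM_lt1 ua) => //; vle ua.
  have vr00 := v_lt1_sqr ua vr02.
  apply: (nr al val).
  have -> : al ^+ 3 + A * al + B = r1 * al + r0 by rewrite /r1 /r0; ring.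
  by apply: (uaD_lt ua) => //; apply: (vM_lt1 ua).
(* When e2 is not a unit, e is linear modulo p and its norm is e1^3 times minus the cubic at - e0 /
   e1. *)
have {}lt1 : v (e0 ^+ 3 + A * e0 * e1 ^+ 2 - B * e1 ^+ 3) < 1.
  have -> : e0 ^+ 3 + A * e0 * e1 ^+ 2 - B * e1 ^+ 3 = normA A B (e0, e1, e2) +
     e2 * ((2%:R * A * e0 - A ^+ 2 * e2) * e0 - e0 * (e1 * B) - B * (e1 * (e0 - A * e2) + e2 * (A * e1 + B * e2)) - B * e1 * (e0 - A * e2)).
    by rewrite /normA; ring.
  by apply: (uaD_lt ua) => //; apply: (vM_lt1 ua) => //; vle ua.
have [ve1|ve1] := v1_or h1.
  have e10 := v_neq0 ua ve1; have vi := vV_1 ua ve1; pose a := - (e0 / e1).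
  have va : v a <= 1 by rewrite /a; vle ua; rewrite vi.
  apply: (nr a va); have -> : a ^+ 3 + A * a + B = - (e1^-1) ^+ 3 * (e0 ^+ 3 + A * e0 * e1 ^+ 2 - B * e1 ^+ 3).
    by rewrite /a; field.
  by apply: (vMr_lt1 ua) => //; vle ua; rewrite vi.
case: h => h; last by move: ve2; rewrite h (ua1 ua) ltxx.
  move: lt1; rewrite h expr1n mulr1; have -> : 1 + A * e1 ^+ 2 - B * e1 ^+ 3 = e1 * (A * e1 - B * e1 ^+ 2) + 1 by ring.
  by rewrite (uaD_eql ua) (ua1 ua) ?ltxx //; apply: (vM_lt1 ua) => //; vle ua.
by move: ve1; rewrite h (ua1 ua) ltxx.
Qed.

Lemma noroot_isotropic (e : tri K) : e != (0, 0, 0) :> K * K * K -> tiso (gram A B e).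
Proof.
case: e => [[e0 e1] e2] n0; have [t [t0 [h0 h1 h2 h]]] := max_scale ua n0.
have -> : (e0, e1, e2) = scA t (e0 / t, e1 / t, e2 / t) :> tri K.
  by rewrite /scA; congr (_, _, _); rewrite mulrC divfK.
apply/tiso_gram_sc => //; apply: (unimodular_isotropic cv ua pp vp op).
  by split=> /=; [| | |split]; vle ua.
by rewrite gram_det (uaN ua) noroot_norm.
Qed.
End NoRoot.

(* With S = 1 + X / (2 b^2), so that beta = 4 b^2 S and (S - 1)^3 = - h S for h = g / (4 b^4), one has
   (1 - al S)^2 = S (S + be)^2 as soon as be = (al^2 - 3) / 2 and (al^2 - 3)^2 + 8 al = 12 + 4 h. *)
Section Ramified.
Variables (R : realType) (K : fieldType) (v : K -> R) (p : nat).
Hypotheses (cv : is_completion v) (ua : ultra_abs v) (pp : prime p) (vp : v p%:R < 1) (op : odd p).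
Variables (b : nat).
Local Notation g := (gF K b).
Local Notation B := (2%:R * g * b%:R ^+ 2).
Definition betaA (F : fieldType) : tri F := (4%:R * b%:R ^+ 2, 2%:R, 0).

Lemma quartic_poly (h : K) (F := ('X ^+ 2 - 3%:R%:P) ^+ 2 + 8%:R%:P * 'X - (12%:R + 4%:R * h)%:P : {poly K}) :
  v h < 1 -> v 2%:R = 1 -> exists2 al, (al ^+ 2 - 3%:R) ^+ 2 + 8%:R * al - (12%:R + 4%:R * h) = 0 & v (al + 3%:R) < 1.
Proof.
move=> vh v2; have vh' := ltW vh.
have Fx x : F.[x] = (x ^+ 2 - 3%:R) ^+ 2 + 8%:R * x - (12%:R + 4%:R * h).
  by rewrite /F !hornerE.
(* For h = 0 the quartic has the simple root -3, with derivative - 2^6. *)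
have F3 : F.[- 3%:R] = - (4%:R * h) by rewrite Fx; ring.
have [||||r] := hensel cv ua (F := F) (a := - 3%:R).
- rewrite /F; repeat first [apply: (vintD ua) | apply: (vintN ua) | apply: (vintM ua) | apply: (vintXn ua) | exact: (vintX ua) | apply: (vintC ua); by vle ua].
- by vle ua.
- by rewrite F3 (uaN ua); apply: (vMr_lt1 ua) => //; exact: ua_nat.
- have eF : F^`() = 2%:R%:P * ('X ^+ 2 - 3%:R%:P) * (2%:R%:P * 'X) + 8%:R%:P by rewrite /F !derivE; ring.
  have -> : F^`().[- 3%:R] = - 2%:R ^+ 6 by rewrite eF !(hornerD, hornerM, hornerN, hornerXn, hornerX, hornerC); ring.
  by rewrite (uaN ua) (uaX ua) v2 expr1n.
rewrite Fx F3 opprK => hr h3; exists r => //.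
by apply: le_lt_trans h3 _; rewrite (uaN ua); apply: (vMr_lt1 ua) => //; exact: ua_nat.
Qed.

Lemma ramified_iso (e : tri K) : v g < 1 -> tiso (gram g B (mulA g B (betaA K) e)) <-> tiso (gram g B e).
Proof.
move=> vg; have v2 := v2_odd ua pp vp op.
have vb : v b%:R = 1.
  have [//|vb] := v1_or (ua_nat ua b); exfalso.
  have : v (2%:R ^+ 8) < 1.
    have -> : 2%:R ^+ 8 = g + 27%:R * (b%:R * b%:R ^+ 3) by rewrite gFE; ring.
    have h3 : v (b%:R * b%:R ^+ 3) < 1 by apply: (vM_lt1 ua) => //; apply: (vX_le1 ua); exact: ua_nat.
    by apply: (uaD_lt ua) => //; apply: (vMr_lt1 ua) => //; exact: ua_nat.
  by rewrite (uaX ua) v2 expr1n ltxx.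
have b0 := v_neq0 ua vb; have n2 := v_neq0 ua v2.
have e4 : 4%:R = 2%:R * 2%:R :> K by ring.
have n4 : 4%:R != 0 :> K by rewrite e4 mulf_neq0.
pose h := g / (4%:R * b%:R ^+ 4).
have vh : v h < 1.
  have -> : h = g * (2%:R^-1 ^+ 2 * (b%:R^-1) ^+ 4) by rewrite /h; field; rewrite ?b0 ?n2 ?n4.
  have := vV_1 ua vb; have := vV_1 ua v2 => i2 ib; apply: (vM_lt1 ua) => //; vle ua; by rewrite ?i2 ?ib.
have eg : g = 4%:R * b%:R ^+ 4 * h by rewrite /h; field; rewrite ?b0 ?n2 ?n4.
have [al eal val3] := quartic_poly vh v2.
pose be := (al ^+ 2 - 3%:R) / 2%:R; have ebe : al ^+ 2 = 2%:R * be + 3%:R by rewrite /be; field.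
have val : v al <= 1.
  have -> : al = (al + 3%:R) - 3%:R by ring.
  by apply: (uaD_le ua); [exact: ltW | vle ua].
pose c : K := (2%:R * b%:R ^+ 2)^-1; have ec : 2%:R * b%:R ^+ 2 * c = 1 by rewrite /c divff // mulf_neq0 ?expf_neq0.
pose S : tri K := (1, c, 0).
pose W1 : tri K := (1 - al, - al * c, 0); pose W2 : tri K := (1 + be, c, 0).
have ebe2 : be ^+ 2 = 3%:R + h - 2%:R * al.
  apply: (mulfI n4); transitivity ((al ^+ 2 - 3%:R) ^+ 2); first by rewrite ebe; ring.
  by apply/eqP; rewrite -subr_eq0; apply/eqP; rewrite -eal; ring.
have e3 : B * c ^+ 3 = h by rewrite eg; transitivity (h * (2%:R * b%:R ^+ 2 * c) ^+ 3); [ring | rewrite ec expr1n mulr1].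
have e2 : g * c ^+ 2 = h by rewrite eg; transitivity (h * (2%:R * b%:R ^+ 2 * c) ^+ 2); [ring | rewrite ec expr1n mulr1].
have key : mulA g B W1 W1 = mulA g B S (mulA g B W2 W2).
  move: e3 e2; move: (B) => B'; move: (g) => g' e3 e2; rewrite /mulA /W1 /W2 /S; congr (_, _, _).
  - transitivity ((1 + be) ^+ 2 - B' * c ^+ 3); last by ring.
    rewrite e3; ring: ebe ebe2.
  - transitivity (c * ((1 + be) * (3%:R + be) - g' * c ^+ 2)); last by ring.
    rewrite e2; ring: ebe ebe2.
  - ring: ebe.
have nS : normA g B S = 1.
  transitivity (1 + g * c ^+ 2 - B * c ^+ 3); first by rewrite /normA /S; move: (B) (g) => B' g'; ring.
  by rewrite e2 e3 addrK.
(* As al is close to -3, be is close to 3, and the norm of [W2] is close to 2^6. *)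
have nW2 : normA g B W2 != 0.
  have e1 : normA g B W2 = be ^+ 3 + 3%:R * be ^+ 2 + (3%:R + h) * be + 1.
    transitivity ((1 + be) ^+ 3 + (1 + be) * (g * c ^+ 2) - B * c ^+ 3); first by rewrite /normA /W2; move: (B) (g) => B' g'; ring.
    by rewrite e2 e3; ring.
  have d : be - 3%:R = (al + 3%:R) * ((al - 3%:R) / 2%:R) by rewrite /be; field.
  have i2 := vV_1 ua v2.
  have vd : v (be - 3%:R) < 1 by rewrite d; apply: (vM_lt1 ua) => //; vle ua; rewrite i2.
  have vbe : v be <= 1 by rewrite /be; vle ua; rewrite i2.
  apply: (v_neq0 ua); apply: (v_near1 ua (y := 2%:R ^+ 6)); first by rewrite (uaX ua) v2 expr1n.
  have -> : normA g B W2 - 2%:R ^+ 6 = (be - 3%:R) * (be ^+ 2 + 6%:R * be + 21%:R) + h * be by rewrite e1; ring.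
  by apply: (uaD_lt ua); apply: (vM_lt1 ua) => //; vle ua.
have nW1 : normA g B W1 != 0.
  have := congr1 (normA g B) key; rewrite !normA_mul nS mul1r => e1.
  by apply: contra_neq nW2 => e0; move: e1; rewrite e0 mul0r => /esym/eqP; rewrite mulf_eq0 orbb => /eqP.
rewrite -(tiso_gram_square e nW1) key mulAA (tiso_gram_square _ nW2).
have -> : betaA K = scA (4%:R * b%:R ^+ 2) S.
  rewrite /betaA /S /scA; congr (_, _, _); rewrite ?mulr1 ?mulr0 //.
  by transitivity (2%:R * (2%:R * b%:R ^+ 2 * c)); [rewrite ec mulr1|ring].
rewrite -(scA_mul g B) -mulAA scA_mul tiso_gram_sc ?[mulA g B S e]mulAC //.
by rewrite mulf_neq0 ?expf_neq0.
Qed.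
End Ramified.

(** * The forms when the cubic has a rational root *)

Section SplitForm.
Variables (K : fieldType) (A B th m d : K).
Hypotheses (eA : A = m ^+ 2 + d ^+ 2 + 2%:R * m * th) (eB : B = - th * (m ^+ 2 + d ^+ 2)) (e0 : 2%:R * m + th = 0).
Hypotheses (d0 : d != 0) (n2 : 2%:R != 0 :> K).
Definition fp := (th - m) ^+ 2 + d ^+ 2.
Hypothesis f0 : fp != 0.
Definition c0 (e : tri K) : K := let: (e0, e1, e2) := e in e0 + e1 * m + e2 * (m ^+ 2 - d ^+ 2).
Definition c1 (e : tri K) : K := let: (e0, e1, e2) := e in d * (e1 + 2%:R * e2 * m).
(** By Euler's formula the coefficient of X^2 in u is the sum of u(t) / f'(t) over the roots t. Here
    [fp] is f'(th), e(m + d i) is c0 + c1 i, and the quotient of e by f' at m + d i is sa0 + sa1 i.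
    So [split_form] is the trace form in the coordinates u(th) and u(m + d i) = y + z i. *)
Definition sa0 e := (- (d * c0 e) + (m - th) * c1 e) / (2%:R * d * fp).
Definition sa1 e := - (d * c1 e + (m - th) * c0 e) / (2%:R * d * fp).
Definition split_form e := TForm (ev e th / fp) (2%:R * sa0 e) (- 2%:R * sa0 e) (- 2%:R * sa1 e) 0 0.

Definition interp (x y z : K) : tri K :=
  let u2 := (x - y - z / d * (th - m)) / fp in
  (y - z / d * m + u2 * (m ^+ 2 + d ^+ 2), z / d - 2%:R * m * u2, u2).
Lemma interp_ev x y z : ev (interp x y z) th = x /\ c0 (interp x y z) = y /\ c1 (interp x y z) = z.
Proof.
have fpE : (th - m) ^+ 2 + d ^+ 2 != 0 by [].
rewrite /interp /ev /c0 /c1 /fp; do 2?split; first by field; rewrite fpE d0.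
  by field; rewrite fpE d0.
by field; rewrite fpE d0.
Qed.

Lemma Qf_interp e x y z : Qf A B e (interp x y z) = teval (split_form e) x y z.
Proof.
have fpE : (th - m) ^+ 2 + d ^+ 2 != 0 by [].
have eth : th = - (2%:R * m) by apply/eqP; rewrite -addr_eq0 addrC e0.
move: fpE; case: e => [[u0 u1] u2]; rewrite /split_form /Qf /top /interp /teval /sa0 /sa1 /ev /c0 /c1 /fp /mulA /=.
rewrite eA eB eth => fpE; field; by rewrite ?fpE ?d0 ?n2.
Qed.

Lemma split_iso e : tiso (split_form e) -> tiso (gram A B e).
Proof.
move=> [x [y [z [n0 h]]]]; apply/tiso_gram; exists (interp x y z); rewrite Qf_interp; split=> //.
have [h1 [h2 h3]] := interp_ev x y z; apply: contra_neq n0 => e1; rewrite e1 /= in h1 h2 h3.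
by congr (_, _, _); rewrite -?h1 -?h2 -?h3; ring.
Qed.

Lemma split_iso_inv e : tiso (gram A B e) -> tiso (split_form e).
Proof.
move=> /tiso_gram[[[u0 u1] u2] [n0 h]].
have eu : (u0, u1, u2) = interp (ev (u0, u1, u2) th) (c0 (u0, u1, u2)) (c1 (u0, u1, u2)).
  have fpE : (th - m) ^+ 2 + d ^+ 2 != 0 by [].
  by rewrite /interp /ev /c0 /c1 /fp; congr (_, _, _); field; rewrite fpE d0.
exists (ev (u0, u1, u2) th), (c0 (u0, u1, u2)), (c1 (u0, u1, u2)); rewrite -Qf_interp -eu; split=> //.
apply: contra_neq n0 => -[h1 h2 h3]; rewrite eu /ev /c0 /c1 /= h1 h2 h3 /interp; congr (_, _, _); ring.
Qed.

Lemma split_norm e : sa0 e ^+ 2 + sa1 e ^+ 2 = (c0 e ^+ 2 + c1 e ^+ 2) / (4%:R * d ^+ 2 * fp).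
Proof.
have n4 : 4%:R != 0 :> K by rewrite (_ : 4%:R = 2%:R * 2%:R) ?mulf_neq0 //; ring.
have fpE : (th - m) ^+ 2 + d ^+ 2 != 0 by [].
rewrite /sa0 /sa1 /fp; move: (c0 e) (c1 e) => x y; field; by rewrite ?fpE ?d0 ?n2 ?n4.
Qed.

End SplitForm.

(* A root th of x^3 + g x + 2 g b^2 determines the two others, m +- d i. *)
Lemma split_root (K : fieldType) (b : nat) (th : K) (m := - th / 2%:R) (f1 := 3%:R * th ^+ 2 + gF K b)
    (d := 16%:R * gF K b / f1) : 2%:R != 0 :> K -> f1 != 0 -> fb b th = 0 ->
  [/\ gF K b = m ^+ 2 + d ^+ 2 + 2%:R * m * th, 2%:R * gF K b * b%:R ^+ 2 = - th * (m ^+ 2 + d ^+ 2),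
     2%:R * m + th = 0 & fp th m d = f1].
Proof.
move=> n2 n1 fth; have e2m : 2%:R * m = - th by rewrite /m mulrC divfK.
have ed : d * f1 = 16%:R * gF K b by rewrite /d divfK.
have n4 : 4%:R != 0 :> K by rewrite (_ : 4%:R = 2%:R * 2%:R) ?mulf_neq0 //; ring.
(* Both sides are minus the discriminant of the quadratic cofactor of x - th; the identity 256 = g +
   27 b^4 is what makes d rational. *)
have key : 4%:R * d ^+ 2 = 4%:R * gF K b + 3%:R * th ^+ 2.
  apply: (mulIf (expf_neq0 2 n1)).
  transitivity (4%:R * (d * f1) ^+ 2); first by ring.
  rewrite ed; transitivity (4%:R * gF K b ^+ 2 * 256%:R); first by ring.
  rewrite -(gF_256 K b) /f1; move: fth; rewrite /fb; move: (gF K b) => g fth.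
  transitivity (4%:R * g ^+ 2 * (g + 27%:R * b%:R ^+ 4) + 27%:R * (th ^+ 3 + g * th + 2%:R * g * b%:R ^+ 2) * (th ^+ 3 + g * th - 2%:R * g * b%:R ^+ 2)).
    by rewrite fth; ring.
  by ring.
have ms : m ^+ 2 + d ^+ 2 = gF K b + th ^+ 2.
  apply: (mulfI n4); rewrite mulrDr key; transitivity ((2%:R * m) ^+ 2 + (4%:R * gF K b + 3%:R * th ^+ 2)); first by ring.
  by rewrite e2m; ring.
have e0 : 2%:R * m + th = 0 by rewrite e2m addNr.
split=> //.
- by rewrite ms e2m; ring.
- rewrite ms; apply/eqP; rewrite -subr_eq0 -fth /fb; apply/eqP; ring.
- transitivity (th ^+ 2 - 2%:R * m * th + (m ^+ 2 + d ^+ 2)); first by rewrite /fp; ring.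
  by rewrite ms e2m /f1; ring.
Qed.

(** * Even valuations, and the local data extracted from Sha *)

Section EvenValue.
Variables (R : realType) (K : fieldType) (v : K -> R) (ua : ultra_abs v).
Definition evn (x : R) : Prop := exists2 s : K, s != 0 & x = v s ^+ 2.
Lemma evnM x y : evn x -> evn y -> evn (x * y).
Proof. by move=> [s s0 ->] [t t0 ->]; exists (s * t); rewrite ?mulf_neq0 // (ua_M ua) exprMn. Qed.
Lemma evnV x : evn x -> evn x^-1.
Proof. by move=> [s s0 ->]; exists s^-1; rewrite ?invr_eq0 // (uaV ua) exprVn. Qed.
Lemma evn1 : evn 1. Proof. by exists 1; rewrite ?oner_eq0 // (ua1 ua) expr1n. Qed.
Lemma evn_div x y z : evn z -> evn x -> y != 0 -> z = x * y -> evn y.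
Proof.
move=> hz hx y0 e; have x0 : x != 0 by case: hx => s s0 ->; rewrite expf_neq0 // gt_eqF // (ua_gt0 ua).
have -> : y = z * x^-1 by rewrite e mulrC mulKf.
exact: evnM hz (evnV hx).
Qed.
End EvenValue.

Section EvenCoordinate.
Variables (R : realType) (K : fieldType) (v : K -> R) (ua : ultra_abs v).
Variables (L : fieldType) (S : L -> Prop) (w : L -> R).
Hypotheses (S1 : S 1) (SD : forall x y, S x -> S y -> S (x + y)) (SN : forall x, S x -> S (- x))
  (SM : forall x y, S x -> S y -> S (x * y)).
Hypotheses (wN : forall x, S x -> w (- x) = w x)
  (wM : forall x y, S x -> S y -> w (x * y) = w x * w y)
  (wD : forall x y, S x -> S y -> w (x + y) <= Num.max (w x) (w y))
  (wV : forall x, S x -> x != 0 -> exists2 s : K, s != 0 & w x = v s).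
Local Notation evn := (evn v).

Lemma evn_sqr x : S x -> x != 0 -> evn (w x ^+ 2).
Proof. by move=> Sx x0; have [s s0 ->] := wV Sx x0; exists s. Qed.

Lemma w_dom x y : S x -> S y -> w y < w x -> w (x + y) = w x.
Proof.
move=> Sx Sy h; apply/le_anti/andP; split.
  by apply: le_trans (wD Sx Sy) _; rewrite ge_max lexx ltW.
have := wD (SD Sx Sy) (SN Sy); rewrite addrK wN // le_max => /orP[//|].
by rewrite leNgt h.
Qed.

(** Good reduction makes Kummer classes unramified. If |X| > 1 the three factors all have value |X|,
    and |X|^3 = |Y|^2; otherwise at most one factor is not a unit, as the roots differ by units. The
    value [w] is given only on a subring [S], in practice K(I), so that none is needed on the
    algebraic closure. *)
Lemma even_coordinate X Y t1 t2 t3 : S X -> S Y -> S t1 -> S t2 -> S t3 ->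
  w t1 <= 1 -> w t2 <= 1 -> w t3 <= 1 -> w (t1 - t2) = 1 -> w (t1 - t3) = 1 ->
  Y != 0 -> X - t1 != 0 -> w ((X - t1) * (X - t2) * (X - t3)) = w Y ^+ 2 -> evn (w (X - t1)).
Proof.
move=> SX SY St1 St2 St3 h1 h2 h3 h12 h13 Y0 X1; have SB x y (Sx : S x) (Sy : S y) : S (x - y) := SD Sx (SN Sy).
have S'1 := SB _ _ SX St1; have S'2 := SB _ _ SX St2; have S'3 := SB _ _ SX St3.
rewrite !wM //; last exact: SM.
move=> eprod; have eY := evn_sqr SY Y0.
have [wX|wX] := ltP 1 (w X).
  have dom t : S t -> w t <= 1 -> w (X - t) = w X.
    by move=> St ht; apply: w_dom => //; [exact: SN | rewrite wN //; exact: le_lt_trans wX].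
  rewrite !dom // in eprod *; apply: (evn_div ua (z := w Y ^+ 2) (x := w X ^+ 2)); first exact: eY.
  - apply: evn_sqr => //; apply/eqP => X0; have S0 : S 0 by rewrite -(addrN 1); exact: SB.
    by have := wM S0 S0; rewrite mulr0 -X0; apply/eqP; rewrite lt_eqF // ltr_pMl // (lt_trans _ wX).
  - by rewrite gt_eqF // (lt_trans _ wX).
  by rewrite -eprod expr2.
have le1 t : S t -> w t <= 1 -> w (X - t) <= 1.
  by move=> St ht; apply: le_trans (wD SX (SN St)) _; rewrite ge_max wX wN.
have [lt1|ge1] := ltP (w (X - t1)) 1; last first.
  have -> : w (X - t1) = 1 by apply/le_anti; rewrite ge1 le1.
  exact: evn1.
have other t : S t -> w (t1 - t) = 1 -> w (X - t) = 1.
  move=> St h; have -> : X - t = (t1 - t) + (X - t1) by ring.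
  by rewrite w_dom // ?h //; exact: SB.
by move: eprod; rewrite (other t2) // (other t3) // !mulr1 => ->.
Qed.
End EvenCoordinate.

Definition mapA (K L : fieldType) (j : K -> L) (e : tri K) : tri L := let: (e0, e1, e2) := e in (j e0, j e1, j e2).

Section LocalData.
Variables (b : nat) (K L : fieldType) (j : {rmorphism K -> L}) (e : tri K).
Local Notation g := (gF L b).
Local Notation x1 := (- 3%:R * b%:R ^+ 2 : L).
Local Notation ep := (ev (mapA j e)).

(** What local triviality of c gives at one place: if c is the coboundary of R, then (X, Y) = 2 R,
    and n_j is a square root of X - t_j times the descended square root of e(t_j) (x1 - t_(j+1)).
    The two factors have the same character, so n_j is fixed with I and the roots. *)
Record ldata (I t1 t2 t3 X Y n1 n2 n3 : L) : Prop := LData {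
  ld_I : I ^+ 2 = -1;
  ld_s1 : t1 + t2 + t3 = 0;
  ld_s2 : t1 * t2 + t1 * t3 + t2 * t3 = g;
  ld_s3 : t1 * t2 * t3 = - (2%:R * g * b%:R ^+ 2);
  ld_vdm : (t1 - t2) * (t1 - t3) * (t2 - t3) = 32%:R * g * I;
  ld_ep : [/\ ep t1 != 0, ep t2 != 0 & ep t3 != 0];
  ld_curve : Y ^+ 2 = fb b X;
  ld_Y : Y != 0;
  ld_1 : n1 ^+ 2 = (X - t1) * ep t1 * (x1 - t2);
  ld_2 : n2 ^+ 2 = (X - t2) * ep t2 * (x1 - t3);
  ld_3 : n3 ^+ 2 = (X - t3) * ep t3 * (x1 - t1);
  ld_fix : forall t : gal j, t I = I -> t t1 = t1 -> t t2 = t2 -> t t3 = t3 ->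
    [/\ t X = X, t Y = Y, t n1 = n1, t n2 = n2 & t n3 = n3];
  ld_move : forall t : gal j, t I = - I ->
    sadd g (Some (X, Y)) (Some (x1, 16%:R * b%:R * I)) = Some (t X, t Y) }.

Lemma ldata_rot I t1 t2 t3 X Y n1 n2 n3 : ldata I t1 t2 t3 X Y n1 n2 n3 -> ldata I t2 t3 t1 X Y n2 n3 n1.
Proof.
case=> h1 h2 h3 h4 h5 [h6 h6' h6''] h7 h8 h9 h10 h11 h12 h13; split=> //.
- by rewrite -h2; ring.
- by rewrite -h3; ring.
- by rewrite -h4; ring.
- by rewrite -h5; ring.
- by move=> t e1 e2 e3 e4; have [] := h12 t e1 e4 e2 e3.
Qed.

Lemma ld_fbE I t1 t2 t3 X Y n1 n2 n3 : ldata I t1 t2 t3 X Y n1 n2 n3 ->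
  forall x, fb b x = (x - t1) * (x - t2) * (x - t3).
Proof.
move=> h x; transitivity (x ^+ 3 - (t1 + t2 + t3) * x ^+ 2 + (t1 * t2 + t1 * t3 + t2 * t3) * x - t1 * t2 * t3); last by ring.
by rewrite (ld_s1 h) (ld_s2 h) (ld_s3 h) /fb; ring.
Qed.

(** A cyclic relabelling makes the root in K the first one; [ld_vdm] then decides which of m + d I
    and m - d I comes second. *)
Lemma ld_root I t1 t2 t3 X Y n1 n2 n3 (th : K) (f1 := 3%:R * th ^+ 2 + gF K b) :
  ldata I t1 t2 t3 X Y n1 n2 n3 -> fb b th = 0 -> 2%:R != 0 :> K -> f1 != 0 ->
  exists t2 t3 n1 n2 n3, [/\ ldata I (j th) t2 t3 X Y n1 n2 n3,
    t2 = j (- th / 2%:R) + j (16%:R * gF K b / f1) * I & t3 = j (- th / 2%:R) - j (16%:R * gF K b / f1) * I].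
Proof.
move=> h fth m2 m1.
have [t2' [t3' [n1' [n2' [n3' h']]]]] : exists t2 t3 n1 n2 n3, ldata I (j th) t2 t3 X Y n1 n2 n3.
  have : (j th - t1) * (j th - t2) * (j th - t3) == 0 by rewrite -(ld_fbE h) -rmorph_fb fth rmorph0.
  rewrite !mulf_eq0 !subr_eq0 -orbA => /or3P[] /eqP ->; [exists t2, t3, n1, n2, n3 | exists t3, t1, n2, n3, n1 | exists t1, t2, n3, n1, n2] => //.
    exact: ldata_rot.
  by do 2!apply: ldata_rot.
exists t2', t3', n1', n2', n3'; split=> //; have jn2 : 2%:R != 0 :> L by rewrite -(rmorph_nat j) fmorph_eq0.
all: apply: (mulfI jn2).
all: have e2 : 2%:R * j (- th / 2%:R) = - j th by rewrite -[2%:R](rmorph_nat j) -rmorphM mulrC divfK // rmorphN.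
all: have ef : (j th - t2') * (j th - t3') = j f1 by
  rewrite /f1 rmorphD rmorphM rmorph_nat rmorphXn rmorph_gF -(ld_s2 h'); have := ld_s1 h'; set T := j th => es;
  transitivity (3%:R * T ^+ 2 + (T * t2' + T * t3' + t2' * t3') - 2%:R * T * (T + t2' + t3')); [ring | rewrite es; ring].
all: have jf : j f1 != 0 by rewrite fmorph_eq0.
all: have ed : t2' - t3' = 2%:R * (j (16%:R * gF K b / f1) * I) by
  apply: (mulfI jf); rewrite -{1}ef (ld_vdm h') fmorph_div (rmorphM j 16%:R) rmorph_nat rmorph_gF; field.
all: have es : t2' + t3' = - j th by apply/eqP; rewrite -addr_eq0 addrC addrA (ld_s1 h').
- transitivity ((t2' + t3') + (t2' - t3')); first by ring.
  by rewrite es ed mulrDr e2.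
- transitivity ((t2' + t3') - (t2' - t3')); first by ring.
  by rewrite es ed mulrBr e2.
Qed.
End LocalData.

Section QuadraticExtension.
Variables (K : fieldType) (L : closedFieldType) (j : {rmorphism K -> L}) (I : L).
Hypothesis I2 : I ^+ 2 = -1.
Definition KI (z : L) : Prop := exists a c, z = j a + j c * I.
Lemma KI_j a : KI (j a). Proof. by exists a, 0; rewrite rmorph0 mul0r addr0. Qed.
Lemma KI_I : KI I. Proof. by exists 0, 1; rewrite rmorph0 rmorph1 mul1r add0r. Qed.
Lemma KI_D x y : KI x -> KI y -> KI (x + y).
Proof. by move=> [a [c ->]] [a' [c' ->]]; exists (a + a'), (c + c'); rewrite !rmorphD; ring. Qed.
Lemma KI_N x : KI x -> KI (- x).
Proof. by move=> [a [c ->]]; exists (- a), (- c); rewrite !rmorphN; ring. Qed.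
Lemma KI_M x y : KI x -> KI y -> KI (x * y).
Proof.
move=> [a [c ->]] [a' [c' ->]]; exists (a * a' - c * c'), (a * c' + c * a').
by rewrite rmorphB rmorphD !rmorphM; ring: I2.
Qed.
Lemma KI_fixed z : has_char0 L -> (forall x, algebraicOver j x) ->
  (forall t : gal j, t I = I -> t z = z) -> KI z.
Proof.
move=> c0 aj h; apply: contrapT => nz.
have [|||t [ht tz]] := gal_moves (D := KI) c0 aj _ _ _ nz.
- exact: KI_j.
- by move=> x y hx hy; apply: KI_D => //; exact: KI_N.
- exact: KI_M.
by move: tz; rewrite h ?eqxx //; apply: ht; exact: KI_I.
Qed.

Section NotIn.
Hypothesis nI : forall k : K, k ^+ 2 != -1.
Lemma KI_inj a c a' c' : j a + j c * I = j a' + j c' * I -> a = a' /\ c = c'.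
Proof.
move=> h; have [ec|nc] := eqVneq c c'.
  by split=> //; move: h; rewrite ec => /addIr /fmorph_inj.
have cc : c - c' != 0 by rewrite subr_eq0.
have : I = j ((a' - a) / (c - c')).
  apply: (mulfI (x := j (c - c'))); first by rewrite fmorph_eq0.
  rewrite -rmorphM [_ * ((a' - a) / _)]mulrC divfK // !rmorphB; apply/eqP; rewrite -subr_eq0; apply/eqP.
  by transitivity ((j a + j c * I) - (j a' + j c' * I)); [ring | rewrite h subrr].
move=> e; exfalso; have := nI ((a' - a) / (c - c')); rewrite -(inj_eq (fmorph_inj j)) rmorphXn -e I2 rmorphN rmorph1.
by rewrite eqxx.
Qed.
End NotIn.
End QuadraticExtension.

Lemma mapA_mulA (K L : fieldType) (j : {rmorphism K -> L}) (A B : K) (u w : tri K) :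
  mapA j (mulA A B u w) = mulA (j A) (j B) (mapA j u) (mapA j w).
Proof. by case: u w => [[? ?] ?] [[? ?] ?]; rewrite /mapA /mulA; congr (_, _, _); rewrite !(rmorphB, rmorphD, rmorphM). Qed.

Lemma mapA_beta (K L : fieldType) (j : {rmorphism K -> L}) b : mapA j (betaA b K) = betaA b L.
Proof. by rewrite /mapA /betaA rmorphM rmorphXn !rmorph_nat rmorph0. Qed.

Lemma ev_map_split (K L : fieldType) (j : {rmorphism K -> L}) (I : L) (m d : K) (e : tri K) : I ^+ 2 = -1 ->
  ev (mapA j e) (j m + j d * I) = j (c0 m d e) + j (c1 m d e) * I /\
  ev (mapA j e) (j m - j d * I) = j (c0 m d e) - j (c1 m d e) * I.
Proof.
move=> I2; case: e => [[e0 e1] e2]; rewrite /mapA /ev /c0 /c1.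
have -> : j (e0 + e1 * m + e2 * (m ^+ 2 - d ^+ 2)) = j e0 + j e1 * j m + j e2 * (j m ^+ 2 - j d ^+ 2).
  by rewrite !(rmorphN, rmorphD, rmorphXn, rmorphM).
have -> : j (d * (e1 + 2%:R * e2 * m)) = j d * (j e1 + 2%:R * j e2 * j m).
  by rewrite rmorphM rmorphD (rmorphM j _ m) rmorphM rmorph_nat.
by split; ring: I2.
Qed.

Lemma rmorph_cB (K L : fieldType) (j : {rmorphism K -> L}) b :
  j (2%:R * gF K b * b%:R ^+ 2) = 2%:R * gF L b * b%:R ^+ 2.
Proof. by rewrite (rmorphM j (2%:R * _)) (rmorphM j 2%:R) (rmorphXn j) !rmorph_nat rmorph_gF. Qed.

Section Disc.
Variables (R : realType) (K : fieldType) (v : K -> R) (p : nat).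
Hypotheses (cv : is_completion v) (ua : ultra_abs v) (pp : prime p) (vp : v p%:R < 1) (op : odd p).
Variables (b : nat).
Hypothesis vg : v (gF K b) = 1.

Lemma disc_unit a : v a <= 1 -> v (fb b a) < 1 -> v (3%:R * a ^+ 2 + gF K b) = 1.
Proof.
move=> va vf; have v2 := v2_odd ua pp vp op.
(* A Bezout relation expressing the discriminant, here the unit 2^10 g^2, through f and f'. *)
have e : (6%:R * gF K b * a ^+ 2 - 18%:R * gF K b * b%:R ^+ 2 * a + 4%:R * gF K b ^+ 2) * (3%:R * a ^+ 2 + gF K b) =
    2%:R ^+ 10 * gF K b ^+ 2 - fb b a * (54%:R * gF K b * b%:R ^+ 2 - 18%:R * gF K b * a).
  transitivity (4%:R * gF K b ^+ 2 * 256%:R - fb b a * (54%:R * gF K b * b%:R ^+ 2 - 18%:R * gF K b * a)); last by ring.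
  by rewrite -(gF_256 K b) /fb; ring.
have vg1 : v (gF K b) <= 1 by rewrite vg.
have l1 : v (3%:R * a ^+ 2 + gF K b) <= 1 by vle ua.
have [//|l2] := v1_or l1; have : v (2%:R ^+ 10 * gF K b ^+ 2) < 1; last first.
  by rewrite (ua_M ua) !(uaX ua) v2 vg !expr1n mulr1 ltxx.
move/eqP: e; rewrite eq_sym subr_eq => /eqP ->; apply: (uaD_lt ua).
  by apply: (vMr_lt1 ua) => //; vle ua.
by apply: (vM_lt1 ua) => //; vle ua.
Qed.

Lemma root_int a : fb b a = 0 -> v a <= 1.
Proof.
move=> fa; rewrite leNgt; apply/negP => va; have : v (a ^+ 3) <= v a.
  have -> : a ^+ 3 = - (gF K b * a + 2%:R * gF K b * b%:R ^+ 2) by apply/eqP; rewrite -addr_eq0 addrA -/(fb b a) fa.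
  rewrite (uaN ua); apply: (uaD_le ua); first by rewrite (ua_M ua) vg mul1r.
  have vg1 : v (gF K b) <= 1 by rewrite vg.
  by apply: le_trans (ltW va); vle ua.
rewrite (uaX ua) exprS -[leRHS]mulr1 ler_pM2l ?(lt_trans _ va) //.
by apply/negP; rewrite -ltNge exprn_egt1.
Qed.

Lemma root_or_not : (exists th : K, fb b th = 0) \/ (forall a, v a <= 1 -> v (a ^+ 3 + gF K b * a + 2%:R * gF K b * b%:R ^+ 2) = 1).
Proof.
have vg1 : v (gF K b) <= 1 by rewrite vg.
have [[a [va fa]]|nr] := pselect (exists a, v a <= 1 /\ v (fb b a) < 1); [left|right]; last first.
  move=> a va; have l1 : v (fb b a) <= 1 by rewrite /fb; vle ua.
  by have [//|l2] := v1_or l1; exfalso; apply: nr; exists a.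
pose F : {poly K} := 'X ^+ 3 + (gF K b)%:P * 'X + (2%:R * gF K b * b%:R ^+ 2)%:P.
have Fx x : F.[x] = fb b x by rewrite /F !(hornerD, hornerM, hornerXn, hornerX, hornerC).
have F'x x : F^`().[x] = 3%:R * x ^+ 2 + gF K b.
  rewrite /F !derivE !(hornerD, hornerM, hornerMn, hornerXn, hornerX, hornerC); ring.
have [||||r fr _] := hensel cv ua (F := F) (a := a) => //.
- rewrite /F; repeat first [apply: (vintD ua) | apply: (vintM ua) | apply: (vintXn ua) | exact: (vintX ua) | apply: (vintC ua); by vle ua].
- by rewrite Fx.
- by rewrite F'x disc_unit.
by exists r; rewrite -Fx.
Qed.
End Disc.

Section EvenCore.
Variables (R : realType) (K : fieldType) (v : K -> R) (p : nat).
Hypotheses (cv : is_completion v) (ua : ultra_abs v) (pp : prime p) (vp : v p%:R < 1) (op : odd p).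
Variables (b : nat).
Hypothesis ob : b%:R != 0 :> K.
Hypothesis vg : v (gF K b) = 1.
Variables (L : fieldType) (j : {rmorphism K -> L}) (S : L -> Prop) (w : L -> R).
Hypotheses (SD : forall x y, S x -> S y -> S (x + y)) (SN : forall x, S x -> S (- x))
  (SM : forall x y, S x -> S y -> S (x * y)) (Sj : forall a, S (j a)).
Hypotheses (wj : forall a, w (j a) = v a)
  (wM : forall x y, S x -> S y -> w (x * y) = w x * w y)
  (wD : forall x y, S x -> S y -> w (x + y) <= Num.max (w x) (w y))
  (wV : forall x, S x -> x != 0 -> exists2 s : K, s != 0 & w x = v s).
Variables (e : tri K) (I t1 t2 t3 X Y n1 n2 n3 : L) (th : K).
Hypothesis h : ldata b j e I t1 t2 t3 X Y n1 n2 n3.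
Hypotheses (fth : fb b th = 0) (et1 : t1 = j th).
Hypotheses (SI : S I) (St2 : S t2) (St3 : S t3) (SX : S X) (SY : S Y) (Sn1 : S n1) (Sn2 : S n2) (Sn3 : S n3).
Local Notation evn := (evn v).

Lemma core_S1 : S 1. Proof. by rewrite -(rmorph1 j). Qed.
Lemma core_wN x : S x -> w (- x) = w x.
Proof.
by move=> Sx; rewrite -mulN1r -(rmorph1 j) -rmorphN wM // wj (uaN ua) (ua1 ua) mul1r.
Qed.
Let ew := even_coordinate ua core_S1 SD SN SM core_wN wM wD wV.
Let SB x y : S x -> S y -> S (x - y). Proof. by move=> Sx Sy; apply: SD => //; exact: SN. Qed.
Let vg1 : v (gF K b) <= 1. Proof. by rewrite vg. Qed.
Let wg : w (gF L b) = 1. Proof. by rewrite -(rmorph_gF j) wj. Qed.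
Let St1 : S t1. Proof. by rewrite et1. Qed.

Lemma core_w_le t : S t -> fb b t = 0 -> w t <= 1.
Proof.
move=> St ft; rewrite leNgt; apply/negP => wt.
have S3 : S (t * (t * t)) by do !apply: SM.
have eb : 2%:R * gF L b * b%:R ^+ 2 = j (2%:R * gF K b * b%:R ^+ 2) by rewrite rmorph_cB.
have : w (t * (t * t)) <= w t.
  have -> : t * (t * t) = - (gF L b * t + 2%:R * gF L b * b%:R ^+ 2).
    by apply/eqP; rewrite -addr_eq0 -ft /fb; apply/eqP; ring.
  have Sgt : S (gF L b * t) by apply: SM; rewrite // -(rmorph_gF j).
  have Sb : S (2%:R * gF L b * b%:R ^+ 2) by rewrite eb.
  rewrite core_wN; last exact: SD.
  apply: le_trans (wD Sgt Sb) _; rewrite ge_max wM // ?wg ?mul1r ?lexx /=; last by rewrite -(rmorph_gF j).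
  rewrite eb wj; apply: le_trans (ltW wt); vle ua.
rewrite !wM //; last exact: SM.
rewrite -[leRHS]mulr1 ler_pM2l ?(lt_trans _ wt) //.
by apply/negP; rewrite -ltNge -[1]mulr1 ltr_pM // ltW.
Qed.

(** The differences are integral and their product 32 g I is a unit. *)
Lemma core_units : [/\ w (t1 - t2) = 1, w (t1 - t3) = 1 & w (t2 - t3) = 1].
Proof.
have f1 : fb b t1 = 0 by rewrite (ld_fbE h); ring.
have f2 : fb b t2 = 0 by rewrite (ld_fbE h); ring.
have f3 : fb b t3 = 0 by rewrite (ld_fbE h); ring.
have le1 x y : S x -> S y -> fb b x = 0 -> fb b y = 0 -> w (x - y) <= 1.
  by move=> Sx Sy fx fy; apply: le_trans (wD Sx (SN Sy)) _; rewrite core_wN // ge_max !core_w_le.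
have l12 := le1 _ _ St1 St2 f1 f2; have l13 := le1 _ _ St1 St3 f1 f3; have l23 := le1 _ _ St2 St3 f2 f3.
have v2 := v2_odd ua pp vp op.
have w1 : w 1 = 1 by rewrite -(rmorph1 j) wj (ua1 ua).
have wI : w I ^+ 2 = 1 by rewrite expr2 -wM // -expr2 (ld_I h) core_wN ?w1 //; exact: core_S1.
have S12 := SB St1 St2; have S13 := SB St1 St3; have S23 := SB St2 St3.
have p2 : (w (t1 - t2) * w (t1 - t3) * w (t2 - t3)) ^+ 2 = 1.
  rewrite -(wM S12 S13) -(wM (SM S12 S13) S23).
  rewrite (ld_vdm h) -[32%:R](rmorph_nat j) -(rmorph_gF j) -rmorphM wM // exprMn wI mulr1 wj (ua_M ua) vg mulr1.
  have -> : 32%:R = 2%:R ^+ 5 :> K by ring.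
  by rewrite (uaX ua) v2 !expr1n.
have nn x y : S x -> S y -> 0 <= w (x - y).
  move=> Sx Sy; have [->|n0] := eqVneq (x - y) 0; first by rewrite -(rmorph0 j) wj (ua_ge0 ua).
  by have [s _ ->] := wV (SB Sx Sy) n0; exact: ua_ge0.
have n12 := nn _ _ St1 St2; have n13 := nn _ _ St1 St3; have n23 := nn _ _ St2 St3.
have p1 : w (t1 - t2) * w (t1 - t3) * w (t2 - t3) = 1.
  by apply/eqP; rewrite -sqrp_eq1 ?p2 // !mulr_ge0.
move: p1 l12 l13 l23 n12 n13 n23; move: (w (t1 - t2)) => x; move: (w (t1 - t3)) => y; move: (w (t2 - t3)) => z hp x1 y1 z1 x0 y0 z0.
have hx : 1 <= x by have := ler_wpM2l x0 (mulr_ile1 y0 z0 y1 z1); rewrite mulr1 mulrA hp.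
have hy : 1 <= y by rewrite -hp mulrAC ler_piMl // mulr_ile1 ?mulr_ge0.
have hz : 1 <= z by have := ler_wpM2r z0 (mulr_ile1 x0 y0 x1 y1); rewrite mul1r hp.
by split; apply/le_anti; rewrite ?x1 ?y1 ?z1.
Qed.

Lemma core_even_at x y : S x -> S y -> y != 0 -> w (fb b x) = w y ^+ 2 -> fb b x != 0 ->
  [/\ evn (w (x - t1)), evn (w (x - t2)) & evn (w (x - t3))].
Proof.
move=> Sx Sy y0; rewrite (ld_fbE h) => exy; rewrite !mulf_eq0 !negb_or => /andP[/andP[n1' n2'] n3'].
have f1 : fb b t1 = 0 by rewrite (ld_fbE h); ring.
have f2 : fb b t2 = 0 by rewrite (ld_fbE h); ring.
have f3 : fb b t3 = 0 by rewrite (ld_fbE h); ring.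
have [u12 u13 u23] := core_units.
have u21 : w (t2 - t1) = 1 by rewrite -opprB core_wN //; exact: SB.
have u31 : w (t3 - t1) = 1 by rewrite -opprB core_wN //; exact: SB.
have u32 : w (t3 - t2) = 1 by rewrite -opprB core_wN //; exact: SB.
have l1 := core_w_le St1 f1; have l2 := core_w_le St2 f2; have l3 := core_w_le St3 f3.
split.
- exact: (ew Sx Sy St1 St2 St3).
- by apply: (ew Sx Sy St2 St1 St3) => //; rewrite -exy; congr (w _); ring.
- by apply: (ew Sx Sy St3 St1 St2) => //; rewrite -exy; congr (w _); ring.
Qed.

(** In n_j^2 the factors X - t_j and x1 - t_(j+1) come from the points (X, Y) and Q1 of the curve,
    so [even_coordinate] makes them even; hence e(t_j) is even. *)
Lemma core_ep : [/\ evn (w (ev (mapA j e) t1)), evn (w (ev (mapA j e) t2)) & evn (w (ev (mapA j e) t3))].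
Proof.
have fX : fb b X != 0 by rewrite -(ld_curve h) expf_neq0 // (ld_Y h).
have [X1 X2 X3] : [/\ evn (w (X - t1)), evn (w (X - t2)) & evn (w (X - t3))].
  by apply: (core_even_at SX SY (ld_Y h)) => //; rewrite -(ld_curve h) expr2 wM // expr2.
have v2 := v2_odd ua pp vp op.
pose x1 : K := - 3%:R * b%:R ^+ 2; have jx1 : j x1 = - 3%:R * b%:R ^+ 2.
  by rewrite /x1 mulNr rmorphN rmorphM rmorphXn !rmorph_nat mulNr.
have n0 : 16%:R * b%:R != 0 :> K.
  rewrite mulf_neq0 // (_ : 16%:R = 2%:R ^+ 4) ?expf_neq0 ?(v_neq0 ua v2) //; ring.
have fx1 : fb b (j x1) = j (- (16%:R * b%:R) ^+ 2).
  rewrite -rmorph_fb; congr (j _); rewrite /fb /x1 gFE; ring.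
have fx10 : fb b (j x1) != 0 by rewrite fx1 fmorph_eq0 oppr_eq0 expf_neq0.
have [Q1 Q2 Q3] : [/\ evn (w (j x1 - t1)), evn (w (j x1 - t2)) & evn (w (j x1 - t3))].
  apply: (core_even_at (y := j (16%:R * b%:R))) => //; first by rewrite fmorph_eq0.
  by rewrite fx1 !wj (uaN ua) (uaX ua).
rewrite jx1 in Q1 Q2 Q3 fx10.
have X0 : [/\ X - t1 != 0, X - t2 != 0 & X - t3 != 0].
  by move: fX; rewrite (ld_fbE h) !mulf_eq0 !negb_or => /andP[/andP[-> ->] ->].
have Q0 : [/\ - 3%:R * b%:R ^+ 2 - t1 != 0, - 3%:R * b%:R ^+ 2 - t2 != 0 & - 3%:R * b%:R ^+ 2 - t3 != 0].
  by move: fx10; rewrite (ld_fbE h) !mulf_eq0 !negb_or => /andP[/andP[-> ->] ->].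
have Sx1 : S (- 3%:R * b%:R ^+ 2) by rewrite -jx1.
have Sep t : S t -> S (ev (mapA j e) t).
  by move=> St; case: (e) => [[e0 e1] e2] /=; apply: SD; [apply: SD => //; exact: SM|rewrite expr2; apply: SM => //; exact: SM].
have step t x n : S n -> S t -> S x -> evn (w (X - t)) -> evn (w (- 3%:R * b%:R ^+ 2 - x)) -> X - t != 0 ->
    - 3%:R * b%:R ^+ 2 - x != 0 -> ev (mapA j e) t != 0 ->
    n ^+ 2 = (X - t) * ev (mapA j e) t * (- 3%:R * b%:R ^+ 2 - x) -> evn (w (ev (mapA j e) t)).
  move=> Sn St Sx eX eQ X0' Q0' e0' en.
  have nn0 : n != 0 by apply: contra_neq (mulf_neq0 (mulf_neq0 X0' e0') Q0') => n0'; rewrite -en n0' expr0n.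
  apply: (evn_div ua (z := w n ^+ 2) (x := w (X - t) * w (- 3%:R * b%:R ^+ 2 - x))).
  - exact: (evn_sqr wV Sn nn0).
  - exact: evnM.
  - by have [s s0 ->] := wV (Sep t St) e0'; rewrite gt_eqF // (ua_gt0 ua).
  rewrite expr2 -wM // -expr2 en; have S1' := SB SX St; have S2' := Sep t St; have S3' := SB Sx1 Sx.
  by rewrite !wM //; [rewrite mulrAC | exact: SM].
have [e1 e2 e3] := ld_ep h; case: X0 Q0 => a1 a2 a3 [b1 b2 b3]; split.
- exact: (step t1 t2 n1 _ _ _ _ _ _ _ _ (ld_1 h)).
- exact: (step t2 t3 n2 _ _ _ _ _ _ _ _ (ld_2 h)).
- exact: (step t3 t1 n3 _ _ _ _ _ _ _ _ (ld_3 h)).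
Qed.

Lemma core_beta : let e' := mulA (gF K b) (2%:R * gF K b * b%:R ^+ 2) (betaA b K) e in
  [/\ evn (w (ev (mapA j e') t1)), evn (w (ev (mapA j e') t2)) & evn (w (ev (mapA j e') t3))].
Proof.
move=> e'; have [E1 E2 E3] := core_ep; have v2 := v2_odd ua pp vp op; have v20 := v_neq0 ua v2.
(* beta is -2 (x - X) at x = - 2 b^2, where f takes the value -2 (2 b^3)^2, of even valuation at odd
   primes. *)
pose x : K := - 2%:R * b%:R ^+ 2.
have fx : fb b (j x) = j (- 2%:R * (2%:R * b%:R ^+ 3) ^+ 2).
  rewrite -rmorph_fb; congr (j _); rewrite /fb /x; ring.
have n0 : 2%:R * b%:R ^+ 3 != 0 :> K by rewrite mulf_neq0 ?expf_neq0.
have [B1 B2 B3] : [/\ evn (w (j x - t1)), evn (w (j x - t2)) & evn (w (j x - t3))].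
  apply: (core_even_at (y := j (2%:R * b%:R ^+ 3))) => //; rewrite ?fmorph_eq0 //.
    by rewrite fx !wj (ua_M ua (- 2%:R)) (uaN ua) v2 mul1r (uaX ua).
  by rewrite fx fmorph_eq0 mulf_neq0 ?expf_neq0 ?oppr_eq0.
have Sep t : S t -> S (ev (mapA j e) t).
  by move=> St; case: (e) => [[e0 e1] e2] /=; apply: SD; [apply: SD => //; exact: SM|rewrite expr2; apply: SM => //; exact: SM].
have step t : S t -> fb b t = 0 -> evn (w (j x - t)) -> evn (w (ev (mapA j e) t)) -> evn (w (ev (mapA j e') t)).
  move=> St ft hb he; rewrite /e' mapA_mulA ev_mulA; last first.
    by rewrite rmorph_gF rmorph_cB.
  rewrite mapA_beta; have -> : ev (betaA b L) t = j (- 2%:R) * (j x - t).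
    by rewrite /ev /betaA /x !mulNr !rmorphN rmorphM rmorphXn !rmorph_nat; ring.
  rewrite wM //; [|exact: SM (SB _ _)|exact: Sep].
  rewrite wM //; last exact: SB.
  by rewrite wj (uaN ua) v2 mul1r; exact: evnM.
have f1 : fb b t1 = 0 by rewrite (ld_fbE h); ring.
have f2 : fb b t2 = 0 by rewrite (ld_fbE h); ring.
have f3 : fb b t3 = 0 by rewrite (ld_fbE h); ring.
by split; apply: step.
Qed.
End EvenCore.

(** * Isotropy at odd primes of good reduction when f has a root *)

Section GoodRoot.
Variables (R : realType) (K : fieldType) (v : K -> R) (p : nat).
Hypotheses (cv : is_completion v) (ua : ultra_abs v) (pp : prime p) (vp : v p%:R < 1) (op : odd p).
Variables (b : nat).
Hypothesis ob : b%:R != 0 :> K.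
Hypothesis vg : v (gF K b) = 1.
Variables (L : closedFieldType) (j : {rmorphism K -> L}).
Hypotheses (c0L : has_char0 L) (aj : forall x, algebraicOver j x).

Lemma sol_even x y : evn v (v x) -> evn v (v y) -> sol x y.
Proof.
have dec z : evn v (v z) -> exists s u, [/\ s != 0, v u = 1 & z = u * s ^+ 2].
  move=> [s s0 e]; exists s, (z / s ^+ 2); split=> //; last by rewrite divfK ?expf_neq0.
  by rewrite (ua_div ua) e (uaX ua) divff // expf_neq0 // gt_eqF // (ua_gt0 ua).
move=> /dec[s [u [s0 vu ->]]] /dec[t [w [t0 vw ->]]].
by apply/(sol_sqr _ _ s0)/solC/(sol_sqr _ _ t0)/solC; exact: (sol_units_K cv ua pp vp op).
Qed.

(** K(i) is then unramified over K; a smaller value of a^2 + c^2 would give a square root of -1 by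
    Hensel's lemma. *)
Lemma norm_nonsquare : (forall k : K, k ^+ 2 != -1) -> forall a c, v (a ^+ 2 + c ^+ 2) = Num.max (v a) (v c) ^+ 2.
Proof.
move=> nI a c; have [h|h|h] := ltgtP (v a) (v c).
- by rewrite (uaD_eql ua) (uaX ua) // (uaX ua) ltr_pXn2r ?nnegrE ?(ua_ge0 ua).
- by rewrite addrC (uaD_eql ua) (uaX ua) // (uaX ua) ltr_pXn2r ?nnegrE ?(ua_ge0 ua).
have [c0|c0] := eqVneq c 0.
  by move: h; rewrite c0 (ua0 ua) => /(ua_eq0 ua) ->; rewrite expr0n addr0 !(ua0 ua) expr0n.
have vx : v (a / c) = 1 by rewrite (ua_div ua) h divff // gt_eqF // (ua_gt0 ua).
have -> : a ^+ 2 + c ^+ 2 = ((a / c) ^+ 2 + 1) * c ^+ 2 by field.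
rewrite (ua_M ua) (uaX ua); suff -> : v ((a / c) ^+ 2 + 1) = 1 by rewrite mul1r ?h.
have vx1 : v (a / c) <= 1 by rewrite vx.
have le1 : v ((a / c) ^+ 2 + 1) <= 1 by vle ua.
have [//|lt1] := v1_or le1; have [|s hs _] := sqrt_odd cv ua (u := -1) (v2_odd ua pp vp op) vx.
  by rewrite -opprD (uaN ua) addrC.
by have := nI s; rewrite hs eqxx.
Qed.

Variables (e : tri K) (I t1 t2 t3 X Y n1 n2 n3 : L) (th : K).
Local Notation A := (gF K b).
Local Notation B := (2%:R * gF K b * b%:R ^+ 2).
Hypothesis h0 : ldata b j e I t1 t2 t3 X Y n1 n2 n3.
Hypothesis fth : fb b th = 0.

(** Even values at all roots mean that e is a unit times a square in each factor of K[X]/(f), so the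
    trace form becomes unimodular after rescaling. The same argument serves e and beta e, hence the
    general statement [main]. *)
Theorem good_root_isotropic : tiso (gram A B e) /\ tiso (gram A B (mulA A B (betaA b K) e)).
Proof.
have v2 := v2_odd ua pp vp op; have m2 := v_neq0 ua v2; have vth := root_int ua vg fth.
have vf1 : v (3%:R * th ^+ 2 + A) = 1.
  by apply: (disc_unit ua pp vp op vg) => //; rewrite fth (ua0 ua).
have f10 := v_neq0 ua vf1; have vg1 : v A <= 1 by rewrite vg.
have [eA eB e0 efp] := split_root m2 f10 fth.
have [s2 [s3 [k1 [k2 [k3 [h es2 es3]]]]]] := ld_root h0 fth m2 f10.
set m := - th / 2%:R in eA eB e0 efp es2 es3; set d := 16%:R * A / _ in eA eB e0 efp es2 es3.
have I2 := ld_I h.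
have vd : v d = 1.
  rewrite /d (ua_div ua) vf1 divr1 (ua_M ua) vg mulr1 (_ : 16%:R = 2%:R ^+ 4); last by ring.
  by rewrite (uaX ua) v2 expr1n.
have vm : v m <= 1 by rewrite /m; vle ua; rewrite (vV_1 ua v2).
have vd1 : v d <= 1 by rewrite vd.
clearbody m d.
have d0 := v_neq0 ua vd; have fp0 : fp th m d != 0 by rewrite efp.
have KS2 : KI j I s2 by rewrite es2; exists m, d.
have KS3 : KI j I s3 by rewrite es3; exists m, (- d); rewrite rmorphN mulNr.
have fixd z : (forall t : gal j, t I = I -> t (j th) = j th -> t s2 = s2 -> t s3 = s3 -> t z = z) -> KI j I z.
  move=> hz; apply: (KI_fixed I2 c0L aj) => t tI; apply: hz => //; first exact: gal_fix.
    by rewrite es2 rmorphD rmorphM !gal_fix tI.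
  by rewrite es3 (rmorphB t) (rmorphM t (j d)) !gal_fix tI.
have KX : KI j I X by apply: fixd => t a1 a2 a3 a4; have [] := ld_fix h a1 a2 a3 a4.
have KY : KI j I Y by apply: fixd => t a1 a2 a3 a4; have [] := ld_fix h a1 a2 a3 a4.
have K1 : KI j I k1 by apply: fixd => t a1 a2 a3 a4; have [] := ld_fix h a1 a2 a3 a4.
have K2 : KI j I k2 by apply: fixd => t a1 a2 a3 a4; have [] := ld_fix h a1 a2 a3 a4.
have K3 : KI j I k3 by apply: fixd => t a1 a2 a3 a4; have [] := ld_fix h a1 a2 a3 a4.
suff main (e' : tri K) (w : L -> R) : (forall a, w (j a) = v a) ->
    ((exists2 k : K, k ^+ 2 = -1 & I = j k) \/
     (forall k : K, k ^+ 2 != -1) /\ forall a c, w (j a + j c * I) = Num.max (v a) (v c)) ->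
    [/\ evn v (w (ev (mapA j e') (j th))), evn v (w (ev (mapA j e') s2)) & evn v (w (ev (mapA j e') s3))] ->
    tiso (gram A B e').
  have [[k ek]|nk] := pselect (exists k : K, k ^+ 2 = -1).
    have [k' ek' eI] : exists2 k' : K, k' ^+ 2 = -1 & I = j k'.
      have [e1|e1] := galQ_i j ek I2; first by exists k.
      by exists (- k); rewrite ?sqrrN // rmorphN e1 opprK.
    pose w (z : L) := v (xget 0 [set a | z = j a]%classic).
    have wj a : w (j a) = v a.
      rewrite /w; have : (exists a', [set a' | j a = j a']%classic a') by exists a.
      by move/(xgetPex (0 : K)) => /= /fmorph_inj <-.
    have Sj z : KI j I z -> exists a, z = j a.
      by move=> [a [c ->]]; exists (a + c * k'); rewrite eI rmorphD rmorphM.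
    have SI : KI j I I by exact: KI_I.
    have SD x y : KI j I x -> KI j I y -> KI j I (x + y) by exact: KI_D.
    have SN x : KI j I x -> KI j I (- x) by exact: KI_N.
    have SM x y : KI j I x -> KI j I y -> KI j I (x * y) by exact: (KI_M I2).
    have SJ a : KI j I (j a) by exact: KI_j.
    have wM x y : KI j I x -> KI j I y -> w (x * y) = w x * w y.
      by move=> /Sj[a ->] /Sj[c ->]; rewrite -rmorphM !wj (ua_M ua).
    have wD x y : KI j I x -> KI j I y -> w (x + y) <= Num.max (w x) (w y).
      by move=> /Sj[a ->] /Sj[c ->]; rewrite -rmorphD !wj (ua_D ua).
    have wV x : KI j I x -> x != 0 -> exists2 s : K, s != 0 & w x = v s.
      by move=> /Sj[a ->]; rewrite fmorph_eq0 => a0; exists a.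
    split; apply: (main _ w) => //; try by left; exists k'.
      apply: (@core_ep _ _ _ _ ua pp vp op _ ob vg _ _ (KI j I) w) => //; try exact: h; by [].
    apply: (@core_beta _ _ _ _ ua pp vp op _ ob vg _ _ (KI j I) w) => //; try exact: h; by [].
  have nI (k : K) : k ^+ 2 != -1 by apply/eqP => ek; apply: nk; exists k.
  (* The unramified extension of v to K(I) is the maximum of the coordinates; it is multiplicative
     by [norm_nonsquare]. *)
  pose w (z : L) := let ac := xget (0, 0) [set ac : K * K | z = j ac.1 + j ac.2 * I]%classic in Num.max (v ac.1) (v ac.2).
  have wE a c : w (j a + j c * I) = Num.max (v a) (v c).
    rewrite /w; have : (exists ac : K * K, [set ac : K * K | j a + j c * I = j ac.1 + j ac.2 * I]%classic ac) by exists (a, c).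
    by move/(xgetPex ((0, 0) : K * K)) => /= /(KI_inj I2 nI)[<- <-].
  have wj a : w (j a) = v a.
    rewrite -[j a]addr0 -[0](mul0r I) -(rmorph0 j) wE (ua0 ua); apply/max_idPl; exact: (ua_ge0 ua).
  have SD x y : KI j I x -> KI j I y -> KI j I (x + y) by exact: KI_D.
  have SN x : KI j I x -> KI j I (- x) by exact: KI_N.
  have SM x y : KI j I x -> KI j I y -> KI j I (x * y) by exact: (KI_M I2).
  have SJ a : KI j I (j a) by exact: KI_j.
  have mx0 a c : 0 <= Num.max (v a) (v c) by rewrite le_max (ua_ge0 ua).
  have wM x y : KI j I x -> KI j I y -> w (x * y) = w x * w y.
    move=> [a [c ->]] [a' [c' ->]].
    have -> : (j a + j c * I) * (j a' + j c' * I) = j (a * a' - c * c') + j (a * c' + c * a') * I.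
      by rewrite rmorphB rmorphD !rmorphM; ring: I2.
    rewrite !wE; have q1 := norm_nonsquare nI (a * a' - c * c') (a * c' + c * a').
    have q2 := norm_nonsquare nI a c; have q3 := norm_nonsquare nI a' c'.
    apply/eqP; rewrite -(eqrXn2 (n := 2)) ?mulr_ge0 // exprMn -q1 -q2 -q3 -(ua_M ua); apply/eqP.
    by congr v; ring.
  have wD x y : KI j I x -> KI j I y -> w (x + y) <= Num.max (w x) (w y).
    move=> [a [c ->]] [a' [c' ->]].
    have -> : (j a + j c * I) + (j a' + j c' * I) = j (a + a') + j (c + c') * I by rewrite !rmorphD; ring.
    rewrite !wE ge_max; apply/andP; split; apply: le_trans (ua_D ua _ _) _; rewrite ge_max !le_max !lexx ?orbT //.
  have wV x : KI j I x -> x != 0 -> exists2 s : K, s != 0 & w x = v s.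
    move=> [a [c ->]] n0; rewrite wE; have [hc|hc] := leP (v a) (v c).
      exists c => //; apply: contra_neq n0 => c0; move: hc; rewrite c0 (ua0 ua) => ha.
      have -> : a = 0 by apply/(ua_eq0 ua)/le_anti; rewrite ha (ua_ge0 ua).
      by rewrite !rmorph0 mul0r addr0.
    by exists a => //; rewrite -(ua_gt0 ua); apply: le_lt_trans hc; exact: (ua_ge0 ua).
  have SI : KI j I I by exact: KI_I.
  split; apply: (main _ w) => //; try by right.
    apply: (@core_ep _ _ _ _ ua pp vp op _ ob vg _ _ (KI j I) w) => //; try exact: h; by [].
  apply: (@core_beta _ _ _ _ ua pp vp op _ ob vg _ _ (KI j I) w) => //; try exact: h; by [].
move=> wj wI [E1 E2 E3]; apply: (split_iso eA eB e0 d0 m2 fp0).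
have eth : ev (mapA j e') (j th) = j (ev e' th).
  by case: (e') => [[u0 u1] u2]; rewrite /mapA /ev !rmorphD !rmorphM.
have [ec ec'] := ev_map_split j m d e' I2; rewrite -es2 -es3 in ec ec'.
rewrite eth wj in E1; rewrite ec in E2; rewrite ec' in E3.
have vA0 : v (ev e' th / fp th m d) = v (ev e' th) by rewrite (ua_div ua) efp vf1 divr1.
have vfp : v (fp th m d) = 1 by rewrite efp.
(* If -1 = k^2 in K, all roots are in K: [a] and [a'] are the values of e' / f' at m + d k and m - d
   k, and the form is diagonal in y + k z and y - k z. *)
case: wI => [[k ek eI]|[nI wI]].
  pose a := sa0 th m d e' + sa1 th m d e' * k; pose a' := sa0 th m d e' - sa1 th m d e' * k.
  have evn_a x : v x = 1 -> forall y z, z * x = y -> evn v (v y) -> evn v (v z).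
    by move=> vx y z <-; rewrite (ua_M ua) vx mulr1.
  have vk : v k = 1.
    have : v k ^+ 2 = 1 by rewrite -(uaX ua) ek (uaN ua) (ua1 ua).
    by move/eqP; rewrite sqrp_eq1 ?(ua_ge0 ua) // => /eqP.
  have vk1 : v k <= 1 by rewrite vk.
  have q1 : v (m - th + d * k) = 1 /\ v (m - th - d * k) = 1.
    have l1 : v (m - th + d * k) <= 1 by vle ua.
    have l2 : v (m - th - d * k) <= 1 by vle ua.
    have pr : v (m - th + d * k) * v (m - th - d * k) = 1.
      by rewrite -(ua_M ua) -vfp; congr v; rewrite /fp; ring: ek.
    have g1 := ua_ge0 ua (m - th + d * k); have g2 := ua_ge0 ua (m - th - d * k).
    split; apply/le_anti; rewrite ?l1 ?l2 /=; first by have := ler_wpM2l g1 l2; rewrite mulr1 pr.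
    by have := ler_wpM2r g2 l1; rewrite mul1r pr.
  have Ea : evn v (v a).
    apply: (evn_a ((m - th + d * k) * (2%:R * d * k)) _ (c0 m d e' + c1 m d e' * k)).
    - by rewrite !(ua_M ua) q1.1 v2 vd vk !mulr1.
    - rewrite /a /sa0 /sa1; move: (c0 _ _ _) (c1 _ _ _) fp0; rewrite /fp => x y fp0; field: ek; by rewrite ?fp0 ?d0 ?m2.
    by move: E2; rewrite eI -rmorphM -rmorphD wj.
  have Ea' : evn v (v a').
    apply: (evn_a (- (m - th - d * k) * (2%:R * d * k)) _ (c0 m d e' - c1 m d e' * k)).
    - by rewrite (ua_M ua) (uaN ua) !(ua_M ua) q1.2 v2 vd vk !mulr1.
    - rewrite /a' /sa0 /sa1; move: (c0 _ _ _) (c1 _ _ _) fp0; rewrite /fp => x y fp0; field: ek; by rewrite ?fp0 ?d0 ?m2.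
    by move: E3; rewrite eI -rmorphM -rmorphB wj.
  have EA : evn v (v (ev e' th / fp th m d)) by rewrite vA0.
  have nz x : evn v (v x) -> x != 0.
    by move=> [s s0 ex]; rewrite -(ua_gt0 ua) ex exprn_gt0 // (ua_gt0 ua).
  have : tiso (tdiag (ev e' th / fp th m d) a a').
    apply/tiso_diag; rewrite ?nz //; apply: sol_even; rewrite (uaN ua) (ua_M ua); exact: evnM.
  have k0 := v_neq0 ua vk.
  move=> [x [y [z [n0 hq]]]]; exists x, ((y + z) / 2%:R), ((y - z) / (2%:R * k)); split.
    apply: contra_neq n0 => -[-> hy hz]; congr (_, _, _).
      have -> : y = (y + z) / 2%:R + (y - z) / (2%:R * k) * k by field; rewrite ?m2 ?k0.
      by rewrite hy hz mul0r addr0.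
    have -> : z = (y + z) / 2%:R - (y - z) / (2%:R * k) * k by field; rewrite ?m2 ?k0.
    by rewrite hy hz mul0r subr0.
  rewrite -hq teval_diag /teval /split_form /a /a' /=.
  set Y' := (y + z) / 2%:R; set Z' := (y - z) / (2%:R * k).
  have -> : y = Y' + Z' * k by rewrite /Y' /Z'; field; rewrite ?m2 ?k0.
  have -> : z = Y' - Z' * k by rewrite /Y' /Z'; field; rewrite ?m2 ?k0.
  by ring: ek.
rewrite wI in E2.
have [s s0 es] := E2; have [t t0 et] := E1.
have vsa : v (sa0 th m d e' ^+ 2 + sa1 th m d e' ^+ 2) = v s ^+ 4.
  rewrite (split_norm d0 m2 fp0) (ua_div ua) norm_nonsquare // es (ua_M ua _ (fp th m d)) (ua_M ua 4%:R) vfp (uaX ua d) vd.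
  rewrite (_ : 4%:R = 2%:R ^+ 2); last by ring.
  by rewrite (uaX ua) v2 !expr1n !mulr1 divr1 -exprM.
have vmax : Num.max (v (sa0 th m d e')) (v (sa1 th m d e')) = v s ^+ 2.
  apply/eqP; rewrite -(eqrXn2 (n := 2)) ?exprn_ge0 ?le_max ?(ua_ge0 ua) //.
  by rewrite -norm_nonsquare // vsa -exprM.
have vs0 : 0 < v s ^+ 2 by rewrite exprn_gt0 // (ua_gt0 ua).
(* In the inert case dividing by t^2 at th and by s^2 in K(I) leaves units, so the rescaled form is
   unimodular. *)
pose q := TForm (ev e' th / fp th m d / t ^+ 2) (2%:R * (sa0 th m d e' / s ^+ 2)) (- 2%:R * (sa0 th m d e' / s ^+ 2))
  (- 2%:R * (sa1 th m d e' / s ^+ 2)) 0 0.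
have va0 : v (sa0 th m d e' / s ^+ 2) <= 1.
  by rewrite (ua_div ua) (uaX ua) ler_pdivrMr // mul1r -vmax le_max lexx.
have va1 : v (sa1 th m d e' / s ^+ 2) <= 1.
  by rewrite (ua_div ua) (uaX ua) ler_pdivrMr // mul1r -vmax le_max lexx orbT.
have vt1 : v (ev e' th / fp th m d / t ^+ 2) = 1.
  by rewrite (ua_div ua) vA0 et (uaX ua) divff // gt_eqF // exprn_gt0 // (ua_gt0 ua).
have : tiso q.
  apply: (unimodular_isotropic cv ua pp vp op).
    by split=> /=; rewrite ?vt1 //; [| |split]; vle ua; rewrite (ua0 ua).
  have -> : tdet q = - 4%:R * (ev e' th / fp th m d / t ^+ 2) * ((sa0 th m d e' ^+ 2 + sa1 th m d e' ^+ 2) / s ^+ 4).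
    by rewrite /q /tdet /=; field; rewrite ?s0 ?t0 ?fp0.
  rewrite (ua_M ua _ (_ / s ^+ 4)) (ua_M ua (- 4%:R)) (ua_div ua _ (s ^+ 4)) vsa (uaX ua) divff ?expf_neq0 ?gt_eqF ?(ua_gt0 ua) //.
  rewrite vt1 (uaN ua) (_ : 4%:R = 2%:R ^+ 2); last by ring.
  by rewrite (uaX ua) v2 expr1n !mulr1.
move=> [x [y [z [n0 hq]]]]; exists (x / t), (y / s), (z / s); split.
  by move: n0; rewrite !tri_neq0 !mulf_eq0 !invr_eq0 (negPf s0) (negPf t0) !orbF.
by rewrite -hq /teval /q /=; field; rewrite ?s0 ?t0 ?fp0.
Qed.
End GoodRoot.

(** * The forms at the prime 2 *)

(** With k = (s^2 - 9 b^2) / 8 and w replaced by w / 8 the quartic reads k^2 + w^2 = 2 b s + 16;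
    this finite check is the origin of the class 10 in [norm_class]. *)
Lemma residues_check : all (fun b => all (fun s => all (fun k => all (fun w =>
   (odd b && ((k ^ 2 + w ^ 2) %% 16 == (2 * b * s + 16) %% 16) && (s ^ 2 %% 16 == (9 * b ^ 2 + 8 * k) %% 16)) ==>
   ((k ^ 2 + w ^ 2 + 8 * w) %% 16 == 10))%N (iota 0 16)) (iota 0 16)) (iota 0 16)) (iota 0 16).
Proof. by vm_compute. Qed.

Lemma residues_mod16 (b s k w : nat) : odd b ->
  (k ^ 2 + w ^ 2 = 2 * b * s + 16 %[mod 16])%N -> (s ^ 2 = 9 * b ^ 2 + 8 * k %[mod 16])%N ->
  (k ^ 2 + w ^ 2 + 8 * w = 10 %[mod 16])%N.
Proof.
move=> ob h1 h2.
have md x : (x %% 16 \in iota 0 16)%N by rewrite mem_iota ltn_mod.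
have ob' : odd (b %% 16) by rewrite odd_mod.
have e1 : (((k %% 16) ^ 2 + (w %% 16) ^ 2) %% 16 = (k ^ 2 + w ^ 2) %% 16)%N by rewrite -modnDm !modnXm modnDm.
have e2 : ((2 * (b %% 16) * (s %% 16) + 16) %% 16 = (2 * b * s + 16) %% 16)%N.
  by apply/eqP; rewrite eqn_modDr -!mulnA -modnMmr modnMm modnMmr.
have e3 : ((s %% 16) ^ 2 %% 16 = s ^ 2 %% 16)%N by rewrite modnXm.
have e4 : ((9 * (b %% 16) ^ 2 + 8 * (k %% 16)) %% 16 = (9 * b ^ 2 + 8 * k) %% 16)%N.
  by rewrite -modnDm modnMmr -modnMmr modnXm modnMmr modnDm.
have e5 : (((k %% 16) ^ 2 + (w %% 16) ^ 2 + 8 * (w %% 16)) %% 16 = (k ^ 2 + w ^ 2 + 8 * w) %% 16)%N.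
  by rewrite -modnDm e1 modnMmr modnDm.
have := allP (allP (allP (allP residues_check _ (md b)) _ (md s)) _ (md k)) _ (md w).
by rewrite ob' e1 e2 e3 e4 e5 h1 h2 !eqxx => /eqP.
Qed.

Lemma c_mulA (F : fieldType) (m d : F) (u w : tri F) (A := d ^+ 2 - 3%:R * m ^+ 2) (B := 2%:R * m * (m ^+ 2 + d ^+ 2)) :
  c0 m d (mulA A B u w) = c0 m d u * c0 m d w - c1 m d u * c1 m d w /\
  c1 m d (mulA A B u w) = c0 m d u * c1 m d w + c1 m d u * c0 m d w.
Proof. by case: u w => [[? ?] ?] [[? ?] ?]; rewrite /mulA /c0 /c1 /A /B; split; ring. Qed.

Section Dyadic.
Variables (R : realType) (K : fieldType) (v : K -> R).
Hypotheses (cv : is_completion v) (ua : ultra_abs v) (v2 : v 2%:R < 1).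
Local Notation t := (v 2%:R).
Let pp : prime 2 := isT.

Lemma two_neq0 : 2%:R != 0 :> K. Proof. by rewrite (natK_eq0 cv). Qed.
Lemma t_gt0 : 0 < t. Proof. by rewrite (ua_gt0 ua) two_neq0. Qed.
Lemma t_le1 : t <= 1. Proof. exact: ltW. Qed.
Lemma t_exp m n : (m <= n)%N -> t ^+ n <= t ^+ m.
Proof. by move=> h; apply: ler_wiXn2l => //; [exact: ltW t_gt0 | exact: t_le1]. Qed.
Lemma t_exp1 n : t ^+ n <= 1. Proof. by rewrite exprn_ile1 ?t_le1 // ltW // t_gt0. Qed.
Lemma v_odd n : odd n -> v n%:R = 1.
Proof. by move=> h; apply: (v_coprime ua pp v2); rewrite dvdn2 h. Qed.
Lemma v_pow2 n : v (2 ^ n)%N%:R = t ^+ n. Proof. by rewrite natrX (uaX ua). Qed.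
Lemma v8 : v 8%:R = t ^+ 3. Proof. by rewrite -(v_pow2 3). Qed.

Lemma v_dvd_int (N : int) k : v N%:~R <= t ^+ k -> ((2 ^ k)%N %| N)%Z.
Proof.
have [->|N0] := eqVneq N 0; first by rewrite dvdz0.
have hN : (0 < `|N|)%N by rewrite absz_gt0.
have vN : v N%:~R = v `|N|%:R.
  by case: (N) => n; rewrite ?NegzE ?rmorphN ?(uaN ua) ?abszN /= -pmulrn.
rewrite vN (v_nat ua pp v2 hN) (ler_iXn2l t_gt0 v2) => h.
by rewrite dvdzE absz_nat pfactor_dvdn.
Qed.

Lemma unit_sqr8 x : v x = 1 -> v (x ^+ 2 - 1) <= t ^+ 3.
Proof.
move=> vx; have [|n hn] := residue cv ua pp v2 (x := x) 3; first by rewrite vx.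
have t3 : t ^+ 3 < 1 by rewrite exprn_ilt1 // ltW // t_gt0.
have vn : v n%:R = 1.
  by apply: (v_near1 ua vx); rewrite -opprB (uaN ua); exact: le_lt_trans hn t3.
have on : odd n.
  apply/negPn/negP => hn2; have : v n%:R <= t.
    by rewrite -(even_halfK hn2) -mul2n natrM (ua_M ua) ler_piMr ?(ua_ge0 ua) ?(ua_nat ua).
  by rewrite vn leNgt v2.
have -> : x ^+ 2 - 1 = (x - n%:R) * (x + n%:R) + (n%:R ^+ 2 - 1) by ring.
apply: (uaD_le ua).
  rewrite (ua_M ua) -[leRHS]mulr1 ler_pM ?(ua_ge0 ua) //.
  by apply: (uaD_le ua); rewrite ?vx // (ua_nat ua).
have h8 := sqr_odd_mod8 on; rewrite -natrX -(natrB _ (m := n ^ 2) (n := 1)); last by rewrite expn_gt0; case: (n) on.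
have -> : (n ^ 2 - 1 = 8 * ((n ^ 2) %/ 8))%N by rewrite {1}(divn_eq (n ^ 2) 8) h8; lia.
by rewrite natrM (ua_M ua) v8 ler_piMr ?(ua_nat ua) // exprn_ge0 // ltW // t_gt0.
Qed.

Lemma neg1_nonsquare (k : K) : k ^+ 2 != -1.
Proof.
apply/eqP => e; have vk : v k = 1.
  by apply/eqP; rewrite -sqrp_eq1 ?(ua_ge0 ua) // -(uaX ua) e (uaN ua) (ua1 ua).
have := unit_sqr8 vk; rewrite e -opprD (uaN ua) => h.
have : t ^+ 3 < t ^+ 1 by rewrite (ltr_iXn2l t_gt0 v2).
by rewrite expr1 ltNge h.
Qed.

Lemma near1_sqr u : v (u - 1) <= t ^+ 3 -> exists2 s : K, s != 0 & u = s ^+ 2.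
Proof.
move=> h; have [|s es hs] := sqrt_two cv ua (u := u) v2; first by rewrite v8.
exists s => //; rewrite -(ua_gt0 ua) (v_near1 ua (y := 1)) ?(ua1 ua) //.
by apply: le_lt_trans hs _; rewrite exprn_ilt1 // ltW // t_gt0.
Qed.

Lemma int_square_class m : m != 0 -> exists2 n : int, n != 0 & exists2 s : K, s != 0 & m = n%:~R * s ^+ 2.
Proof.
have unit_case u : v u = 1 -> exists2 n : nat, n != 0%N & exists2 s : K, s != 0 & u = n%:R * s ^+ 2.
  move=> vu; have [|n hn] := residue cv ua pp v2 (x := u) 3; first by rewrite vu.
  have t3 : t ^+ 3 < 1 by rewrite exprn_ilt1 // ltW // t_gt0.
  have vn : v n%:R = 1.
    by apply: (v_near1 ua vu); rewrite -opprB (uaN ua); exact: le_lt_trans hn t3.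
  have n0 := v_neq0 ua vn; exists n; first by rewrite -(natK_eq0 cv).
  have [|s s0 es] := @near1_sqr (u / n%:R).
    have -> : u / n%:R - 1 = (u - n%:R) / n%:R by rewrite mulrBl divff.
    by rewrite (ua_div ua) vn divr1.
  by exists s => //; rewrite -es mulrC divfK.
move=> m0; have [y y0 [e|e]] := v_parity cv ua pp v2 m0.
  have [|n n0 [s s0 es]] := unit_case (m / y ^+ 2).
    by rewrite (ua_div ua) e (uaX ua) divff // expf_neq0 // gt_eqF // (ua_gt0 ua).
  exists (n : int) => //; exists (s * y); rewrite ?mulf_neq0 // -pmulrn exprMn mulrA -es divfK // expf_neq0 //.
have [|n n0 [s s0 es]] := unit_case (m / (2%:R * y ^+ 2)).
  rewrite (ua_div ua) e (ua_M ua) (uaX ua) divff // mulf_neq0 ?expf_neq0 // gt_eqF ?t_gt0 // (ua_gt0 ua) //.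
exists ((2 * n)%N : int); first by rewrite eqz_nat muln_eq0.
exists (s * y); rewrite ?mulf_neq0 // -pmulrn natrM.
transitivity (m / (2%:R * y ^+ 2) * (2%:R * y ^+ 2)); last by rewrite es; ring.
by rewrite divfK // mulf_neq0 ?expf_neq0 ?two_neq0.
Qed.

Lemma hs_2_10 : hs 2 2 10 = true.
Proof. by vm_compute. Qed.

(** Since (2, 10)_2 = -1, halving m reverses its symbol with 10. The disagreement of the two forms
    at 2 is exactly this. *)
Lemma sol_half m : m != 0 -> ~ (sol m 10%:R <-> sol (m / 2%:R) (10%:R : K)).
Proof.
move=> m0; have [n n0 [s s0 ->]] := int_square_class m0.
have -> : n%:~R * s ^+ 2 / 2%:R = ((2 : int) * n)%:~R * (s / 2%:R) ^+ 2 :> K.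
  rewrite rmorphM /= -pmulrn; field; exact: two_neq0.
rewrite sol_sqr // sol_sqr ?mulf_neq0 ?invr_eq0 ?two_neq0 //.
have e10 : 10%:R = (10 : int)%:~R :> K by rewrite -pmulrn.
rewrite e10 !(sol_symbol cv ua pp v2) ?mulf_neq0 // hsM // hs_2_10.
by case: (hs 2 n 10) => -[h1 h2] //; [have := h2 erefl | have := h1 erefl].
Qed.

(** Completing the square in the trace form of a0 + a1 i gives 2 a0 (Y^2 - N Z^2) with N the norm up
    to squares, here 10. *)
Lemma sol_pair (A0 a0 a1 la : K) : a0 != 0 -> la != 0 -> a0 ^+ 2 + a1 ^+ 2 = 10%:R * la ^+ 2 ->
  tiso (TForm A0 (2%:R * a0) (- 2%:R * a0) (- 2%:R * a1) 0 0) <-> sol (- A0 / (2%:R * a0)) 10%:R.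
Proof.
have n2 := two_neq0; move=> a00 la0 eN; split=> -[x [y [z [n0 e]]]].
  exists x, (z * la / a0), (y - a1 / a0 * z); split.
    apply: contra_neq n0 => -[-> h1 h2].
    have z0 : z = 0 by move/eqP: h1; rewrite !mulf_eq0 invr_eq0 (negPf la0) (negPf a00) !orbF => /eqP.
    by move: h2; rewrite z0 mulr0 subr0 => ->.
  have e' : 2%:R * a0 * (y - a1 / a0 * z) ^+ 2 = - A0 * x ^+ 2 + 2%:R / a0 * (a0 ^+ 2 + a1 ^+ 2) * z ^+ 2.
    apply/eqP; rewrite -subr_eq0 -e /teval /=; apply/eqP; field; exact: a00.
  apply: (mulfI (mulf_neq0 n2 a00)); rewrite e' eN; field; by rewrite a00 n2.
pose Z := a0 * y / la; exists x, (z + a1 / a0 * Z), Z; split.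
  apply: contra_neq n0 => -[-> h1 h2].
  have y0 : y = 0 by move/eqP: h2; rewrite /Z !mulf_eq0 invr_eq0 (negPf la0) (negPf a00) !orbF => /eqP.
  by move: h1; rewrite h2 mulr0 addr0 y0 => ->.
transitivity (A0 * x ^+ 2 + 2%:R * a0 * (z ^+ 2 - (a0 ^+ 2 + a1 ^+ 2) / a0 ^+ 2 * Z ^+ 2)).
  by rewrite /teval /=; field.
rewrite e eN /Z; field; by rewrite a00 n2 la0.
Qed.

(* Multiplying y + z i by eta = h1 + h2 i carries the trace form of 2 eta^2 a to twice that of a. *)
Lemma tiso_eta (A0 a0 a1 mu h1 h2 a0' a1' : K) : mu != 0 -> h1 ^+ 2 + h2 ^+ 2 != 0 ->
  a0' = 2%:R * ((h1 ^+ 2 - h2 ^+ 2) * a0 - 2%:R * h1 * h2 * a1) ->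
  a1' = 2%:R * ((h1 ^+ 2 - h2 ^+ 2) * a1 + 2%:R * h1 * h2 * a0) ->
  tiso (TForm (A0 * mu ^+ 2) (2%:R * a0') (- 2%:R * a0') (- 2%:R * a1') 0 0) <->
  tiso (TForm A0 (2%:R * (2%:R * a0)) (- 2%:R * (2%:R * a0)) (- 2%:R * (2%:R * a1)) 0 0).
Proof.
move=> mu0 hN -> ->; split=> -[x [y [z [n0 e]]]].
  exists (mu * x), (h1 * y - h2 * z), (h1 * z + h2 * y); split; last by apply: etrans e; rewrite /teval /=; ring.
  apply: contra_neq n0 => -[/eqP]; rewrite mulf_eq0 (negPf mu0) => /eqP -> e1 e2.
  have y0 : y = 0.
    apply: (mulfI hN); rewrite mulr0; transitivity (h1 * (h1 * y - h2 * z) + h2 * (h1 * z + h2 * y)); first by ring.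
    by rewrite e1 e2; ring.
  have -> : z = 0.
    apply: (mulfI hN); rewrite mulr0; transitivity (h1 * (h1 * z + h2 * y) - h2 * (h1 * y - h2 * z)); first by ring.
    by rewrite e1 e2; ring.
  by rewrite y0.
set n := h1 ^+ 2 + h2 ^+ 2 in hN.
exists (x / mu), ((h1 * y + h2 * z) / n), ((h1 * z - h2 * y) / n); split.
  apply: contra_neq n0 => -[/eqP]; rewrite mulf_eq0 invr_eq0 (negPf mu0) orbF => /eqP -> /eqP.
  rewrite mulf_eq0 invr_eq0 (negPf hN) orbF => /eqP e1 /eqP; rewrite mulf_eq0 invr_eq0 (negPf hN) orbF => /eqP e2.
  have y0 : y = 0.
    apply: (mulfI hN); rewrite mulr0; transitivity (h1 * (h1 * y + h2 * z) - h2 * (h1 * z - h2 * y)); first by rewrite /n; ring.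
    by rewrite e1 e2; ring.
  have -> : z = 0.
    apply: (mulfI hN); rewrite mulr0; transitivity (h2 * (h1 * y + h2 * z) + h1 * (h1 * z - h2 * y)); first by rewrite /n; ring.
    by rewrite e1 e2; ring.
  by rewrite y0.
apply: etrans e; rewrite /teval /n /=; field; by rewrite mu0 hN.
Qed.

Section Point.
Variables (b : nat).
Hypothesis ob : odd b.
Local Notation bK := (b%:R : K).

Lemma vb1 : v bK = 1. Proof. exact: v_odd. Qed.
Lemma b_neq0 : bK != 0. Proof. exact: (v_neq0 ua vb1). Qed.

(** If s is not a unit, S = s^2 - 9 b^2 satisfies |S| >= 1 and dominates, and the quartic is minus a
    square times a number congruent to 1 modulo 8; but -1 is not a square. *)
Lemma qval_unit s w : w ^+ 2 = qval bK s -> v s = 1.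
Proof.
move=> e; apply/eqP; apply/negPn/negP => ns; pose S := s ^+ 2 - 9%:R * bK ^+ 2.
have vs0 := ua_ge0 ua s; have v9 : v (9%:R * bK ^+ 2) = 1 by rewrite (ua_M ua) (uaX ua) vb1 v_odd // expr1n mulr1.
have [vS h1] : 1 <= v S /\ v (2%:R * bK * s + 16%:R) <= v S ^+ 2.
  have [lt|gt|eq] := ltgtP (v s) 1; last by move: ns; rewrite eq eqxx.
    have vS : v S = 1.
      by rewrite /S -opprB (uaN ua) addrC (uaD_eql ua) // (uaN ua) (uaX ua) v9 exprn_ilt1.
    split; rewrite vS ?expr1n //; have vs := ltW lt; vle ua.
  have vS : v S = v s ^+ 2.
    by rewrite /S addrC (uaD_eql ua) (uaX ua) // (uaN ua) v9 exprn_egt1.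
  have g2 : v s <= v s ^+ 2 by rewrite expr2 ler_peMl // ltW.
  rewrite vS; split; first by rewrite exprn_ege1 // ltW.
  apply: (uaD_le ua).
    rewrite !(ua_M ua) vb1 mulr1; apply: le_trans (_ : v s ^+ 2 <= _).
      by apply: le_trans g2; rewrite ler_piMl ?t_le1.
    by rewrite -exprM ler_weXn2l // ltW.
  by apply: le_trans (ua_nat ua _) _; rewrite -exprM exprn_ege1 // ltW.
have S0 : S != 0 by rewrite -(ua_gt0 ua); apply: lt_le_trans vS.
have [|r r0 er] := @near1_sqr (1 - 64%:R * (2%:R * bK * s + 16%:R) / S ^+ 2).
  rewrite addrAC subrr add0r (uaN ua) (ua_div ua) (ua_M ua) (uaX ua).
  have -> : v 64%:R = t ^+ 6 by rewrite -(v_pow2 6).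
  rewrite ler_pdivrMr ?exprn_gt0 ?(ua_gt0 ua) //; apply: ler_pM => //; rewrite ?(ua_ge0 ua) //; last exact: t_exp.
  by rewrite exprn_ge0 // (ua_ge0 ua).
have := neg1_nonsquare (w / (S * r)); rewrite expr_div_n e exprMn -er => /eqP; apply.
have nz : 1 - 64%:R * (2%:R * bK * s + 16%:R) / S ^+ 2 != 0 by rewrite er expf_neq0.
have -> : qval bK s = - (S ^+ 2 * (1 - 64%:R * (2%:R * bK * s + 16%:R) / S ^+ 2)).
  by rewrite mulrBr mulr1 mulrCA divff ?mulr1 ?expf_neq0 // /qval /S; ring.
by rewrite mulNr divff // mulf_neq0 ?expf_neq0.
Qed.

(** The left side is the norm to K of X - t2, for the point given by (s, w) and the root t2 = - b^2
    z + d i with d = 16 g / f1. Since g / f1 is -1/3, that is 5, modulo 16, this norm is 16 times a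
    number congruent to 10 modulo 16. *)
Lemma norm_class s w z f1 : w ^+ 2 = qval bK s -> v (z - 3%:R) <= t ^+ 10 ->
  f1 = 12%:R * bK ^+ 4 * z ^+ 2 + gF K b ->
  exists2 r, r != 0 &
    (bK ^+ 2 * (z - 3%:R) - (s ^+ 2 - 9%:R * bK ^+ 2) / 2%:R) ^+ 2 + (w / 2%:R - 16%:R * gF K b / f1) ^+ 2 = 10%:R * r ^+ 2.
Proof.
move=> e hz ef; have vs := qval_unit e; have n2 := two_neq0; have vb := vb1.
pose k := (s ^+ 2 - 9%:R * bK ^+ 2) / 8%:R; pose w' := w / 8%:R.
have e8 : 8%:R = 2%:R ^+ 3 :> K by ring.
have n8 : 8%:R != 0 :> K by rewrite e8 expf_neq0.
have tt := t_gt0; have t0 n : 0 <= t ^+ n by rewrite exprn_ge0 // ltW.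
have vk : v k <= 1.
  rewrite /k (ua_div ua) v8 ler_pdivrMr ?exprn_gt0 // mul1r.
  have -> : s ^+ 2 - 9%:R * bK ^+ 2 = (s ^+ 2 - 1) - ((3%:R * bK) ^+ 2 - 1) by ring.
  by apply: (uaB_le ua); apply: unit_sqr8; rewrite // (ua_M ua) vb mulr1 v_odd.
have ek : s ^+ 2 = 9%:R * bK ^+ 2 + 8%:R * k by rewrite /k [8%:R * _]mulrC divfK // addrC subrK.
have ew : k ^+ 2 + w' ^+ 2 = 2%:R * bK * s + 16%:R.
  have n64 : 64%:R != 0 :> K by rewrite (_ : 64%:R = 2%:R ^+ 6) ?expf_neq0 //; ring.
  apply: (mulfI n64); rewrite /k /w'; transitivity ((s ^+ 2 - 9%:R * bK ^+ 2) ^+ 2 + w ^+ 2); first by field.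
  by rewrite e /qval; ring.
have vs1 : v s <= 1 by rewrite vs.
have vb' : v bK <= 1 by rewrite vb.
have vw : v w' <= 1.
  have : v (w' ^+ 2) <= 1.
    have -> : w' ^+ 2 = (2%:R * bK * s + 16%:R) - k ^+ 2 by rewrite -ew addrC addKr.
    by vle ua.
  by rewrite (uaX ua); apply: contraTT; rewrite -!ltNge => ?; exact: exprn_egt1.
have [kn hk] := residue cv ua pp v2 4 vk; have [wn hw] := residue cv ua pp v2 4 vw.
have [sn hs] := residue cv ua pp v2 4 vs1.
have scale x y n : v x <= t ^+ n -> v y <= 1 -> v (x * y) <= t ^+ n.
  by move=> hx hy; rewrite (ua_M ua) -[leRHS]mulr1 ler_pM ?(ua_ge0 ua).
have sq x n : v x <= 1 -> v (x - n%:R) <= t ^+ 4 -> v (x ^+ 2 - n%:R ^+ 2) <= t ^+ 4.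
  move=> hx hn; rewrite subr_sqr; apply: scale => //; vle ua.
have h1 : (kn ^ 2 + wn ^ 2 = 2 * b * sn + 16 %[mod 16])%N.
  have : ((2 ^ 4)%N %| ((kn ^ 2 + wn ^ 2)%N : int) - ((2 * b * sn + 16)%N : int))%Z.
    apply: v_dvd_int; rewrite rmorphB /= -!pmulrn !natrD !natrX !natrM.
    have -> : kn%:R ^+ 2 + wn%:R ^+ 2 - (2%:R * bK * sn%:R + 16%:R) =
      - ((k ^+ 2 - kn%:R ^+ 2) + (w' ^+ 2 - wn%:R ^+ 2)) + (s - sn%:R) * (2%:R * bK).
      transitivity (kn%:R ^+ 2 + wn%:R ^+ 2 - (k ^+ 2 + w' ^+ 2) + (2%:R * bK * s + 16%:R) - (2%:R * bK * sn%:R + 16%:R)); last by ring.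
      by rewrite ew; ring.
    by apply: (uaD_le ua); [rewrite (uaN ua); apply: (uaD_le ua); exact: sq | apply: scale => //; vle ua].
  by rewrite -eqz_mod_dvd !modz_nat eqz_nat => /eqP.
have h2 : (sn ^ 2 = 9 * b ^ 2 + 8 * kn %[mod 16])%N.
  have : ((2 ^ 4)%N %| ((sn ^ 2)%N : int) - ((9 * b ^ 2 + 8 * kn)%N : int))%Z.
    apply: v_dvd_int; rewrite rmorphB /= -!pmulrn natrD (natrM _ 9) (natrM _ 8) !natrX.
    have -> : sn%:R ^+ 2 - (9%:R * bK ^+ 2 + 8%:R * kn%:R) = - (s ^+ 2 - sn%:R ^+ 2) + (k - kn%:R) * 8%:R by rewrite ek; ring.
    by apply: (uaD_le ua); [rewrite (uaN ua); exact: sq | apply: scale => //; vle ua].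
  by rewrite -eqz_mod_dvd !modz_nat eqz_nat => /eqP.
have h3 := residues_mod16 ob h1 h2.
have vz : v z <= 1.
  have -> : z = (z - 3%:R) + 3%:R by rewrite subrK.
  by apply: (uaD_le ua); [exact: le_trans hz (t_exp1 _) | vle ua].
have vg1 : v (gF K b) <= 1 by rewrite gFE; vle ua.
have e16 : 16%:R = 2%:R ^+ 4 :> K by ring.
have v16 : v 16%:R = t ^+ 4 by rewrite e16 (uaX ua).
have vf1 : v f1 = 1.
  have v1 : v (81 * b ^ 4 + 256)%N%:R = 1 by apply: v_odd; rewrite oddD oddM oddX ob.
  have hf : v (f1 - (81 * b ^ 4 + 256)%N%:R) <= t ^+ 10.
    have -> : f1 - (81 * b ^ 4 + 256)%N%:R = (z - 3%:R) * (12%:R * bK ^+ 4 * (z + 3%:R)).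
      by rewrite ef gFE natrD natrM natrX; ring.
    by apply: scale => //; vle ua.
  by apply: (v_near1 ua v1); apply: le_lt_trans hf _; rewrite exprn_ilt1 // ltW.
have f10 := v_neq0 ua vf1.
have hq : v (gF K b / f1 - 5%:R) <= t ^+ 4.
  have -> : gF K b / f1 - 5%:R = (16%:R * (- 27%:R * bK ^+ 4 - 64%:R) - (z - 3%:R) * (60%:R * bK ^+ 4 * (z + 3%:R))) / f1.
    have -> : 5%:R = 5%:R * f1 / f1 by rewrite mulfK.
    by rewrite -mulrBl; congr (_ / _); rewrite ef gFE; ring.
  rewrite (ua_div ua) vf1 divr1; apply: (uaB_le ua); first by apply: scale; rewrite ?v16 //; vle ua.
  by apply: scale; [apply: le_trans hz _; exact: t_exp | vle ua].
set gq := gF K b / f1 in hq *.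
have vgq : v gq <= 1 by rewrite /gq (ua_div ua) vf1 divr1.
pose N := (k - bK ^+ 2 * ((z - 3%:R) / 4%:R)) ^+ 2 + (w' - 4%:R * gq) ^+ 2.
have e4 : 4%:R = 2%:R ^+ 2 :> K by ring.
have n4 : 4%:R != 0 :> K by rewrite e4 expf_neq0.
have vz4 : v ((z - 3%:R) / 4%:R) <= t ^+ 4.
  rewrite (ua_div ua) e4 (uaX ua) ler_pdivrMr ?exprn_gt0 // -exprD; apply: le_trans hz _; exact: t_exp.
have hN : v (N - 10%:R) <= t ^+ 4.
  set zz := (z - 3%:R) / 4%:R in vz4 N *.
  have vzz : v zz <= 1 by apply: le_trans vz4 (t_exp1 _).
  pose n := (kn ^ 2 + wn ^ 2 + 8 * wn)%N.
  have hn : v (n%:R - 10%:R) <= t ^+ 4.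
    have -> : n%:R - 10%:R = (((n : int) - (10%N : int))%:~R) :> K by rewrite rmorphB /= -!pmulrn.
    apply: (v_int_dvd ua (p := 2) (k := 4)).
    by rewrite -eqz_mod_dvd !modz_nat eqz_nat; apply/eqP.
  have -> : N - 10%:R = (k ^+ 2 - kn%:R ^+ 2) + (w' ^+ 2 - wn%:R ^+ 2) - zz * (bK ^+ 2 * (2%:R * k - bK ^+ 2 * zz))
     + (gq - 5%:R) * (- 8%:R * w' + 16%:R * (gq + 5%:R)) - (w' - wn%:R) * 40%:R + (n%:R - 10%:R) - 16%:R * (3%:R * wn%:R - 25%:R).
    by rewrite /N /n (natrD _ (kn ^ 2 + wn ^ 2)%N) (natrD _ (kn ^ 2)%N) (natrM _ 8) !natrX; ring.
  apply: (uaB_le ua); last by apply: scale; rewrite ?v16 //; vle ua.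
  apply: (uaD_le ua) => //; apply: (uaB_le ua); last by apply: scale => //; vle ua.
  apply: (uaD_le ua); last by apply: scale => //; vle ua.
  apply: (uaB_le ua); last by apply: scale => //; vle ua.
  by apply: (uaD_le ua); exact: sq.
have v10 : v 10%:R = t by rewrite (natrM _ 2 5) (ua_M ua) (@v_odd 5) // mulr1.
have n10 : 10%:R != 0 :> K by rewrite (natK_eq0 cv).
have [|r r0 er] := @near1_sqr (N / 10%:R).
  have -> : N / 10%:R - 1 = (N - 10%:R) / 10%:R by rewrite mulrBl divff.
  by rewrite (ua_div ua) v10 ler_pdivrMr // -exprSr.
exists (4%:R * r); first by rewrite mulf_neq0.
rewrite exprMn -er; transitivity (16%:R * N); last by field.
rewrite /N /k /w' /gq; field; by rewrite ?n2 ?f10 ?n4 ?n8.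
Qed.

(** Putting x = 2 b^2 z makes f equal to 2 b^2 (4 b^4 z^3 + g z + g); the second factor at 3 is 108
    b^4 + 4 g = 2^10. *)
Lemma dyadic_root : exists z, [/\ v (z - 3%:R) <= t ^+ 10 & fb b (2%:R * bK ^+ 2 * z) = 0].
Proof.
pose F : {poly K} := (4%:R * bK ^+ 4)%:P * 'X ^+ 3 + (gF K b)%:P * 'X + (gF K b)%:P.
have Fx x : F.[x] = 4%:R * bK ^+ 4 * x ^+ 3 + gF K b * x + gF K b.
  by rewrite /F !(hornerD, hornerM, hornerXn, hornerX, hornerC).
have F'x x : F^`().[x] = 12%:R * bK ^+ 4 * x ^+ 2 + gF K b.
  rewrite /F !derivE !(hornerD, hornerM, hornerMn, hornerXn, hornerX, hornerC); ring.
have vb' : v bK <= 1 by rewrite vb1.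
have vg1 : v (gF K b) <= 1 by rewrite gFE; vle ua.
have F3 : F.[3%:R] = 2%:R ^+ 10 by rewrite Fx gFE; ring.
have [||||z fz hz] := hensel cv ua (F := F) (a := 3%:R).
- rewrite /F; repeat first [apply: (vintD ua) | apply: (vintM ua) | apply: (vintXn ua) | exact: (vintX ua) | apply: (vintC ua); by vle ua].
- exact: ua_nat.
- by rewrite F3 (uaX ua) exprn_ilt1 // ltW // t_gt0.
- rewrite F'x gFE; have -> : 12%:R * bK ^+ 4 * 3%:R ^+ 2 + (256%:R - 27%:R * bK ^+ 4) = (81 * b ^ 4 + 256)%N%:R.
    by rewrite natrD natrM natrX; ring.
  by apply: v_odd; rewrite oddD oddM oddX ob.
exists z; split; first by move: hz; rewrite F3 (uaX ua).
transitivity (2%:R * bK ^+ 2 * F.[z]); last by rewrite fz mulr0.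
by rewrite Fx /fb; ring.
Qed.

Variables (L : closedFieldType) (j : {rmorphism K -> L}).
Hypotheses (c0L : has_char0 L) (aj : forall x, algebraicOver j x).

Lemma conj_exists (I : L) : I ^+ 2 = -1 -> exists sg : gal j, sg I = - I.
Proof.
move=> I2; have [||||sg [_ hI]] := gal_moves (D := [set z | exists a, z = j a]%classic) (z := I) c0L aj.
- by move=> k; exists k.
- by move=> x y [a ->] [c ->]; exists (a - c); rewrite rmorphB.
- by move=> x y [a ->] [c ->]; exists (a * c); rewrite rmorphM.
- move=> [a ea]; have /eqP := neg1_nonsquare a; apply; apply: (fmorph_inj j).
  by rewrite rmorphXn -ea I2 rmorphN rmorph1.
exists sg; have [e|//] := galQ_i sg I2 I2; by rewrite e eqxx in hI.
Qed.

Lemma nine_b4 : 9%:R * bK ^+ 4 != 64%:R.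
Proof.
rewrite -natrX -natrM -subr_eq0; apply/negP => /eqP e; have := congr1 v (subr0_eq e).
rewrite (v_odd (n := 9 * b ^ 4)); last by rewrite oddM oddX ob.
have h6 : t ^+ 6 < 1 by rewrite exprn_ilt1 // ltW // t_gt0.
by rewrite -[64%N]/(2 ^ 6)%N v_pow2 => /eqP; rewrite eq_sym lt_eqF.
Qed.

Variables (e : tri K) (I t1 t2 t3 X Y n1 n2 n3 : L).
Hypothesis h0 : ldata b j e I t1 t2 t3 X Y n1 n2 n3.

Hypothesis fixXY : forall sg : gal j, sg I = I -> sg X = X /\ sg Y = Y.

(* The line through M, Q1 and - sg M has slope s i with s in K. *)
Lemma dyadic_point : exists s w : K, w ^+ 2 = qval bK s /\
  X = j (- (- 3%:R * bK ^+ 2 + s ^+ 2) / 2%:R) + j (w / 2%:R) * I.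
Proof.
have I2 := ld_I h0; have [sg sI] := conj_exists I2; have mv := ld_move h0 sI.
have m2 : 2%:R != 0 :> L by rewrite -(rmorph_nat j) fmorph_eq0 two_neq0.
have I0 : I != 0 by apply: contra_eq_neq I2 => ->; rewrite expr0n eq_sym oppr_eq0 oner_eq0.
pose x1 : K := - 3%:R * bK ^+ 2; have jx1 : j x1 = - 3%:R * b%:R ^+ 2.
  by rewrite /x1 (rmorphM j) rmorphN (rmorphXn j) !rmorph_nat.
have jb0 : b%:R != 0 :> L by rewrite -(rmorph_nat j) fmorph_eq0 b_neq0.
have n16 : 16%:R != 0 :> L by rewrite (_ : 16%:R = 2%:R ^+ 4) ?expf_neq0 //; ring.
have fx1 : fb b (j x1) = (16%:R * b%:R * I) ^+ 2.
  by rewrite jx1 /fb gFE; ring: I2.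
rewrite -jx1 in mv.
have [l [lx ly lsg]] : exists l, [/\ l ^+ 2 = X + sg X + j x1, Y - 16%:R * b%:R * I = l * (X - j x1) & X != j x1 -> sg l = - l].
  have [eX|nX] := eqVneq X (j x1).
    have : Y ^+ 2 == (16%:R * b%:R * I) ^+ 2 by rewrite (ld_curve h0) eX fx1.
    rewrite eqf_sqr => /orP[] /eqP eY; last by move: mv; rewrite eY eX /= eqxx opprK eqxx.
    exists (sslope (gF L b) X Y (j x1) (16%:R * b%:R * I)); split=> //; last by rewrite eY eX !subrr mulr0.
    move: mv; rewrite /=; case: ifP => // _ [<- _]; by rewrite addrC addrCA; ring.
  have nX' : j x1 - X != 0 by rewrite subr_eq0 eq_sym.
  have nXs : sg X != j x1 by rewrite -(gal_fix sg) (inj_eq (fmorph_inj sg)).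
  have sb : sg (16%:R * b%:R * I) = - (16%:R * b%:R * I) by rewrite (rmorphM sg _ I) (rmorphM sg) !rmorph_nat sI mulrN.
  exists ((16%:R * b%:R * I - Y) / (j x1 - X)); move: mv; rewrite /= (negPf nX) /= /sslope (negPf nX).
  set l := _ / _; move=> [eX eY]; have el : l * (j x1 - X) = 16%:R * b%:R * I - Y by rewrite /l divfK.
  split.
  - by rewrite -eX; ring.
  - by rewrite -opprB -el; ring.
  move=> _; have nz : j x1 - sg X != 0 by rewrite subr_eq0 eq_sym.
  apply: (mulIf nz); rewrite {1}/l fmorph_div (rmorphB sg (j x1)) gal_fix divfK // rmorphB sb -eY -{1}eX.
  have -> : 16%:R * b%:R * I = Y + l * (j x1 - X) by rewrite el addrC subrK.
  by rewrite eX; ring.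
(* Otherwise M = Q1 and 2 Q1 has the abscissa of Q1; the tangent there has slope squared 3 x1, which
   amounts to 9 b^4 = 64. *)
have nX : X != j x1.
  apply/eqP => eX; move: mv; rewrite /=; case: ifP => // nQ; rewrite eX in ly *.
  have eY : Y = 16%:R * b%:R * I by apply/eqP; rewrite -subr_eq0 ly subrr mulr0.
  rewrite /sslope eqxx => -[e1 _].
  have : ((3%:R * j x1 ^+ 2 + gF L b) / (2%:R * Y)) ^+ 2 = 3%:R * j x1.
    by move/eqP: e1; rewrite gal_fix !subr_eq => /eqP ->; ring.
  have -> : 3%:R * j x1 ^+ 2 + gF L b = 256%:R by rewrite jx1 gFE; ring.
  have nY : 2%:R * Y != 0 by rewrite mulf_neq0 // (ld_Y h0).
  move=> e2; have e3 : 256%:R ^+ 2 = 3%:R * j x1 * (2%:R * Y) ^+ 2 by rewrite -e2 -exprMn divfK.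
  have n1024 : 1024%:R != 0 :> L by rewrite (_ : 1024%:R = 2%:R ^+ 10) ?expf_neq0 //; ring.
  have := nine_b4; rewrite -(inj_eq (fmorph_inj j)) (rmorphM j) (rmorphXn j) !rmorph_nat => /eqP; apply.
  apply: (mulfI n1024); transitivity (256%:R ^+ 2 : L); last by ring.
  by rewrite e3 eY jx1; ring: I2.
have nX0 : X - j x1 != 0 by rewrite subr_eq0.
have [s hs] : exists s : K, l = j s * I.
  (* The slope lies in K(I) and is negated by the conjugation, so it is a multiple of I. *)
  have [p [q eq]] : KI j I l.
    apply: (KI_fixed I2 c0L aj) => u uI; have [uX uY] := fixXY uI.
    have el : l = (Y - 16%:R * b%:R * I) / (X - j x1) by rewrite ly mulfK.
    by rewrite el fmorph_div (rmorphB u Y) (rmorphB u X) (rmorphM u _ I) (rmorphM u 16%:R) !rmorph_nat uI uX uY gal_fix.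
  exists q; move: (lsg nX); rewrite eq rmorphD rmorphM !gal_fix sI => h.
  have : j (2%:R * p) = 0.
    rewrite rmorphM rmorph_nat; transitivity ((j p + j q * - I) + (j p + j q * I)); first by ring.
    by rewrite h addNr.
  by move/eqP; rewrite fmorph_eq0 mulf_eq0 (negPf two_neq0) => /eqP ->; rewrite rmorph0 add0r.
have [al [be eX]] : KI j I X by apply: (KI_fixed I2 c0L aj) => u /fixXY[].
have eal : 2%:R * al = - (x1 + s ^+ 2).
  apply: (fmorph_inj j); rewrite rmorphM rmorph_nat rmorphN rmorphD rmorphXn.
  move: lx; rewrite hs eX rmorphD rmorphM !gal_fix sI => lx.
  transitivity ((j al + j be * I + (j al + j be * - I) + j x1) - j x1); first by ring.
  by rewrite -lx; ring: I2.
exists s, (2%:R * be); split; last first.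
  by rewrite eX; congr (j _ + j _ * I); rewrite ?[2%:R * be]mulrC ?mulfK ?two_neq0 // -/x1 -eal mulrC mulKf ?two_neq0.
have eY : Y = I * (16%:R * b%:R + j s * (X - j x1)).
  by move/eqP: ly; rewrite subr_eq hs => /eqP ->; ring.
have Q0 : X ^+ 2 + (j x1 + j s ^+ 2) * X + (j x1 ^+ 2 + gF L b + 2%:R * (16%:R * b%:R) * j s - j s ^+ 2 * j x1) = 0.
  apply: (mulfI nX0); rewrite mulr0; transitivity (fb b X - Y ^+ 2); last by rewrite (ld_curve h0) subrr.
  rewrite eY exprMn I2 jx1 /fb !gFE; ring.
have e2X : 2%:R * X + (j x1 + j s ^+ 2) = j (2%:R * be) * I.
  have ea' : 2%:R * j al = - (j x1 + j s ^+ 2) by rewrite -[2%:R](rmorph_nat j) -rmorphM eal rmorphN rmorphD rmorphXn.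
  rewrite eX rmorphM rmorph_nat; transitivity (2%:R * j al + (j x1 + j s ^+ 2) + 2%:R * j be * I); first by ring.
  by rewrite ea' addNr add0r.
apply: (fmorph_inj j); rewrite rmorphXn rmorph_qval rmorph_nat; apply/eqP; rewrite -subr_eq0; apply/eqP.
transitivity (- (4%:R * (X ^+ 2 + (j x1 + j s ^+ 2) * X + (j x1 ^+ 2 + gF L b + 2%:R * (16%:R * b%:R) * j s - j s ^+ 2 * j x1)))); last first.
  by rewrite Q0 mulr0 oppr0.
transitivity (- ((2%:R * X + (j x1 + j s ^+ 2)) ^+ 2 - (j x1 + j s ^+ 2) ^+ 2 + 4%:R * (j x1 ^+ 2 + gF L b + 2%:R * (16%:R * b%:R) * j s - j s ^+ 2 * j x1))); last by ring.
by rewrite e2X exprMn I2 jx1 /qval gFE; ring.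
Qed.
End Point.

Section DyadicIso.
Variables (b : nat).
Hypothesis ob : odd b.
Variables (L : closedFieldType) (j : {rmorphism K -> L}).
Hypotheses (c0L : has_char0 L) (aj : forall x, algebraicOver j x).
Local Notation bK := (b%:R : K).
Local Notation A := (gF K b).
Local Notation B := (2%:R * gF K b * b%:R ^+ 2).

(** Both forms reduce by [sol_pair] to symbols with 10, the norm of e at t2 being 10 times a square.
    Passing to beta e doubles a0 + a1 i up to squares and keeps the class at th, so the first
    argument is halved and [sol_half] applies. *)
Theorem dyadic_iso (e : tri K) (I t1 t2 t3 X Y n1 n2 n3 : L) : ldata b j e I t1 t2 t3 X Y n1 n2 n3 ->
  ~ (tiso (gram A B e) <-> tiso (gram A B (mulA A B (betaA b K) e))).
Proof.
move=> h0; have m2 := two_neq0; have tt := t_gt0; have vb := vb1 ob; have b0 := b_neq0 ob.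
have [z [hz fth]] := dyadic_root ob; set th := 2%:R * bK ^+ 2 * z in fth.
have vz1 : v (z - 3%:R) <= 1 := le_trans hz (t_exp1 _).
have vz : v z <= 1 by rewrite -[z](subrK 3%:R); apply: (uaD_le ua) => //; exact: ua_nat.
have vb' : v bK <= 1 by rewrite vb.
have scale x y n : v x <= t ^+ n -> v y <= 1 -> v (x * y) <= t ^+ n.
  by move=> hx hy; rewrite (ua_M ua) -[leRHS]mulr1 ler_pM ?(ua_ge0 ua).
have lt1 n : (0 < n)%N -> t ^+ n < 1 by case: n => // n _; rewrite exprn_ilt1 // ltW.
set f1 := 3%:R * th ^+ 2 + A.
have ef1 : f1 = 12%:R * bK ^+ 4 * z ^+ 2 + A by rewrite /f1 /th; ring.
pose c81 : K := 9%:R * bK ^+ 2.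
have vc81 : v c81 = 1 by rewrite /c81 (ua_M ua) (uaX ua) vb (@v_odd 9) // expr1n mulr1.
have c810 := v_neq0 ua vc81.
have hf1 : v (f1 - c81 ^+ 2) <= t ^+ 8.
  have -> : f1 - c81 ^+ 2 = 2%:R ^+ 8 + (z - 3%:R) * (12%:R * bK ^+ 4 * (z + 3%:R)) by rewrite ef1 gFE /c81; ring.
  apply: (uaD_le ua); first by rewrite (uaX ua).
  by apply: scale; [apply: le_trans hz _; exact: t_exp | vle ua].
have vf1 : v f1 = 1.
  apply: (v_near1 ua (y := c81 ^+ 2)); first by rewrite (uaX ua) vc81 expr1n.
  by apply: le_lt_trans hf1 _; exact: lt1.
have f10 := v_neq0 ua vf1.
(* f'(th) is close to (9 b^2)^2, hence a square; it occurs in [split_norm]. *)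
have [fr fr0 efr] : exists2 r, r != 0 & f1 = r ^+ 2.
  have [|r r0 er] := @near1_sqr (f1 / c81 ^+ 2).
    have -> : f1 / c81 ^+ 2 - 1 = (f1 - c81 ^+ 2) / c81 ^+ 2 by rewrite mulrBl divff // expf_neq0.
    by rewrite (ua_div ua) (uaX ua) vc81 expr1n divr1; apply: le_trans hf1 _; exact: t_exp.
  exists (r * c81); first exact: mulf_neq0.
  by rewrite [RHS]exprMn -er divfK // expf_neq0.
have [eA eB e0 efp] := split_root m2 f10 fth.
have [s2 [s3 [k1 [k2 [k3 [h es2 es3]]]]]] := ld_root h0 fth m2 f10.
rewrite -/f1 in eA eB e0 efp es2 es3.
set m := - th / 2%:R in eA eB e0 efp es2 es3; set d := 16%:R * A / _ in eA eB e0 efp es2 es3.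
have em : m = - (bK ^+ 2 * z) by rewrite /m /th; field.
have I2 := ld_I h; have [sg sI] := conj_exists c0L aj I2.
have vg1 : v A <= 1 by rewrite gFE; vle ua.
have vA : v A = 1.
  apply: (v_near1 ua (y := (27 * b ^ 4)%N%:R)); first by apply: v_odd; rewrite oddM oddX ob.
  have -> : A - (27 * b ^ 4)%N%:R = 2%:R * (128%:R - 27%:R * bK ^+ 4) by rewrite gFE natrM natrX; ring.
  by apply: (vM_lt1 ua) => //; vle ua.
have v16 : v 16%:R = t ^+ 4 by rewrite -(v_pow2 4).
have vd : v d = t ^+ 4 by rewrite /d (ua_div ua) vf1 divr1 (ua_M ua) vA mulr1.
have fixI (u : gal j) : u I = I -> [/\ u X = X, u Y = Y, u k1 = k1, u k2 = k2 & u k3 = k3].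
  move=> uI; apply: (ld_fix h) => //; first exact: gal_fix.
    by rewrite es2 (rmorphD u) (rmorphM u (j d)) !gal_fix uI.
  by rewrite es3 (rmorphB u) (rmorphM u (j d)) !gal_fix uI.
have [s [w [eq eX]]] : exists s w : K, w ^+ 2 = qval bK s /\
    X = j (- (- 3%:R * bK ^+ 2 + s ^+ 2) / 2%:R) + j (w / 2%:R) * I.
  by apply: (dyadic_point ob c0L aj h) => u /fixI[].
have d0 : d != 0 by rewrite -(ua_gt0 ua) vd exprn_gt0.
have dE : d = 16%:R * gF K b / f1 by [].
have [rN rN0 erN] := norm_class ob eq hz ef1.
clearbody m d.
have [ec ec'] := ev_map_split j m d e I2; rewrite -es2 -es3 in ec ec'.
pose x1 : K := - 3%:R * bK ^+ 2; have jx1 : j x1 = - 3%:R * b%:R ^+ 2.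
  by rewrite /x1 (rmorphM j) rmorphN (rmorphXn j) !rmorph_nat.
(* the norms to K of the three factors of n2^2 *)
pose al := - (x1 + s ^+ 2) / 2%:R; pose be := w / 2%:R.
have N1 : (al - m) ^+ 2 + (be - d) ^+ 2 = 10%:R * rN ^+ 2.
  rewrite -erN dE em /al /be /x1; congr (_ ^+ 2 + _); by field.
(* This norm is (16 b)^2 / (th - x1), because f(x1) = -(16 b)^2, and th - x1 = b^2 (2 z + 3) is a
   square as z is close to 3. *)
have [rQ rQ0 eQ] : exists2 r, r != 0 & (x1 - m) ^+ 2 + d ^+ 2 = r ^+ 2.
  have [|r r0 er] := @near1_sqr ((2%:R * z + 3%:R) / 3%:R ^+ 2).
    have m3 : 3%:R != 0 :> K by rewrite (natK_eq0 cv).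
    have -> : (2%:R * z + 3%:R) / 3%:R ^+ 2 - 1 = (z - 3%:R) * (2%:R / 3%:R ^+ 2).
      by field; rewrite ?(natK_eq0 cv).
    apply: scale; first by apply: le_trans hz _; exact: t_exp.
    by rewrite (ua_div ua) (uaX ua) (@v_odd 3) // expr1n divr1; vle ua.
  have m3 : 3%:R != 0 :> K by rewrite (natK_eq0 cv).
  have n16 : 16%:R != 0 :> K by rewrite (natK_eq0 cv).
  have e3 : th - x1 = (bK * (3%:R * r)) ^+ 2.
    transitivity (bK ^+ 2 * (2%:R * z + 3%:R)); first by rewrite /th /x1; ring.
    by rewrite !exprMn -er [3%:R ^+ 2 * _]mulrC divfK // expf_neq0.
  exists (16%:R * bK / (bK * (3%:R * r))); first by rewrite !mulf_neq0 ?invr_eq0 ?mulf_neq0.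
  have nz : th - x1 != 0 by rewrite e3 expf_neq0 ?mulf_neq0.
  apply: (mulfI nz); rewrite {2}e3 -exprMn mulrCA divff ?mulf_neq0 // mulr1.
  transitivity (- fb b x1); last by rewrite /fb /x1 gFE; ring.
  have -> : fb b x1 = (x1 - th) * ((x1 - m) ^+ 2 + d ^+ 2).
    have eth : th = - (2%:R * m) by apply/eqP; rewrite -addr_eq0 addrC e0.
    by rewrite /fb eB eA eth; ring.
  by ring.
have eX' : X = j al + j be * I by rewrite eX.
clearbody al be x1.
have K2 : KI j I k2 by apply: (KI_fixed I2 c0L aj) => u /fixI[].
case: K2 => [p [q ek2]].
(* The norm to K of [ld_2]: the class of the norm of e(t2) is therefore that of X - t2, namely
   10. *)
have n2eq : (p ^+ 2 + q ^+ 2) ^+ 2 = ((al - m) ^+ 2 + (be - d) ^+ 2) * (c0 m d e ^+ 2 + c1 m d e ^+ 2) * ((x1 - m) ^+ 2 + d ^+ 2).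
  apply: (fmorph_inj j); have hh := ld_2 h; have := congr1 sg hh.
  rewrite ec -jx1 ek2 eX' es2 es3 in hh.
  rewrite ec -jx1 ek2 eX' es2 es3 !(rmorphXn, rmorphM, rmorphB, rmorphD) !gal_fix sI => hh'.
  transitivity ((j p + j q * I) ^+ 2 * (j p + j q * - I) ^+ 2).
    by ring: I2.
  rewrite hh hh'.
  by ring: I2.
have c00 : c0 m d e ^+ 2 + c1 m d e ^+ 2 != 0.
  have [_ ep2 ep3] := ld_ep h; rewrite ec in ep2; rewrite ec' in ep3.
  rewrite -(fmorph_eq0 j) rmorphD !rmorphXn; have := mulf_neq0 ep2 ep3; apply: contra_neq => hz0.
  by rewrite -hz0; ring: I2.
have fp0 : fp th m d != 0 by rewrite efp.
have n10 : 10%:R != 0 :> K by rewrite (natK_eq0 cv).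
have pq0 : p ^+ 2 + q ^+ 2 != 0.
  have Nz : (al - m) ^+ 2 + (be - d) ^+ 2 != 0 by rewrite N1 mulf_neq0 ?expf_neq0.
  have Qz : (x1 - m) ^+ 2 + d ^+ 2 != 0 by rewrite eQ expf_neq0.
  by have := mulf_neq0 (mulf_neq0 Nz c00) Qz; rewrite -n2eq expf_eq0.
set a0 := sa0 th m d e; set a1 := sa1 th m d e.
pose la := (p ^+ 2 + q ^+ 2) / (10%:R * rN * rQ * 2%:R * d * fr).
have la0 : la != 0 by rewrite /la !mulf_neq0 ?invr_eq0 ?mulf_neq0.
have eN : a0 ^+ 2 + a1 ^+ 2 = 10%:R * la ^+ 2.
  rewrite /a0 /a1 (split_norm d0 m2 fp0) efp efr.
  have -> : c0 m d e ^+ 2 + c1 m d e ^+ 2 = (p ^+ 2 + q ^+ 2) ^+ 2 / (10%:R * rN ^+ 2 * rQ ^+ 2).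
    by rewrite n2eq N1 eQ; field; rewrite ?n10 ?rN0 ?rQ0.
  have n4 : 4%:R != 0 :> K by rewrite (natK_eq0 cv).
  by rewrite /la; field; rewrite ?n10 ?rN0 ?rQ0 ?m2 ?d0 ?fr0 ?n4.
have a00 : a0 != 0.
  apply/eqP => a0E; have := v_prime_odd cv ua pp v2 (a1 / la) => /eqP; apply.
  rewrite -(uaX ua) expr_div_n; move: eN; rewrite a0E expr0n add0r => ->.
  by rewrite mulfK ?expf_neq0 // (natrM _ 2 5) (ua_M ua) (@v_odd 5) // mulr1.
have g1 e' : tiso (gram A B e') <-> tiso (split_form th m d e').
  by split; [exact: (split_iso_inv eA eB e0 d0 m2 fp0) | exact: (split_iso eA eB e0 d0 m2 fp0)].
set A0 := ev e th / fp th m d.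
have A00 : A0 != 0.
  have [ep1 _ _] := ld_ep h; rewrite /A0 mulf_neq0 ?invr_eq0 //.
  apply: contra_neq ep1 => e1; have -> : ev (mapA j e) (j th) = j (ev e th).
    by case: (e) => [[u0 u1] u2]; rewrite /mapA /ev !rmorphD !rmorphM.
  by rewrite e1 rmorph0.
have S1 : tiso (gram A B e) <-> sol (- A0 / (2%:R * a0)) 10%:R.
  by rewrite g1 /split_form -/A0 -/a0 -/a1; exact: (sol_pair A0 a00 la0 eN).
(* beta = 4 b^2 (z + 1) at th, a square, and 2 eta^2 at the other two roots *)
have [mu mu0 emu] : exists2 mu, mu != 0 & 4%:R * bK ^+ 2 + 2%:R * th = mu ^+ 2.
  have n4 : 4%:R != 0 :> K by rewrite (natK_eq0 cv).
  have [|r r0 er] := @near1_sqr ((z + 1) / 4%:R).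
    have -> : (z + 1) / 4%:R - 1 = (z - 3%:R) / 4%:R by field.
    rewrite (ua_div ua) -[4%N]/(2 ^ 2)%N v_pow2 ler_pdivrMr ?exprn_gt0 // -exprD; apply: le_trans hz _; exact: t_exp.
  exists (4%:R * bK * r); first by rewrite !mulf_neq0.
  by rewrite exprMn -er /th; field.
have [h1 [h2 [hN hA hd]]] : exists h1 h2 : K, [/\ h1 ^+ 2 + h2 ^+ 2 != 0, h1 ^+ 2 - h2 ^+ 2 = bK ^+ 2 * (2%:R - z) & 2%:R * h1 * h2 = d].
  pose A' := bK ^+ 2 * (2%:R - z).
  have vA' : v A' = 1.
    rewrite /A' (ua_M ua) (uaX ua) vb expr1n mul1r -opprB (uaN ua); apply: (v_near1 ua (ua1 ua)).
    have -> : z - 2%:R - 1 = z - 3%:R by ring.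
    by apply: le_lt_trans hz _; exact: lt1.
  have A'0 := v_neq0 ua vA'.
  have hq : v (1 + (d / A') ^+ 2 - 1) = t ^+ 8.
    by rewrite addrAC subrr add0r (uaX ua) (ua_div ua) vA' divr1 vd -exprM.
  (* Half-angle formulas for a square root of A' + d i, whose norm is (A' r)^2: h2^2 = - A' (r + 1)
     / 2 is b^2 times a number close to 1. *)
  have [|r er hr] := sqrt_two cv ua (u := 1 + (d / A') ^+ 2) v2; first by rewrite hq v8; exact: t_exp.
  have vr1 : v (r + 1) = t.
    have -> : r + 1 = (r - 1) + 2%:R by ring.
    by rewrite (uaD_eql ua) //; apply: le_lt_trans hr _; rewrite -[ltRHS]expr1 (ltr_iXn2l tt v2).
  have hr7 : v (r - 1) <= t ^+ 4.
    have : v (r - 1) * v (r + 1) = t ^+ 8 by rewrite -(ua_M ua) -subr_sqr expr1n er.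
    rewrite vr1 => hr8; rewrite -(ler_pM2r tt) hr8 -exprSr; exact: t_exp.
  have [|y y0 ey] := @near1_sqr ((z - 2%:R) * ((r + 1) / 2%:R)).
    have -> : (z - 2%:R) * ((r + 1) / 2%:R) - 1 = (z - 3%:R) * ((r + 1) / 2%:R) + (r - 1) / 2%:R by field.
    apply: (uaD_le ua).
      by apply: scale; [apply: le_trans hz _; exact: t_exp | rewrite (ua_div ua) vr1 divff // gt_eqF].
    by rewrite (ua_div ua) ler_pdivrMr // -exprSr.
  have y2 : (bK * y) ^+ 2 = - A' * ((r + 1) / 2%:R) by rewrite exprMn -ey /A'; ring.
  have by0 : bK * y != 0 by rewrite mulf_neq0.
  exists (d / (2%:R * (bK * y))), (bK * y).
  have ed : d ^+ 2 = A' ^+ 2 * (r ^+ 2 - 1) by rewrite er; field.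
  have e1 : (d / (2%:R * (bK * y))) ^+ 2 - (bK * y) ^+ 2 = A'.
    have y40 : 4%:R * (bK * y) ^+ 2 != 0 by rewrite mulf_neq0 ?expf_neq0 // (natK_eq0 cv).
    apply: (mulfI y40); rewrite mulrBr; transitivity (d ^+ 2 - 4%:R * (bK * y) ^+ 2 * (bK * y) ^+ 2).
      congr (_ - _); move: by0; move: (bK * y) => Y0 Y00; have n4 : 4%:R != 0 :> K by rewrite (natK_eq0 cv).
      by field; rewrite ?Y00 ?m2.
    rewrite y2 ed; by field.
  split=> //; last by field; rewrite ?by0 ?b0 ?y0 ?m2.
  apply/eqP => e2; have /eqP := neg1_nonsquare ((d / (2%:R * (bK * y))) / (bK * y)); apply.
  rewrite expr_div_n; move/eqP: e2; rewrite addr_eq0 => /eqP ->.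
  by rewrite mulNr divff // expf_neq0.
pose e' := mulA A B (betaA b K) e.
have evth : ev e' th = mu ^+ 2 * ev e th.
  rewrite /e' ev_mulA; last by rewrite -[RHS]fth /fb.
  by congr (_ * _); rewrite -emu /betaA /ev; ring.
have eth : th = - (2%:R * m) by apply/eqP; rewrite -addr_eq0 addrC e0.
have eA2 : A = d ^+ 2 - 3%:R * m ^+ 2 by rewrite eA eth; ring.
have eB2 : B = 2%:R * m * (m ^+ 2 + d ^+ 2) by rewrite eB eth; ring.
have cb0 : c0 m d (betaA b K) = 2%:R * (h1 ^+ 2 - h2 ^+ 2) by rewrite hA /c0 /betaA em; ring.
have cb1 : c1 m d (betaA b K) = 2%:R * (2%:R * h1 * h2) by rewrite hd /c1 /betaA; ring.
have c0E : c0 m d e' = 2%:R * ((h1 ^+ 2 - h2 ^+ 2) * c0 m d e - 2%:R * h1 * h2 * c1 m d e).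
  by rewrite /e' eB2 eA2 (c_mulA m d _ e).1 cb0 cb1; ring.
have c1E : c1 m d e' = 2%:R * ((h1 ^+ 2 - h2 ^+ 2) * c1 m d e + 2%:R * h1 * h2 * c0 m d e).
  by rewrite /e' eB2 eA2 (c_mulA m d _ e).2 cb0 cb1; ring.
have S2 : tiso (gram A B e') <-> sol (- A0 / (2%:R * (2%:R * a0))) 10%:R.
  rewrite g1; have a20 : 2%:R * a0 != 0 by rewrite mulf_neq0.
  have la20 : 2%:R * la != 0 by rewrite mulf_neq0.
  rewrite -(sol_pair A0 (a0 := 2%:R * a0) (a1 := 2%:R * a1) a20 la20); last first.
    have -> : (2%:R * a0) ^+ 2 + (2%:R * a1) ^+ 2 = 4%:R * (a0 ^+ 2 + a1 ^+ 2) by ring.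
    by rewrite eN; ring.
  have -> : split_form th m d e' = TForm (A0 * mu ^+ 2) (2%:R * sa0 th m d e') (- 2%:R * sa0 th m d e') (- 2%:R * sa1 th m d e') 0 0.
    by rewrite /split_form evth /A0; congr TForm; ring.
  by apply: (tiso_eta A0 mu0 hN); rewrite /a0 /a1 /sa0 /sa1 c0E c1E; field; rewrite ?d0 ?fp0 ?m2.
have m0 : - A0 / (2%:R * a0) != 0.
  by apply: mulf_neq0; [rewrite oppr_eq0 | rewrite invr_eq0 mulf_neq0].
rewrite S1 S2; have := sol_half m0.
by have -> : - A0 / (2%:R * a0) / 2%:R = - A0 / (2%:R * (2%:R * a0)) by field; rewrite ?m2 ?a00.
Qed.
End DyadicIso.
End Dyadic.

(** * Half points *)

Section HalfPoints.
Variables (b : nat) (ob : odd b).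
Local Notation hAB := (family_disc ob).

Section OneField.
Variables (L : fieldType) (r : {rmorphism rat -> L}).
Local Notation pt := (spoint hAB r).
Local Notation g := (gF L b).

Let n2 : 2%:R != 0 :> L. Proof. exact: (char0_natr_neq0 r 1). Qed.

(* kf t (val R) is the square root of x(2R) - t given by the tangent line at R. *)
Definition kf (t : L) (P : option (L * L)) : L :=
  if P is Some (x, y) then ((x - t) ^+ 2 - (3%:R * t ^+ 2 + g)) / (2%:R * y) else 0.

Lemma spt_on (P : pt) x y : val P = Some (x, y) -> y ^+ 2 = fb b x.
Proof. by move=> e; have := pointP P; rewrite -[point_val P]/(val P) e (on_Eb ob r) => /eqP. Qed.

Lemma kf_double (R : pt) t X Y : fb b t = 0 -> val R = Some (X, Y) -> Y != 0 ->
  exists y2, val (R *+ 2) = Some ((kf t (val R)) ^+ 2 + t, y2).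
Proof.
move=> ft eR Y0; have hY := spt_on eR; rewrite -[R *+ 2]/(R + R) spt_addval eR /=.
have -> : (Y == - Y) = false by rewrite (oppr_eqself n2) (negPf Y0).
rewrite eqxx /= /sslope eqxx; eexists; congr (Some (_, _)); rewrite /kf.
have Y20 : 2%:R * Y != 0 by rewrite mulf_neq0.
have key : (3%:R * X ^+ 2 + g) ^+ 2 = ((X - t) ^+ 2 - (3%:R * t ^+ 2 + g)) ^+ 2 + (2%:R * X + t) * (2%:R * Y) ^+ 2.
  apply/eqP; rewrite -subr_eq0; apply/eqP.
  transitivity (- ((8%:R * X + 4%:R * t) * fb b t)); last by rewrite ft mulr0 oppr0.
  by rewrite exprMn hY /fb; ring.
rewrite !expr_div_n key mulrDl mulfK ?expf_neq0 //; ring.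
Qed.

Lemma kf_opp (R : pt) t : kf t (val (- R)) = - kf t (val R).
Proof.
rewrite -[- R]/(pt_opp R : pt) /= (raw_oppE hAB r) -[point_val R]/(val R); case: (val R) => [[x y]|] /=; last by rewrite oppr0.
by rewrite mulrN invrN mulrN.
Qed.

Lemma torsion2P (D : pt) : D + D = 0 -> D = 0 \/ exists2 u, val D = Some (u, 0) & fb b u = 0.
Proof.
move=> e; case eD : (val D) => [[u y]|]; last by left; apply: val_inj.
right; have : val (- D) = val D by congr val; apply/eqP; rewrite eq_sym -addr_eq0 e.
rewrite -[- D]/(pt_opp D : pt) /= (raw_oppE hAB r) -[point_val D]/(val D) eD /= => -[] /eqP.
rewrite eq_sym (oppr_eqself n2) => /eqP y0; exists u; first by rewrite y0.
by rewrite -(spt_on eD) y0 expr0n.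
Qed.

Lemma torsion2_double (u : L) (D : pt) : val D = Some (u, 0) -> D + D = 0.
Proof. by move=> e; apply: val_inj; rewrite spt_addval e /= oppr0 !eqxx. Qed.

Lemma add_T2 (R D : pt) u X Y : fb b u = 0 -> val D = Some (u, 0) -> val R = Some (X, Y) -> Y != 0 ->
  val (R + D) = Some (u + (3%:R * u ^+ 2 + g) / (X - u), - (Y * (3%:R * u ^+ 2 + g)) / (X - u) ^+ 2) /\ X != u.
Proof.
move=> fu eD eR Y0; have hY := spt_on eR.
have nX : X != u by apply: contra_neq Y0 => eX; move: hY; rewrite eX fu => /eqP; rewrite expf_eq0 => /eqP.
have nXu : X - u != 0 by rewrite subr_eq0.
have nuX : u - X != 0 by rewrite subr_eq0 eq_sym.
split=> //; rewrite spt_addval eD eR /= (negPf nX) /= /sslope (negPf nX).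
have eY : Y ^+ 2 = (X - u) * (X ^+ 2 + u * X + u ^+ 2 + g).
  by rewrite hY; transitivity (fb b X - fb b u); [rewrite fu subr0 | rewrite /fb; ring].
have el : ((0 - Y) / (u - X)) ^+ 2 = (X ^+ 2 + u * X + u ^+ 2 + g) / (X - u).
  rewrite expr_div_n sub0r sqrrN eY; field; by rewrite nXu nuX.
have ex : ((0 - Y) / (u - X)) ^+ 2 - X - u = u + (3%:R * u ^+ 2 + g) / (X - u) by rewrite el; field.
congr (Some (_, _)); first exact: ex.
by rewrite ex; field; rewrite nXu nuX.
Qed.

Lemma kf_add_T2 (R D : pt) u t X Y : fb b u = 0 -> fb b t = 0 -> val D = Some (u, 0) -> val R = Some (X, Y) -> Y != 0 ->
  3%:R * u ^+ 2 + g != 0 -> kf t (val (R + D)) = if u == t then kf t (val R) else - kf t (val R).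
Proof.
move=> fu ft eD eR Y0 fu'; have [-> nX] := add_T2 fu eD eR Y0; rewrite eR /kf.
have nXu : X - u != 0 by rewrite subr_eq0.
have [eu|nu] := eqVneq u t.
  rewrite -eu; move: fu'; move: (3%:R * u ^+ 2 + g) => F F0; field; by rewrite nXu n2 Y0 oppr_eq0 mulf_neq0.
have nut : u - t != 0 by rewrite subr_eq0.
have eg : g = - (u ^+ 2 + u * t + t ^+ 2).
  apply: (mulfI nut); apply/eqP; rewrite -subr_eq0; apply/eqP.
  by transitivity (fb b u - fb b t); [rewrite /fb; ring | rewrite fu ft subrr].
have e1 : 3%:R * u ^+ 2 + g = (u - t) * (2%:R * u + t) by rewrite eg; ring.
have nw : 2%:R * u + t != 0 by move: fu'; rewrite e1 mulf_eq0 negb_or => /andP[].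
rewrite e1 eg; field; by rewrite nXu Y0 n2 oppr_eq0 !mulf_neq0.
Qed.

(** On 2-torsion points D, [true] means that the Weil pairing of D with (t, 0) is trivial;
    translation by D multiplies [kf t] by this sign. *)
Definition chi t (D : pt) : bool := (D == 0) || (val D == Some (t, 0)).
Definition sg (x : bool) : L := if x then 1 else - 1.

Lemma fb'_neq0 u : fb b u = 0 -> 3%:R * u ^+ 2 + g != 0.
Proof.
move=> fu; have := scurve_smooth hAB r (x := u); rewrite (ratrA b r) (ratrB b r); apply; exact: fu.
Qed.

Lemma kf_chi (R D : pt) t X Y : fb b t = 0 -> val R = Some (X, Y) -> Y != 0 -> D + D = 0 ->
  kf t (val (R + D)) = sg (chi t D) * kf t (val R).
Proof.
move=> ft eR Y0 /torsion2P[->|[u eD fu]]; first by rewrite addr0 /chi eqxx mul1r.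
rewrite (kf_add_T2 fu ft eD eR Y0) ?fb'_neq0 // /chi eD.
have -> : (D == 0) = false by apply/eqP => D0; move: eD; rewrite D0.
have -> : (Some (u, 0) == Some (t, 0) :> option (L * L)) = (u == t).
  by apply/eqP/eqP => [[]|->].
by rewrite /sg /=; case: eqP => _; rewrite ?mul1r ?mulN1r.
Qed.

Lemma torsion2_sum (R D : pt) X Y : val R = Some (X, Y) -> Y != 0 -> D + D = 0 ->
  exists X' Y', val (R + D) = Some (X', Y') /\ Y' != 0.
Proof.
move=> eR Y0 /torsion2P[->|[u eD fu]]; first by rewrite addr0; exists X, Y.
have [e nX] := add_T2 fu eD eR Y0; do 2!eexists; split; first exact: e.
by rewrite !mulf_neq0 ?invr_eq0 ?expf_neq0 ?oppr_eq0 ?mulf_neq0 ?fb'_neq0 // subr_eq0.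
Qed.
End OneField.

Lemma kf_map (L L' : fieldType) (r : {rmorphism rat -> L}) (r' : {rmorphism rat -> L'}) (f : {rmorphism L -> L'})
   (R : spoint hAB r) t : f (kf t (val R)) = kf (f t) (val (smap r' f R)).
Proof.
rewrite /smap /= /raw_map -[point_val R]/(val R); case: (val R) => [[x y]|] /=; last by rewrite rmorph0.
rewrite fmorph_div (rmorphB f ((x - t) ^+ 2)) (rmorphXn f) (rmorphB f x) (rmorphD f (3%:R * _)) (rmorphM f 3%:R).
by rewrite (rmorphXn f) (rmorphM f 2%:R) !(rmorph_nat f) rmorph_gF.
Qed.

(** Choose square roots s_j of x - t_j with product y. The point with X - t1 = (s1 + s2)(s1 + s3),
    and symmetrically, has tangent slope s1 + s2 + s3 and is a half of (x, y). *)
Lemma halving (L : closedFieldType) (r : {rmorphism rat -> L}) (t1 t2 t3 : L) :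
  t1 + t2 + t3 = 0 -> (forall x, fb b x = (x - t1) * (x - t2) * (x - t3)) ->
  forall P : spoint hAB r, exists R, R + R = P.
Proof.
move=> et ft P; have n2 : 2%:R != 0 :> L := char0_natr_neq0 r 1.
have sqrtL (a : L) : exists s, s ^+ 2 = a.
  have [|s] := @solve_monicpoly L 2 (fun i => if i == 0%N then a else 0) _; first by [].
  by rewrite !big_ord_recl big_ord0 /= expr0 mulr1 mul0r !addr0 => h; exists s.
case eP : (val P) => [[x y]|]; last by exists 0; rewrite addr0; apply: val_inj.
have hy := spt_on eP; have [s1 e1] := sqrtL (x - t1); have [s2 e2] := sqrtL (x - t2); have [s3' e3'] := sqrtL (x - t3).
have [s3 e3 ey] : exists2 s3, s3 ^+ 2 = x - t3 & y = s1 * s2 * s3.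
  have /eqP : y ^+ 2 = (s1 * s2 * s3') ^+ 2 by rewrite hy ft -e1 -e2 -e3'; ring.
  by rewrite eqf_sqr => /orP[/eqP|/eqP] ->; [exists s3' | exists (- s3'); rewrite ?sqrrN // mulrN].
pose X := x + s1 * s2 + s1 * s3 + s2 * s3; pose Y := (s1 + s2) * (s1 + s3) * (s2 + s3).
have eX1 : X - t1 = (s1 + s2) * (s1 + s3).
  by transitivity (x - t1 + (s1 * s2 + s1 * s3 + s2 * s3)); [rewrite /X; ring | rewrite -e1; ring].
have eX2 : X - t2 = (s1 + s2) * (s2 + s3).
  by transitivity (x - t2 + (s1 * s2 + s1 * s3 + s2 * s3)); [rewrite /X; ring | rewrite -e2; ring].
have eX3 : X - t3 = (s1 + s3) * (s2 + s3).
  by transitivity (x - t3 + (s1 * s2 + s1 * s3 + s2 * s3)); [rewrite /X; ring | rewrite -e3; ring].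
have hY : Y ^+ 2 = fb b X by rewrite ft eX1 eX2 eX3 /Y; ring.
have fd t : fb b t = 0 -> 3%:R * t ^+ 2 + gF L b != 0 by exact: fb'_neq0.
have ds x' : 3%:R * x' ^+ 2 + gF L b = (x' - t1) * (x' - t2) + (x' - t1) * (x' - t3) + (x' - t2) * (x' - t3).
  have n6 : 6%:R != 0 :> L := char0_natr_neq0 r 5.
  have g1 := ft 1; have g2 := ft (- 1).
  have eg : gF L b = t1 * t2 + t1 * t3 + t2 * t3.
    apply: (mulfI n2); transitivity (fb b (1 : L) - fb b (- 1) - 2%:R); first by rewrite /fb; ring.
    by rewrite !ft; ring.
  rewrite eg; transitivity (3%:R * x' ^+ 2 - 2%:R * (t1 + t2 + t3) * x' + (t1 * t2 + t1 * t3 + t2 * t3)); last by ring.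
  by rewrite et; ring.
have f1 := fd t1; have f2 := fd t2; have f3 := fd t3.
have z1 : fb b t1 = 0 by rewrite ft; ring.
have z2 : fb b t2 = 0 by rewrite ft; ring.
have z3 : fb b t3 = 0 by rewrite ft; ring.
have d12 : (s1 + s2) * (s1 - s2) = t2 - t1 by transitivity (s1 ^+ 2 - s2 ^+ 2); [ring | rewrite e1 e2; ring].
have d13 : (s1 + s3) * (s1 - s3) = t3 - t1 by transitivity (s1 ^+ 2 - s3 ^+ 2); [ring | rewrite e1 e3; ring].
have d23 : (s2 + s3) * (s2 - s3) = t3 - t2 by transitivity (s2 ^+ 2 - s3 ^+ 2); [ring | rewrite e2 e3; ring].
have n12 : s1 + s2 != 0.
  by apply: contra_neq (f1 z1) => h; move: d12; rewrite h mul0r => /esym/subr0_eq h'; rewrite ds h'; ring.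
have n13 : s1 + s3 != 0.
  by apply: contra_neq (f1 z1) => h; move: d13; rewrite h mul0r => /esym/subr0_eq h'; rewrite ds h'; ring.
have n23 : s2 + s3 != 0.
  by apply: contra_neq (f2 z2) => h; move: d23; rewrite h mul0r => /esym/subr0_eq h'; rewrite ds h'; ring.
have Y0 : Y != 0 by rewrite !mulf_neq0.
exists (mkpt ob r hY); apply: val_inj; rewrite spt_addval eP /=.
have -> : (Y == - Y) = false by rewrite (oppr_eqself n2) (negPf Y0).
rewrite eqxx /= /sslope eqxx.
have -> : (3%:R * X ^+ 2 + gF L b) / (2%:R * Y) = s1 + s2 + s3.
  rewrite ds eX1 eX2 eX3; have Y20 : 2%:R * Y != 0 by rewrite mulf_neq0.
  by apply: (mulIf Y20); rewrite divfK // /Y; ring.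
have ex : (s1 + s2 + s3) ^+ 2 - X - X = x.
  transitivity (s1 ^+ 2 + s2 ^+ 2 + s3 ^+ 2 - 2%:R * x); first by rewrite /X; ring.
  rewrite e1 e2 e3; transitivity (x - (t1 + t2 + t3)); [ring | by rewrite et subr0].
rewrite ex; congr (Some (_, _)); rewrite ey /X /Y; ring.
Qed.
End HalfPoints.

(** * Descent over the rationals *)

Local Notation rQ := (ratr : {rmorphism rat -> algC}).

Lemma algC_algebraic (x : algC) : algebraicOver rQ x.
Proof. by have [p p0 px] := algC_rat_root x; exists p. Qed.

Lemma algC_char0 : has_char0 algC.
Proof. exact: Cpchar. Qed.

Fact gal_id_bij : bijective (idfun : {rmorphism algC -> algC}). Proof. by exists idfun. Qed.
Definition gal_id : galQ := @Gal rat algC rQ idfun gal_id_bij (fun=> erefl).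

Fact gal_conj_bij : bijective (Num.conj : {rmorphism algC -> algC}).
Proof. by exists Num.conj; exact: conjCK. Qed.
Fact gal_conj_fix x : (Num.conj : {rmorphism algC -> algC}) (rQ x) = rQ x.
Proof. exact: fmorph_rat. Qed.
Definition gal_conj : galQ := Gal gal_conj_bij gal_conj_fix.

Lemma gal_inv_ex (s : galQ) : exists s' : galQ, (forall x, s' (s x) = x) /\ (forall x, s (s' x) = x).
Proof.
have [g sK gK] := gal_bij s.
have gB : zmod_morphism g by move=> x y; apply: (can_inj sK); rewrite rmorphB !gK.
have gM : monoid_morphism g.
  by split=> [|x y]; apply: (can_inj sK); rewrite gK ?rmorph1 // rmorphM !gK.
have [h eh] := exists_rmorphism gB gM.
have hb : bijective h by exists s => x; rewrite eh ?sK ?gK.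
have hf x : h (rQ x) = rQ x by rewrite eh -{1}(gal_fix s x) sK.
by exists (Gal hb hf); split=> x /=; rewrite eh.
Qed.

Section Roots.
Variables (b : nat) (ob : odd b).
Local Notation g := (gF algC b).

Lemma exists_roots : exists t1 t2 t3 : algC, [/\ t1 + t2 + t3 = 0, forall x, fb b x = (x - t1) * (x - t2) * (x - t3),
  (t1 - t2) * (t1 - t3) * (t2 - t3) = 32%:R * g * 'i & [/\ t1^* = t1, t2^* = t3 & t3^* = t2]].
Proof.
have [t1 [t2 [t3 [s1 fE]]]] : exists t1 t2 t3 : algC, t1 + t2 + t3 = 0 /\ forall x, fb b x = (x - t1) * (x - t2) * (x - t3).
  have [|u hu] := @solve_monicpoly algC 3 (fun k => if k == 0%N then - (2%:R * g * b%:R ^+ 2) else if k == 1%N then - g else 0) _; first by [].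
  move: hu; rewrite !big_ord_recl big_ord0 /= expr0 mulr1 expr1 mul0r !addr0 => hu.
  have fu : fb b u = 0 by rewrite /fb hu; ring.
  have [|w hw] := @solve_monicpoly algC 2 (fun k => if k == 0%N then - (u ^+ 2 + g) else - u) _; first by [].
  move: hw; rewrite !big_ord_recl big_ord0 /= expr0 mulr1 expr1 !addr0 => hw.
  exists u, w, (- u - w); split; first by ring.
  move=> x; transitivity (fb b x - fb b u); first by rewrite fu subr0.
  rewrite /fb; transitivity ((x - u) * (x ^+ 2 + u * x + u ^+ 2 + g)); first by ring.
  rewrite -mulrA; congr (_ * _); transitivity (x ^+ 2 + u * x + (u ^+ 2 + g) - (w ^+ 2 - (- (u ^+ 2 + g) + - u * w))); first by rewrite hw subrr subr0; ring.
  by ring.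
have e2 : t1 * t2 + t1 * t3 + t2 * t3 = g.
  have n2 : 2%:R != 0 :> algC by rewrite pnatr_eq0.
  apply: (mulfI n2); transitivity ((1 - t1) * (1 - t2) * (1 - t3) - (-1 - t1) * (-1 - t2) * (-1 - t3) - 2%:R); first by ring.
  by rewrite -!fE /fb; ring.
have e3 : t1 * t2 * t3 = - (2%:R * g * b%:R ^+ 2).
  by transitivity (- ((0 - t1) * (0 - t2) * (0 - t3))); [ring | rewrite -fE /fb; ring].
have g0 : g != 0 := gF_neq0L ob rQ.
have n32 : 32%:R * g != 0 by rewrite mulf_neq0 // pnatr_eq0.
pose D (x y z : algC) := (x - y) * (x - z) * (y - z).
have D2 : D t1 t2 t3 ^+ 2 = (32%:R * g * 'i) ^+ 2.
  rewrite [RHS]exprMn sqrCi; transitivity (- 4%:R * g ^+ 2 * 256%:R); last by ring.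
  rewrite -(gF_256 algC b).
  transitivity (- 4%:R * g ^+ 3 - 27%:R * (2%:R * g * b%:R ^+ 2) ^+ 2); last by ring.
  rewrite -(sqrrN (2%:R * g * _)) -e3 -e2 /D; have -> : t3 = - t1 - t2.
    by apply/eqP; rewrite -subr_eq0 -s1; apply/eqP; ring.
  by ring.
have gr : g^* = g by rewrite (rmorph_gF (Num.conj : {rmorphism algC -> algC})).
have rt (t : algC) : fb b t = 0 -> fb b t^* = 0.
  by move=> h; rewrite -(rmorph_fb b (Num.conj : {rmorphism algC -> algC})) h rmorph0.
have main (x y z : algC) : x + y + z = 0 -> (forall u, fb b u = (u - x) * (u - y) * (u - z)) -> D x y z ^+ 2 = (32%:R * g * 'i) ^+ 2 ->
    [/\ x^* = x, y^* = z & z^* = y] ->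
    exists t1 t2 t3 : algC, [/\ t1 + t2 + t3 = 0, forall x, fb b x = (x - t1) * (x - t2) * (x - t3),
      (t1 - t2) * (t1 - t3) * (t2 - t3) = 32%:R * g * 'i & [/\ t1^* = t1, t2^* = t3 & t3^* = t2]].
  move=> h1 h2 /eqP; rewrite eqf_sqr => /orP[] /eqP h3 [h4 h5 h6]; first by exists x, y, z.
  exists x, z, y; split=> //; first by rewrite -h1; ring.
  - by move=> u; rewrite h2; ring.
  - by rewrite -[RHS]opprK -h3 /D; ring.
have D0 : D t1 t2 t3 != 0.
  have : D t1 t2 t3 ^+ 2 != 0 by rewrite D2 expf_neq0 // mulf_neq0 // neq0Ci.
  by rewrite expf_eq0.
have [d12 d13 d23] : [/\ t1 != t2, t1 != t3 & t2 != t3].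
  by move: D0; rewrite /D !mulf_eq0 !negb_or !subr_eq0 => /andP[/andP[-> ->] ->].
have three (u : algC) : fb b u = 0 -> [\/ u = t1, u = t2 | u = t3].
  move=> h; have /eqP := fE u; rewrite h eq_sym !mulf_eq0 !subr_eq0 -orbA => /or3P[] /eqP ->; by [constructor 1|constructor 2|constructor 3].
have c1 (h : fb b t1 = 0) := three _ (rt _ h); have c2 (h : fb b t2 = 0) := three _ (rt _ h); have c3 (h : fb b t3 = 0) := three _ (rt _ h).
have {c1} c1 : [\/ t1^* = t1, t1^* = t2 | t1^* = t3] by apply: c1; rewrite fE; ring.
have {c2} c2 : [\/ t2^* = t1, t2^* = t2 | t2^* = t3] by apply: c2; rewrite fE; ring.
have {c3} c3 : [\/ t3^* = t1, t3^* = t2 | t3^* = t3] by apply: c3; rewrite fE; ring.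
have inj (x y : algC) : x^* = y^* -> x = y by move=> h; rewrite -[x]conjCK h conjCK.
(* The Vandermonde product is 32 g i up to sign, hence not real; so exactly one root is real, and
   ordering the other two fixes the sign. *)
have nr : ~ [/\ t1^* = t1, t2^* = t2 & t3^* = t3].
  move=> [h1 h2 h3]; have hD : (D t1 t2 t3)^* = D t1 t2 t3 by rewrite /D !rmorphM !rmorphB /= h1 h2 h3.
  have : (32%:R * g * 'i)^* = - (32%:R * g * 'i) by rewrite !rmorphM /= conjCi gr conjC_nat mulrN.
  have /eqP : D t1 t2 t3 ^+ 2 = (32%:R * g * 'i) ^+ 2 by [].
  have nD : - D t1 t2 t3 = D t1 t2 t3 -> False.
    by move/eqP; rewrite eq_sym -subr_eq0 opprK -mulr2n -mulr_natl mulf_eq0 pnatr_eq0 (negPf D0).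
  rewrite eqf_sqr => /orP[] /eqP eD h; apply: nD; rewrite -[RHS]hD eD; first by rewrite h.
  by rewrite (rmorphN (Num.conj : {rmorphism algC -> algC})) /= h.
have inv (x y : algC) : x^* = y -> y^* = x by move=> <-; rewrite conjCK.
have ne (x y : algC) : x != y -> x = y -> False by move=> /eqP.
case: c1 => h1.
- case: c2 => h2; first by case: (ne _ _ d12); apply: inj; rewrite h1 h2.
    case: c3 => h3; [by case: (ne _ _ d13); apply: inj; rewrite h1 h3 | by case: (ne _ _ d23); apply: inj; rewrite h2 h3 | by case: nr].
  by apply: (main t1 t2 t3) => //; split=> //; exact: inv.
- apply: (main t3 t1 t2).
  + by rewrite -s1; ring.
  + by move=> u; rewrite fE; ring.
  + by rewrite -D2 /D; ring.
  case: c3 => h3; [by case: (ne _ _ d23); apply: inj; rewrite (inv _ _ h1) h3 | by case: (ne _ _ d13); apply: inj; rewrite h1 h3 | by split=> //; exact: inv].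
apply: (main t2 t1 t3).
- by rewrite -s1; ring.
- by move=> u; rewrite fE; ring.
- by rewrite -D2 /D; ring.
case: c2 => h2; [by case: (ne _ _ d23); apply: inj; rewrite (inv _ _ h1) h2 | by split=> //; exact: inv | by case: (ne _ _ d12); apply: inj; rewrite h1 h2].
Qed.
End Roots.

Section Character.
Variables (b : nat) (ob : odd b).
Local Notation hAB := (family_disc ob).
Local Notation pt := (spoint hAB rQ).
Local Notation act := (smap (hAB := hAB) (r := rQ) rQ).
Local Notation g := (gF algC b).
Local Notation x1 := (- 3%:R * b%:R ^+ 2 : algC).
Variables (t1 t2 t3 : algC).
Hypotheses (s1 : t1 + t2 + t3 = 0) (fE : forall x, fb b x = (x - t1) * (x - t2) * (x - t3))
  (vdm : (t1 - t2) * (t1 - t3) * (t2 - t3) = 32%:R * g * 'i) (cj1 : t1^* = t1) (cj2 : t2^* = t3) (cj3 : t3^* = t2).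
Variable c : galQ -> pt.
Hypotheses (cc : cocycle (c : cochain (Eb ob) rQ)) (c2 : forall s, c s + c s = xi ob s).

Definition GN (s : galQ) : Prop := [/\ s 'i = 'i, s t1 = t1, s t2 = t2 & s t3 = t3].

Lemma c_mul s t : c (gal_mul s t) = c s + act s (c t).
Proof. by have /cocycleP[_ h] := cc. Qed.
Lemma c_ext (s t : galQ) : s =1 t -> c s = c t.
Proof. by have /cocycleP[h _] := cc; have [A hA] := h t => e; apply: hA => x _; rewrite e. Qed.
Lemma c_id : c gal_id = 0.
Proof.
have := c_mul gal_id gal_id; rewrite (c_ext (s := gal_mul gal_id gal_id) (t := gal_id)) //.
have -> : act gal_id (c gal_id) = c gal_id.
  by apply: val_inj; rewrite /smap /= /raw_map; case: (point_val _) => [[]|].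
by move/eqP; rewrite eq_sym -subr_eq0 addrK => /eqP.
Qed.

Lemma froot1 : fb b t1 = 0. Proof. by rewrite fE; ring. Qed.
Lemma froot2 : fb b t2 = 0. Proof. by rewrite fE; ring. Qed.
Lemma froot3 : fb b t3 = 0. Proof. by rewrite fE; ring. Qed.

Lemma GN_torsion s (D : pt) : GN s -> D + D = 0 -> act s D = D.
Proof.
move=> [_ h1 h2 h3] /torsion2P[->|[u eD fu]]; first exact: raddf0.
apply: val_inj; rewrite /smap /= -[point_val D]/(val D) eD /= rmorph0; congr (Some (_, _)).
move/eqP: fu; rewrite fE !mulf_eq0 !subr_eq0 -orbA => /or3P[] /eqP -> //.
Qed.

Lemma GN_c s : GN s -> c s + c s = 0.
Proof. by move=> [h _ _ _]; rewrite c2 (xi_fix ob h).1. Qed.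

Lemma GN_mul s t : GN s -> GN t -> GN (gal_mul s t).
Proof. by move=> [h1 h2 h3 h4] [k1 k2 k3 k4]; split=> /=; rewrite ?k1 ?k2 ?k3 ?k4. Qed.

Definition H0 := c gal_conj.
Lemma H0_double : H0 + H0 = QC ob.
Proof. by rewrite c2 (xi_move ob (s := gal_conj) _).1 //= conjCi. Qed.

Lemma n16_neq0 : 16%:R * b%:R * 'i != 0 :> algC.
Proof. by rewrite !mulf_neq0 ?pnatr_eq0 ?neq0Ci //; case: (b) ob. Qed.

Lemma QC_neq0 : QC ob != 0. Proof. by apply/eqP => /(congr1 val). Qed.

Lemma H0_val : exists X Y, val H0 = Some (X, Y) /\ Y != 0.
Proof.
case e : (val H0) => [[X Y]|].
  exists X, Y; split=> //; apply: contra_neq QC_neq0 => Y0; rewrite -H0_double.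
  by apply: (torsion2_double (u := X)); rewrite e Y0.
have h : H0 = 0 by exact: val_inj.
by have := QC_neq0; rewrite -H0_double h addr0 eqxx.
Qed.

Definition rk t := kf b t (val H0).
Lemma rk_sqr t : fb b t = 0 -> rk t ^+ 2 = x1 - t.
Proof.
move=> ft; have [X [Y [e Y0]]] := H0_val; have [y2] := kf_double ft e Y0.
rewrite -[H0 *+ 2]/(H0 + H0) H0_double /= => -[e2 _]; by rewrite /rk e2 addrK.
Qed.
Lemma x1_neq t : fb b t = 0 -> x1 - t != 0.
Proof.
move=> ft; apply: contra_neq (expf_neq0 2 n16_neq0) => h; rewrite (Q1_on b (sqrCi algC)).
by have -> : x1 = t by exact: subr0_eq.
Qed.
Lemma rk_neq0 t : fb b t = 0 -> rk t != 0.
Proof. by move=> ft; have := x1_neq ft; rewrite -rk_sqr // expf_eq0. Qed.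

(** Bilinearity of the Weil pairing, read off by translating H0 first by D and then by D'. *)
Lemma sg_chiD t (D D' : pt) : fb b t = 0 -> D + D = 0 -> D' + D' = 0 ->
  sg algC (chi t (D + D')) = sg algC (chi t D) * sg algC (chi t D').
Proof.
move=> ft hD hD'; have [X [Y [e Y0]]] := H0_val.
have hDD : (D + D') + (D + D') = 0 by rewrite addrACA hD hD' addr0.
apply: (mulIf (rk_neq0 ft)); rewrite /rk -(kf_chi ft e Y0 hDD) addrA.
have [X' [Y' [e' Y0']]] := torsion2_sum e Y0 hD.
by rewrite (kf_chi ft e' Y0' hD') (kf_chi ft e Y0 hD) mulrA [sg _ _ * sg _ _]mulrC.
Qed.

Lemma sg_sqr x : sg algC x * sg algC x = 1. Proof. by case: x; rewrite /sg ?mulr1 // mulrNN mulr1. Qed.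
Lemma sg_inj : injective (sg algC).
Proof.
have h : (1 == - 1 :> algC) = false by rewrite -subr_eq0 opprK -(natrD _ 1 1) pnatr_eq0.
by move=> [] [] //= /eqP; rewrite ?h // eq_sym h.
Qed.

Lemma chi_map (f : galQ) t (D : pt) : chi (f t) (act f D) = chi t D.
Proof.
rewrite /chi raddf_eq0; last first.
  by move=> P Q /(congr1 val); rewrite /= /raw_map => h; apply: val_inj => /=; move: h; rewrite -![point_val _]/(val _);
   case: (val P) (val Q) => [[? ?]|] [[? ?]|] //= [/fmorph_inj -> /fmorph_inj ->].
congr (_ || _); rewrite /smap /= /raw_map -[point_val D]/(val D); case: (val D) => [[x y]|] //=.
apply/eqP/eqP => [[/fmorph_inj -> /eqP]|[-> ->]]; last by rewrite rmorph0.
by rewrite fmorph_eq0 => /eqP ->.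
Qed.

Definition ch t s := sg algC (chi t (c s)).

Lemma ch_mul t s s' : fb b t = 0 -> GN s -> GN s' -> ch t (gal_mul s s') = ch t s * ch t s'.
Proof. by move=> ft hs hs'; rewrite /ch c_mul (GN_torsion hs (GN_c hs')) sg_chiD // GN_c. Qed.

(* A square root of the character ch t1: an element of the field cut out by the kernel, made anti-invariant. *)
Lemma resolvent : exists2 u : algC, u != 0 & forall s, GN s -> s u = ch t1 s * u.
Proof.
have [[s0 [N0 h0]]|all1] := pselect (exists s0, GN s0 /\ chi t1 (c s0) = false); last first.
  exists 1; rewrite ?oner_eq0 // => s hs; rewrite rmorph1 mulr1 /ch.
  by case e : (chi t1 (c s)) => //; case: all1; exists s.
pose H h := GN h /\ chi t1 (c h) = true.
have chH h : H h -> ch t1 h = 1 by move=> [_ e]; rewrite /ch e.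
have Hch h : GN h -> ch t1 h = 1 -> H h.
  by move=> hh e; split=> //; apply: sg_inj; rewrite -[sg _ (chi _ _)]/(ch t1 h) e.
have ch0 : ch t1 s0 = -1 by rewrite /ch h0.
have f1 := froot1; have [s0' [s0K s0'K]] := gal_inv_ex s0.
have N0' : GN s0'.
  by case: N0 => k1 k2 k3 k4; split; [rewrite -{1}k1 | rewrite -{1}k2 | rewrite -{1}k3 | rewrite -{1}k4]; exact: s0K.
(* The kernel H has index 2 and misses s0, so z - s0 z is fixed by H and negated by the rest of
   [GN]. *)
suff [z [fz mz]] : exists z, (forall h, H h -> h z = z) /\ s0 z <> z.
  exists (z - s0 z); first by rewrite subr_eq0; apply/eqP => e; apply: mz.
  move=> s Ns; pose h := gal_mul s0' s.
  have eh : ch t1 s = ch t1 s0 * ch t1 h.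
    rewrite -ch_mul //; last exact: GN_mul.
    by rewrite /ch (c_ext (s := s) (t := gal_mul s0 h)) // => x /=; rewrite s0'K.
  have es x : s x = s0 (h x) by rewrite /= s0'K.
  have Nss : GN (gal_mul s s0) by exact: GN_mul.
  case e : (chi t1 (c s)).
    have Hs : H s by []. pose k := gal_mul s0' (gal_mul s s0).
    have Nk : GN k by exact: GN_mul.
    have ek : ch t1 s0 * ch t1 k = ch t1 s * ch t1 s0.
      rewrite -!ch_mul // /ch (c_ext (s := gal_mul s0 k) (t := gal_mul s s0)) // => x /=; by rewrite s0'K.
    have Hk : H k.
      apply: Hch => //; move: ek; rewrite (chH s Hs) ch0 mul1r mulN1r => /eqP; rewrite eqr_opp => /eqP //.
    have ess x : s (s0 x) = s0 (k x) by rewrite /= s0'K.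
    by rewrite (chH s Hs) mul1r rmorphB ess (fz k Hk) (fz s Hs).
  have chs : ch t1 s = -1 by rewrite /ch e.
  have Hh : H h.
    apply: Hch; first exact: GN_mul.
    by move: eh; rewrite chs ch0 mulN1r => /eqP; rewrite eqr_opp eq_sym => /eqP.
  have Hss : H (gal_mul s s0) by apply: Hch => //; rewrite ch_mul // chs ch0 mulrNN mulr1.
  by rewrite rmorphB es (fz h Hh) -[s (s0 z)]/(gal_mul s s0 z) (fz _ Hss) chs mulN1r opprB.
(* Suppose s0 fixes all that H fixes. By continuity c agrees with c s0 at any h with the same value
   at a primitive element al. The polynomial whose roots are the H-orbit of al is fixed by H, hence
   by s0; so s0 al = h al for some h in H, and c s0 = c h, a contradiction. *)
apply: contrapT => nz; have fixs z : (forall h, H h -> h z = z) -> s0 z = z.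
  by move=> hz; apply: contrapT => ne; apply: nz; exists z.
have /cocycleP[cont _] := cc; have [A hA] := cont s0.
have [al _ [ps eA]] := algC_PET A.
have agree (h : galQ) : h al = s0 al -> c h = c s0.
  move=> e; apply: hA => x; rewrite eA => /mapP[p _ ->] /=.
  have pev (f : galQ) : f (map_poly ratr p).[al] = (map_poly ratr p).[f al].
    rewrite -horner_map -map_poly_comp; congr (_.[_]); apply: eq_map_poly => q /=; exact: gal_fix.
  by rewrite !pev e.
have [p p0 pal] := algC_rat_root al.
have [rs Drs] := closed_field_poly_normal (map_poly ratr p : {poly algC}).
have lp0 : lead_coef (map_poly ratr p : {poly algC}) != 0 by rewrite lead_coef_eq0 map_poly_eq0.
have in_rs (h : galQ) x : x \in rs -> h x \in rs.
  have rsE y : (y \in rs) = root (map_poly ratr p) y by rewrite Drs rootZ // root_prod_XsubC.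
  rewrite !rsE => /(rmorph_root h); rewrite -map_poly_comp.
  by rewrite (eq_map_poly (g := ratr)) // => q /=; exact: gal_fix.
have al_rs : al \in rs by move: pal; rewrite Drs rootZ // root_prod_XsubC.
pose O := [seq x <- undup rs | `[< exists h, H h /\ h al = x >]].
have Hid : H gal_id by split; [by split | rewrite c_id /chi eqxx].
have alO : al \in O by rewrite mem_filter mem_undup al_rs andbT; apply/asboolP; exists gal_id.
have uO : uniq O by rewrite filter_uniq ?undup_uniq.
pose P := \prod_(x <- O) ('X - x%:P).
have HO h x : H h -> x \in O -> h x \in O.
  move=> Hh; rewrite !mem_filter !mem_undup => /andP[/asboolP[k [Hk <-]] xr].
  rewrite in_rs // andbT; apply/asboolP; exists (gal_mul h k); split=> //.
  by apply: Hch; [exact: GN_mul Hh.1 Hk.1 | rewrite ch_mul // ?(chH _ Hh) ?(chH _ Hk) ?mulr1 //; [exact: Hh.1 | exact: Hk.1]].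
have mapP' h : H h -> map_poly h P = P.
  move=> Hh; rewrite /P rmorph_prod /= (eq_bigr (fun x => 'X - (h x)%:P)); last first.
    by move=> x _; rewrite rmorphB /= map_polyX map_polyC.
  rewrite -(big_map h xpredT (fun x => 'X - x%:P)); apply: perm_big.
  apply: uniq_perm => //; first by rewrite map_inj_uniq //; exact: fmorph_inj.
  have sub : {subset [seq h x | x <- O] <= O} by move=> y /mapP[x xO ->]; exact: HO.
  have [//||_ e] := uniq_min_size (s1 := [seq h x | x <- O]) (s2 := O) _ sub; rewrite ?size_map //.
  by rewrite map_inj_uniq //; exact: fmorph_inj.
have fP : map_poly s0 P = P.
  apply/polyP => k; rewrite coef_map /=; apply: fixs => h Hh.
  by have := coef_map h P k; rewrite (mapP' h Hh).
have : root P (s0 al).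
  by rewrite -fP fmorph_root root_prod_XsubC.
rewrite root_prod_XsubC mem_filter => /andP[/asboolP[h [Hh eh]] _].
by have := Hh.2; rewrite (agree h eh) h0.
Qed.

Lemma gal_conj_H0 : act gal_conj H0 = - H0.
Proof.
apply/eqP; rewrite -addr_eq0 addrC -c_mul -[0]c_id; apply/eqP/c_ext => x /=; exact: conjCK.
Qed.
Lemma conj_rk2 : (rk t2)^* = - rk t3.
Proof. by rewrite /rk -[_^*]/(gal_conj _) (kf_map rQ) gal_conj_H0 kf_opp /= cj2. Qed.
Lemma conj_rk3 : (rk t3)^* = - rk t2.
Proof. by rewrite /rk -[_^*]/(gal_conj _) (kf_map rQ) gal_conj_H0 kf_opp /= cj3. Qed.

(** The Kummer character of x1 - t, whose square root [rk t] comes from the half H0 of Q1. *)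
Definition ka t (s : galQ) := sg algC (chi t (act s H0 - H0)).
Lemma GN_D s : GN s -> (act s H0 - H0) + (act s H0 - H0) = 0.
Proof.
move=> [h _ _ _]; rewrite addrACA -opprD H0_double; have -> : act s H0 + act s H0 = QC ob; last by rewrite subrr.
have -> : act s H0 + act s H0 = act s (H0 + H0) := esym (raddfD (smap rQ s) H0 H0).
by rewrite H0_double; exact: (xi_fix ob h).2.
Qed.
Lemma ka_rk s t : GN s -> fb b t = 0 -> s t = t -> s (rk t) = ka t s * rk t.
Proof.
move=> hs ft st; rewrite {1}/rk (kf_map rQ) st; have [X [Y [e Y0]]] := H0_val.
by rewrite -(kf_chi ft e Y0 (GN_D hs)) addrC subrK.
Qed.
(** The product of the three x1 - t_j is f(x1), the square of 16 b i, which s fixes. *)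
Lemma ka_prod s : GN s -> ka t1 s * ka t2 s * ka t3 s = 1.
Proof.
move=> hs; have [h1 h2 h3 h4] := hs; have f1 := froot1; have f2 := froot2; have f3 := froot3.
set P := rk t1 * rk t2 * rk t3; have P0 : P != 0 by rewrite !mulf_neq0 ?rk_neq0.
have P2 : P ^+ 2 = (16%:R * b%:R * 'i) ^+ 2.
  by rewrite (Q1_on b (sqrCi algC)) fE -!rk_sqr // /P; ring.
have sP : s P = P.
  move/eqP: P2; rewrite eqf_sqr => /orP[] /eqP ->; rewrite ?rmorphN;
  by rewrite (rmorphM s _ 'i) (rmorphM s 16%:R) !rmorph_nat h1.
apply: (mulIf P0); rewrite mul1r -{2}sP /P !rmorphM /= !ka_rk //; ring.
Qed.

Definition cgc (s : galQ) := gal_mul gal_conj (gal_mul s gal_conj).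
Lemma GN_cgc s : GN s -> GN (cgc s).
Proof.
move=> [h1 h2 h3 h4]; have ei : ('i : algC)^* = - 'i := conjCi _; split; rewrite /cgc /=.
- by rewrite ei rmorphN h1 rmorphN /= ei opprK.
- by rewrite cj1 h2 cj1.
- by rewrite cj2 h4 cj3.
- by rewrite cj3 h3 cj2.
Qed.
(** The value of c at complex conjugation is a half of Q1, not a 2-torsion point, so [ch t1] is not
    invariant under conjugation. This defect forces the factor x1 - t_(j+1) in the descent. *)
Lemma ch_cgc s : GN s -> ch t1 (cgc s) = ch t1 s * ka t1 s.
Proof.
move=> hs; rewrite /ch /cgc !c_mul -/H0; set D := act s H0 - H0.
have -> : act s H0 = H0 + D by rewrite /D addrC subrK.
have -> : H0 + act gal_conj (c s + (H0 + D)) = act gal_conj (c s + D).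
  rewrite addrCA; have -> : act gal_conj (H0 + (c s + D)) = act gal_conj H0 + act gal_conj (c s + D) := raddfD (smap rQ gal_conj) _ _.
  by have -> := gal_conj_H0; rewrite addrA subrr add0r.
by rewrite -{1}cj1 -[t1^*]/(gal_conj t1) chi_map sg_chiD ?GN_c ?GN_D //; exact: froot1.
Qed.
Lemma ka_cgc s : GN s -> ka t2 (cgc s) = ka t3 s.
Proof.
move=> hs; have f2 := froot2; have f3 := froot3; apply: (mulIf (rk_neq0 f2)).
have [_ _ e2 e3] := hs; have hk := GN_cgc hs; have [_ _ e2' _] := hk.
rewrite -ka_rk //= conj_rk2 rmorphN (ka_rk hs f3 e3) rmorphN rmorphM /= conj_rk3 mulrN opprK.
by congr (_ * _); rewrite /ka; case: (chi _ _); rewrite /sg ?rmorphN rmorph1.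
Qed.

Lemma GN_or (s : galQ) : s t1 = t1 -> GN s \/ GN (gal_mul s gal_conj).
Proof.
have D0 : (t1 - t2) * (t1 - t3) * (t2 - t3) != 0.
  by rewrite vdm !mulf_neq0 ?neq0Ci ?pnatr_eq0 //; exact: (gF_neq0L ob rQ).
have [d12 d13 d23] : [/\ t1 != t2, t1 != t3 & t2 != t3].
  by move: D0; rewrite !mulf_eq0 !negb_or !subr_eq0 => /andP[/andP[-> ->] ->].
have key (s' : galQ) : s' t1 = t1 -> s' 'i = 'i -> GN s'.
  move=> e1 ei; have rt t : fb b t = 0 -> [\/ s' t = t1, s' t = t2 | s' t = t3].
    move=> ft; have /eqP := fE (s' t); rewrite -(rmorph_fb b s') ft rmorph0 eq_sym !mulf_eq0 !subr_eq0 -orbA.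
    by move=> /or3P[] /eqP ->; [constructor 1|constructor 2|constructor 3].
  have inj x y : x != y -> s' x = s' y -> False by move=> /eqP n /fmorph_inj.
  have h2 := rt _ froot2; have h3 := rt _ froot3.
  case: h2 => h2; first by case: (inj _ _ d12); rewrite e1 h2.
    case: h3 => h3; [by case: (inj _ _ d13); rewrite e1 h3 | by case: (inj _ _ d23); rewrite h2 h3 | by split].
  case: h3 => h3; [by case: (inj _ _ d13); rewrite e1 h3 | | by case: (inj _ _ d23); rewrite h2 h3].
  have : s' ((t1 - t2) * (t1 - t3) * (t2 - t3)) = (t1 - t2) * (t1 - t3) * (t2 - t3).
    by rewrite {1}vdm (rmorphM s' _ 'i) (rmorphM s' 32%:R) rmorph_nat rmorph_gF ei vdm.
  rewrite !rmorphM !rmorphB /= e1 h2 h3 => h.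
  have : 2%:R * ((t1 - t2) * (t1 - t3) * (t2 - t3)) == 0.
    by rewrite mulr_natl mulr2n -{1}h; apply/eqP; ring.
  by rewrite mulf_eq0 pnatr_eq0 (negPf D0).
move=> e1; have [ei|ei] := galQ_i s (sqrCi algC) (sqrCi algC); [left|right]; apply: key => //=.
  by rewrite cj1.
by rewrite conjCi rmorphN ei opprK.
Qed.

(* omega = W r_2 with W fixed by conj, and W^2 fixed by the stabiliser of t1. *)
Lemma exists_omega : exists W : algC, [/\ W != 0, W^* = W, forall s : galQ, s t1 = t1 -> s (W ^+ 2) = W ^+ 2 &
  forall s, GN s -> s (W * rk t2) = ch t1 s * (W * rk t2)].
Proof.
have [u u0 hu] := resolvent; have f1 := froot1; have f2 := froot2; have f3 := froot3.
have r20 := rk_neq0 f2.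
suff [w [w0 wn hw]] : exists w : algC, [/\ w != 0, w + w^* != 0 & forall s, GN s -> s w = ch t1 s * ka t2 s * w].
  (* The character ch t1 ka t2 is invariant: conjugation multiplies it by ka t1 ka t2 ka t3 = 1. So
     w and its conjugate transform alike, and the square of their sum descends to Q(t1). *)
  have sW s : GN s -> s (w + w^*) = ch t1 s * ka t2 s * (w + w^*).
    move=> hs; rewrite rmorphD hw // mulrDr; congr (_ + _).
    have hk := GN_cgc hs.
    have -> : s w^* = (cgc s w)^* by rewrite /= conjCK.
    rewrite hw // ch_cgc // ka_cgc // rmorphM /=; congr (_ * _).
    have real x : (sg algC x)^* = sg algC x by case: x; rewrite /sg ?rmorphN rmorph1.
    have cr t : (ch t s)^* = ch t s by exact: real.
    have kr t : (ka t s)^* = ka t s by exact: real.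
    rewrite !rmorphM /= cr !kr; apply: (mulIf (x := ka t2 s)); first by rewrite /ka /sg; case: (chi _ _); rewrite ?oppr_eq0 oner_eq0.
    transitivity (ch t1 s * (ka t1 s * ka t2 s * ka t3 s)); first by ring.
    by rewrite ka_prod // -mulrA sg_sqr.
  have cW : (w + w^*)^* = w + w^* by rewrite rmorphD /= conjCK addrC.
  exists (w + w^*); split=> //.
    have G s : GN s -> s ((w + w^*) ^+ 2) = (w + w^*) ^+ 2.
      by move=> hs; rewrite rmorphXn sW // exprMn [(_ * _) ^+ 2]exprMn !expr2 !sg_sqr !mul1r.
    move=> s /GN_or[/G //|/G /=].
    by rewrite rmorphXn /= cW.
  move=> s hs; have [_ _ e2 _] := hs; rewrite rmorphM sW // (ka_rk hs f2 e2).
  transitivity (ch t1 s * (w + w^*) * rk t2 * (ka t2 s * ka t2 s)); first by ring.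
  by rewrite sg_sqr mulr1 mulrA.
have base s : GN s -> s (u / rk t2) = ch t1 s * ka t2 s * (u / rk t2).
  move=> hs; have [_ _ e2 _] := hs; rewrite fmorph_div hu // (ka_rk hs f2 e2).
  have : ka t2 s * ka t2 s = 1 by exact: sg_sqr.
  have k0 : ka t2 s != 0 by rewrite /ka /sg; case: (chi _ _); rewrite ?oppr_eq0 oner_eq0.
  move=> kk; have -> : (ka t2 s * rk t2)^-1 = ka t2 s * (rk t2)^-1.
    by rewrite invfM; congr (_ * _); apply: (mulIf k0); rewrite mulVf.
  by ring.
have wn0 : u / rk t2 != 0 by rewrite mulf_neq0 ?invr_eq0.
(* If w is purely imaginary its trace vanishes, and i w, which has the same character, is used
   instead. *)
have [e|ne] := eqVneq (u / rk t2 + (u / rk t2)^*) 0; last by exists (u / rk t2).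
exists ('i * (u / rk t2)); split; first by rewrite mulf_neq0 ?neq0Ci.
  rewrite rmorphM /= conjCi; move/eqP: e; rewrite addrC addr_eq0 => /eqP ->.
  by rewrite mulrNN -mulr2n -mulr_natl !mulf_neq0 ?pnatr_eq0 ?neq0Ci ?invr_eq0.
by move=> s hs; have [ei _ _ _] := hs; rewrite rmorphM base // ei; ring.
Qed.

Lemma stab_poly (z : algC) : (forall s : galQ, s t1 = t1 -> s z = z) -> exists e : tri rat, z = ev (mapA rQ e) t1.
Proof.
move=> hz; pose D : set algC := [set x | exists p : {poly rat}, x = (map_poly rQ p).[t1]]%classic.
have [p ep] : D z.
  apply: contrapT => nz; have [|||t [ht tz]] := gal_moves (j := rQ) (D := D) algC_char0 algC_algebraic _ _ _ nz.
  - by move=> q; exists q%:P; rewrite map_polyC hornerC.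
  - by move=> x y [p ->] [q ->]; exists (p - q); rewrite rmorphB !hornerE.
  - by move=> x y [p ->] [q ->]; exists (p * q); rewrite rmorphM hornerM.
  by move: tz; rewrite hz ?eqxx //; apply: ht; exists 'X; rewrite map_polyX hornerX.
have [A hA] : exists A : rat, rQ A = gF algC b by exists (gF rat b); exact: (rmorph_gF rQ b).
have [B hB] : exists B : rat, rQ B = 2%:R * gF algC b * b%:R ^+ 2.
  by exists (2%:R * gF rat b * b%:R ^+ 2); exact: (rmorph_cB rQ b).
pose F : {poly rat} := 'X ^+ 3 + A%:P * 'X + B%:P.
have sF : size F = 4%N.
  rewrite /F -addrA size_polyDl ?size_polyXn //; apply: leq_ltn_trans (size_polyD _ _) _.
  by rewrite gtn_max !(leq_ltn_trans (size_polyC_leq1 _)) // andbT mul_polyC (leq_ltn_trans (size_scale_leq _ _)) // size_polyX.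
have Ft : (map_poly rQ F).[t1] = 0.
  have -> : (map_poly rQ F).[t1] = t1 ^+ 3 + rQ A * t1 + rQ B.
    by rewrite /F !rmorphD rmorphM rmorphXn /= map_polyX !map_polyC !(hornerD, hornerM, hornerXn, hornerX, hornerC).
  rewrite hA hB; exact: froot1.
have F0 : F != 0 by rewrite -size_poly_eq0 sF.
exists ((p %% F)`_0, (p %% F)`_1, (p %% F)`_2); rewrite ep {1}(divp_eq p F) rmorphD rmorphM hornerD hornerM Ft mulr0 add0r.
have sz : (size (map_poly rQ (p %% F)) <= 3)%N by rewrite size_map_poly -ltnS -sF ltn_modp.
by rewrite (horner_coef_wide _ sz) !big_ord_recl big_ord0 /= !coef_map /ev /mapA /= expr0 mulr1 expr1 addr0 addrA.
Qed.

Hypothesis nQ : forall q : rat, t1 <> rQ q.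

(** Some automorphism moves t1 and, after composition with conjugation, fixes i. It fixes the
    Vandermonde product, so it permutes the roots cyclically; one takes it or its square. *)
Lemma exists_tau : exists tau : galQ, [/\ tau 'i = 'i, tau t1 = t2, tau t2 = t3 & tau t3 = t1].
Proof.
have D0 : (t1 - t2) * (t1 - t3) * (t2 - t3) != 0.
  by rewrite vdm !mulf_neq0 ?neq0Ci ?pnatr_eq0 //; exact: (gF_neq0L ob rQ).
have [d12 d13 d23] : [/\ t1 != t2, t1 != t3 & t2 != t3].
  by move: D0; rewrite !mulf_eq0 !negb_or !subr_eq0 => /andP[/andP[-> ->] ->].
have [t [ti t11]] : exists t : galQ, t 'i = 'i /\ t t1 != t1.
  have [||||t [_ tz]] := gal_moves (j := rQ) (D := [set x | exists q, x = rQ q]%classic) (z := t1) algC_char0 algC_algebraic _ _ _ _.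
  - by move=> q; exists q.
  - by move=> x y [p ->] [q ->]; exists (p - q); rewrite rmorphB.
  - by move=> x y [p ->] [q ->]; exists (p * q); rewrite rmorphM.
  - by move=> [q /nQ].
  have [ei|ei] := galQ_i t (sqrCi algC) (sqrCi algC); first by exists t.
  exists (gal_mul t gal_conj); rewrite /= cj1; split=> //.
  have e' : ('i : algC)^* = - 'i := conjCi _.
  by rewrite e' rmorphN ei opprK.
have rt u : fb b u = 0 -> [\/ t u = t1, t u = t2 | t u = t3].
  move=> fu; have /eqP := fE (t u); rewrite -(rmorph_fb b t) fu rmorph0 eq_sym !mulf_eq0 !subr_eq0 -orbA.
  by move=> /or3P[] /eqP ->; [constructor 1|constructor 2|constructor 3].
have inj x y : x != y -> t x = t y -> False by move=> /eqP n /fmorph_inj.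
have tD : (t t1 - t t2) * (t t1 - t t3) * (t t2 - t t3) = (t1 - t2) * (t1 - t3) * (t2 - t3).
  by rewrite -!rmorphB -!rmorphM vdm (rmorphM t _ 'i) (rmorphM t 32%:R) rmorph_nat rmorph_gF ti.
have nD : (t1 - t2) * (t1 - t3) * (t2 - t3) = - ((t1 - t2) * (t1 - t3) * (t2 - t3)) -> False.
  move/eqP; rewrite -subr_eq0 opprK -mulr2n -mulr_natl mulf_eq0 pnatr_eq0 (negPf D0) //.
have k1 := rt _ froot1; have k2 := rt _ froot2; have k3 := rt _ froot3.
case: k1 => k1; first by rewrite k1 eqxx in t11.
  case: k2 => k2; last 1 first.
  - case: k3 => k3; [by exists t | by case: (inj _ _ d13); rewrite k1 k3 | by case: (inj _ _ d23); rewrite k2 k3].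
  - case: k3 => k3; [by case: (inj _ _ d23); rewrite k2 k3 | by case: (inj _ _ d13); rewrite k1 k3 | ].
    by case: nD; rewrite -{1}tD k1 k2 k3; ring.
  by case: (inj _ _ d12); rewrite k1 k2.
case: k2 => k2; last by case: (inj _ _ d12); rewrite k1 k2.
  case: k3 => k3; [by case: (inj _ _ d23); rewrite k2 k3 | | by case: (inj _ _ d13); rewrite k1 k3].
  by exists (gal_mul t t); split; rewrite /= ?ti ?k1 ?k2 ?k3 ?k1 ?k2.
case: k3 => k3; [ | by case: (inj _ _ d23); rewrite k2 k3 | by case: (inj _ _ d13); rewrite k1 k3].
by case: nD; rewrite -{1}tD k1 k2 k3; ring.
Qed.

(** Since tau fixes i, c tau is 2-torsion, so c (tau s tau^-1) = tau (c s) on [GN]: tau carries the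
    descent from one root to the next. *)
Lemma twist (tau : galQ) (om u : algC) : tau 'i = 'i -> tau t1 = t2 -> tau t2 = t3 -> tau t3 = t1 ->
  (forall t, GN t -> t om = ch u t * om) -> forall t, GN t -> t (tau om) = ch (tau u) t * tau om.
Proof.
move=> ei e1 e2 e3 h t ht; have [tau' [K1 K2]] := gal_inv_ex tau.
pose s := gal_mul tau' (gal_mul t tau); have [hi h1 h2 h3] := ht.
have hs : GN s.
  by split; rewrite /= ?ei ?hi ?e1 ?e2 ?e3 ?h1 ?h2 ?h3; [rewrite -{1}ei|rewrite -{1}e1|rewrite -{1}e2|rewrite -{1}e3]; exact: K1.
have ts x : t (tau x) = tau (s x) by rewrite /= K2.
have ctau : c tau + c tau = 0 by rewrite c2 (xi_fix ob ei).1.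
have ec : c t = act tau (c s).
  have : c (gal_mul t tau) = c (gal_mul tau s) by apply: c_ext => x; exact: ts.
  by rewrite !c_mul (GN_torsion ht ctau) addrC => /addrI.
rewrite ts h // rmorphM /ch ec chi_map; congr (_ * _).
by case: (chi _ _); rewrite /sg ?rmorphN rmorph1.
Qed.

Theorem descent : exists (e : tri rat) (o1 o2 o3 : algC),
  [/\ o1 ^+ 2 = ev (mapA rQ e) t1 * (x1 - t2), o2 ^+ 2 = ev (mapA rQ e) t2 * (x1 - t3), o3 ^+ 2 = ev (mapA rQ e) t3 * (x1 - t1) &
   forall s, GN s -> [/\ s o1 = ch t1 s * o1, s o2 = ch t2 s * o2 & s o3 = ch t3 s * o3]] /\
  [/\ 0 < ev (mapA rQ e) t1, ev (mapA rQ e) t2 != 0 & ev (mapA rQ e) t3 != 0].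
Proof.
have [W [W0 cW fW hW]] := exists_omega; have [e ee] := stab_poly fW.
have [tau [ei e1 e2 e3]] := exists_tau; have f2 := froot2.
have evm (f : galQ) t : f (ev (mapA rQ e) t) = ev (mapA rQ e) (f t).
  by case: (e) => [[u0 u1] u2]; rewrite /mapA /ev (rmorphD f) (rmorphD f) (rmorphM f _ t) (rmorphM f _ (t ^+ 2)) (rmorphXn f) !(fmorph_rat f).
have tx1 (f : galQ) : f x1 = x1 by rewrite (rmorphM f) rmorphN (rmorphXn f) !rmorph_nat.
pose o1 := W * rk t2; have q1 : o1 ^+ 2 = ev (mapA rQ e) t1 * (x1 - t2) by rewrite exprMn ee rk_sqr.
have q2 : (tau o1) ^+ 2 = ev (mapA rQ e) t2 * (x1 - t3).
  by rewrite -rmorphXn q1 rmorphM evm e1 (rmorphB tau x1) tx1 e2.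
have q3 : (tau (tau o1)) ^+ 2 = ev (mapA rQ e) t3 * (x1 - t1).
  by rewrite -rmorphXn q2 rmorphM evm e2 (rmorphB tau x1) tx1 e3.
have ne1 : ev (mapA rQ e) t1 != 0 by rewrite -ee expf_neq0.
exists e, o1, (tau o1), (tau (tau o1)); split; last split.
- split=> // s hs; have h2 := twist ei e1 e2 e3 hW; have h3 := twist ei e1 e2 e3 h2.
  by rewrite hW // h2 // h3 // e1 e2.
- by rewrite -ee lt0r expf_neq0 //= real_exprn_even_ge0 // CrealE cW.
- by rewrite -e1 -evm fmorph_eq0.
- by rewrite -e2 -e1 -!evm !fmorph_eq0.
Qed.
End Character.

(** * Localisation of the descent *)

Lemma four_mul (V : zmodType) (x : V) : x + x + (x + x) = x *+ 4.
Proof. by rewrite -[x + x]mulr2n -mulrnDr. Qed.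
Lemma four_sub (V : zmodType) (x y : V) : x + x + (x + x) = 0 -> y + y + (y + y) = 0 ->
  x - y + (x - y) + (x - y + (x - y)) = 0.
Proof. by rewrite !four_mul mulrnBl => -> ->; rewrite subrr. Qed.
Lemma four_add (V : zmodType) (x y : V) : x + x + (x + x) = 0 ->
  x + y + (x + y) + (x + y + (x + y)) = y + y + (y + y).
Proof. by rewrite !four_mul mulrnDl => ->; rewrite add0r. Qed.

Lemma roots_coef (F : fieldType) (b : nat) (t1 t2 t3 : F) : 2%:R != 0 :> F ->
  (forall x, fb b x = (x - t1) * (x - t2) * (x - t3)) ->
  t1 * t2 + t1 * t3 + t2 * t3 = gF F b /\ t1 * t2 * t3 = - (2%:R * gF F b * b%:R ^+ 2).
Proof.
move=> n2 fE; split; last by transitivity (- ((0 - t1) * (0 - t2) * (0 - t3))); [ring | rewrite -fE /fb; ring].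
apply: (mulfI n2); transitivity ((1 - t1) * (1 - t2) * (1 - t3) - (-1 - t1) * (-1 - t2) * (-1 - t3) - 2%:R); first by ring.
by rewrite -!fE /fb; ring.
Qed.

Lemma chi_mapL (b : nat) (ob : odd b) (L L' : fieldType) (r : {rmorphism rat -> L}) (r' : {rmorphism rat -> L'})
    (f : {rmorphism L -> L'}) t (D : spoint (family_disc ob) r) :
  chi (r := r') (f t) (smap r' f D) = chi t D.
Proof.
have z : (smap r' f D == 0) = (D == 0).
  rewrite -!val_eqE /= /raw_map -[point_val D]/(val D); by case: (val D) => [[? ?]|].
rewrite /chi z; congr (_ || _); rewrite /smap /= /raw_map -[point_val D]/(val D); case: (val D) => [[x y]|] //=.
apply/eqP/eqP => [[/fmorph_inj -> /eqP]|[-> ->]]; last by rewrite rmorph0.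
by rewrite fmorph_eq0 => /eqP ->.
Qed.

Section LocalData.
Variables (b : nat) (ob : odd b).
Local Notation hAB := (family_disc ob).
Variables (t1 t2 t3 : algC).
Hypotheses (s1 : t1 + t2 + t3 = 0) (fE : forall x, fb b x = (x - t1) * (x - t2) * (x - t3))
  (vdm : (t1 - t2) * (t1 - t3) * (t2 - t3) = 32%:R * gF algC b * 'i).
Hypothesis nr : forall q : rat, fb b q <> 0.
Variable c : galQ -> spoint hAB rQ.
Variables (e : tri rat) (o1 o2 o3 : algC).
Local Notation xC := (- 3%:R * b%:R ^+ 2 : algC).
Hypotheses (c2 : forall s, c s + c s = xi ob s).
Hypotheses (q1 : o1 ^+ 2 = ev (mapA rQ e) t1 * (xC - t2)) (q2 : o2 ^+ 2 = ev (mapA rQ e) t2 * (xC - t3))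
  (q3 : o3 ^+ 2 = ev (mapA rQ e) t3 * (xC - t1)).
Hypothesis ho : forall s, GN t1 t2 t3 s -> [/\ s o1 = ch c t1 s * o1, s o2 = ch c t2 s * o2 & s o3 = ch c t3 s * o3].
Hypotheses (ne1 : ev (mapA rQ e) t1 != 0) (ne2 : ev (mapA rQ e) t2 != 0) (ne3 : ev (mapA rQ e) t3 != 0).

Variables (K : fieldType) (L : closedFieldType) (j : {rmorphism K -> L}) (i : {rmorphism algC -> L}) (r : {rmorphism rat -> K}).
Hypotheses (c0L : has_char0 L) (aj : forall x, algebraicOver j x).
Local Notation rL := (i \o rQ).
Local Notation pt := (spoint hAB rL).
Local Notation act t := (smap (hAB := hAB) (r := rL) rL (t : gal j)).
Variable P0 : pt.
Hypothesis hP : forall t : gal j, res_cochain i c t = act t P0 - P0.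
Local Notation I := (i 'i).
Local Notation x1 := (- 3%:R * b%:R ^+ 2 : L).

Let I2 : I ^+ 2 = -1. Proof. by rewrite -rmorphXn sqrCi rmorphN rmorph1. Qed.
Let n2 : 2%:R != 0 :> L. Proof. exact: (char0_natr_neq0 rL 1). Qed.
Local Notation Q := (Q1 ob rL I2).

Lemma fEL x : fb b x = (x - i t1) * (x - i t2) * (x - i t3).
Proof.
have n2C : 2%:R != 0 :> algC by rewrite pnatr_eq0.
have [e2 e3] := roots_coef n2C fE.
transitivity (x ^+ 3 - i (t1 + t2 + t3) * x ^+ 2 + i (t1 * t2 + t1 * t3 + t2 * t3) * x - i (t1 * t2 * t3)).
  rewrite s1 e2 e3 rmorph0 (rmorph_gF i) (rmorphN i) (rmorph_cB i) /fb; ring.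
rewrite !rmorphD !rmorphM; ring.
Qed.

Lemma resxi (t : gal j) : (t I = I -> res_cochain i c t + res_cochain i c t = 0) /\
  (t I = - I -> res_cochain i c t + res_cochain i c t = Q).
Proof.
have e' : res_cochain i c t + res_cochain (j := j) i c t = res_cochain i (xi ob) t.
  rewrite /res_cochain -(raddfD (smap rL i)) c2 //.
by rewrite e'; exact: xi_res.
Qed.

Lemma Q_nontorsion : Q + Q <> 0.
Proof.
move=> /torsion2P[/(congr1 val) //|[u [_ e0] _]].
move/eqP: e0; rewrite !mulf_eq0 -[I == 0]negbK; have -> : I != 0 by rewrite fmorph_eq0 neq0Ci.
have n16 : 16%:R != 0 :> L := char0_natr_neq0 rL 15.
by rewrite (negPf n16) (negPf (bF_neq0L ob rL)).
Qed.

(** The abscissa 6 b^2 - 64 / b^2 of 2 Q1 is rational, whereas f has no rational root. *)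
Lemma QQ_nontorsion : (Q + Q) + (Q + Q) <> 0.
Proof.
move=> /torsion2P[|[u eu fu]]; first exact: Q_nontorsion.
have b0 : b%:R != 0 :> L := bF_neq0L ob rL.
have I0 : I != 0 by rewrite fmorph_eq0 neq0Ci.
have n32 : 32%:R != 0 :> L := char0_natr_neq0 rL 31.
have n16 : 16%:R != 0 :> L := char0_natr_neq0 rL 15.
have eu' : u = 6%:R * b%:R ^+ 2 - 64%:R / b%:R ^+ 2.
  move: eu; rewrite spt_addval /=.
  have Y0 : 16%:R * b%:R * I != 0 by rewrite !mulf_neq0.
  rewrite (oppr_eqself n2) (negPf Y0) eqxx /= /sslope eqxx => -[<- _].
  have -> : 3%:R * x1 ^+ 2 + gF L b = 256%:R by rewrite gFE; ring.
  have -> : 2%:R * (16%:R * b%:R * I) = 32%:R * b%:R * I by ring.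
  rewrite expr_div_n.
  have n1024 : 1024%:R != 0 :> L := char0_natr_neq0 rL 1023.
  have -> : (32%:R * b%:R * I) ^+ 2 = - (1024%:R * b%:R ^+ 2).
    by transitivity (1024%:R * b%:R ^+ 2 * I ^+ 2); [ring | rewrite I2; ring].
  by rewrite invrN mulrN; field; rewrite ?b0 ?n1024.
have [q eq] : exists q : rat, rL q = u.
  exists (6%:R * b%:R ^+ 2 - 64%:R / b%:R ^+ 2); rewrite eu'.
  by rewrite (rmorphB rL) (rmorphM rL 6%:R) (fmorph_div rL 64%:R) !(rmorphXn rL) !(rmorph_nat rL).
apply: (nr (q := q)); apply: (fmorph_inj rL).
have eq' : fb b (rL q) = 0 by rewrite eq.
exact: etrans (rmorph_fb b rL q) (etrans eq' (esym (rmorph0 rL))).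
Qed.

Lemma Q_act (t : gal j) : t I = I -> act t Q = Q.
Proof. by move=> h; exact: (smap_Q1 ob rL rL t I2 I2).1. Qed.

(** R and 2 R must have coordinates with nonzero ordinate. If 4 P0 = 0, no automorphism moves I, for
    otherwise 2 Q1 = 0; then Q1 is Galois invariant and P0 + Q1 has the same coboundary. *)
Lemma good_half : exists R : pt, [/\ forall t : gal j, act t R - R = act t P0 - P0 & (R + R) + (R + R) <> 0].
Proof.
have [bad|good] := pselect ((P0 + P0) + (P0 + P0) = 0); last by exists P0.
have [[t ht]|fixI] := pselect (exists t : gal j, t I = - I).
  exfalso; apply: Q_nontorsion; rewrite -((resxi t).2 ht) hP.
  have e1 : act t ((P0 + P0) + (P0 + P0)) = 0 by rewrite bad raddf0.
  rewrite !(raddfD (smap rL t)) in e1.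
  exact: four_sub e1 bad.
have {}fixI (t : gal j) : t I = I.
  by have [//|h] := galQ_i t I2 I2; case: fixI; exists t.
exists (P0 + Q); split.
  move=> t; have -> : act t (P0 + Q) = act t P0 + act t Q := raddfD (smap rL t) _ _.
  by rewrite (Q_act (fixI t)) opprD addrACA subrr addr0.
by rewrite (four_add _ bad); exact: QQ_nontorsion.
Qed.

Lemma i_ev t : i (ev (mapA rQ e) t) = ev (mapA j (mapA r e)) (i t).
Proof.
have h q : i (rQ q) = j (r q) by rewrite -[i (rQ q)]/(rL q) -[j (r q)]/((j \o r) q) -!rmorph_ratr.
case: (e) => [[u0 u1] u2]; rewrite /mapA /ev (rmorphD i) (rmorphD i) (rmorphM i _ t) (rmorphM i _ (t ^+ 2)) (rmorphXn i).
by rewrite !h.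
Qed.

Theorem local_ldata : exists X Y n1 n2 n3, ldata b j (mapA r e) I (i t1) (i t2) (i t3) X Y n1 n2 n3.
Proof.
have [R [hR nR]] := good_half.
have {}hR (t : gal j) : act t R = R + res_cochain i c t by rewrite hP -hR addrC subrK.
have f1 : fb b (i t1) = 0 by rewrite fEL; ring.
have f2 : fb b (i t2) = 0 by rewrite fEL; ring.
have f3 : fb b (i t3) = 0 by rewrite fEL; ring.
have [x0 [y0 [eR y00]]] : exists x0 y0, val R = Some (x0, y0) /\ y0 != 0.
  case eR : (val R) => [[x y]|]; last first.
    by case: nR; have -> : R = 0; [exact: val_inj | rewrite !addr0].
  exists x, y; split=> //; apply/eqP => y0; case: nR.
  have RR : R + R = 0 by apply: (torsion2_double (u := x)); rewrite eR y0.
  by rewrite RR addr0.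
have [X [Y [eM Y0]]] : exists X Y, val (R + R) = Some (X, Y) /\ Y != 0.
  case eM : (val (R + R)) => [[x y]|]; last first.
    by case: nR; have -> : R + R = 0; [exact: val_inj | rewrite addr0].
  exists x, y; split=> //; apply/eqP => y0'; case: nR.
  by rewrite (torsion2_double (u := x)) // eM y0'.
have ksq t : fb b t = 0 -> kf b t (val R) ^+ 2 = X - t.
  move=> ft; have [y2] := kf_double ft eR y00; rewrite -[R *+ 2]/(R + R) eM => -[-> _]; by rewrite addrK.
have tx1 : i xC = x1 by rewrite (rmorphM i) rmorphN (rmorphXn i) !rmorph_nat.
have n2C : 2%:R != 0 :> algC by rewrite pnatr_eq0.
have [e2 e3] := roots_coef n2 fEL.
exists X, Y, (kf b (i t1) (val R) * i o1), (kf b (i t2) (val R) * i o2), (kf b (i t3) (val R) * i o3).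
have eMt (t : gal j) : val (act t (R + R)) = Some (t X, t Y).
  by rewrite -[LHS]/(raw_map t (val (R + R))) eM.
have aM (t : gal j) : act t (R + R) = (R + R) + (res_cochain i c t + res_cochain i c t).
  have -> : act t (R + R) = act t R + act t R := raddfD (smap rL t) _ _.
  by rewrite hR addrACA.
split=> //.
- by rewrite -!rmorphD s1 rmorph0.
- by rewrite -!(rmorphB i) -!(rmorphM i) vdm (rmorphM i _ 'i) (rmorphM i 32%:R) rmorph_nat rmorph_gF.
- by rewrite -!i_ev !fmorph_eq0.
- exact: (spt_on eM).
- by rewrite exprMn ksq // -rmorphXn q1 (rmorphM i) i_ev (rmorphB i) tx1 mulrA.
- by rewrite exprMn ksq // -rmorphXn q2 (rmorphM i) i_ev (rmorphB i) tx1 mulrA.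
- by rewrite exprMn ksq // -rmorphXn q3 (rmorphM i) i_ev (rmorphB i) tx1 mulrA.
- move=> t tI h1 h2 h3; have hG : GN t1 t2 t3 (gal_res i t).
    by split; apply: (fmorph_inj i); rewrite gal_resE.
  have MM : act t (R + R) = R + R by rewrite aM ((resxi t).1 tI) addr0.
  have := eMt t; rewrite MM eM => -[eX eY].
  have D2 := (resxi t).1 tI; have [g1 g2 g3] := ho hG.
  (* Both factors are multiplied by the same sign, the pairing of c(t) with (u, 0). *)
  have kt u o : fb b (i u) = 0 -> t (i u) = i u -> gal_res i t o = ch c u (gal_res i t) * o ->
      t (kf b (i u) (val R) * i o) = kf b (i u) (val R) * i o.
    move=> fu tu ho'; rewrite rmorphM (kf_map rL) tu -gal_resE ho' (rmorphM i).
    have -> : kf b (i u) (val (act t R)) = sg L (chi (i u) (res_cochain i c t)) * kf b (i u) (val R).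
      by rewrite hR (kf_chi fu eR y00 D2).
    rewrite /res_cochain (chi_mapL rL i) /ch; case: (chi _ _); rewrite /sg ?rmorphN ?rmorph1; ring.
  by split=> //; apply: kt.
move=> t tI; rewrite -eMt aM ((resxi t).2 tI) spt_addval eM //.
Qed.
End LocalData.

(** * The forms over the rationals *)

Lemma Qp_with_rat (R : realType) (p : nat) : prime p -> exists (K : fieldType) (v : K -> R) (r : {rmorphism rat -> K}),
  [/\ is_completion v, ultra_abs v & v p%:R < 1].
Proof.
move=> pp; have [|K [v [r [cv vr]]]] := exists_completion (pabs_ultra R pp).
  exists p%:R; first by rewrite pnatr_eq0 -lt0n prime_gt0.
  by rewrite pabs_p // invr_eq1 pnatr_eq1 neq_ltn prime_gt1 ?orbT.
exists K, v, r; split=> //.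
  have [h|//] := arch_or_ultra cv; move: h; rewrite -(rmorph_nat r) vr ltNge.
  by rewrite (ua_nat (pabs_ultra R pp)).
rewrite -(rmorph_nat r) vr pabs_p // invf_lt1 ?ltr0n ?prime_gt0 // ltr1n prime_gt1 //.
Qed.

(** For b = 1 modulo 5 the cubic reduces to x^3 + 4 x + 3, which has no root modulo 5. *)
Lemma no_rational_root (R : realType) (b : nat) : (b %% 5 = 1)%N -> forall q : rat, fb b q <> 0.
Proof.
move=> b5 q fq; have pp : prime 5 by []. have [K [v [r [cv ua vp]]]] := Qp_with_rat R pp.
have fr : fb b (r q) = 0 by rewrite -rmorph_fb fq rmorph0.
have nat5 n : v (5 * n)%N%:R < 1 by rewrite natrM; apply: (vM_lt1 ua) => //; exact: ua_nat.
have vb1 : v (b%:R - 1) < 1.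
  have -> : b%:R - 1 = (5 * (b %/ 5))%N%:R :> K by rewrite {1}(divn_eq b 5) b5 natrD addrK mulnC.
  exact: nat5.
have vb := ua_nat ua b; have one : v 1 <= 1 by rewrite (ua1 ua).
have vb2 : v (b%:R ^+ 2 - 1) < 1.
  have -> : b%:R ^+ 2 - 1 = (b%:R - 1) * (b%:R + 1) :> K by ring.
  by apply: (vM_lt1 ua) => //; vle ua.
have vg1 : v (gF K b + 1) < 1.
  have -> : gF K b + 1 = (5 * 46)%N%:R - (b%:R ^+ 2 - 1) * (27%:R * (b%:R ^+ 2 + 1)) by rewrite gFE natrM; ring.
  by apply: (uaB_lt ua) => //; apply: (vM_lt1 ua) => //; vle ua.
have vg : v (gF K b) = 1.
  apply: (v_near1 ua (y := - 1)); first by rewrite (uaN ua) (ua1 ua).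
  by rewrite opprK.
have vq := root_int ua vg fr; have [n hn] := residue cv ua pp vp 1 vq.
rewrite expr1 in hn; have hn1 : v (r q - n%:R) < 1 := le_lt_trans hn vp.
have vn := ua_nat ua n; have vgl : v (gF K b) <= 1 by rewrite vg.
have : v (n ^ 3 + 4 * n + 3)%N%:R < 1.
  have -> : (n ^ 3 + 4 * n + 3)%N%:R = fb b (r q) - (r q - n%:R) * ((r q) ^+ 2 + r q * n%:R + n%:R ^+ 2 + gF K b)
     - (gF K b + 1) * (n%:R + 2%:R * b%:R ^+ 2) + 2%:R * (b%:R ^+ 2 - 1) + (5 * (n + 1))%N%:R :> K.
    by rewrite (natrD _ (n ^ 3 + 4 * n)%N) (natrD _ (n ^ 3)%N) (natrM _ 4) (natrM _ 5) (natrD _ n) (natrX _ n 3) /fb; ring.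
  rewrite fr; apply: (uaD_lt ua) => //; apply: (uaD_lt ua); last by apply: (vMr_lt1 ua) => //; exact: ua_nat.
  apply: (uaB_lt ua); last by apply: (vM_lt1 ua) => //; vle ua.
  by rewrite sub0r (uaN ua); apply: (vM_lt1 ua) => //; vle ua.
rewrite pmulrn (v_lt1_dvd ua pp vp) => h.
have {}h : (5 %| n ^ 3 + 4 * n + 3)%N by [].
have chk : all (fun m => ~~ (5 %| m ^ 3 + 4 * m + 3)%N) (iota 0 5) by [].
have := allP chk (n %% 5)%N; rewrite mem_iota ltn_mod => /(_ isT) /negP; apply.
have e5 : ((n %% 5) ^ 3 + 4 * (n %% 5) + 3 = n ^ 3 + 4 * n + 3 %[mod 5])%N.
  by apply/eqP; rewrite eqn_modDr -modnDm modnXm modnMmr modnDm.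
by rewrite /dvdn e5.
Qed.

(** Between short equations only scalings remain: u^4 g' = g and u^2 c' = c, so g c'^2 = g' c^2, and
    g + 27 c^2 = 256 on both sides gives c^2 = c'^2. *)
Lemma short_iso (F : fieldType) (u r s t g g' c c' : F) : 2%:R != 0 :> F -> 3%:R != 0 :> F -> 256%:R != 0 :> F -> g != 0 ->
  g = 256%:R - 27%:R * c ^+ 2 -> g' = 256%:R - 27%:R * c' ^+ 2 ->
  u * 0 = 0 + 2%:R * s -> u ^+ 2 * 0 = 0 - s * 0 + 3%:R * r - s ^+ 2 -> u ^+ 3 * 0 = 0 + r * 0 + 2%:R * t ->
  u ^+ 4 * g' = g - s * 0 + 2%:R * r * 0 - (t + r * s) * 0 + 3%:R * r ^+ 2 - 2%:R * s * t ->
  u ^+ 6 * (2%:R * g' * c') = 2%:R * g * c + r * g + r ^+ 2 * 0 + r ^+ 3 - t * 0 - t ^+ 2 - r * t * 0 ->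
  c' ^+ 2 = c ^+ 2.
Proof.
move=> n2 n3 n256 g0 eg eg' h1 h2 h3 h4 h6.
have s0 : s = 0 by apply: (mulfI n2); rewrite mulr0 -[RHS](mulr0 u) h1 add0r.
have r0 : r = 0.
  apply: (mulfI n3); rewrite mulr0 -[RHS](mulr0 (u ^+ 2)) h2 s0; ring.
have t0 : t = 0.
  apply: (mulfI n2); rewrite mulr0 -[RHS](mulr0 (u ^+ 3)) h3 r0; ring.
move: h4 h6; rewrite s0 r0 t0 => h4 h6.
have {}h4 : u ^+ 4 * g' = g by rewrite h4; ring.
have {}h6 : u ^+ 6 * (2%:R * g' * c') = 2%:R * g * c by rewrite h6; ring.
have e1 : u ^+ 2 * c' = c.
  apply: (mulfI (mulf_neq0 n2 g0)); rewrite -h6 -{1}h4; ring.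
have e2 : g * c' ^+ 2 = g' * c ^+ 2.
  by transitivity (g' * (u ^+ 2 * c') ^+ 2); [rewrite -h4; ring | rewrite e1].
apply: (mulfI n256); apply/eqP; rewrite -subr_eq0; apply/eqP.
transitivity (g * c' ^+ 2 - g' * c ^+ 2); last by rewrite e2 subrr.
by rewrite eg eg'; ring.
Qed.

Lemma family_not_iso (b b' : nat) (ob : odd b) (ob' : odd b') : ec_iso (Eb ob) (Eb ob') -> b = b'.
Proof.
move=> [u [r [s [t [_ [h1 h2 h3] h4 h6]]]]].
have nz k : k.+1%:R != 0 :> rat by rewrite pnatr_eq0.
have hg k : gF rat k = 256%:R - 27%:R * (k%:R ^+ 2) ^+ 2 by rewrite gFE -exprM.
have := short_iso (nz 1%N) (nz 2%N) (nz 255%N) (gF_neq0 ob) (hg b) (hg b') h1 h2 h3 h4 h6.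
rewrite -!natrX => /eqP; rewrite eqr_nat -!expnM => /eqP /esym h.
by apply/eqP; rewrite -(eqn_exp2r _ _ (isT : 0 < 2 * 2)%N) h.
Qed.

Lemma gram_map (F F' : fieldType) (h : {rmorphism F -> F'}) A B e : tmap h (gram A B e) = gram (h A) (h B) (mapA h e).
Proof.
by case: e => [[u0 u1] u2]; rewrite /tmap /gram /mapA /=; congr TForm; rewrite !(rmorphB, rmorphN, rmorphM).
Qed.

Lemma sol_rat (K : fieldType) (r : {rmorphism rat -> K}) (x y : rat) :
  sol (r x) (r y) <-> sol ((numq x * denq x)%:~R : K) (numq y * denq y)%:~R.
Proof.
have h q : r q = (numq q * denq q)%:~R * ((denq q)%:~R^-1) ^+ 2 /\ (denq q)%:~R^-1 != 0 :> K.
  have d0 : (denq q)%:~R != 0 :> K by rewrite -(rmorph_int r) fmorph_eq0 intr_eq0 denq_eq0.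
  split; last by rewrite invr_eq0.
  by rewrite -{1}(divq_num_den q) fmorph_div !rmorph_int intrM; field.
by have [-> d1] := h x; have [-> d2] := h y; split=> [/(sol_sqr _ _ d1)/solC/(sol_sqr _ _ d2)/solC|/solC/(sol_sqr _ _ d2)/solC/(sol_sqr _ _ d1)].
Qed.

Lemma numden_sign (q : rat) : (numq q * denq q < 0) = (q < 0).
Proof. by rewrite pmulr_llt0 ?denq_gt0 // numq_lt0. Qed.
Lemma numden_neq0 (q : rat) : q != 0 -> numq q * denq q != 0.
Proof. by move=> h; rewrite mulf_neq0 ?denq_neq0 // numq_eq0. Qed.

(** With the trivial value every rational is integral, so [diagonalise] also serves over Q. *)
Lemma trivial_abs_ultra (R : realType) : ultra_abs (fun x : rat => (x != 0)%:R : R).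
Proof.
split=> [x|x|x y|x y].
- exact: ler0n.
- by split=> [/eqP|->]; rewrite ?eqxx // pnatr_eq0 eqb0 negbK => /eqP.
- by rewrite mulf_eq0 negb_or -natrM mulnb.
have [->|x0] := eqVneq x 0; first by rewrite add0r le_max lexx orbT.
by rewrite le_max; apply/orP; left; rewrite ler_nat leq_b1.
Qed.

(** A negative determinant means one or three negative diagonal entries; a positive value excludes
    three. So the form is indefinite and the real symbol of (A, B) is trivial. *)
Lemma rational_form (R : realType) (q : tform rat) : tdet q < 0 ->
  (exists x y z : algC, [/\ x \is Num.real, y \is Num.real, z \is Num.real & 0 < teval (tmap rQ q) x y z]) ->
  exists A B : int, [/\ A != 0, B != 0, (A < 0) && (B < 0) = false &
    forall (K : fieldType) (v : K -> R) (p : nat) (r : {rmorphism rat -> K}), is_completion v -> ultra_abs v -> prime p ->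
      v p%:R < 1 -> tiso (tmap r q) <-> hs p A B = false].
Proof.
move=> dq [x [y [z [rx ry rz pos]]]].
have [a [b [c h]]] := diagonalise (trivial_abs_ultra R) (erefl _) q.
have eabc : a * b * c = tdet q by rewrite -tdet_diag -(tdet_teq h).
have abc0 : a * b * c < 0 by rewrite eabc.
have [a0 b0 c0] : [/\ a != 0, b != 0 & c != 0].
  by have := ltr0_neq0 abc0; rewrite !mulf_eq0 !negb_or => /andP[/andP[-> ->] ->].
have nneg : ~ [/\ a < 0, b < 0 & c < 0].
  move=> [na nb nc].
  have t (k : rat) (f : algC) : k < 0 -> f \is Num.real -> rQ k * f ^+ 2 <= 0.
    by move=> k0 rf; apply: mulr_le0_ge0; [rewrite ltW // ltrq0 | rewrite real_exprn_even_ge0].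
  have H (u w m : algC) : u \is Num.real -> w \is Num.real -> m \is Num.real -> teval (tmap rQ (tdiag a b c)) u w m <= 0.
    move=> ru rw rm; have -> : tmap rQ (tdiag a b c) = tdiag (rQ a) (rQ b) (rQ c) by rewrite /tmap /tdiag /= rmorph0.
    rewrite teval_diag.
    have add (f f' : algC) : f <= 0 -> f' <= 0 -> f + f' <= 0 by move=> h1 h2; rewrite -[leRHS]addr0 lerD.
    by apply: (add); [apply: (add)|]; exact: t.
  by have := lt_le_trans pos (tneg_teq h H rx ry rz); rewrite ltxx.
exists (numq (- (a * c)) * denq (- (a * c))), (numq (- (b * c)) * denq (- (b * c))); split.
- by apply: numden_neq0; rewrite oppr_eq0 mulf_neq0.
- by apply: numden_neq0; rewrite oppr_eq0 mulf_neq0.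
- rewrite !numden_sign !oppr_lt0; apply/negP => /andP[ac bc]; apply: nneg.
  have nb : b < 0 by move: abc0; rewrite mulrAC pmulr_rlt0.
  by rewrite nmulr_rgt0 // in bc; rewrite nmulr_lgt0 // in ac.
move=> K v p r cv ua pp vp; rewrite (tiso_teq r h).
have -> : tmap r (tdiag a b c) = tdiag (r a) (r b) (r c) by rewrite /tmap /tdiag /= rmorph0.
rewrite tiso_diag ?fmorph_eq0 // -!rmorphM -!rmorphN sol_rat.
by apply: (sol_symbol cv ua pp vp); apply: numden_neq0; rewrite oppr_eq0 mulf_neq0.
Qed.

Section RealPlace.
Variables (b : nat) (t1 t2 t3 : algC) (A B : rat).
Hypotheses (s1 : t1 + t2 + t3 = 0) (eA : rQ A = t1 * t2 + t1 * t3 + t2 * t3) (eB : rQ B = - (t1 * t2 * t3)).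
Hypotheses (cj1 : t1^* = t1) (cj2 : t2^* = t3) (d12 : t1 != t2).

Lemma normA_roots (e : tri rat) : rQ (normA A B e) = ev (mapA rQ e) t1 * ev (mapA rQ e) t2 * ev (mapA rQ e) t3.
Proof.
have n (F F' : fieldType) (h : {rmorphism F -> F'}) (a b' : F) (u : tri F) : h (normA a b' u) = normA (h a) (h b') (mapA h u).
  by case: u => [[u0 u1] u2]; rewrite /normA /mapA !(rmorphB, rmorphD, rmorphXn, rmorphM, rmorphN).
rewrite n eA eB; have -> : t3 = - t1 - t2 by apply/eqP; rewrite -subr_eq0 -s1; apply/eqP; ring.
by case: e => [[u0 u1] u2]; rewrite /normA /ev /mapA; ring.
Qed.

Lemma ev_conj (e : tri rat) : (ev (mapA rQ e) t2)^* = ev (mapA rQ e) t3.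
Proof.
pose cj := (Num.conj : {rmorphism algC -> algC}); rewrite -[LHS]/(cj _).
case: e => [[u0 u1] u2]; rewrite /mapA /ev (rmorphD cj) (rmorphD cj) (rmorphM cj _ t2) (rmorphM cj _ (t2 ^+ 2)) (rmorphXn cj).
by rewrite !(fmorph_rat cj) /= cj2.
Qed.

Lemma real_place (e : tri rat) : 0 < ev (mapA rQ e) t1 -> ev (mapA rQ e) t2 != 0 ->
  tdet (gram A B e) < 0 /\
  exists x y z : algC, [/\ x \is Num.real, y \is Num.real, z \is Num.real & 0 < teval (tmap rQ (gram A B e)) x y z].
Proof.
move=> p1 n2; split.
  rewrite gram_det oppr_lt0 -(ltr0q algC) normA_roots -ev_conj -mulrA.
  by rewrite mulr_gt0 // -normCK exprn_gt0 // normr_gt0.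
(* The coordinates of (X - t2)(X - t3): only the root t1 contributes to the trace form, with e(t1)
   f'(t1) > 0. *)
exists (t2 * t3), t1, 1; split.
- by rewrite -cj2 -normCK realX // normr_real.
- by rewrite CrealE cj1.
- exact: real1.
rewrite gram_map gramE.
have -> : Qf (rQ A) (rQ B) (mapA rQ e) (t2 * t3, t1, 1) = ev (mapA rQ e) t1 * ((t1 - t2) * (t1 - t3)).
  rewrite eA eB; have -> : t3 = - t1 - t2 by apply/eqP; rewrite -subr_eq0 -s1; apply/eqP; ring.
  by case: (e) => [[u0 u1] u2]; rewrite /Qf /top /mulA /ev /mapA /=; ring.
rewrite mulr_gt0 //; have -> : t1 - t3 = (t1 - t2)^* by rewrite rmorphB /= cj1 cj2.
by rewrite -normCK exprn_gt0 // normr_gt0 subr_eq0.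
Qed.
End RealPlace.

(** * Non divisibility of xi *)

Section NonDivisible.
Variables (R : realType) (b : nat) (ob : odd b) (b5 : (b %% 5 = 1)%N).
Local Notation hAB := (family_disc ob).
Local Notation pt := (spoint hAB rQ).

Lemma cobound_cocycle (P : pt) : cocycle ((fun s : galQ => smap rQ s P - P) : cochain (Eb ob) rQ).
Proof.
apply/cocycleP; split=> [s|s t].
  exists (if val P is Some (x, y) then [:: x; y] else [::]) => t h.
  suff -> : smap rQ t P = smap rQ s P by [].
  apply: val_inj; move: h; rewrite /smap /= /raw_map -[point_val P]/(val P); case: (val P) => [[x y]|] //= h.
  by rewrite !h ?inE ?eqxx ?orbT.
have -> : smap rQ (gal_mul s t) P = smap rQ s (smap rQ t P).
  by apply: val_inj; rewrite /smap /= /raw_map -[point_val P]/(val P); case: (val P) => [[x y]|].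
by rewrite (raddfB (smap rQ s)) [RHS]addrC addrA subrK.
Qed.

Lemma cobound_locally_trivial (P : pt) : locally_trivial R ((fun s : galQ => smap rQ s P - P) : cochain (Eb ob) rQ).
Proof.
move=> K v cv L j aj i; rewrite -/(res_cochain i _); apply/coboundaryP.
exists (smap (i \o rQ) i P) => t.
transitivity (smap (i \o rQ) i (smap rQ (gal_res i t) P) - smap (i \o rQ) i P); first exact: (raddfB (smap (i \o rQ) i)).
congr (_ - _).
apply: val_inj; rewrite /smap /= /raw_map -[point_val P]/(val P); case: (val P) => [[x y]|] //=.
by rewrite !gal_resE.
Qed.

Lemma ratr_char0 (K L : fieldType) (r : {rmorphism rat -> K}) (j : {rmorphism K -> L}) : has_char0 L.
Proof.
move=> p; apply/negP => /andP[pp /eqP p0]; have := char0_natr_neq0 (j \o r) p.-1.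
by rewrite prednK ?prime_gt0 // p0 eqxx.
Qed.

Theorem xi_not_divisible (c : cochain (Eb ob) rQ) : sha R c -> ~ coboundary (cochain_sub (cochain_muln 2 c) (xi ob : cochain (Eb ob) rQ)).
Proof.
move=> [cc cl] [P0 hP0].
have [t1 [t2 [t3 [s1 fE vdm [cj1 cj2 cj3]]]]] := exists_roots ob.
(* As 2 c - xi is the coboundary of P0 = 2 P, subtracting the coboundary of P from c makes 2 d = xi
   hold exactly. *)
have [P hP] := halving (r := rQ) s1 fE (P0 : pt).
pose d : galQ -> pt := (c : galQ -> pt) - (fun s : galQ => smap rQ s P - P).
have dc : cocycle (d : cochain (Eb ob) rQ) := cocycle_sub cc (cobound_cocycle P).
have dl : locally_trivial R (d : cochain (Eb ob) rQ) := locally_trivial_sub cl (cobound_locally_trivial P).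
have d2 s : d s + d s = xi ob s.
  have := hP0 s; rewrite /cochain_sub (cochain_mulnE (r := rQ)) => h.
  have {}h : (c s : pt) + c s - xi ob s = smap rQ s (P + P) - (P + P) by rewrite hP; exact: h.
  rewrite (raddfD (smap rQ s)) in h.
  rewrite -[d s]/((c s : pt) - (smap rQ s P - P)) addrACA -opprD.
  apply/eqP; rewrite subr_eq addrC -subr_eq h opprD addrACA //.
have nr := no_rational_root R b5.
have nQ (q : rat) : t1 <> rQ q.
  move=> e1; apply: (nr q); apply: (fmorph_inj rQ); rewrite rmorph0; apply: etrans (rmorph_fb b rQ q) _.
  by rewrite -e1 fE; ring.
have [e [o1 [o2 [o3 [[q1 q2 q3 ho] [p1 ne2 ne3]]]]]] := descent fE vdm cj1 cj2 cj3 dc d2 nQ.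
have ne1 : ev (mapA rQ e) t1 != 0 by rewrite gt_eqF.
pose A := gF rat b; have [B eB] : exists B : rat, B = 2%:R * gF rat b * b%:R ^+ 2 by eexists.
have n2C : 2%:R != 0 :> algC by rewrite pnatr_eq0.
have [k2 k3] := roots_coef n2C fE.
have hA : rQ A = t1 * t2 + t1 * t3 + t2 * t3 by rewrite k2; exact: (rmorph_gF rQ b).
have hB : rQ B = - (t1 * t2 * t3) by rewrite k3 opprK eB; exact: (rmorph_cB rQ b).
have d12 : t1 != t2.
  apply/eqP => h; move: vdm; rewrite h subrr !mul0r => /esym/eqP; rewrite !mulf_eq0 pnatr_eq0 (negPf (neq0Ci _)) orbF /=.
  by rewrite (negPf (gF_neq0L ob rQ)).
pose e' := mulA A B (betaA b rat) e.
have evb t : fb b t = 0 -> ev (mapA rQ e') t = (4%:R * b%:R ^+ 2 + 2%:R * t) * ev (mapA rQ e) t.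
  move=> ft; rewrite mapA_mulA ev_mulA; last by rewrite hA hB k2 k3 opprK.
  by rewrite mapA_beta; congr (_ * _); rewrite /ev /betaA; ring.
have f1 : fb b t1 = 0 by rewrite fE; ring.
have f2 : fb b t2 = 0 by rewrite fE; ring.
have f3 : fb b t3 = 0 by rewrite fE; ring.
pose bt (t : algC) := 4%:R * b%:R ^+ 2 + 2%:R * t.
have b0 : (0 : algC) < 64%:R * b%:R ^+ 6 by rewrite mulr_gt0 ?exprn_gt0 ?ltr0n //; case: (b) ob.
have bprod : bt t1 * bt t2 * bt t3 = 64%:R * b%:R ^+ 6.
  transitivity (- 8%:R * ((- 2%:R * b%:R ^+ 2 - t1) * (- 2%:R * b%:R ^+ 2 - t2) * (- 2%:R * b%:R ^+ 2 - t3))); first by rewrite /bt; ring.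
  by rewrite -fE /fb; ring.
have bt2 : bt t2 != 0 by apply: contra_eq_neq bprod => ->; rewrite mulr0 mul0r lt_eqF.
have bt3 : bt t3 != 0 by apply: contra_eq_neq bprod => ->; rewrite mulr0 lt_eqF.
(* The norm 64 b^6 of beta is positive, and its values at t2 and t3 are conjugate. *)
have bt1 : 0 < bt t1.
  have e23 : bt t3 = (bt t2)^*.
    pose cj := (Num.conj : {rmorphism algC -> algC}); rewrite /bt -cj2 -[RHS]/(cj _) (rmorphD cj).
    by rewrite (rmorphM cj 4%:R) (rmorphM cj 2%:R) (rmorphXn cj) !(rmorph_nat cj).
  have n23 : 0 < bt t2 * bt t3 by rewrite e23 -normCK exprn_gt0 // normr_gt0.
  by rewrite -(pmulr_lgt0 _ n23) mulrA bprod.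
have p1' : 0 < ev (mapA rQ e') t1 by rewrite evb // mulr_gt0.
have ne2' : ev (mapA rQ e') t2 != 0 by rewrite evb // mulf_neq0.
have [dq pq] := real_place s1 hA hB cj1 cj2 d12 p1 ne2.
have [dq' pq'] := real_place s1 hA hB cj1 cj2 d12 p1' ne2'.
have [M [N [M0 N0 sMN hMN]]] := rational_form R dq pq.
have [M' [N' [M0' N0' sMN' hMN']]] := rational_form R dq' pq'.
have tri0 (K : fieldType) (r : {rmorphism rat -> K}) (u : tri rat) : ev (mapA rQ u) t1 != 0 -> mapA r u != (0, 0, 0) :> K * K * K.
  case: u => [[u0 u1] u2]; apply: contra_neq => -[/eqP h0 /eqP h1 /eqP h2].
  by move: h0 h1 h2; rewrite !fmorph_eq0 => /eqP -> /eqP -> /eqP ->; rewrite /mapA /ev !rmorph0 !mul0r !addr0.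
have gK (K : fieldType) (r : {rmorphism rat -> K}) u :
    tmap r (gram A B u) = gram (gF K b) (2%:R * gF K b * b%:R ^+ 2) (mapA r u).
  rewrite gram_map; congr (gram _ _ _); first exact: (rmorph_gF r b).
  by rewrite eB; exact: (rmorph_cB r b).
have mK (K : fieldType) (r : {rmorphism rat -> K}) :
    mapA r e' = mulA (gF K b) (2%:R * gF K b * b%:R ^+ 2) (betaA b K) (mapA r e).
  rewrite /e' mapA_mulA mapA_beta; congr (mulA _ _ _ _); first exact: (rmorph_gF r b).
  by rewrite eB; exact: (rmorph_cB r b).
have data (K : fieldType) (v : K -> R) (r : {rmorphism rat -> K}) : is_completion v ->
    exists (L : closedFieldType) (j : {rmorphism K -> L}), [/\ has_char0 L, forall x, algebraicOver j x &
      exists I u1 u2 u3 X Y n1 n2 n3, ldata b j (mapA r e) I u1 u2 u3 X Y n1 n2 n3].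
  move=> cv; have [L [j aj]] := exists_algebraic_closure K; have c0L := ratr_char0 r j.
  have [i _] := algebraic_rmorphism (j \o r); exists L, j; split=> //.
  have := dl K v cv L j aj i; rewrite -/(res_cochain i d) => /coboundaryP[Q hQ].
  have [X [Y [n1 [n2 [n3 h]]]]] := local_ldata s1 fE vdm nr d2 q1 q2 q3 ho ne1 ne2 ne3 r hQ.
  by exists (i 'i), (i t1), (i t2), (i t3), X, Y, n1, n2, n3.
(* Three cases: p divides g and beta is a square; f has a root in K; f has no root modulo p. In the
   last two both forms are isotropic. *)
have hs_odd p : prime p -> odd p -> hs p M N = hs p M' N'.
  move=> pp op; have [K [v [r [cv ua vp]]]] := Qp_with_rat R pp.
  suff : hs p M N = false <-> hs p M' N' = false.
    by case: (hs p M N); case: (hs p M' N') => -[h1 h2] //; [have := h2 erefl | have := h1 erefl].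
  rewrite -(hMN K v p r cv ua pp vp) -(hMN' K v p r cv ua pp vp) !gK mK.
  have vg1 : v (gF K b) <= 1.
    have one : v 1 <= 1 by rewrite (ua1 ua).
    by have vb := ua_nat ua b; rewrite gFE; vle ua.
  have [vg|vg] := v1_or vg1; last exact: iff_sym (ramified_iso cv ua pp vp op _ vg).
  have [[th fth]|nort] := root_or_not cv ua pp vp op vg.
    have [L [j [c0L aj [I [u1 [u2 [u3 [X [Y [n1 [n2 [n3 h]]]]]]]]]]]] := data K v r cv.
    have bK0 : b%:R != 0 :> K := bF_neq0L ob r.
    by have [g1 g2] := good_root_isotropic cv ua pp vp op bK0 vg c0L aj h fth.
  have vB : v (2%:R * gF K b * b%:R ^+ 2) <= 1 by have vb := ua_nat ua b; vle ua.
  have g1 := noroot_isotropic cv ua pp vp op vg1 vB nort (tri0 K r e ne1).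
  have g2 : tiso (gram (gF K b) (2%:R * gF K b * b%:R ^+ 2) (mapA r e')).
    by apply: (noroot_isotropic cv ua pp vp op vg1 vB nort); apply: tri0; rewrite gt_eqF.
  by rewrite -mK.
have pp : prime 2 by []. have [K [v [r [cv ua vp]]]] := Qp_with_rat R pp.
have := symbol_parity M0 N0 M0' N0' hs_odd; rewrite sMN sMN' => /(_ erefl) h2.
have [L [j [c0L aj [I [u1 [u2 [u3 [X [Y [n1 [n2 [n3 h]]]]]]]]]]]] := data K v r cv.
apply: (dyadic_iso cv ua vp ob c0L aj h); rewrite -mK -!gK.
by rewrite (hMN K v 2%N r cv ua pp vp) (hMN' K v 2%N r cv ua pp vp) h2.
Qed.

Lemma Eb_torsion : trivial_rational_2torsion (Eb ob).
Proof.
pose r : {rmorphism rat -> rat} := idfun.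
move=> P h; have := @torsion2P b ob rat r (P : spoint hAB r); case=> [|//|[u _ fu]]; first exact: h.
by case: (no_rational_root R b5 fu).
Qed.

Theorem Eb_sha : sha_2primary_has_Z2_factor R (Eb ob).
Proof. exact: sha_direct_factor (xi_sha ob R) (xi_double ob) xi_not_divisible. Qed.
End NonDivisible.

Theorem mainTheorem5 (R : realType) :
  exists E : nat -> elliptic_curve,
    (forall m n : nat, m <> n -> ~ ec_iso (E m) (E n)) /\
    (forall n : nat,
       trivial_rational_2torsion (E n) /\ sha_2primary_has_Z2_factor R (E n)).
Proof.
(* The values b = 10 n + 1 are odd and 1 modulo 5, so f has no rational root. *)
have od n : odd (10 * n + 1) by rewrite oddD oddM.
have m5 n : ((10 * n + 1) %% 5 = 1)%N by rewrite -modnDml -modnMml mul0n.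
exists (fun n => Eb (od n)); split=> [m n ne /family_not_iso h|n].
  by apply: ne; move: h; lia.
by split; [exact: (@Eb_torsion R _ (od n) (m5 n)) | exact: (@Eb_sha R _ (od n) (m5 n))].
Qed.
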